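(* Let $\lambda\in\mathbb{R}^3$, $0<\varepsilon<\tfrac12$, $\gamma=(\gamma_1,\gamma_2,\gamma_3)=(\lambda_1+\mathrm{i}\varepsilon,\lambda_2-\mathrm{i}\varepsilon,\lambda_3)$ and $0<\varkappa<\tfrac12$. Given the Gelfand-Tsetlin realization ${}^{\varkappa}\widetilde E_{ij}$ and the modified Gauss-Givental realization $\hat{\mathcal E}_{ij}$ of the principal series representation $\mathcal{V}_{-\mathrm{i}\gamma-\rho}$ of $\mathcal{U}(\mathfrak{gl}_3)$, the operators $\mathcal{B}_R$ and $\mathcal{B}_L$, acting in $\mathcal{V}_{-\mathrm{i}\gamma-\rho}$ and in its dual $\mathcal{V}^\vee_{-\mathrm{i}\gamma-\rho}\simeq\mathcal{V}_{-\mathrm{i}\bar\gamma-\rho}$ respectively, satisfy the following intertwining relations: $${}^{\varkappa}\widetilde E_{ij}\circ\mathcal{B}_R=\mathcal{B}_R\circ\hat{\mathcal E}_{ij},\qquad {}^{\varkappa}\widetilde E^{\vee}_{ij}\circ\mathcal{B}_L=\mathcal{B}_L\circ\hat{\mathcal E}^{\vee}_{ij},\qquad 1\le i,j\le3.$$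
   Context: $\mathrm{i}=\sqrt{-1}$; $\tau=(\tau_{11},\tau_{21},\tau_{22})$, $s=(s_{11},s_{21},s_{22})$, $\tau_{2,1}=\tau_{21}$, $\tau_{2,2}=\tau_{22}$, $\rho=(1,0,-1)$; $e^{\pm\mathrm{i}\partial_y}$ is the shift $y\mapsto y\pm\mathrm{i}$. The principal series representation is realized by difference operators in function spaces: the Gelfand-Tsetlin realization in the space of functions of $\tau$ obtained by acting with polynomials in the generators on the Whittaker vectors, and the modified Gauss-Givental realization in Schwartz functions of $s$. Gelfand-Tsetlin operators: $\widetilde E_{11}=-\mathrm{i}\tau_{11}$, $\widetilde E_{22}=-\mathrm{i}(\tau_{21}+\tau_{22})+\mathrm{i}\tau_{11}$, $\widetilde E_{33}=-\mathrm{i}(\gamma_1+\gamma_2+\gamma_3)+\mathrm{i}(\tau_{21}+\tau_{22})$, $$\widetilde E_{12}=-\mathrm{i}\big(\mathrm{i}(\tau_{11}-\tau_{21})+\tfrac12\big)\big(\mathrm{i}(\tau_{11}-\tau_{22})+\tfrac12\big)e^{-\mathrm{i}\partial_{\tau_{11}}},\qquad \widetilde E_{21}=-\mathrm{i}\,e^{\mathrm{i}\partial_{\tau_{11}}},$$ $$\widetilde E_{23}=\prod_{i=1}^3\big(\mathrm{i}(\tau_{21}-\gamma_i)+\tfrac12\big)e^{-\mathrm{i}\partial_{\tau_{21}}}+\frac{\prod_{i=1}^3(\mathrm{i}(\tau_{22}-\gamma_i)+\frac12)}{\mathrm{i}(\tau_{22}-\tau_{21})[\mathrm{i}(\tau_{21}-\tau_{22})-1]}e^{-\mathrm{i}\partial_{\tau_{22}}},$$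 $$\widetilde E_{32}=\frac{\mathrm{i}(\tau_{11}-\tau_{21})+\frac12}{\mathrm{i}(\tau_{21}-\tau_{22})[\mathrm{i}(\tau_{21}-\tau_{22})-1]}e^{\mathrm{i}\partial_{\tau_{21}}}-\big(\mathrm{i}(\tau_{11}-\tau_{22})+\tfrac12\big)e^{\mathrm{i}\partial_{\tau_{22}}},$$ with Whittaker vectors $$\widetilde\psi_L(\tau)=\frac{1}{(2\pi)^{3/2}}\frac{e^{-\frac{\pi\tau_{11}}{2}}}{\Gamma(\mathrm{i}\tau_{21}-\mathrm{i}\tau_{22})},\qquad \widetilde\psi_R(\tau)=\frac{1}{(2\pi)^{3/2}}\frac{e^{\frac{\pi\tau_{11}}{2}}}{\Gamma(\mathrm{i}\tau_{21}-\mathrm{i}\tau_{22})}\prod_{j=1}^2\Gamma\big(\mathrm{i}(\tau_{2,j}-\tau_{11})+\tfrac12\big)\prod_{i=1}^3\prod_{j=1}^2\Gamma\big(\mathrm{i}(\gamma_i-\tau_{2,j})+\tfrac12\big).$$ The operators ${}^{\varkappa}\widetilde E_{ij}$ are the operators $\widetilde E_{ij}$ with shifted argument $\tau_{11}\mapsto\tau_{11}-\mathrm{i}\varkappa$. Modified Gauss-Givental operators: $\hat{\mathcal E}_{11}=-\mathrm{i}(\gamma_1+s_{11}+s_{21})$, $\hat{\mathcal E}_{22}=\mathrm{i}(-\gamma_2+s_{21}-s_{22})$, $\hat{\mathcal E}_{33}=\mathrm{i}(-\gamma_3+s_{11}+s_{22})$, $\hat{\mathcal E}_{12}=(\mathrm{i}s_{21}+\frac12)e^{-\mathrm{i}\partial_{s_{21}}}$,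 $$\hat{\mathcal E}_{23}=(\mathrm{i}s_{11}+\tfrac12)e^{\mathrm{i}\partial_{s_{21}}-\mathrm{i}\partial_{s_{11}}}+\big(\mathrm{i}(s_{11}-s_{21}+s_{22})+\tfrac12\big)e^{-\mathrm{i}\partial_{s_{22}}},$$ $$\hat{\mathcal E}_{21}=\big(\mathrm{i}(\gamma_2-\gamma_1-s_{11})+\tfrac12\big)e^{\mathrm{i}\partial_{s_{11}}-\mathrm{i}\partial_{s_{22}}}+\big(\mathrm{i}(\gamma_2-\gamma_1-s_{11}-s_{21}+s_{22})+\tfrac12\big)e^{\mathrm{i}\partial_{s_{21}}},$$ $$\hat{\mathcal E}_{32}=\big(\mathrm{i}(\gamma_3-\gamma_2-s_{22})+\tfrac12\big)e^{\mathrm{i}\partial_{s_{22}}}.$$ In each realization the operators with indices $13$ and $31$ are the commutators $[X_{12},X_{23}]$ and $[X_{32},X_{21}]$. Operators with superscript $\vee$ are those of the dual representation $\mathcal{V}_{-\mathrm{i}\bar\gamma-\rho}$, i.e. given by the same formulas with $\gamma$ replaced by $\bar\gamma$. Operators. $(\mathcal{B}\phi)(\tau)=\int_{\mathbb{R}^3}ds\,B(\tau;s)\phi(s)$ with kernels $$B_R(\tau;s)=\frac{1}{2\pi}\frac{e^{\frac{\pi(\tau_{11}-\mathrm{i}\varkappa)}{2}}}{\Gamma(\mathrm{i}\tau_{21}-\mathrm{i}\tau_{22})}\frac{\Gamma(\mathrm{i}(\gamma_2-\gamma_1-s_{11})+\frac12)}{\Gamma(-\mathrm{i}s_{21}+\frac12)}\prod_{j=1}^2\Gamma\big(\mathrm{i}(\tau_{11}-\tau_{2,j}-s_{21})+\varkappa\big)\Gamma\big(\mathrm{i}(\tau_{2,j}-\tau_{11})-\varkappa+\tfrac12\big)\Gamma\big(\mathrm{i}(\gamma_3-\tau_{2,j})+\tfrac12\big)$$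 $$\times\,\delta(\gamma_1+s_{11}+s_{21}-\tau_{11}+\mathrm{i}\varkappa)\,\delta(\gamma_1+\gamma_2+s_{11}+s_{22}-\tau_{21}-\tau_{22}),$$ $$B_L(\tau;s)=\frac{1}{2\pi}\frac{e^{-\frac{\pi(\tau_{11}-\mathrm{i}\varkappa)}{2}}}{\Gamma(\mathrm{i}\tau_{21}-\mathrm{i}\tau_{22})}\frac{\Gamma(\mathrm{i}s_{21}+\frac12)}{\Gamma(\mathrm{i}(\bar\gamma_1-\bar\gamma_2+s_{11})+\frac12)}\prod_{j=1}^2\frac{\Gamma(\mathrm{i}(\tau_{11}-\tau_{2,j}-s_{21})+\varkappa)}{\Gamma(\mathrm{i}(\tau_{11}-\tau_{2,j})+\varkappa+\frac12)\,\Gamma(\mathrm{i}(\tau_{2,j}-\gamma_3)+\frac12)}$$ $$\times\,\delta(\bar\gamma_1+s_{11}+s_{21}-\tau_{11}+\mathrm{i}\varkappa)\,\delta(\bar\gamma_1+\bar\gamma_2+s_{11}+s_{22}-\tau_{21}-\tau_{22}).$$ The delta-function of complex argument is defined by $\int_{\mathbb{R}}dy\,\delta(y-t+\mathrm{i}c)\phi(y)=\phi(t-\mathrm{i}c)$ on Schwartz functions $\phi$ allowing analytic continuation into the strip bounded by $\mathbb{R}$ and $\mathbb{R}-\mathrm{i}c$. *)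

(* Defs.v *)
(* Stdlib reals with Coquelicot. *)
From Stdlib Require Export Reals Factorial.
From Coquelicot Require Export Coquelicot.
Open Scope R_scope.

Definition Cexp (z : C) : C :=
  (exp (Re z) * cos (Im z), exp (Re z) * sin (Im z)).

Definition CLim_seq (u : nat -> C) : C :=
  (real (Lim_seq (fun n => Re (u n))), real (Lim_seq (fun n => Im (u n)))).

Fixpoint rising (z : C) (n : nat) : C :=
  match n with
  | O => RtoC 1
  | S m => (rising z m * (z + RtoC (INR m)))%C
  end.

(* Gauss's formula  Gamma z = lim n! n^z / (z (z+1) ... (z+n)).
   Since [/ 0 = 0] in [C], at a pole the sequence vanishes eventually and the
   value is 0; hence [/ Gamma z] is everywhere the entire function 1/Gamma. *)
Definition Gamma (z : C) : C :=
  CLim_seq (fun n =>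
    (RtoC (INR (fact n)) * Cexp (z * RtoC (ln (INR n))) / rising z (S n))%C).

(* Functions of (tau_11, tau_21, tau_22) or of (s_11, s_21, s_22), always in
   this order; the arguments are complex, so that e^{+-i d_y} is the literal
   substitution y -> y +- i in the analytic continuation. *)
Definition fun3 := C -> C -> C -> C.
Definition oper := fun3 -> fun3.

Definition comm (X Y : oper) : oper :=
  fun F a b c => (X (Y F) a b c - Y (X F) a b c)%C.

Definition prod2 (a b : C) (f : C -> C) : C := (f a * f b)%C.
Definition prod3 (a b c : C) (f : C -> C) : C := (f a * f b * f c)%C.

Definition half : C := RtoC (1 / 2).

(* GT i j and GG i j are the operators E_ij of the Gelfand-Tsetlin and of the
   modified Gauss-Givental realization with parameters g1, g2, g3; the dual
   realizations are obtained by passing the conjugate parameters. *)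

Definition GT12 : oper := fun F t11 t21 t22 =>
  (- Ci * (Ci * (t11 - t21) + half) * (Ci * (t11 - t22) + half)
     * F (t11 - Ci) t21 t22)%C.

Definition GT21 : oper := fun F t11 t21 t22 =>
  (- Ci * F (t11 + Ci) t21 t22)%C.

Definition GT23 (g1 g2 g3 : C) : oper := fun F t11 t21 t22 =>
  (prod3 g1 g2 g3 (fun g => Ci * (t21 - g) + half) * F t11 (t21 - Ci) t22
   + prod3 g1 g2 g3 (fun g => Ci * (t22 - g) + half)
       / (Ci * (t22 - t21) * (Ci * (t21 - t22) - 1))
       * F t11 t21 (t22 - Ci))%C.

Definition GT32 : oper := fun F t11 t21 t22 =>
  ((Ci * (t11 - t21) + half)
       / (Ci * (t21 - t22) * (Ci * (t21 - t22) - 1))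
       * F t11 (t21 + Ci) t22
   - (Ci * (t11 - t22) + half) * F t11 t21 (t22 + Ci))%C.

Definition GT (g1 g2 g3 : C) (i j : nat) : oper :=
  match i, j with
  | 1, 1 => fun F t11 t21 t22 => (- Ci * t11 * F t11 t21 t22)%C
  | 2, 2 => fun F t11 t21 t22 =>
      ((- Ci * (t21 + t22) + Ci * t11) * F t11 t21 t22)%C
  | 3, 3 => fun F t11 t21 t22 =>
      ((- Ci * (g1 + g2 + g3) + Ci * (t21 + t22)) * F t11 t21 t22)%C
  | 1, 2 => GT12
  | 2, 1 => GT21
  | 2, 3 => GT23 g1 g2 g3
  | 3, 2 => GT32
  | 1, 3 => comm GT12 (GT23 g1 g2 g3)
  | 3, 1 => comm GT32 GT21
  | _, _ => fun F => F
  end%nat.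

(* The operator X with shifted argument tau_11 -> tau_11 - i kap: coefficients
   are evaluated at tau_11 - i kap, the shifts e^{+-i d} are unchanged. *)
Definition shift_arg (kap : R) (X : oper) : oper := fun F t11 t21 t22 =>
  X (fun u11 u21 u22 => F (u11 + Ci * RtoC kap)%C u21 u22)
    (t11 - Ci * RtoC kap)%C t21 t22.

Definition kGT (kap : R) (g1 g2 g3 : C) (i j : nat) : oper :=
  shift_arg kap (GT g1 g2 g3 i j).

Definition GG12 : oper := fun f s11 s21 s22 =>
  ((Ci * s21 + half) * f s11 (s21 - Ci) s22)%C.

Definition GG23 : oper := fun f s11 s21 s22 =>
  ((Ci * s11 + half) * f (s11 - Ci) (s21 + Ci) s22
   + (Ci * (s11 - s21 + s22) + half) * f s11 s21 (s22 - Ci))%C.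

Definition GG21 (g1 g2 : C) : oper := fun f s11 s21 s22 =>
  ((Ci * (g2 - g1 - s11) + half) * f (s11 + Ci) s21 (s22 - Ci)
   + (Ci * (g2 - g1 - s11 - s21 + s22) + half) * f s11 (s21 + Ci) s22)%C.

Definition GG32 (g2 g3 : C) : oper := fun f s11 s21 s22 =>
  ((Ci * (g3 - g2 - s22) + half) * f s11 s21 (s22 + Ci))%C.

Definition GG (g1 g2 g3 : C) (i j : nat) : oper :=
  match i, j with
  | 1, 1 => fun f s11 s21 s22 => (- Ci * (g1 + s11 + s21) * f s11 s21 s22)%C
  | 2, 2 => fun f s11 s21 s22 => (Ci * (- g2 + s21 - s22) * f s11 s21 s22)%C
  | 3, 3 => fun f s11 s21 s22 => (Ci * (- g3 + s11 + s22) * f s11 s21 s22)%C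
  | 1, 2 => GG12
  | 2, 1 => GG21 g1 g2
  | 2, 3 => GG23
  | 3, 2 => GG32 g2 g3
  | 1, 3 => comm GG12 GG23
  | 3, 1 => comm (GG32 g2 g3) (GG21 g1 g2)
  | _, _ => fun f => f
  end%nat.

Definition tube (r : R) (a b c : C) : Prop :=
  Rabs (Im a) < r /\ Rabs (Im b) < r /\ Rabs (Im c) < r.

(* Schwartz functions of real s that continue analytically to the tube
   |Im s_jk| < w, with the Schwartz estimates on every closed subtube.
   [d a b c] is the complex partial derivative of order (a, b, c) of [f]. *)
Definition schwartz_tube (w : R) (f : fun3) : Prop :=
  exists d : nat -> nat -> nat -> fun3,
    (forall s11 s21 s22, tube w s11 s21 s22 ->
       d 0%nat 0%nat 0%nat s11 s21 s22 = f s11 s21 s22) /\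
    (forall a b c s11 s21 s22, tube w s11 s21 s22 ->
       is_derive (fun z : C => d a b c z s21 s22) s11 (d (S a) b c s11 s21 s22) /\
       is_derive (fun z : C => d a b c s11 z s22) s21 (d a (S b) c s11 s21 s22) /\
       is_derive (fun z : C => d a b c s11 s21 z) s22 (d a b (S c) s11 s21 s22)) /\
    (forall (w' : R) (a b c N : nat), w' < w ->
       exists M : R, forall s11 s21 s22,
         Rabs (Im s11) <= w' -> Rabs (Im s21) <= w' -> Rabs (Im s22) <= w' ->
         (1 + Cmod s11 + Cmod s21 + Cmod s22) ^ N
           * Cmod (d a b c s11 s21 s22) <= M).

Definition holomorphic_tube (r : R) (G : fun3) : Prop :=
  forall a b c, tube r a b c ->
    continuous (fun z : C * C * C => G (fst (fst z)) (snd (fst z)) (snd z))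
               (a, b, c) /\
    ex_derive (fun z : C => G z b c) a /\
    ex_derive (fun z : C => G a z c) b /\
    ex_derive (fun z : C => G a b z) c.

Definition unit_shift (z : C) : Prop := Im z = -1 \/ Im z = 0 \/ Im z = 1.

(* F is meromorphic in a tube larger than |Im tau_jk| <= 1, as a quotient N / D
   of holomorphic functions, and regular at the real points and at their shifts
   by 0, +i, -i in each variable.  By the identity theorem its values at those
   points are determined by its values at the real points. *)
Definition meromorphic_unit_tube (F : fun3) : Prop :=
  exists (r : R) (N D : fun3),
    1 < r /\ holomorphic_tube r N /\ holomorphic_tube r D /\
    (forall a b c, unit_shift a -> unit_shift b -> unit_shift c ->
       D a b c <> RtoC 0) /\
    (forall a b c, tube r a b c -> D a b c <> RtoC 0 ->
       F a b c = (N a b c / D a b c)%C).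

(* \int_R dy delta(y - a) f(y) for complex a: evaluation at a of the analytic
   continuation of f. *)
Definition delta_int (a : C) (f : C -> C) : C := f a.

(* Arguments: tau_11 tau_21 tau_22 s_11 s_21 s_22. *)
Definition kernel := C -> C -> C -> C -> C -> C -> C.

(* [is_apply kap g1 g2 K f t11 t21 t22 v]: v is the value at the real point
   (t11, t21, t22) of the integral of f over s in R^3 against the kernel
   K(tau; s) delta(g1 + s11 + s21 - t11 + i kap)
             delta(g1 + g2 + s11 + s22 - t21 - t22);
   the integral over s21 is required to converge. *)
Definition is_apply (kap : R) (g1 g2 : C) (K : kernel) (f : fun3)
    (t11 t21 t22 : R) (v : C) : Prop :=
  is_RInt_gen (V := C_R_NormedModule)
    (fun s21 : R =>
       delta_int (t11 - Ci * kap - g1 - s21)%C (fun s11 : C =>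
       delta_int (t21 + t22 - g1 - g2 - s11)%C (fun s22 : C =>
         (K t11 t21 t22 s11 s21 s22 * f s11 s21 s22)%C)))
    (Rbar_locally m_infty) (Rbar_locally p_infty) v.

(* The kernels B_R and B_L without their delta-functions, which are in
   [is_apply]; kappa enters through tau_11 -> tau_11 - i kap. *)
Definition KR (kap : R) (g1 g2 g3 : C) : kernel :=
  fun t11 t21 t22 s11 s21 s22 =>
  (RtoC (1 / (2 * PI))
   * (Cexp (PI * (t11 - Ci * kap) / 2) / Gamma (Ci * t21 - Ci * t22))
   * (Gamma (Ci * (g2 - g1 - s11) + half) / Gamma (- Ci * s21 + half))
   * prod2 t21 t22 (fun t =>
       Gamma (Ci * (t11 - t - s21) + kap)
       * Gamma (Ci * (t - t11) - kap + half)
       * Gamma (Ci * (g3 - t) + half)))%C.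

Definition KL (kap : R) (g1 g2 g3 : C) : kernel :=
  fun t11 t21 t22 s11 s21 s22 =>
  (RtoC (1 / (2 * PI))
   * (Cexp (- (PI * (t11 - Ci * kap) / 2)) / Gamma (Ci * t21 - Ci * t22))
   * (Gamma (Ci * s21 + half) / Gamma (Ci * (Cconj g1 - Cconj g2 + s11) + half))
   * prod2 t21 t22 (fun t =>
       Gamma (Ci * (t11 - t - s21) + kap)
       / (Gamma (Ci * (t11 - t) + kap + half) * Gamma (Ci * (t - g3) + half))))%C.

Definition is_BR (kap : R) (g1 g2 g3 : C) :
    fun3 -> R -> R -> R -> C -> Prop :=
  is_apply kap g1 g2 (KR kap g1 g2 g3).

Definition is_BL (kap : R) (g1 g2 g3 : C) :
    fun3 -> R -> R -> R -> C -> Prop :=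
  is_apply kap (Cconj g1) (Cconj g2) (KL kap g1 g2 g3).

(* X_ij o B = B o Y_ij.  Here f ranges over the Schwartz functions with analytic
   continuation to |Im s_jk| < 3: Y_ij moves each variable by at most 1, the
   delta-functions by less than 1, and the continuation of B f by the shifts
   in X_ij moves the arguments of f by less than 3 in total.  F is the
   continuation of B f, on which the difference operators X_ij act; t21 <> t22
   keeps the denominators in X_ij away from 0. *)
Definition intertwines (B : fun3 -> R -> R -> R -> C -> Prop)
    (X Y : nat -> nat -> oper) : Prop :=
  forall f : fun3, schwartz_tube 3 f ->
  exists F : fun3,
    meromorphic_unit_tube F /\
    (forall t11 t21 t22 : R, B f t11 t21 t22 (F t11 t21 t22)) /\
    (forall i j : nat, (1 <= i <= 3)%nat -> (1 <= j <= 3)%nat ->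
     forall t11 t21 t22 : R, t21 <> t22 ->
       B (Y i j f) t11 t21 t22 (X i j F t11 t21 t22)).

(* Main.v *)
Require Import Defs.
From Stdlib Require Import Lra Lia Psatz FunctionalExtensionality List.

(* With T = tau_11 - i kap and x = s_21 - T the value of B f is an explicit
   prefactor times a Mellin-Barnes integral
     int Gamma(a1 - ix) Gamma(a2 - ix) Gamma(b + ix) Phi(x) dx,   a_j = -i tau_2j,
   over a horizontal contour, where Phi is 1/Gamma(e - ix) times the values of f
   along a line; b = 1/2 + i gamma_2, e = 1/2 - iT for R and b = 1/2 + iT,
   e = 1/2 - i gamma_2 for L; kap enters only as the height of the contour.
   Moving the contour by i gives
     (a1 + b) J(a1, a2)[Phi] = J(a1 + 1, a2)[Phi] + J(a1 + 1, a2 + 1)[Phi(. + i)],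
   which continues B f analytically in tau to the strips needed and, together
   with the recursion of Gamma in the prefactor, turns every intertwining
   relation into a contiguity relation between such integrals.  Each contiguity
   relation is linear over affine factors in x once the integrals are brought to
   common parameters.

   Convergence rests on |Gamma(z)| <= Gamma(Re z) and on the polynomial growth of
   Gamma(z) / Gamma(z') for bounded Im z - Im z'; f contributes the decay. *)

(** * Local holomorphy *)

(** The obstacle is room for the contour. For R, [Re b = 1/2 + eps] is fixed, and when [Im tau_2j]
    reaches -1 one use of the relation above in each [a_j] reopens a gap between the two kinds of
    poles. For L, [Re b = 1/2 - Im T] itself falls to [kap - 1/2], and two uses are needed. Each use
    evaluates f one unit higher. For L this exhausts the tube of half-width 3: the height must lie
    below [-1 + eps] where both [Im tau_2j] are 1 and above it where both are -1, so the contour has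
    to depend on tau. The factors [a_j + b] created on the way are, for L, absorbed by the
    reciprocal Gammas of the prefactor, and the continuation is holomorphic; for R they are divided
    out and leave zeros of the denominator away from the unit shifts. Holomorphy is carried by
    inequalities with explicit constants, so that limits (for 1/Gamma) and integrals over the line
    inherit it from their terms and integrands. *)

Lemma Cmod_sub_sym (a b : C) : Cmod (a - b) = Cmod (b - a).
Proof. rewrite <- Cmod_opp. f_equal. ring. Qed.

Lemma Cmod_tri3 (a b c : C) : Cmod (a - c) <= Cmod (a - b) + Cmod (b - c).
Proof. replace (a - c)%C with ((a - b) + (b - c))%C by ring. apply Cmod_triangle. Qed.

Lemma Cmod_plus_le (a b : C) (x y : R) :
  Cmod a <= x -> Cmod b <= y -> Cmod (a + b) <= x + y.
Proof. intros. eapply Rle_trans; [apply Cmod_triangle | lra]. Qed.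

Lemma Cmod_mult_le (a b : C) (x y : R) :
  Cmod a <= x -> Cmod b <= y -> Cmod (a * b) <= x * y.
Proof.
  intros. rewrite Cmod_mult. apply Rmult_le_compat; auto using Cmod_ge_0.
Qed.

Lemma Cmod_sub_ge (a b : C) : Cmod a - Cmod b <= Cmod (a - b).
Proof.
  assert (H := Cmod_triangle (a - b) b).
  replace (a - b + b)%C with a in H by ring. lra.
Qed.

Lemma Cmod_zero_sub (z : C) : Cmod (z - z) = 0.
Proof. replace (z - z)%C with (RtoC 0) by ring. apply Cmod_0. Qed.

Lemma im_le_Cmod (z : C) : Rabs (Im z) <= Cmod z.
Proof. eapply Rle_trans; [apply Rmax_r | apply (Rmax_Cmod z)]. Qed.

Lemma Cmod_le_abs (z : C) : Cmod z <= Rabs (Re z) + Rabs (Im z).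
Proof.
  replace z with (RtoC (Re z) + Ci * RtoC (Im z))%C at 1.
  - eapply Rle_trans; [apply Cmod_triangle|].
    rewrite Cmod_mult, Cmod_Ci, !Cmod_R. lra.
  - destruct z as [a b]; unfold Ci, RtoC, Cplus, Cmult, Re, Im; cbn. f_equal; ring.
Qed.

(** The estimate compares any two points of the ball, not only a point with the centre. This
    uniformity is what yields a Lipschitz bound on [g'] and holomorphy at neighbouring points with
    the same constant. *)
Definition quad_rem (g g' : C -> C) (z0 : C) (r K : R) : Prop :=
  forall z w, Cmod (z - z0) < r -> Cmod (w - z0) < r ->
    Cmod (g w - g z - g' z * (w - z)) <= K * (Cmod (w - z) * Cmod (w - z)).

(* A local form of holomorphy that already contains the continuity of the
   derivative and bounds, so that it passes to products and compositions
   without any complex analysis. *)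
Definition hol (g : C -> C) (z0 : C) : Prop :=
  exists (r K : R) (g' : C -> C), 0 < r /\ 0 <= K /\
    (forall z, Cmod (z - z0) < r -> Cmod (g z) <= K /\ Cmod (g' z) <= K) /\
    quad_rem g g' z0 r K.

(** Adding the estimates for [(z, w)] and [(w, z)] cancels the values of [g] and leaves
    [(g' w - g' z) (w - z)], from which one factor [|w - z|] is divided out. *)
Lemma quad_rem_deriv_lip (g g' : C -> C) (z0 : C) (r K : R) :
  quad_rem g g' z0 r K ->
  forall z w, Cmod (z - z0) < r -> Cmod (w - z0) < r ->
    Cmod (g' w - g' z) <= 2 * K * Cmod (w - z).
Proof.
  intros H z w Hz Hw.
  destruct (Ceq_dec w z) as [->|Hne].
  - rewrite !Cmod_zero_sub. lra.
  - assert (Hp : 0 < Cmod (w - z)).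
    { apply Cmod_gt_0. intros E. apply Hne.
      replace w with ((w - z) + z)%C by ring. rewrite E. ring. }
    assert (H1 := H z w Hz Hw). assert (H2 := H w z Hw Hz).
    assert (E : Cmod ((g' w - g' z) * (w - z)) <=
      K * (Cmod (w - z) * Cmod (w - z)) + K * (Cmod (z - w) * Cmod (z - w))).
    { replace ((g' w - g' z) * (w - z))%C with
        ((g w - g z - g' z * (w - z)) + (g z - g w - g' w * (z - w)))%C by ring.
      apply Cmod_plus_le; assumption. }
    rewrite Cmod_mult, (Cmod_sub_sym z w) in E.
    apply Rmult_le_reg_r with (Cmod (w - z)); lra.
Qed.

(** The bounds on [g] and [g'] demanded by [hol] follow from the remainder estimate at the centre,
    so that later proofs have to supply the remainder only. *)
Lemma hol_intro (g g' : C -> C) (z0 : C) (r K : R) :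
  0 < r -> quad_rem g g' z0 r K -> hol g z0.
Proof.
  intros Hr H.
  assert (H0 : Cmod (z0 - z0) < r) by (rewrite Cmod_zero_sub; lra).
  assert (HK : K <= Rabs K) by apply Rle_abs.
  assert (HK0 := Rabs_pos K).
  assert (A1 := Cmod_ge_0 (g z0)). assert (A2 := Cmod_ge_0 (g' z0)).
  exists r, (Rabs K + Cmod (g z0) + Cmod (g' z0) * r + Rabs K * (r * r)
             + Cmod (g' z0) + 2 * Rabs K * r), g'.
  assert (0 <= Cmod (g' z0) * r) by (apply Rmult_le_pos; lra).
  assert (0 <= Rabs K * (r * r)) by (repeat apply Rmult_le_pos; lra).
  assert (0 <= Rabs K * r) by (apply Rmult_le_pos; lra).
  split; [lra|]. split; [lra|]. split.
  - intros z Hz. assert (Hzp := Cmod_ge_0 (z - z0)). split.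
    + assert (Hq := H z0 z H0 Hz).
      replace (g z) with ((g z - g z0 - g' z0 * (z - z0)) + g z0 + g' z0 * (z - z0))%C by ring.
      eapply Rle_trans; [apply Cmod_plus_le; [apply Cmod_plus_le; [exact Hq|apply Rle_refl]|
        rewrite Cmod_mult; apply Rle_refl]|].
      assert (K * (Cmod (z - z0) * Cmod (z - z0)) <= Rabs K * (r * r)).
      { apply Rle_trans with (Rabs K * (Cmod (z - z0) * Cmod (z - z0))).
        - apply Rmult_le_compat_r; [apply Rmult_le_pos|]; lra.
        - apply Rmult_le_compat_l; [lra|]. apply Rmult_le_compat; lra. }
      assert (Cmod (g' z0) * Cmod (z - z0) <= Cmod (g' z0) * r)
        by (apply Rmult_le_compat_l; lra).
      lra.
    + assert (Hl := quad_rem_deriv_lip _ _ _ _ _ H z0 z H0 Hz).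
      assert (Hs := Cmod_sub_ge (g' z) (g' z0)).
      assert (K * Cmod (z - z0) <= Rabs K * r).
      { apply Rle_trans with (Rabs K * Cmod (z - z0)).
        - apply Rmult_le_compat_r; lra.
        - apply Rmult_le_compat_l; lra. }
      lra.
  - intros z w Hz Hw. eapply Rle_trans; [apply H; assumption|].
    apply Rmult_le_compat_r; [apply Rmult_le_pos; apply Cmod_ge_0 | lra].
Qed.

Lemma hol_lip (g : C -> C) (z0 : C) : hol g z0 ->
  exists r K, 0 < r /\ 0 <= K /\ forall z w, Cmod (z - z0) < r -> Cmod (w - z0) < r ->
    Cmod (g w - g z) <= K * Cmod (w - z).
Proof.
  intros (r & K & g' & Hr & HK & Hb & Hq).
  exists r, (K + K * (2 * r)).
  split; [lra|]. split.
  { assert (0 <= K * (2 * r)) by (apply Rmult_le_pos; lra). lra. }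
  intros z w Hz Hw.
  destruct (Hb z Hz) as [_ Hg'].
  assert (Hd : Cmod (w - z) <= 2 * r).
  { assert (E := Cmod_tri3 w z0 z). rewrite (Cmod_sub_sym z0 z) in E. lra. }
  replace (g w - g z)%C with ((g w - g z - g' z * (w - z)) + g' z * (w - z))%C by ring.
  assert (A := Cmod_ge_0 (w - z)).
  eapply Rle_trans; [apply Cmod_plus_le; [apply Hq; assumption | rewrite Cmod_mult; apply Rle_refl]|].
  assert (Cmod (g' z) * Cmod (w - z) <= K * Cmod (w - z)) by (apply Rmult_le_compat_r; lra).
  assert (K * (Cmod (w - z) * Cmod (w - z)) <= K * (2 * r) * Cmod (w - z)).
  { rewrite <- Rmult_assoc. apply Rmult_le_compat_r; [lra|]. apply Rmult_le_compat_l; lra. }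
  lra.
Qed.

Lemma hol_at_near (g : C -> C) (z0 : C) : hol g z0 ->
  exists r, 0 < r /\ forall z, Cmod (z - z0) < r -> hol g z.
Proof.
  intros (r & K & g' & Hr & HK & Hb & Hq). exists r. split; [lra|].
  intros z Hz. apply hol_intro with g' (r - Cmod (z - z0)) K; [lra|].
  intros a b Ha Hb'. apply Hq.
  - assert (E := Cmod_tri3 a z z0). lra.
  - assert (E := Cmod_tri3 b z z0). lra.
Qed.

Lemma hol_ext_near (f g : C -> C) (z0 : C) (r : R) : 0 < r ->
  (forall z, Cmod (z - z0) < r -> f z = g z) -> hol f z0 -> hol g z0.
Proof.
  intros Hr E (r' & K & g' & Hr' & HK & Hb & Hq).
  apply hol_intro with g' (Rmin r r') K; [apply Rmin_glb_lt; lra|].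
  intros z w Hz Hw.
  assert (A := Rmin_l r r'). assert (B := Rmin_r r r').
  rewrite <- !E by lra. apply Hq; lra.
Qed.

Lemma hol_ext (f g : C -> C) (z0 : C) :
  (forall z, f z = g z) -> hol f z0 -> hol g z0.
Proof. intros E. apply hol_ext_near with 1; auto; lra. Qed.

Lemma hol_const (c z0 : C) : hol (fun _ => c) z0.
Proof.
  apply hol_intro with (fun _ => RtoC 0) 1 0; [lra|].
  intros z w _ _. replace (c - c - 0 * (w - z))%C with (RtoC 0) by ring.
  rewrite Cmod_0. lra.
Qed.

Lemma hol_id (z0 : C) : hol (fun z => z) z0.
Proof.
  apply hol_intro with (fun _ => RtoC 1) 1 0; [lra|].
  intros z w _ _. replace (w - z - 1 * (w - z))%C with (RtoC 0) by ring.
  rewrite Cmod_0. lra.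
Qed.

Lemma hol_plus (f g : C -> C) (z0 : C) :
  hol f z0 -> hol g z0 -> hol (fun z => (f z + g z)%C) z0.
Proof.
  intros (r & K & f' & Hr & HK & Hb & Hq) (s & L & g' & Hs & HL & Hb' & Hq').
  apply hol_intro with (fun z => (f' z + g' z)%C) (Rmin r s) (K + L);
    [apply Rmin_glb_lt; lra|].
  intros z w Hz Hw.
  assert (A := Rmin_l r s). assert (B := Rmin_r r s).
  replace (f w + g w - (f z + g z) - (f' z + g' z) * (w - z))%C
    with ((f w - f z - f' z * (w - z)) + (g w - g z - g' z * (w - z)))%C by ring.
  rewrite Rmult_plus_distr_r.
  apply Cmod_plus_le; [apply Hq | apply Hq']; lra.
Qed.

Lemma hol_comp (g l : C -> C) (z0 : C) :
  hol l z0 -> hol g (l z0) -> hol (fun z => g (l z)) z0.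
Proof.
  intros Hl (s & L & g' & Hs & HL & Hb' & Hq').
  destruct (hol_lip _ _ Hl) as (r1 & K1 & Hr1 & HK1 & HL1).
  destruct Hl as (r & K & l' & Hr & HK & Hb & Hq).
  (* The radius makes the Lipschitz map [l] send the ball into the ball of radius [s]; [K1 + 1]
     avoids a division by zero. *)
  set (r2 := Rmin (Rmin r r1) (s / (K1 + 1))).
  assert (Hsp : 0 < s / (K1 + 1)) by (apply Rdiv_lt_0_compat; lra).
  assert (A0 : 0 < r2) by (repeat apply Rmin_glb_lt; lra).
  assert (A1 : r2 <= r) by (eapply Rle_trans; [apply Rmin_l | apply Rmin_l]).
  assert (A2 : r2 <= r1) by (eapply Rle_trans; [apply Rmin_l | apply Rmin_r]).
  assert (A3 : r2 <= s / (K1 + 1)) by apply Rmin_r.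
  assert (Hm : forall z, Cmod (z - z0) < r2 -> Cmod (l z - l z0) < s).
  { intros z Hz. apply Rle_lt_trans with (K1 * Cmod (z - z0)).
    - apply HL1; [rewrite Cmod_zero_sub; lra | lra].
    - assert (P := Cmod_ge_0 (z - z0)).
      apply Rle_lt_trans with (K1 * (s / (K1 + 1))).
      + apply Rmult_le_compat_l; lra.
      + apply Rmult_lt_reg_r with (K1 + 1); [lra|].
        field_simplify; [nra | lra]. }
  (* [L K1^2] is the remainder of [g] at the increment of [l], and [L K] is [g'] times the remainder
     of [l]. *)
  apply hol_intro with (fun z => (g' (l z) * l' z)%C) r2 (L * (K1 * K1) + L * K); [lra|].
  intros z w Hz Hw.
  replace (g (l w) - g (l z) - g' (l z) * l' z * (w - z))%C with
    ((g (l w) - g (l z) - g' (l z) * (l w - l z)) + g' (l z) * (l w - l z - l' z * (w - z)))%C by ring.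
  rewrite Rmult_plus_distr_r. apply Cmod_plus_le.
  - eapply Rle_trans; [apply Hq'; apply Hm; assumption|].
    assert (E := HL1 z w ltac:(lra) ltac:(lra)).
    assert (P := Cmod_ge_0 (l w - l z)).
    rewrite Rmult_assoc. apply Rmult_le_compat_l; [lra|].
    replace (K1 * K1 * (Cmod (w - z) * Cmod (w - z)))
      with ((K1 * Cmod (w - z)) * (K1 * Cmod (w - z))) by ring.
    apply Rmult_le_compat; lra.
  - rewrite Rmult_assoc. apply Cmod_mult_le.
    + apply Hb'. apply Hm; assumption.
    + apply Hq; lra.
Qed.

Lemma hol_sqr (z0 : C) : hol (fun z => (z * z)%C) z0.
Proof.
  apply hol_intro with (fun z => (2 * z)%C) 1 1; [lra|].
  intros z w _ _. replace (w * w - z * z - 2 * z * (w - z))%C with ((w - z) * (w - z))%C by ring.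
  rewrite Cmod_mult. lra.
Qed.

Lemma hol_scal (c : C) (f : C -> C) (z0 : C) :
  hol f z0 -> hol (fun z => (c * f z)%C) z0.
Proof.
  intros (r & K & f' & Hr & HK & Hb & Hq).
  apply hol_intro with (fun z => (c * f' z)%C) r (Cmod c * K); [lra|].
  intros z w Hz Hw.
  replace (c * f w - c * f z - c * f' z * (w - z))%C
    with (c * (f w - f z - f' z * (w - z)))%C by ring.
  rewrite Rmult_assoc. apply Cmod_mult_le; [lra | apply Hq; assumption].
Qed.

(* Polarisation reduces products to squares. *)
Lemma hol_mult (f g : C -> C) (z0 : C) :
  hol f z0 -> hol g z0 -> hol (fun z => (f z * g z)%C) z0.
Proof.
  intros Hf Hg.
  assert (Hs : forall h, hol h z0 -> hol (fun z => (h z * h z)%C) z0).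
  { intros h Hh. apply (hol_comp (fun z => (z * z)%C) h); [exact Hh | apply hol_sqr]. }
  apply hol_ext with (fun z => (/ 2 * ((f z + g z) * (f z + g z)
     + (- (1)) * (f z * f z + g z * g z)))%C).
  - intros z. field.
  - apply hol_scal. apply hol_plus.
    + apply Hs. apply hol_plus; assumption.
    + apply hol_scal. apply hol_plus; apply Hs; assumption.
Qed.

Lemma hol_opp (f : C -> C) (z0 : C) : hol f z0 -> hol (fun z => (- f z)%C) z0.
Proof.
  intros H. apply hol_ext with (fun z => (- (1) * f z)%C); [intros; ring|].
  apply hol_scal, H.
Qed.

Lemma hol_minus (f g : C -> C) (z0 : C) :
  hol f z0 -> hol g z0 -> hol (fun z => (f z - g z)%C) z0.
Proof. intros Hf Hg. apply hol_plus; [exact Hf | apply hol_opp, Hg]. Qed.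

(** The remainder is exactly [(w - z)^2 / (z^2 w)], and every modulus in the half-size ball is at
    least [|z0| / 2]. *)
Lemma Cinv_hol (z0 : C) : z0 <> 0 -> hol Cinv z0.
Proof.
  intros H0. apply Cmod_gt_0 in H0.
  apply hol_intro with (fun z => (- / (z * z))%C) (Cmod z0 / 2) (/ (Cmod z0 / 2) ^ 3); [lra|].
  assert (Hn : forall z, Cmod (z - z0) < Cmod z0 / 2 -> Cmod z0 / 2 <= Cmod z).
  { intros z Hz. assert (E := Cmod_sub_ge z0 z). rewrite Cmod_sub_sym in E. lra. }
  intros z w Hz Hw. apply Hn in Hz, Hw.
  assert (Nz : z <> 0) by (apply Cmod_gt_0; lra).
  assert (Nw : w <> 0) by (apply Cmod_gt_0; lra).
  replace (/ w - / z - - / (z * z) * (w - z))%C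
    with ((w - z) * (w - z) * / (z * z * w))%C by (field; auto).
  assert (Nzz : (z * z * w)%C <> 0).
  { apply Cmod_gt_0. rewrite !Cmod_mult. repeat apply Rmult_lt_0_compat; lra. }
  rewrite !Cmod_mult, Cmod_inv, !Cmod_mult by exact Nzz.
  rewrite Rmult_comm. apply Rmult_le_compat_r.
  - apply Rmult_le_pos; apply Cmod_ge_0.
  - apply Rinv_le_contravar; [apply pow_lt; lra|].
    set (m := Cmod z0 / 2) in *.
    replace (m ^ 3) with (m * m * m) by ring.
    assert (0 < m) by (unfold m; lra).
    apply Rmult_le_compat; try lra; [apply Rmult_le_pos; lra|].
    apply Rmult_le_compat; lra.
Qed.

Lemma hol_inv (f : C -> C) (z0 : C) :
  f z0 <> 0 -> hol f z0 -> hol (fun z => (/ f z)%C) z0.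
Proof. intros H0 Hf. apply hol_comp; [exact Hf | apply Cinv_hol, H0]. Qed.

(** In [is_derive] the limit point is quantified through a filter; uniqueness of limits identifies
    it with [z0], after which the epsilon form is the definition. *)
Lemma C_derive_intro (g : C -> C) (z0 l : C) :
  (forall e, 0 < e -> exists d, 0 < d /\ forall w, Cmod (w - z0) < d ->
     Cmod (g w - g z0 - l * (w - z0)) <= e * Cmod (w - z0)) ->
  is_derive g z0 l.
Proof.
  intros H. split; [apply is_linear_scal_l|].
  intros x Hx.
  assert (Ex : x = z0) by (symmetry;
    exact (is_filter_lim_locally_unique (V := AbsRing_NormedModule C_AbsRing) z0 x Hx)).
  subst x. intros [e He].
  destruct (H e He) as (d & Hd & Hw).
  exists (mkposreal d Hd). intros w Hwd. specialize (Hw w Hwd).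
  change (Cmod ((g w - g z0) - (w - z0) * l) <= e * Cmod (w - z0)).
  rewrite (Cmult_comm (w - z0) l). exact Hw.
Qed.

Lemma C_derive_elim (g : C -> C) (z0 l : C) :
  is_derive g z0 l ->
  forall e, 0 < e -> exists d, 0 < d /\ forall w, Cmod (w - z0) < d ->
     Cmod (g w - g z0 - l * (w - z0)) <= e * Cmod (w - z0).
Proof.
  intros [_ H] e He.
  assert (Hl : is_filter_lim (T := AbsRing_UniformSpace C_AbsRing)
      (locally (T := AbsRing_UniformSpace C_AbsRing) z0) z0)
    by (intros P HP; exact HP).
  destruct (H z0 Hl (mkposreal e He)) as [d Hd].
  exists d. split; [apply cond_pos|]. intros w Hw. specialize (Hd w Hw).
  change (Cmod ((g w - g z0) - (w - z0) * l) <= e * Cmod (w - z0)) in Hd.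
  rewrite (Cmult_comm (w - z0) l) in Hd. exact Hd.
Qed.

Lemma R_derive_intro (g : R -> R) (z0 l : R) :
  (forall e, 0 < e -> exists d, 0 < d /\ forall w, Rabs (w - z0) < d ->
     Rabs (g w - g z0 - l * (w - z0)) <= e * Rabs (w - z0)) ->
  is_derive g z0 l.
Proof.
  intros H. split; [apply is_linear_scal_l|].
  intros x Hx.
  assert (Ex : x = z0) by (symmetry;
    exact (is_filter_lim_locally_unique (V := AbsRing_NormedModule R_AbsRing) z0 x Hx)).
  subst x. intros [e He].
  destruct (H e He) as (d & Hd & Hw).
  exists (mkposreal d Hd). intros w Hwd. specialize (Hw w Hwd).
  change (norm (minus w z0)) with (Rabs (w - z0)).
  change (norm (minus (minus (g w) (g z0)) (scal (minus w z0) l))) with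
    (Rabs ((g w - g z0) - (w - z0) * l)).
  rewrite (Rmult_comm (w - z0) l). exact Hw.
Qed.

Lemma quad_rem_is_derive (g g' : C -> C) (z0 : C) (r K : R) :
  0 < r -> quad_rem g g' z0 r K -> forall z, Cmod (z - z0) < r -> is_derive g z (g' z).
Proof.
  intros Hr H z Hz. apply C_derive_intro. intros e He.
  set (d := Rmin (r - Cmod (z - z0)) (e / (Rabs K + 1))).
  assert (HK := Rabs_pos K). assert (HK' := Rle_abs K).
  assert (Hd : 0 < d).
  { apply Rmin_glb_lt; [lra | apply Rdiv_lt_0_compat; lra]. }
  exists d. split; [exact Hd|]. intros w Hw.
  assert (D1 : d <= r - Cmod (z - z0)) by apply Rmin_l.
  assert (D2 : d <= e / (Rabs K + 1)) by apply Rmin_r.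
  assert (T := Cmod_tri3 w z z0).
  eapply Rle_trans; [apply H; lra|].
  assert (P := Cmod_ge_0 (w - z)).
  rewrite <- Rmult_assoc. apply Rmult_le_compat_r; [lra|].
  apply Rle_trans with ((Rabs K + 1) * (e / (Rabs K + 1))).
  - apply Rle_trans with ((Rabs K + 1) * Cmod (w - z)).
    + apply Rmult_le_compat_r; lra.
    + apply Rmult_le_compat_l; lra.
  - right. field. lra.
Qed.

Lemma hol_ex_derive (g : C -> C) (z0 : C) : hol g z0 -> ex_derive g z0.
Proof.
  intros (r & K & g' & Hr & HK & Hb & Hq). exists (g' z0).
  apply (quad_rem_is_derive _ _ _ _ _ Hr Hq). rewrite Cmod_zero_sub; lra.
Qed.

Lemma hol_quad (g : C -> C) (z0 : C) : hol g z0 ->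
  exists r K, 0 < r /\ 0 <= K /\ quad_rem g (C_derive g) z0 r K.
Proof.
  intros (r & K & g' & Hr & HK & Hb & Hq). exists r, K.
  split; [lra|]. split; [lra|].
  intros z w Hz Hw.
  rewrite (is_C_derive_unique _ _ _ (quad_rem_is_derive _ _ _ _ _ Hr Hq z Hz)).
  apply Hq; assumption.
Qed.

Lemma hol_is_derive (g : C -> C) (z0 : C) : hol g z0 -> is_derive g z0 (C_derive g z0).
Proof.
  intros H. destruct (hol_quad g z0 H) as (r & K & Hr & HK & Hq).
  apply (quad_rem_is_derive _ _ _ _ _ Hr Hq). rewrite Cmod_zero_sub; lra.
Qed.

Lemma Re_plus (a b : C) : Re (a + b) = Re a + Re b. Proof. reflexivity. Qed.
Lemma Im_plus (a b : C) : Im (a + b) = Im a + Im b. Proof. reflexivity. Qed.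
Lemma Re_minus (a b : C) : Re (a - b) = Re a - Re b. Proof. reflexivity. Qed.
Lemma Im_minus (a b : C) : Im (a - b) = Im a - Im b. Proof. reflexivity. Qed.
Lemma Re_mult (a b : C) : Re (a * b) = Re a * Re b - Im a * Im b. Proof. reflexivity. Qed.
Lemma Im_mult (a b : C) : Im (a * b) = Re a * Im b + Im a * Re b. Proof. reflexivity. Qed.

(** Restriction to a line and pairing with a constant [u] reduces complex derivatives to real ones;
    [u = 1] and [u = - Ci] recover the real and imaginary parts. *)
Lemma C_derive_along (h : C -> C) (l u p v : C) (t0 : R) :
  is_derive h (p + RtoC t0 * v)%C l ->
  is_derive (fun t : R => Re (u * h (p + RtoC t * v)%C)) t0 (Re (u * (l * v))).
Proof.
  intros H. apply R_derive_intro. intros e He.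
  assert (Pu := Cmod_ge_0 u). assert (Pv := Cmod_ge_0 v).
  set (k := Cmod u * Cmod v + 1).
  assert (Puv : 0 <= Cmod u * Cmod v) by (apply Rmult_le_pos; lra).
  assert (Hk : 0 < k) by (unfold k; lra).
  destruct (C_derive_elim h _ l H (e / k) ltac:(apply Rdiv_lt_0_compat; lra)) as (d & Hd & Hw).
  exists (d / (Cmod v + 1)). split; [apply Rdiv_lt_0_compat; lra|].
  intros t Ht.
  assert (E1 : ((p + RtoC t * v) - (p + RtoC t0 * v))%C = (RtoC (t - t0) * v)%C)
    by (rewrite RtoC_minus; ring).
  assert (E2 : Cmod ((p + RtoC t * v) - (p + RtoC t0 * v)) = Rabs (t - t0) * Cmod v)
    by (rewrite E1, Cmod_mult, Cmod_R; reflexivity).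
  assert (Pt := Rabs_pos (t - t0)).
  specialize (Hw (p + RtoC t * v)%C). rewrite E2 in Hw.
  assert (Hlt : Rabs (t - t0) * Cmod v < d).
  { apply Rle_lt_trans with (Rabs (t - t0) * (Cmod v + 1)); [apply Rmult_le_compat_l; lra|].
    apply Rmult_lt_reg_r with (/ (Cmod v + 1)); [apply Rinv_0_lt_compat; lra|].
    rewrite Rmult_assoc, Rinv_r, Rmult_1_r by lra. exact Ht. }
  specialize (Hw Hlt). rewrite E1 in Hw.
  replace (Re (u * h (p + t * v)%C) - Re (u * h (p + t0 * v)%C) - Re (u * (l * v)) * (t - t0))
    with (Re (u * (h (p + t * v) - h (p + t0 * v) - l * (RtoC (t - t0) * v)))%C).
  2:{ rewrite !Re_mult, !Re_minus, !Im_minus, !Re_mult, !Im_mult, !Re_mult.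
      unfold RtoC, Re, Im; cbn; ring. }
  eapply Rle_trans; [apply re_le_Cmod|]. rewrite Cmod_mult.
  apply Rle_trans with (Cmod u * (e / k * (Rabs (t - t0) * Cmod v))).
  - apply Rmult_le_compat_l; lra.
  - replace (Cmod u * (e / k * (Rabs (t - t0) * Cmod v)))
      with ((Cmod u * Cmod v) * / k * (e * Rabs (t - t0))) by (field; lra).
    assert (0 <= e * Rabs (t - t0)) by (apply Rmult_le_pos; lra).
    rewrite <- (Rmult_1_l (e * Rabs (t - t0))) at 2.
    apply Rmult_le_compat_r; [lra|].
    apply Rmult_le_reg_r with k; [lra|].
    rewrite Rmult_assoc, Rinv_l by lra. unfold k; lra.
Qed.

(** Complex values have no mean value point in general. The real theorem is applied to [Re (u h)] on
    the segment with [u] the conjugate of [h b - h a], so that the increment is [|h b - h a|^2]. *)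
Lemma C_mean_value (h h' : C -> C) (a b : C) (M : R) :
  (forall t, 0 <= t <= 1 -> is_derive h (a + RtoC t * (b - a))%C (h' (a + RtoC t * (b - a))%C)
     /\ Cmod (h' (a + RtoC t * (b - a))%C) <= M) ->
  Cmod (h b - h a) <= M * Cmod (b - a).
Proof.
  intros H.
  set (u := Cconj (h b - h a)).
  assert (Hu : Cmod u = Cmod (h b - h a)) by apply Cmod_conj.
  assert (Pu := Cmod_ge_0 u). assert (Pv := Cmod_ge_0 (b - a)).
  destruct (Req_dec (Cmod u) 0) as [E|E].
  { rewrite <- Hu, E. apply Rmult_le_pos; [|lra].
    apply Rle_trans with (2 := proj2 (H 0 ltac:(lra))). apply Cmod_ge_0. }
  destruct (MVT_gen (fun t : R => Re (u * h (a + RtoC t * (b - a))%C)) 0 1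
     (fun t => Re (u * (h' (a + RtoC t * (b - a))%C * (b - a))))) as (c & Hc & Hv).
  - intros t Ht. rewrite Rmin_left, Rmax_right in Ht by lra.
    apply C_derive_along. apply H. lra.
  - intros t Ht. rewrite Rmin_left, Rmax_right in Ht by lra.
    apply continuity_pt_filterlim, (ex_derive_continuous (fun t : R => Re (u * h (a + RtoC t * (b - a))%C))).
    eexists. apply C_derive_along. apply H. lra.
  - rewrite Rmin_left, Rmax_right in Hc by lra.
    replace (a + 1 * (b - a))%C with b in Hv by ring.
    replace (a + 0 * (b - a))%C with a in Hv by ring.
    replace (Re (u * h b) - Re (u * h a)) with (Re (u * (h b - h a))%C) in Hv.
    2:{ rewrite !Re_mult, Re_minus, Im_minus. ring. }
    assert (Hn : Re (u * (h b - h a)) = Cmod u * Cmod u).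
    { rewrite Hu. unfold u. destruct (h b - h a)%C as [x y]. unfold Cmod, Cconj, Cmult, Re; cbn.
      rewrite sqrt_sqrt by nra. ring. }
    rewrite Hn in Hv.
    assert (Hle : Cmod u * Cmod u <= Cmod u * (M * Cmod (b - a))).
    { rewrite Hv. rewrite Rminus_0_r, Rmult_1_r.
      eapply Rle_trans; [apply Rle_abs|]. eapply Rle_trans; [apply re_le_Cmod|].
      rewrite !Cmod_mult. apply Rmult_le_compat_l; [lra|].
      apply Rmult_le_compat_r; [lra|]. apply H. exact Hc. }
    rewrite <- Hu. apply Rmult_le_reg_l with (Cmod u); lra.
Qed.

Lemma segment_in_ball (z0 a b : C) (r t : R) : 0 <= t <= 1 ->
  Cmod (a - z0) < r -> Cmod (b - z0) < r -> Cmod (a + RtoC t * (b - a) - z0) < r.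
Proof.
  intros Ht Ha Hb.
  replace (a + t * (b - a) - z0)%C with (RtoC (1 - t) * (a - z0) + RtoC t * (b - z0))%C
    by (rewrite RtoC_minus; ring).
  eapply Rle_lt_trans; [apply Cmod_triangle|].
  rewrite !Cmod_mult, !Cmod_R, !Rabs_pos_eq by lra.
  destruct (Req_dec t 0) as [->|Hn]; [lra|].
  assert ((1 - t) * Cmod (a - z0) <= (1 - t) * r) by (apply Rmult_le_compat_l; lra).
  assert (t * Cmod (b - z0) < t * r) by (apply Rmult_lt_compat_l; lra). lra.
Qed.

Lemma is_derive_affine_sub (g : C -> C) (z l c d z1 : C) :
  is_derive g z l -> is_derive (fun w => g w - d - c * (w - z1))%C z (l - c)%C.
Proof.
  intros H. apply C_derive_intro. intros e He.
  destruct (C_derive_elim _ _ _ H e He) as (r & Hr & Hw).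
  exists r. split; [exact Hr|]. intros w Hwr. specialize (Hw w Hwr).
  replace (g w - d - c * (w - z1) - (g z - d - c * (z - z1)) - (l - c) * (w - z))%C
    with (g w - g z - l * (w - z))%C by ring. exact Hw.
Qed.

(** The mean value inequality for [g x - g z - g' z (x - z)], whose derivative [g' x - g' z] is at
    most [L |w - z|] on the segment. *)
Lemma quad_rem_of_lip (g g' : C -> C) (z0 : C) (r L : R) :
  (forall z, Cmod (z - z0) < r -> is_derive g z (g' z)) ->
  (forall z w, Cmod (z - z0) < r -> Cmod (w - z0) < r -> Cmod (g' w - g' z) <= L * Cmod (w - z)) ->
  0 <= L -> quad_rem g g' z0 r L.
Proof.
  intros Hd Hl HL z w Hz Hw.
  assert (P := Cmod_ge_0 (w - z)).
  assert (E := C_mean_value (fun x => g x - g z - g' z * (x - z))%C (fun x => g' x - g' z)%C z w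
     (L * Cmod (w - z))).
  replace (g w - g z - g' z * (w - z))%C
    with (g w - g z - g' z * (w - z) - (g z - g z - g' z * (z - z)))%C by ring.
  rewrite <- Rmult_assoc. apply E. intros t Ht. split.
  - apply is_derive_affine_sub, Hd, segment_in_ball; assumption.
  - eapply Rle_trans; [apply Hl; [assumption | apply segment_in_ball; assumption]|].
    apply Rmult_le_compat_l; [lra|].
    replace (z + t * (w - z) - z)%C with (RtoC t * (w - z))%C by ring.
    rewrite Cmod_mult, Cmod_R, Rabs_pos_eq by lra.
    rewrite <- (Rmult_1_l (Cmod (w - z))) at 2. apply Rmult_le_compat_r; lra.
Qed.

(** * The complex exponential *)

Lemma Rabs_sin_le (y : R) : Rabs (sin y) <= Rabs y.
Proof.
  assert (H := bounded_variation sin cos 1 0 y).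
  rewrite sin_0, !Rminus_0_r, Rmult_1_l in H. apply H.
  intros t _. split; [apply is_derive_sin|].
  apply Rabs_le. assert (B := COS_bound t). lra.
Qed.

Lemma cos_quad (y : R) : Rabs (cos y - 1) <= y * y.
Proof.
  assert (E : cos y - 1 = - (2 * (sin (y / 2) * sin (y / 2)))).
  { replace y with (2 * (y / 2)) at 1 by field. rewrite cos_2a_sin. ring. }
  rewrite E, Rabs_Ropp, Rabs_pos_eq by nra.
  assert (H := Rabs_sin_le (y / 2)).
  assert (sin (y / 2) * sin (y / 2) <= (y / 2) * (y / 2)).
  { apply Rsqr_le_abs_1 in H. exact H. }
  nra.
Qed.

Lemma sin_quad (y : R) : Rabs y <= 1 -> Rabs (sin y - y) <= y * y.
Proof.
  intros Hy.
  assert (H := bounded_variation (fun t => sin t - t) (fun t => cos t - 1) (Rabs y) 0 y).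
  cbv beta in H. rewrite sin_0, !Rminus_0_r in H.
  replace (y * y) with (Rabs y * Rabs y) by (rewrite <- Rabs_mult; apply Rabs_pos_eq; nra).
  apply H. intros t Ht. rewrite Rminus_0_r in Ht. split.
  - apply (is_derive_minus (K := R_AbsRing) (V := R_NormedModule) sin (fun t => t) t (cos t) 1).
    + apply is_derive_sin.
    + apply (is_derive_id t).
  - eapply Rle_trans; [apply cos_quad|].
    replace (t * t) with (Rabs t * Rabs t) by (rewrite <- Rabs_mult; apply Rabs_pos_eq; nra).
    assert (P := Rabs_pos t). nra.
Qed.

(** The upper bound on [exp x] comes from a lower bound at [- x]: multiplying [1 - x <= exp (- x)]
    by [exp x] gives [exp x (1 - x) <= 1]. *)
Lemma exp_quad (x : R) : Rabs x <= / 2 -> Rabs (exp x - 1 - x) <= 2 * (x * x).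
Proof.
  intros Hx. apply Rabs_le_between in Hx.
  assert (L := exp_ineq1_le x).
  assert (L' := exp_ineq1_le (- x)).
  assert (E : exp x * exp (- x) = 1) by (rewrite <- exp_plus; replace (x + - x) with 0 by ring; apply exp_0).
  assert (P := exp_pos x).
  rewrite Rabs_pos_eq by lra.
  assert (U : exp x * (1 + - x) <= 1) by (rewrite <- E; apply Rmult_le_compat_l; lra).
  nra.
Qed.

Lemma Cexp_plus (z w : C) : Cexp (z + w) = (Cexp z * Cexp w)%C.
Proof.
  destruct z as [a b], w as [c d]. unfold Cexp, Cplus, Cmult, Re, Im; cbn.
  rewrite exp_plus, cos_plus, sin_plus. f_equal; ring.
Qed.

Lemma Cexp_0 : Cexp 0 = 1.
Proof. unfold Cexp, RtoC, Re, Im; cbn. rewrite exp_0, cos_0, sin_0. f_equal; ring. Qed.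

Lemma Cexp_neq_0 (z : C) : Cexp z <> 0.
Proof.
  intros E. assert (H := Cexp_plus z (- z)). rewrite E in H.
  replace (z + - z)%C with (RtoC 0) in H by ring.
  rewrite Cexp_0 in H. apply (f_equal fst) in H. cbn in H. lra.
Qed.

Lemma Cmod_Cexp (z : C) : Cmod (Cexp z) = exp (Re z).
Proof.
  unfold Cexp, Cmod; cbn.
  replace (exp (Re z) * cos (Im z) * (exp (Re z) * cos (Im z) * 1) +
     exp (Re z) * sin (Im z) * (exp (Re z) * sin (Im z) * 1))
    with (exp (Re z) * exp (Re z) * ((sin (Im z))² + (cos (Im z))²)) by (unfold Rsqr; ring).
  rewrite sin2_cos2, Rmult_1_r, sqrt_square; [reflexivity | left; apply exp_pos].
Qed.

(** The real and imaginary parts split into four errors built from the real expansions of exp, cos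
    and sin, each at most [2 |h|^2]; hence the constant 8. *)
Lemma Cexp_quad (h : C) : Cmod h <= / 2 -> Cmod (Cexp h - 1 - h) <= 8 * (Cmod h * Cmod h).
Proof.
  intros Hh. set (x := Re h). set (y := Im h).
  assert (Hx : Rabs x <= Cmod h) by apply re_le_Cmod.
  assert (Hy : Rabs y <= Cmod h) by apply im_le_Cmod.
  assert (Px := Rabs_pos x). assert (Py := Rabs_pos y).
  assert (E1 := exp_quad x ltac:(lra)). assert (C1 := cos_quad y). assert (S1 := sin_quad y ltac:(lra)).
  assert (Sq : forall t, t * t = Rabs t * Rabs t)
    by (intros; rewrite <- Rabs_mult; symmetry; apply Rabs_pos_eq; nra).
  rewrite (Sq x) in E1. rewrite (Sq y) in C1, S1.
  assert (Ex : Rabs (exp x) <= 2).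
  { rewrite Rabs_pos_eq by (left; apply exp_pos).
    assert (exp x - 1 - x <= 2 * (Rabs x * Rabs x)) by (eapply Rle_trans; [apply Rle_abs | exact E1]).
    assert (x <= Rabs x) by apply Rle_abs. nra. }
  assert (Ex1 : Rabs (exp x - 1) <= 2 * Rabs x).
  { replace (exp x - 1) with ((exp x - 1 - x) + x) by ring.
    eapply Rle_trans; [apply Rabs_triang|]. nra. }
  set (m := Cmod h) in *.
  eapply Rle_trans; [apply Cmod_le_abs|].
  replace (Re (Cexp h - 1 - h)) with ((exp x - 1 - x) + exp x * (cos y - 1))
    by (unfold Cexp, x, y, Re, Im; cbn; ring).
  replace (Im (Cexp h - 1 - h)) with (exp x * (sin y - y) + (exp x - 1) * y)
    by (unfold Cexp, x, y, Re, Im; cbn; ring).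
  assert (A1 : Rabs (exp x * (cos y - 1)) <= 2 * (Rabs y * Rabs y))
    by (rewrite Rabs_mult; apply Rmult_le_compat; auto using Rabs_pos).
  assert (A2 : Rabs (exp x * (sin y - y)) <= 2 * (Rabs y * Rabs y))
    by (rewrite Rabs_mult; apply Rmult_le_compat; auto using Rabs_pos).
  assert (A3 : Rabs ((exp x - 1) * y) <= 2 * Rabs x * Rabs y)
    by (rewrite Rabs_mult; apply Rmult_le_compat_r; auto using Rabs_pos).
  assert (T1 := Rabs_triang (exp x - 1 - x) (exp x * (cos y - 1))).
  assert (T2 := Rabs_triang (exp x * (sin y - y)) ((exp x - 1) * y)).
  assert (Rabs x * Rabs x <= m * m) by (apply Rmult_le_compat; lra).
  assert (Rabs y * Rabs y <= m * m) by (apply Rmult_le_compat; lra).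
  assert (Rabs x * Rabs y <= m * m) by (apply Rmult_le_compat; lra).
  lra.
Qed.

(** The addition formula transports the estimate at 0 to every point; the radius 1/4 keeps [|w - z|]
    below 1/2. *)
Lemma Cexp_hol (z0 : C) : hol Cexp z0.
Proof.
  apply hol_intro with Cexp (/ 4) (8 * exp (Re z0 + 1)); [lra|].
  intros z w Hz Hw.
  assert (Hd : Cmod (w - z) <= / 2).
  { assert (E := Cmod_tri3 w z0 z). rewrite (Cmod_sub_sym z0 z) in E. lra. }
  replace (Cexp w) with (Cexp z * Cexp (w - z))%C
    by (rewrite <- Cexp_plus; f_equal; ring).
  replace (Cexp z * Cexp (w - z) - Cexp z - Cexp z * (w - z))%C
    with (Cexp z * (Cexp (w - z) - 1 - (w - z)))%C by ring.
  rewrite (Rmult_comm 8), Rmult_assoc. apply Cmod_mult_le.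
  - rewrite Cmod_Cexp.
    assert (E := re_le_Cmod (z - z0)). rewrite Re_minus in E.
    apply Rabs_le_between in E. apply Rlt_le, exp_increasing. lra.
  - apply Cexp_quad, Hd.
Qed.

(** * Cauchy estimates *)

Lemma C_derive_cont (g : C -> C) (z0 : C) : hol g z0 ->
  forall e, 0 < e -> exists d, 0 < d /\ forall w, Cmod (w - z0) < d ->
    Cmod (C_derive g w - C_derive g z0) < e.
Proof.
  intros H e He. destruct (hol_quad g z0 H) as (r & K & Hr & HK & Hq).
  exists (Rmin r (e / (2 * K + 1))).
  split; [apply Rmin_glb_lt; [lra | apply Rdiv_lt_0_compat; lra]|].
  intros w Hw.
  assert (A := Rmin_l r (e / (2 * K + 1))). assert (B := Rmin_r r (e / (2 * K + 1))).
  eapply Rle_lt_trans;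
    [apply (quad_rem_deriv_lip _ _ _ _ _ Hq z0 w); [rewrite Cmod_zero_sub; lra | lra]|].
  assert (P := Cmod_ge_0 (w - z0)).
  apply Rle_lt_trans with (2 * K * (e / (2 * K + 1))); [apply Rmult_le_compat_l; lra|].
  apply Rmult_lt_reg_r with (2 * K + 1); [lra|]. field_simplify; [nra | lra].
Qed.

Lemma hol_C_derive_along (h : C -> C) (u p v : C) (t0 : R) : hol h (p + RtoC t0 * v)%C ->
  is_derive (fun t : R => Re (u * h (p + RtoC t * v)%C)) t0
    (Re (u * (C_derive h (p + RtoC t0 * v)%C * v))).
Proof. intros H. apply C_derive_along, hol_is_derive, H. Qed.

Lemma Cmod_two_step (v1 v2 : C) (s t s0 t0 d : R) : 0 < d ->
  Rabs (s - s0) < d / (Cmod v1 + Cmod v2 + 1) -> Rabs (t - t0) < d / (Cmod v1 + Cmod v2 + 1) ->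
  Cmod (RtoC (s - s0) * v1 + RtoC (t - t0) * v2) < d.
Proof.
  intros Hd Hs Ht. assert (P1 := Cmod_ge_0 v1). assert (P2 := Cmod_ge_0 v2).
  set (q := Cmod v1 + Cmod v2 + 1) in *.
  eapply Rle_lt_trans; [apply Cmod_triangle|]. rewrite !Cmod_mult, !Cmod_R.
  assert (Hq : 0 < d / q) by (apply Rdiv_lt_0_compat; unfold q; lra).
  assert (A : Rabs (s - s0) * Cmod v1 <= d / q * Cmod v1) by (apply Rmult_le_compat_r; lra).
  assert (B : Rabs (t - t0) * Cmod v2 <= d / q * Cmod v2) by (apply Rmult_le_compat_r; lra).
  assert (E : d = d / q * Cmod v1 + d / q * Cmod v2 + d / q) by (unfold q; field; unfold q in *; lra).
  lra.
Qed.

(* The integrand of the derivative is itself a derivative along the segment: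
   [h' v1 = k (h' v2)]. *)
Lemma is_derive_segment_RInt (h : C -> C) (u p v1 v2 k : C) (a b s0 d : R) :
  0 < d -> v1 = (k * v2)%C ->
  (forall s t : R, Rabs (s - s0) < d -> Rmin a b <= t <= Rmax a b ->
     hol h (p + RtoC s * v1 + RtoC t * v2)%C) ->
  is_derive (fun s : R => RInt (fun t : R => Re (u * h (p + RtoC s * v1 + RtoC t * v2)%C)) a b) s0
    (Re (u * k * h (p + RtoC s0 * v1 + RtoC b * v2)%C)
     - Re (u * k * h (p + RtoC s0 * v1 + RtoC a * v2)%C)).
Proof.
  intros Hd Hk Hh.
  assert (Hs0 : Rabs (s0 - s0) < d) by (rewrite Rminus_diag, Rabs_R0; lra).
  assert (Dv : forall s t : R, hol h (p + RtoC s * v1 + RtoC t * v2)%C ->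
     is_derive (fun s : R => Re (u * h (p + RtoC s * v1 + RtoC t * v2)%C)) s
       (Re (u * (C_derive h (p + RtoC s * v1 + RtoC t * v2)%C * v1)))).
  { intros s t H.
    assert (E : forall s, (p + RtoC s * v1 + RtoC t * v2)%C = ((p + RtoC t * v2) + RtoC s * v1)%C)
      by (intros; ring).
    rewrite E in *.
    apply is_derive_ext with (fun s : R => Re (u * h ((p + RtoC t * v2) + RtoC s * v1)%C)).
    - intros s'. rewrite <- E. reflexivity.
    - apply hol_C_derive_along, H. }
  assert (Dt : forall t : R, Rmin a b <= t <= Rmax a b ->
     is_derive (fun t : R => Re (u * k * h (p + RtoC s0 * v1 + RtoC t * v2)%C)) t
       (Re (u * (C_derive h (p + RtoC s0 * v1 + RtoC t * v2)%C * v1)))).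
  { intros t Ht. specialize (Hh s0 t Hs0 Ht).
    replace (u * (C_derive h (p + RtoC s0 * v1 + RtoC t * v2)%C * v1))%C
      with (u * k * (C_derive h (p + RtoC s0 * v1 + RtoC t * v2)%C * v2))%C
      by (rewrite Hk; ring).
    apply hol_C_derive_along, Hh. }
  (* Joint continuity of the [s]-derivative, as differentiation under the integral requires; it
     comes from the continuity of [C_derive h]. *)
  assert (Hc : forall t : R, Rmin a b <= t <= Rmax a b ->
     continuity_2d_pt (fun s t : R => Derive (fun z : R => Re (u * h (p + RtoC z * v1 + RtoC t * v2)%C)) s) s0 t).
  { intros t Ht e. specialize (Hh s0 t Hs0 Ht).
    assert (Pu := Cmod_ge_0 u). assert (Pv1 := Cmod_ge_0 v1). assert (Pv2 := Cmod_ge_0 v2).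
    set (c := Cmod u * Cmod v1 + 1).
    assert (Puv : 0 <= Cmod u * Cmod v1) by (apply Rmult_le_pos; lra).
    assert (Pc : 0 < c) by (unfold c; lra).
    destruct (C_derive_cont _ _ Hh (e / c) ltac:(apply Rdiv_lt_0_compat; [apply cond_pos | lra]))
      as (d1 & Hd1 & Hw1).
    destruct (hol_at_near _ _ Hh) as (d2 & Hd2 & Hw2).
    set (q := Cmod v1 + Cmod v2 + 1).
    assert (Pq : 0 < Rmin d1 d2 / q) by (apply Rdiv_lt_0_compat; [apply Rmin_glb_lt|unfold q]; lra).
    exists (mkposreal _ Pq). intros s' t' Hs' Ht'. cbn [pos] in Hs', Ht'.
    assert (Hn : Cmod ((p + RtoC s' * v1 + RtoC t' * v2) - (p + RtoC s0 * v1 + RtoC t * v2)) < Rmin d1 d2).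
    { replace ((p + RtoC s' * v1 + RtoC t' * v2) - (p + RtoC s0 * v1 + RtoC t * v2))%C
        with (RtoC (s' - s0) * v1 + RtoC (t' - t) * v2)%C by (rewrite !RtoC_minus; ring).
      apply Cmod_two_step; [apply Rmin_glb_lt; lra | assumption | assumption]. }
    assert (M1 := Rmin_l d1 d2). assert (M2 := Rmin_r d1 d2).
    cbv beta. rewrite (is_derive_unique _ _ _ (Dv s' t' (Hw2 (p + RtoC s' * v1 + RtoC t' * v2)%C ltac:(lra)))).
    rewrite (is_derive_unique _ _ _ (Dv s0 t Hh)).
    set (A := C_derive h (p + RtoC s' * v1 + RtoC t' * v2)%C).
    set (B := C_derive h (p + RtoC s0 * v1 + RtoC t * v2)%C).
    rewrite <- Re_minus.
    replace (u * (A * v1) - u * (B * v1))%C with (u * v1 * (A - B))%C by ring.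
    eapply Rle_lt_trans; [apply re_le_Cmod|]. rewrite !Cmod_mult.
    assert (L := Hw1 (p + RtoC s' * v1 + RtoC t' * v2)%C ltac:(lra)). fold A B in L.
    assert (PA := Cmod_ge_0 (A - B)).
    apply Rle_lt_trans with (c * Cmod (A - B)); [apply Rmult_le_compat_r; [lra | unfold c; lra]|].
    apply Rmult_lt_reg_l with (/ c); [apply Rinv_0_lt_compat; lra|].
    rewrite <- Rmult_assoc, Rinv_l, Rmult_1_l by lra.
    rewrite Rmult_comm. exact L. }
  assert (HI := is_derive_RInt_param
     (fun s t : R => Re (u * h (p + RtoC s * v1 + RtoC t * v2)%C)) a b s0).
  cbv beta in HI.
  replace (Re (u * k * h (p + RtoC s0 * v1 + RtoC b * v2)%C)
     - Re (u * k * h (p + RtoC s0 * v1 + RtoC a * v2)%C))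
  with (RInt (fun t : R => Derive (fun s : R => Re (u * h (p + RtoC s * v1 + RtoC t * v2)%C)) s0) a b).
  - apply HI; clear HI.
    + exists (mkposreal d Hd). intros s Hs t Ht. eexists. apply Dv. apply Hh; [exact Hs | exact Ht].
    + exact Hc.
    + exists (mkposreal d Hd). intros s Hs. apply (ex_RInt_continuous (V := R_CompleteNormedModule)).
      intros t Ht. apply (ex_derive_continuous (fun t : R => Re (u * h (p + RtoC s * v1 + RtoC t * v2)%C))).
      eexists. apply hol_C_derive_along. apply Hh; [exact Hs | exact Ht].
  (* The integrated derivative is evaluated by the fundamental theorem: by [Dt] its integrand is the
     [t]-derivative of [Re (u k h)]. *)
  - rewrite (RInt_ext _ (fun t : R => Re (u * (C_derive h (p + RtoC s0 * v1 + RtoC t * v2)%C * v1)))).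
    2:{ intros t Ht. apply is_derive_unique, Dv, Hh; [exact Hs0 | lra]. }
    apply is_RInt_unique.
    apply (is_RInt_derive (fun t : R => Re (u * k * h (p + RtoC s0 * v1 + RtoC t * v2)%C))).
    + exact Dt.
    + intros t Ht.
      apply (continuous_ext_loc _ (fun t : R => Derive (fun s : R => Re (u * h (p + RtoC s * v1 + RtoC t * v2)%C)) s0)).
      * destruct (hol_at_near _ _ (Hh s0 t Hs0 Ht)) as (r & Hr & Hw).
        assert (Pv2 := Cmod_ge_0 v2).
        assert (Pq : 0 < r / (Cmod v2 + 1)) by (apply Rdiv_lt_0_compat; lra).
        exists (mkposreal _ Pq). intros t' Ht'. apply is_derive_unique, Dv, Hw.
        replace ((p + RtoC s0 * v1 + RtoC t' * v2) - (p + RtoC s0 * v1 + RtoC t * v2))%C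
          with (RtoC (t' - t) * v2)%C by (rewrite RtoC_minus; ring).
        rewrite Cmod_mult, Cmod_R. change (Rabs (t' - t) < r / (Cmod v2 + 1)) in Ht'.
        apply Rle_lt_trans with (Rabs (t' - t) * (Cmod v2 + 1)).
        -- apply Rmult_le_compat_l; [apply Rabs_pos | lra].
        -- apply Rmult_lt_reg_r with (/ (Cmod v2 + 1)); [apply Rinv_0_lt_compat; lra|].
           rewrite Rmult_assoc, Rinv_r, Rmult_1_r by lra. exact Ht'.
      * intros P [e He]. destruct (Hc t Ht e) as [d1 Hd1].
        exists d1. intros t' Ht'. apply He. apply Hd1; [rewrite Rminus_diag, Rabs_R0; apply cond_pos | exact Ht'].
Qed.

Lemma ex_RInt_segment (h : C -> C) (u p v : C) (a b : R) :
  (forall t : R, Rmin a b <= t <= Rmax a b -> hol h (p + RtoC t * v)%C) ->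
  ex_RInt (fun t : R => Re (u * h (p + RtoC t * v)%C)) a b.
Proof.
  intros H. apply (ex_RInt_continuous (V := R_CompleteNormedModule)).
  intros t Ht. apply (ex_derive_continuous (fun t : R => Re (u * h (p + RtoC t * v)%C))).
  eexists. apply hol_C_derive_along, H, Ht.
Qed.

Lemma Cexp_period (x : C) : Cexp (x + RtoC (2 * PI) * Ci) = Cexp x.
Proof.
  rewrite Cexp_plus.
  replace (Cexp (RtoC (2 * PI) * Ci)) with (RtoC 1); [ring|].
  unfold Cexp, Ci, RtoC, Cmult, Re, Im; cbn.
  replace ((2 * PI) * 0 - 0 * 1) with 0 by ring.
  replace ((2 * PI) * 1 + 0 * 0) with (2 * PI) by ring.
  rewrite exp_0, cos_2PI, sin_2PI. f_equal; ring.
Qed.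

Lemma RInt_dist_const (f : R -> R) (a b c M : R) : a <= b -> ex_RInt f a b ->
  (forall t, a <= t <= b -> Rabs (f t - c) <= M) ->
  Rabs (RInt f a b - c * (b - a)) <= (b - a) * M.
Proof.
  intros Hab He Hb.
  assert (E : RInt f a b - c * (b - a) = RInt (fun t => f t - c) a b).
  { rewrite (RInt_minus (V := R_CompleteNormedModule) f (fun _ => c));
      [|exact He | apply ex_RInt_const].
    rewrite RInt_const. unfold minus, plus, opp, scal; simpl. unfold mult; simpl. ring. }
  rewrite E. apply abs_RInt_le_const; [exact Hab | | exact Hb].
  apply (ex_RInt_minus (V := R_NormedModule)); [exact He | apply ex_RInt_const].
Qed.

Lemma Re_Cconj_mult (z : C) : Re (Cconj z * z) = Cmod z * Cmod z.
Proof.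
  destruct z as [x y]. unfold Cmod, Cconj, Cmult, Re; cbn.
  rewrite sqrt_sqrt by nra. ring.
Qed.

Lemma Cexp_conj_cancel (x : C) : (Cexp x * Cexp (- x) = 1)%C.
Proof. rewrite <- Cexp_plus. replace (x + - x)%C with (RtoC 0) by ring. apply Cexp_0. Qed.

(* In the coordinate [x = log (z - z0)] the circles are vertical segments of
   length 2 pi, and periodicity makes the integral independent of the radius;
   the limit of small radii is the derivative. *)
Lemma cauchy_deriv (g : C -> C) (z0 : C) (R0 M rho : R) :
  (forall z, Cmod (z - z0) < R0 -> hol g z /\ Cmod (g z) <= M) -> 0 < rho < R0 ->
  Cmod (C_derive g z0) * rho <= 2 * M.
Proof.
  intros H Hrho.
  assert (Hz0 : Cmod (z0 - z0) < R0) by (rewrite Cmod_zero_sub; lra).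
  destruct (H z0 Hz0) as [Hg0 HM0].
  destruct (hol_quad g z0 Hg0) as (r & K & Hr & HK & Hq).
  set (D := C_derive g z0) in *. set (u := Cconj D).
  assert (Hu : Cmod u = Cmod D) by apply Cmod_conj.
  (* The difference quotient of [g] at [z0] in the logarithmic coordinate. Its mean over a circle is
     the derivative [D]; pairing with the conjugate [u] makes the limiting value [|D|^2]. *)
  set (h := fun x : C => ((g (z0 + Cexp x) - g z0) * Cexp (- x))%C).
  assert (Hexp : forall x, Cmod (z0 + Cexp x - z0) = exp (Re x)).
  { intros x. replace (z0 + Cexp x - z0)%C with (Cexp x) by ring. apply Cmod_Cexp. }
  assert (Hlr : forall s, s < ln R0 -> exp s < R0).
  { intros s Hs. rewrite <- (exp_ln R0) by lra. apply exp_increasing, Hs. }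
  assert (Hh : forall x, Re x < ln R0 -> hol h x).
  { intros x Hx. unfold h. apply hol_mult.
    - apply hol_minus; [|apply hol_const].
      apply (hol_comp g (fun x => z0 + Cexp x)%C).
      + apply hol_plus; [apply hol_const | apply Cexp_hol].
      + apply H. rewrite Hexp. apply Hlr, Hx.
    - apply (hol_comp Cexp (fun x => - x)%C); [apply hol_opp, hol_id | apply Cexp_hol]. }
  set (I := fun s : R => RInt (fun t : R => Re (u * h (0 + RtoC s * 1 + RtoC t * Ci)%C)) 0 (2 * PI)).
  assert (Hre : forall s t : R, Re (0 + RtoC s * 1 + RtoC t * Ci) = s)
    by (intros; unfold Ci, RtoC, Cplus, Cmult, Re; cbn; ring).
  assert (HPI := PI_RGT_0).
  (* The two boundary terms of the derivative in [s] agree because [h] has period [2 pi i], so the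
     circle integral does not depend on the radius. *)
  assert (HI : forall s, s < ln R0 -> is_derive I s 0).
  { intros s Hs. unfold I.
    assert (E := is_derive_segment_RInt h u 0 1 Ci (- Ci) 0 (2 * PI) s (ln R0 - s)).
    replace (Re (u * - Ci * h (0 + RtoC s * 1 + RtoC (2 * PI) * Ci)%C)
       - Re (u * - Ci * h (0 + RtoC s * 1 + RtoC 0 * Ci)%C)) with 0 in E.
    - apply E; [lra| |].
      + unfold Ci, RtoC, Cmult, Copp; cbn. f_equal; ring.
      + intros s' t Hs' _. apply Hh. rewrite Hre. apply Rabs_lt_between in Hs'. lra.
    - symmetry. apply Rminus_diag_eq. do 2 f_equal. unfold h.
      replace (0 + RtoC s * 1 + RtoC 0 * Ci)%C with (0 + RtoC s * 1)%C by ring.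
      rewrite Cexp_period. f_equal.
      rewrite <- (Cexp_period (- (0 + RtoC s * 1 + RtoC (2 * PI) * Ci))). f_equal. ring. }
  assert (Hconst : forall s, s < ln rho -> I s = I (ln rho)).
  { intros s Hs. apply (eq_is_derive I s (ln rho)); [|exact Hs].
    intros t Ht. apply HI. assert (ln rho < ln R0) by (apply ln_increasing; lra). lra. }
  assert (Hex : forall s, s < ln R0 ->
     ex_RInt (fun t : R => Re (u * h (0 + RtoC s * 1 + RtoC t * Ci)%C)) 0 (2 * PI)).
  { intros s Hs. apply ex_RInt_segment. intros t _. apply Hh. rewrite Hre. exact Hs. }
  assert (Hlnr : ln rho < ln R0) by (apply ln_increasing; lra).
  assert (PD := Cmod_ge_0 D).
  assert (B1 : Rabs (I (ln rho)) <= 2 * PI * (Cmod D * (2 * M / rho))).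
  { assert (E := RInt_dist_const (fun t : R => Re (u * h (0 + RtoC (ln rho) * 1 + RtoC t * Ci)%C))
       0 (2 * PI) 0 (Cmod D * (2 * M / rho)) ltac:(lra) (Hex _ Hlnr)).
    rewrite Rmult_0_l, !Rminus_0_r in E. apply E. clear E.
    intros t Ht. rewrite Rminus_0_r. eapply Rle_trans; [apply re_le_Cmod|].
    rewrite Cmod_mult, Hu. apply Rmult_le_compat_l; [lra|].
    unfold h. rewrite Cmod_mult, Cmod_Cexp.
    assert (Hb := proj2 (H (z0 + Cexp (0 + RtoC (ln rho) * 1 + RtoC t * Ci))%C
      ltac:(rewrite Hexp, Hre, exp_ln; lra))).
    replace (Re (- (0 + RtoC (ln rho) * 1 + RtoC t * Ci))) with (- ln rho)
      by (unfold Ci, RtoC, Cplus, Cmult, Copp, Re; cbn; ring).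
    rewrite exp_Ropp, exp_ln by lra. unfold Rdiv.
    apply Rmult_le_compat_r; [left; apply Rinv_0_lt_compat; lra|].
    replace (2 * M) with (M + M) by ring.
    eapply Rle_trans; [apply Cmod_triangle|]. rewrite Cmod_opp. lra. }
  assert (B2 : forall s, s < ln rho -> exp s < r ->
     Rabs (I s - (Cmod D * Cmod D) * (2 * PI)) <= 2 * PI * (Cmod D * (K * exp s))).
  { intros s Hs Hsr.
    assert (E := RInt_dist_const (fun t : R => Re (u * h (0 + RtoC s * 1 + RtoC t * Ci)%C))
       0 (2 * PI) (Cmod D * Cmod D) (Cmod D * (K * exp s)) ltac:(lra) (Hex s ltac:(lra))).
    rewrite !Rminus_0_r in E. apply E. clear E.
    intros t Ht. rewrite <- Re_Cconj_mult. fold u. rewrite <- Re_minus.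
    eapply Rle_trans; [apply re_le_Cmod|].
    set (x := (0 + RtoC s * 1 + RtoC t * Ci)%C).
    assert (Hx : Re x = s) by apply Hre.
    replace (u * h x - u * D)%C with (u * (h x - D))%C by ring.
    rewrite Cmod_mult, Hu. apply Rmult_le_compat_l; [lra|].
    assert (E : (h x - D)%C = ((g (z0 + Cexp x) - g z0 - D * (z0 + Cexp x - z0)) * Cexp (- x))%C).
    { unfold h.
      replace ((g (z0 + Cexp x) - g z0 - D * (z0 + Cexp x - z0)) * Cexp (- x))%C with
        ((g (z0 + Cexp x)%C - g z0) * Cexp (- x) - D * (Cexp x * Cexp (- x)))%C by ring.
      rewrite Cexp_conj_cancel. ring. }
    rewrite E, Cmod_mult, Cmod_Cexp.
    assert (Q := Hq z0 (z0 + Cexp x)%C ltac:(rewrite Cmod_zero_sub; lra)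
       ltac:(rewrite Hexp, Hx; lra)).
    fold D in Q. rewrite Hexp, Hx in Q.
    replace (Re (- x)) with (- s) by (rewrite <- Hx; reflexivity).
    apply Rmult_le_reg_r with (exp s); [apply exp_pos|].
    rewrite Rmult_assoc, <- exp_plus, Rplus_opp_l, exp_0, Rmult_1_r. lra. }
  destruct (Req_dec (Cmod D) 0) as [E0|E0].
  { rewrite E0, Rmult_0_l. assert (P := Cmod_ge_0 (g z0)). lra. }
  apply Rnot_lt_le. intros Hlt.
  set (gap := Cmod D - 2 * M / rho).
  assert (Hgap : 0 < gap).
  { unfold gap. apply Rmult_lt_reg_r with rho; [lra|]. field_simplify; lra. }
  (* A radius [exp s] so small that the error [K exp s] in [B2] is at most half of [gap], the amount
     by which the claim is supposed to fail. *)
  set (s := Rmin (ln rho - 1) (ln (Rmin (r / 2) (gap / (2 * (K + 1)))))).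
  assert (Pm : 0 < Rmin (r / 2) (gap / (2 * (K + 1)))).
  { apply Rmin_glb_lt; [lra | apply Rdiv_lt_0_compat; lra]. }
  assert (S1 : s < ln rho).
  { unfold s. eapply Rle_lt_trans; [apply Rmin_l | lra]. }
  assert (S2 : exp s <= Rmin (r / 2) (gap / (2 * (K + 1)))).
  { rewrite <- (exp_ln _ Pm).
    destruct (Rle_lt_or_eq_dec _ _ (Rmin_r (ln rho - 1) (ln (Rmin (r / 2) (gap / (2 * (K + 1))))))) as [L|L].
    - left. apply exp_increasing. exact L.
    - right. f_equal. exact L. }
  assert (S3 : exp s <= r / 2) by (eapply Rle_trans; [exact S2 | apply Rmin_l]).
  assert (S4 : exp s <= gap / (2 * (K + 1))) by (eapply Rle_trans; [exact S2 | apply Rmin_r]).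
  specialize (B2 s S1 ltac:(lra)). rewrite (Hconst s S1) in B2.
  apply Rabs_le_between in B1, B2.
  assert (F : Cmod D * Cmod D * (2 * PI) <= 2 * PI * (Cmod D * (2 * M / rho + K * exp s))) by lra.
  assert (F2 : Cmod D <= 2 * M / rho + K * exp s).
  { apply Rmult_le_reg_l with (2 * PI * Cmod D); [apply Rmult_lt_0_compat; lra | lra]. }
  assert (F3 : K * exp s <= gap / 2).
  { apply Rle_trans with ((K + 1) * (gap / (2 * (K + 1)))).
    - assert (Pe := exp_pos s). apply Rmult_le_compat; lra.
    - right. field. lra. }
  unfold gap in *. lra.
Qed.

(** The first-order estimate is used twice: on [g], bounding [g'] by [6 M / R0], and on
    [g (x + k) - g x], which the mean value inequality bounds by [6 M |k| / R0]. Thus [g'] is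
    Lipschitz without recourse to a second derivative; [108 = 2 * 6 * 9], with the 9 from the radius
    [R0 / 9]. *)
Lemma cauchy_quad (g : C -> C) (z0 : C) (R0 M : R) : 0 < R0 ->
  (forall z, Cmod (z - z0) < R0 -> hol g z /\ Cmod (g z) <= M) ->
  quad_rem g (C_derive g) z0 (R0 / 8) (108 * M / (R0 * R0)).
Proof.
  intros HR H.
  assert (HM : 0 <= M).
  { eapply Rle_trans; [apply Cmod_ge_0 | apply (H z0); rewrite Cmod_zero_sub; lra]. }
  assert (A : forall z, Cmod (z - z0) < R0 / 2 -> Cmod (C_derive g z) <= 6 * M / R0).
  { intros z Hz.
    assert (E := cauchy_deriv g z (R0 / 2) M (R0 / 3)).
    apply Rmult_le_reg_r with (R0 / 3); [lra|].
    replace (6 * M / R0 * (R0 / 3)) with (2 * M) by (field; lra).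
    apply E; [|lra]. intros w Hw. apply H. assert (T := Cmod_tri3 w z z0). lra. }
  apply quad_rem_of_lip.
  - intros z Hz. apply hol_is_derive, H. lra.
  - intros z w Hz Hw.
    set (k := (w - z)%C).
    assert (Hk : Cmod k < R0 / 4).
    { unfold k. assert (T := Cmod_tri3 w z0 z). rewrite (Cmod_sub_sym z0 z) in T. lra. }
    assert (Hs : forall x, Cmod (x - z0) < R0 / 4 -> hol (fun x => g (x + k)%C - g x)%C x).
    { intros x Hx. apply hol_minus.
      - apply (hol_comp g (fun x => x + k)%C).
        + apply hol_plus; [apply hol_id | apply hol_const].
        + apply H. replace (x + k - z0)%C with ((x - z0) + k)%C by ring.
          assert (T := Cmod_triangle (x - z0) k). lra.
      - apply H. lra. }
    assert (E := cauchy_deriv (fun x => g (x + k)%C - g x)%C z (R0 / 8) (6 * M / R0 * Cmod k) (R0 / 9)).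
    replace (C_derive (fun x => g (x + k)%C - g x)%C z) with (C_derive g w - C_derive g z)%C in E.
    + apply Rmult_le_reg_r with (R0 / 9); [lra|].
      replace (108 * M / (R0 * R0) * Cmod k * (R0 / 9)) with (2 * (6 * M / R0 * Cmod k)) by (field; lra).
      apply E; [|lra]. intros x Hx.
      assert (Hx' : Cmod (x - z0) < R0 / 4) by (assert (T := Cmod_tri3 x z z0); lra).
      split; [apply Hs, Hx'|].
      assert (F := C_mean_value g (C_derive g) x (x + k)%C (6 * M / R0)).
      replace (x + k - x)%C with k in F by ring. apply F.
      intros t Ht. replace (x + t * k - z0)%C with ((x - z0) + t * k)%C by ring.
      assert (Hin : Cmod (x + RtoC t * k - z0) < R0 / 2).
      { replace (x + t * k - z0)%C with ((x - z0) + t * k)%C by ring.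
        assert (T := Cmod_triangle (x - z0) (RtoC t * k)).
        rewrite Cmod_mult, Cmod_R, Rabs_pos_eq in T by lra.
        assert (t * Cmod k <= 1 * Cmod k) by (apply Rmult_le_compat_r; [apply Cmod_ge_0 | lra]). lra. }
      split; [apply hol_is_derive, H; lra | apply A, Hin].
    + symmetry. apply is_C_derive_unique. apply C_derive_intro. intros e He.
      destruct (C_derive_elim g w _ (hol_is_derive g w (proj1 (H w ltac:(lra)))) (e / 2) ltac:(lra)) as (d1 & Hd1 & E1).
      destruct (C_derive_elim g z _ (hol_is_derive g z (proj1 (H z ltac:(lra)))) (e / 2) ltac:(lra)) as (d2 & Hd2 & E2).
      exists (Rmin d1 d2). split; [apply Rmin_glb_lt; lra|]. intros x Hx.
      assert (M1 := Rmin_l d1 d2). assert (M2 := Rmin_r d1 d2).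
      specialize (E2 x ltac:(lra)). specialize (E1 (x + k)%C).
      replace (x + k - w)%C with (x - z)%C in E1 by (unfold k; ring).
      specialize (E1 ltac:(lra)).
      replace (z + k)%C with w by (unfold k; ring).
      replace (g (x + k)%C - g x - (g w - g z) - (C_derive g w - C_derive g z) * (x - z))%C with
        ((g (x + k)%C - g w - C_derive g w * (x - z)) + - (g x - g z - C_derive g z * (x - z)))%C by ring.
      eapply Rle_trans; [apply Cmod_triangle|]. rewrite Cmod_opp. lra.
  - apply Rmult_le_pos; [lra | left; apply Rinv_0_lt_compat, Rmult_lt_0_compat; lra].
Qed.

(** * Limits of holomorphic functions *)

Definition Ccv (u : nat -> C) (l : C) : Prop :=
  forall e, 0 < e -> exists N, forall n, (N <= n)%nat -> Cmod (u n - l) < e.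

Lemma Ccv_Re (u : nat -> C) (l : C) : Ccv u l -> is_lim_seq (fun n => Re (u n)) (Re l).
Proof.
  intros H. apply is_lim_seq_spec. intros e. destruct (H e (cond_pos e)) as [N HN].
  exists N. intros n Hn. specialize (HN n Hn).
  rewrite <- Re_minus. eapply Rle_lt_trans; [apply re_le_Cmod | exact HN].
Qed.

Lemma Ccv_Im (u : nat -> C) (l : C) : Ccv u l -> is_lim_seq (fun n => Im (u n)) (Im l).
Proof.
  intros H. apply is_lim_seq_spec. intros e. destruct (H e (cond_pos e)) as [N HN].
  exists N. intros n Hn. specialize (HN n Hn).
  rewrite <- Im_minus. eapply Rle_lt_trans; [apply im_le_Cmod | exact HN].
Qed.

(** [CLim_seq] takes the limits of the two parts separately and always returns a value; convergence
    makes this value the limit. *)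
Lemma Ccv_CLim (u : nat -> C) (l : C) : Ccv u l -> CLim_seq u = l.
Proof.
  intros H. unfold CLim_seq.
  rewrite (is_lim_seq_unique _ _ (Ccv_Re u l H)), (is_lim_seq_unique _ _ (Ccv_Im u l H)).
  destruct l; reflexivity.
Qed.

Lemma Ccv_unique (u : nat -> C) (l l' : C) : Ccv u l -> Ccv u l' -> l = l'.
Proof. intros H H'. rewrite <- (Ccv_CLim u l H). apply Ccv_CLim, H'. Qed.

Lemma Ccv_const (c : C) : Ccv (fun _ => c) c.
Proof. intros e He. exists 0%nat. intros _ _. rewrite Cmod_zero_sub. exact He. Qed.

Lemma Ccv_plus (u v : nat -> C) (a b : C) :
  Ccv u a -> Ccv v b -> Ccv (fun n => u n + v n)%C (a + b)%C.
Proof.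
  intros Hu Hv e He.
  destruct (Hu (e / 2) ltac:(lra)) as [N1 H1]. destruct (Hv (e / 2) ltac:(lra)) as [N2 H2].
  exists (N1 + N2)%nat. intros n Hn.
  replace (u n + v n - (a + b))%C with ((u n - a) + (v n - b))%C by ring.
  eapply Rle_lt_trans; [apply Cmod_triangle|].
  specialize (H1 n ltac:(lia)). specialize (H2 n ltac:(lia)). lra.
Qed.

Lemma Ccv_bounded (u : nat -> C) (a : C) : Ccv u a ->
  exists N M, 0 < M /\ forall n, (N <= n)%nat -> Cmod (u n) <= M.
Proof.
  intros H. destruct (H 1 ltac:(lra)) as [N HN]. exists N, (1 + Cmod a).
  assert (P := Cmod_ge_0 a). split; [lra|]. intros n Hn. specialize (HN n Hn).
  assert (E := Cmod_sub_ge (u n) a). lra.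
Qed.

Lemma Ccv_mult (u v : nat -> C) (a b : C) :
  Ccv u a -> Ccv v b -> Ccv (fun n => u n * v n)%C (a * b)%C.
Proof.
  intros Hu Hv e He.
  destruct (Ccv_bounded u a Hu) as (N0 & M & HM & HB).
  assert (Pb := Cmod_ge_0 b).
  assert (Q1 : 0 < e / (2 * M)) by (apply Rdiv_lt_0_compat; lra).
  assert (Q2 : 0 < e / (2 * (Cmod b + 1))) by (apply Rdiv_lt_0_compat; lra).
  destruct (Hv _ Q1) as [N1 H1]. destruct (Hu _ Q2) as [N2 H2].
  exists (N0 + N1 + N2)%nat. intros n Hn.
  replace (u n * v n - a * b)%C with (u n * (v n - b) + (u n - a) * b)%C by ring.
  eapply Rle_lt_trans; [apply Cmod_triangle|]. rewrite !Cmod_mult.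
  specialize (HB n ltac:(lia)). specialize (H1 n ltac:(lia)). specialize (H2 n ltac:(lia)).
  assert (A1 : Cmod (u n) * Cmod (v n - b) <= M * Cmod (v n - b))
    by (apply Rmult_le_compat_r; [apply Cmod_ge_0 | lra]).
  assert (A2 : M * Cmod (v n - b) < M * (e / (2 * M))) by (apply Rmult_lt_compat_l; lra).
  assert (A3 : Cmod (u n - a) * Cmod b <= e / (2 * (Cmod b + 1)) * Cmod b)
    by (apply Rmult_le_compat_r; lra).
  assert (A4 : e / (2 * (Cmod b + 1)) * Cmod b <= e / 2).
  { apply Rle_trans with (e / (2 * (Cmod b + 1)) * (Cmod b + 1)).
    - apply Rmult_le_compat_l; lra.
    - right. field. lra. }
  replace (M * (e / (2 * M))) with (e / 2) in A2 by (field; lra). lra.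
Qed.

Lemma Ccv_le (u : nat -> C) (a c : C) (K : R) (N : nat) :
  Ccv u a -> (forall n, (N <= n)%nat -> Cmod (u n - c) <= K) -> Cmod (a - c) <= K.
Proof.
  intros H HK. apply Rnot_lt_le. intros Hlt.
  destruct (H (Cmod (a - c) - K) ltac:(lra)) as [N1 H1].
  specialize (H1 (N + N1)%nat ltac:(lia)). specialize (HK (N + N1)%nat ltac:(lia)).
  assert (T := Cmod_tri3 a (u (N + N1)%nat) c).
  rewrite (Cmod_sub_sym a (u _)) in T. lra.
Qed.

Lemma Ccv_cauchy (u : nat -> C) :
  (forall e, 0 < e -> exists N, forall n m, (N <= n)%nat -> (N <= m)%nat -> Cmod (u n - u m) < e) ->
  exists l, Ccv u l.
Proof.
  intros H.
  assert (Hr : ex_finite_lim_seq (fun n => Re (u n))).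
  { apply ex_lim_seq_cauchy_corr. intros e. destruct (H e (cond_pos e)) as [N HN].
    exists N. intros n m Hn Hm. rewrite <- Re_minus.
    eapply Rle_lt_trans; [apply re_le_Cmod | auto]. }
  assert (Hi : ex_finite_lim_seq (fun n => Im (u n))).
  { apply ex_lim_seq_cauchy_corr. intros e. destruct (H e (cond_pos e)) as [N HN].
    exists N. intros n m Hn Hm. rewrite <- Im_minus.
    eapply Rle_lt_trans; [apply im_le_Cmod | auto]. }
  destruct Hr as [a Ha], Hi as [b Hb]. exists (a, b). intros e He.
  apply is_lim_seq_spec in Ha, Hb.
  assert (He2 : 0 < e / 2) by lra.
  destruct (Ha (mkposreal _ He2)) as [N1 H1]. destruct (Hb (mkposreal _ He2)) as [N2 H2].
  exists (N1 + N2)%nat. intros n Hn.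
  specialize (H1 n ltac:(lia)). specialize (H2 n ltac:(lia)). cbn [pos] in H1, H2.
  eapply Rle_lt_trans; [apply Cmod_le_abs|].
  rewrite Re_minus, Im_minus. change (Re (a, b)) with a. change (Im (a, b)) with b. lra.
Qed.

Lemma Ccv_ext_from (u v : nat -> C) (l : C) (N : nat) :
  (forall n, (N <= n)%nat -> u n = v n) -> Ccv u l -> Ccv v l.
Proof.
  intros E H e He. destruct (H e He) as [N1 H1]. exists (N + N1)%nat.
  intros n Hn. rewrite <- E by lia. apply H1. lia.
Qed.

(* The comparison of two difference quotients at the same point mentions no
   derivative and is preserved by limits and integrals. *)
Definition diff_quot (g : C -> C) (z0 : C) (r K : R) : Prop :=
  forall z h k, Cmod (z - z0) < r -> Cmod (z + h - z0) < r -> Cmod (z + k - z0) < r ->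
    Cmod (k * (g (z + h)%C - g z) - h * (g (z + k)%C - g z))
      <= K * (Cmod h * Cmod k * (Cmod h + Cmod k)).

Lemma diff_quot_of_quad_rem (g g' : C -> C) (z0 : C) (r K : R) :
  quad_rem g g' z0 r K -> diff_quot g z0 r K.
Proof.
  intros H z h k Hz Hh Hk.
  assert (E1 := H z (z + h)%C Hz Hh). assert (E2 := H z (z + k)%C Hz Hk).
  replace (z + h - z)%C with h in E1 by ring. replace (z + k - z)%C with k in E2 by ring.
  replace (k * (g (z + h)%C - g z) - h * (g (z + k)%C - g z))%C with
    (k * (g (z + h)%C - g z - g' z * h) + - (h * (g (z + k)%C - g z - g' z * k)))%C by ring.
  eapply Rle_trans; [apply Cmod_triangle|]. rewrite Cmod_opp, !Cmod_mult.
  assert (Ph := Cmod_ge_0 h). assert (Pk := Cmod_ge_0 k).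
  assert (A := Rmult_le_compat_l _ _ _ Pk E1). assert (B := Rmult_le_compat_l _ _ _ Ph E2). lra.
Qed.

Lemma inv_INR_small (e : R) : 0 < e -> exists N, forall n, (N <= n)%nat -> / (INR n + 1) < e.
Proof.
  intros He. assert (Pe : 0 < / e) by (apply Rinv_0_lt_compat, He).
  destruct (nfloor_ex (/ e) ltac:(lra)) as (N & HN1 & HN2).
  exists N. intros n Hn. apply le_INR in Hn.
  apply Rlt_le_trans with (/ / e); [|rewrite Rinv_inv; lra].
  apply Rinv_lt_contravar; [|lra]. apply Rmult_lt_0_compat; lra.
Qed.

(** With [k = 1 / (n + 1)] the comparison shows that the difference quotients at [z] form a Cauchy
    sequence. Their limit is [g'], and letting [n] grow leaves the remainder [K |h|^2]. *)
Lemma quad_rem_of_diff_quot (g : C -> C) (z0 : C) (r K : R) :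
  0 <= K -> diff_quot g z0 r K -> exists g', quad_rem g g' z0 r K.
Proof.
  intros HK H.
  set (q := fun z n => ((g (z + RtoC (/ (INR n + 1)))%C - g z) * RtoC (INR n + 1))%C).
  assert (Pn : forall n, 0 < INR n + 1) by (intros n; assert (E := pos_INR n); lra).
  assert (Pi : forall n, 0 < / (INR n + 1)) by (intros; apply Rinv_0_lt_compat; auto).
  assert (Hin : forall z, Cmod (z - z0) < r -> exists N, forall n, (N <= n)%nat ->
      Cmod (z + RtoC (/ (INR n + 1)) - z0) < r).
  { intros z Hz. destruct (inv_INR_small (r - Cmod (z - z0)) ltac:(lra)) as [N HN].
    exists N. intros n Hn. specialize (HN n Hn).
    replace (z + RtoC (/ (INR n + 1)) - z0)%C with ((z - z0) + RtoC (/ (INR n + 1)))%C by ring.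
    eapply Rle_lt_trans; [apply Cmod_triangle|]. rewrite Cmod_R, Rabs_pos_eq by (left; auto). lra. }
  assert (Hq : forall z n h, Cmod (z - z0) < r -> Cmod (z + h - z0) < r ->
      Cmod (z + RtoC (/ (INR n + 1)) - z0) < r ->
      Cmod ((g (z + h)%C - g z) - h * q z n) <= K * (Cmod h * (Cmod h + / (INR n + 1)))).
  { intros z n h Hz Hh Hk. assert (E := H z h (RtoC (/ (INR n + 1))) Hz Hh Hk).
    rewrite Cmod_R, Rabs_pos_eq in E by (left; auto).
    assert (En : (RtoC (/ (INR n + 1)) * RtoC (INR n + 1) = 1)%C).
    { rewrite <- RtoC_mult, Rinv_l by (apply Rgt_not_eq, Pn). reflexivity. }
    assert (F : (g (z + h)%C - g z - h * q z n)%C = (RtoC (INR n + 1) *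
       (RtoC (/ (INR n + 1)) * (g (z + h)%C - g z) - h * (g (z + RtoC (/ (INR n + 1)))%C - g z)))%C).
    { unfold q. transitivity ((RtoC (/ (INR n + 1)) * RtoC (INR n + 1)) * (g (z + h)%C - g z)
        - h * ((g (z + RtoC (/ (INR n + 1)))%C - g z) * RtoC (INR n + 1)))%C; [rewrite En; ring | ring]. }
    rewrite F, Cmod_mult, Cmod_R, Rabs_pos_eq by (left; auto).
    apply Rle_trans with ((INR n + 1) * (K * (Cmod h * / (INR n + 1) * (Cmod h + / (INR n + 1))))).
    - apply Rmult_le_compat_l; [left; auto | exact E].
    - right. field. apply Rgt_not_eq, Pn. }
  assert (Hcv : forall z, Cmod (z - z0) < r -> exists l, Ccv (q z) l).
  { intros z Hz. apply Ccv_cauchy. intros e He.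
    destruct (Hin z Hz) as [N1 H1].
    destruct (inv_INR_small (e / (2 * (K + 1))) ltac:(apply Rdiv_lt_0_compat; lra)) as [N2 H2].
    exists (N1 + N2)%nat. intros n m Hn Hm.
    assert (A := H1 n ltac:(lia)). assert (B := H1 m ltac:(lia)).
    assert (A2 := H2 n ltac:(lia)). assert (B2 := H2 m ltac:(lia)).
    assert (E := Hq z m _ Hz A B). rewrite Cmod_R, Rabs_pos_eq in E by (left; auto).
    assert (En : (RtoC (INR n + 1) * RtoC (/ (INR n + 1)) = 1)%C).
    { rewrite <- RtoC_mult, Rinv_r by (apply Rgt_not_eq, Pn). reflexivity. }
    replace (q z n - q z m)%C with
      (RtoC (INR n + 1) * ((g (z + RtoC (/ (INR n + 1)))%C - g z) - RtoC (/ (INR n + 1)) * q z m))%C.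
    2:{ transitivity (RtoC (INR n + 1) * (g (z + RtoC (/ (INR n + 1)))%C - g z)
         - (RtoC (INR n + 1) * RtoC (/ (INR n + 1))) * q z m)%C; [ring | rewrite En; unfold q; ring]. }
    rewrite Cmod_mult, Cmod_R, Rabs_pos_eq by (left; auto).
    apply Rle_lt_trans with ((INR n + 1) * (K * (/ (INR n + 1) * (/ (INR n + 1) + / (INR m + 1))))).
    - apply Rmult_le_compat_l; [left; auto | exact E].
    - replace ((INR n + 1) * (K * (/ (INR n + 1) * (/ (INR n + 1) + / (INR m + 1)))))
        with (K * (/ (INR n + 1) + / (INR m + 1))) by (field; split; apply Rgt_not_eq, Pn).
      assert (S : / (INR n + 1) + / (INR m + 1) < e / (K + 1)).
      { replace (e / (K + 1)) with (e / (2 * (K + 1)) + e / (2 * (K + 1))) by (field; lra). lra. }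
      assert (Pn' := Pi n). assert (Pm' := Pi m).
      apply Rle_lt_trans with (K * (e / (K + 1))); [apply Rmult_le_compat_l; lra|].
      apply Rmult_lt_reg_r with (K + 1); [lra|]. field_simplify; nra. }
  exists (fun z => CLim_seq (q z)). intros z w Hz Hw.
  destruct (Hcv z Hz) as [l Hl]. rewrite (Ccv_CLim _ _ Hl).
  destruct (Hin z Hz) as [N HN].
  set (h := (w - z)%C).
  replace w with (z + h)%C in Hw |- * by (unfold h; ring).
  assert (Ph := Cmod_ge_0 h).
  apply Rle_plus_epsilon. intros e He.
  assert (Kh : 0 <= K * Cmod h) by (apply Rmult_le_pos; lra).
  destruct (inv_INR_small (e / (K * Cmod h + 1)) ltac:(apply Rdiv_lt_0_compat; lra)) as [N2 HN2].
  replace (z + h - z)%C with h by ring.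
  rewrite (Cmult_comm l h), Cmod_sub_sym.
  apply (Ccv_le (fun n => h * q z n)%C (h * l)%C _ _ (N + N2)%nat).
  - apply Ccv_mult; [apply Ccv_const | exact Hl].
  - intros n Hn. assert (E := Hq z n h Hz Hw (HN n ltac:(lia))).
    specialize (HN2 n ltac:(lia)). rewrite Cmod_sub_sym.
    eapply Rle_trans; [exact E|].
    assert (Q : K * Cmod h * / (INR n + 1) <= e).
    { apply Rle_trans with ((K * Cmod h + 1) * (e / (K * Cmod h + 1))).
      - assert (Pn' := Pi n). apply Rmult_le_compat; lra.
      - right. field. lra. }
    lra.
Qed.

Lemma hol_of_diff_quot (g : C -> C) (z0 : C) (r K : R) :
  0 < r -> 0 <= K -> diff_quot g z0 r K -> hol g z0.
Proof.
  intros Hr HK H. destruct (quad_rem_of_diff_quot g z0 r K HK H) as [g' Hg'].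
  apply (hol_intro g g' z0 r K Hr Hg').
Qed.

Lemma hol_diff_quot (g : C -> C) (z0 : C) (R0 M : R) : 0 < R0 ->
  (forall z, Cmod (z - z0) < R0 -> hol g z /\ Cmod (g z) <= M) ->
  diff_quot g z0 (R0 / 8) (108 * M / (R0 * R0)).
Proof.
  intros HR H. apply diff_quot_of_quad_rem with (C_derive g). apply cauchy_quad; assumption.
Qed.

(** Pointwise convergence suffices: the constant in the comparison of difference quotients depends
    on [M] and [R0] alone, and the inequality survives pointwise limits. *)
Lemma hol_limit (gn : nat -> C -> C) (g : C -> C) (z0 : C) (R0 M : R) (N : nat) : 0 < R0 ->
  (forall n z, (N <= n)%nat -> Cmod (z - z0) < R0 -> hol (gn n) z /\ Cmod (gn n z) <= M) ->
  (forall z, Cmod (z - z0) < R0 -> Ccv (fun n => gn n z) (g z)) ->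
  hol g z0.
Proof.
  intros HR H Hc.
  assert (HM : 0 <= M).
  { eapply Rle_trans; [apply Cmod_ge_0 | apply (H N z0 (le_n N)); rewrite Cmod_zero_sub; lra]. }
  apply hol_of_diff_quot with (R0 / 8) (108 * M / (R0 * R0)); [lra| |].
  - apply Rmult_le_pos; [lra | left; apply Rinv_0_lt_compat, Rmult_lt_0_compat; lra].
  - intros z h k Hz Hh Hk.
    set (L := fun f : C -> C => (k * (f (z + h)%C + - (1) * f z) + (- h) * (f (z + k)%C + - (1) * f z))%C).
    assert (E : Ccv (fun n => L (gn n)) (L g)).
    { unfold L. repeat first [apply Ccv_plus | apply Ccv_mult | apply Ccv_const]; apply Hc; lra. }
    replace (k * (g (z + h)%C - g z) - h * (g (z + k)%C - g z))%C with (L g - 0)%C by (unfold L; ring).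
    apply (Ccv_le _ _ _ _ N E). intros n Hn.
    replace (L (gn n) - 0)%C with
      (k * (gn n (z + h)%C - gn n z) - h * (gn n (z + k)%C - gn n z))%C by (unfold L; ring).
    apply (hol_diff_quot (gn n) z0 R0 M HR); auto.
Qed.

(** * The Gamma function *)

Lemma C1_neq_0 : RtoC 1 <> 0.
Proof. intros E. apply (f_equal fst) in E. cbn in E. lra. Qed.

Lemma Cmult_neq_0' (a b : C) : a <> 0 -> b <> 0 -> (a * b)%C <> 0.
Proof.
  intros Ha Hb. apply Cmod_gt_0 in Ha, Hb. apply Cmod_gt_0. rewrite Cmod_mult.
  apply Rmult_lt_0_compat; assumption.
Qed.

Lemma Cinv_neq_0 (z : C) : z <> 0 -> (/ z)%C <> 0.
Proof. intros H E. apply C1_neq_0. rewrite <- (Cinv_r z H), E. ring. Qed.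

Lemma Cinv_0 : (/ 0)%C = 0.
Proof.
  unfold Cinv, RtoC; cbn. unfold Rdiv. rewrite Ropp_0, !Rmult_0_l. reflexivity.
Qed.

Lemma Cinv_inv (z : C) : (/ / z)%C = z.
Proof.
  destruct (Ceq_dec z 0) as [->|H]; [rewrite !Cinv_0; reflexivity|].
  field. exact H.
Qed.

Lemma Cinv_mult' (a b : C) : (/ (a * b))%C = (/ a * / b)%C.
Proof.
  destruct (Ceq_dec a 0) as [->|Ha]; [rewrite Cmult_0_l, Cinv_0; ring|].
  destruct (Ceq_dec b 0) as [->|Hb]; [rewrite Cmult_0_r, Cinv_0; ring|].
  field. auto.
Qed.

(* The factors are [u (n+1) / u n]. *)
Lemma product_converges (u e : nat -> C) (N : nat) (A : R) :
  (2 <= N)%nat -> 0 <= A ->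
  (forall n, (N <= n)%nat -> u (S n) = (u n * (1 + e n))%C) ->
  (forall n, (N <= n)%nat -> Cmod (e n) <= A / (INR n * INR n)) ->
  (forall n, (N <= n)%nat -> Cmod (u n) <= Cmod (u N) * exp A) /\ exists l, Ccv u l.
Proof.
  intros HN HA Hu He.
  assert (Hpos : forall n, (N <= n)%nat -> 2 <= INR n).
  { intros n Hn. replace 2 with (INR 2) by reflexivity. apply le_INR. lia. }
  (* [1 / n^2] is replaced by the telescoping [1 / (n - 1) - 1 / n], so that the inductions below
     add up exactly. *)
  assert (Hsq : forall n, (N <= n)%nat ->
     A / (INR n * INR n) <= A * (/ (INR n - 1) - / INR n)).
  { intros n Hn. assert (P := Hpos n Hn). unfold Rdiv. apply Rmult_le_compat_l; [lra|].
    replace (/ (INR n - 1) - / INR n) with (/ ((INR n - 1) * INR n)) by (field; lra).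
    apply Rinv_le_contravar; [apply Rmult_lt_0_compat; lra|].
    apply Rmult_le_compat_r; lra. }
  assert (Pu := Cmod_ge_0 (u N)).
  assert (HB : forall n, (N <= n)%nat ->
     Cmod (u n) <= Cmod (u N) * exp (A * (/ (INR N - 1) - / (INR n - 1)))).
  { intros n Hn. induction Hn as [|n Hn IH].
    - rewrite Rminus_diag, Rmult_0_r, exp_0. lra.
    - assert (P := Hpos n Hn). rewrite Hu by assumption. rewrite Cmod_mult.
      assert (E1 : Cmod (1 + e n) <= exp (A * (/ (INR n - 1) - / INR n))).
      { eapply Rle_trans; [apply Cmod_triangle|]. rewrite Cmod_1.
        eapply Rle_trans; [|apply exp_ineq1_le].
        apply Rplus_le_compat_l. eapply Rle_trans; [apply He, Hn | apply Hsq, Hn]. }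
      rewrite S_INR.
      replace (A * (/ (INR N - 1) - / (INR n + 1 - 1))) with
        (A * (/ (INR N - 1) - / (INR n - 1)) + A * (/ (INR n - 1) - / INR n)).
      2:{ replace (INR n + 1 - 1) with (INR n) by ring. ring. }
      rewrite exp_plus, <- Rmult_assoc.
      apply Rmult_le_compat; try apply Cmod_ge_0; assumption. }
  assert (HB' : forall n, (N <= n)%nat -> Cmod (u n) <= Cmod (u N) * exp A).
  { intros n Hn. eapply Rle_trans; [apply HB, Hn|]. apply Rmult_le_compat_l; [lra|].
    assert (P := Hpos n Hn). assert (P2 := Hpos N (le_n N)).
    assert (Q : A * (/ (INR N - 1) - / (INR n - 1)) <= A).
    { rewrite <- (Rmult_1_r A) at 2. apply Rmult_le_compat_l; [lra|].
      assert (/ (INR N - 1) <= / 1) by (apply Rinv_le_contravar; lra).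
      assert (0 < / (INR n - 1)) by (apply Rinv_0_lt_compat; lra). lra. }
    destruct (Rle_lt_or_eq_dec _ _ Q) as [L|L]; [left; apply exp_increasing; exact L | right; f_equal; exact L]. }
  split; [exact HB'|].
  set (M := Cmod (u N) * exp A).
  assert (PM : 0 <= M) by (apply Rmult_le_pos; [lra | left; apply exp_pos]).
  assert (Hd : forall n m, (N <= n)%nat -> (n <= m)%nat ->
     Cmod (u m - u n) <= M * A * (/ (INR n - 1) - / (INR m - 1))).
  { intros n m Hn Hm. induction Hm as [|m Hm IH].
    - rewrite Cmod_zero_sub, Rminus_diag. lra.
    - assert (P := Hpos m ltac:(lia)).
      replace (u (S m) - u n)%C with (u m * e m + (u m - u n))%C by (rewrite Hu by lia; ring).
      rewrite S_INR.
      replace (M * A * (/ (INR n - 1) - / (INR m + 1 - 1))) with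
        (M * (A * (/ (INR m - 1) - / INR m)) + M * A * (/ (INR n - 1) - / (INR m - 1))).
      2:{ replace (INR m + 1 - 1) with (INR m) by ring. ring. }
      apply Cmod_plus_le; [|exact IH]. apply Cmod_mult_le; [apply HB'; lia|].
      eapply Rle_trans; [apply He; lia | apply Hsq; lia]. }
  apply Ccv_cauchy. intros eps Heps.
  destruct (inv_INR_small (eps / (M * A + 1))) as [N1 HN1].
  { apply Rdiv_lt_0_compat; [lra|]. assert (0 <= M * A) by (apply Rmult_le_pos; lra). lra. }
  assert (PMA : 0 <= M * A) by (apply Rmult_le_pos; lra).
  assert (key : forall n m, (N + N1 + 2 <= n)%nat -> (n <= m)%nat -> Cmod (u m - u n) < eps).
  { intros n m Hn Hm. eapply Rle_lt_trans; [apply Hd; lia|].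
    assert (P := Hpos n ltac:(lia)). assert (P2 := Hpos m ltac:(lia)).
    assert (I1 : / (INR n - 1) < eps / (M * A + 1)).
    { assert (E := HN1 (n - 2)%nat ltac:(lia)).
      rewrite minus_INR in E by lia. cbn in E.
      replace (INR n - (1 + 1) + 1) with (INR n - 1) in E by ring. exact E. }
    assert (I2 : 0 < / (INR m - 1)) by (apply Rinv_0_lt_compat; lra).
    apply Rle_lt_trans with (M * A * (eps / (M * A + 1))).
    - apply Rmult_le_compat_l; lra.
    - apply Rmult_lt_reg_r with (M * A + 1); [lra|]. field_simplify; nra. }
  exists (N + N1 + 2)%nat. intros n m Hn Hm.
  destruct (Nat.le_ge_cases n m) as [L|L].
  - rewrite Cmod_sub_sym. apply key; lia.
  - apply key; lia.
Qed.

Definition nonpole (z : C) : Prop := forall n : nat, (z + RtoC (INR n))%C <> 0.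

Definition gauss (z : C) (n : nat) : C :=
  (RtoC (INR (fact n)) * Cexp (z * RtoC (ln (INR n))) / rising z (S n))%C.

(** The reciprocal of [gauss], written without division by [rising]: for each [n] it is entire in
    [z], and it converges also at the poles of Gamma. *)
Definition gauss_inv (z : C) (n : nat) : C :=
  (rising z (S n) * (Cexp (- (z * RtoC (ln (INR n)))) * RtoC (/ INR (fact n))))%C.

Lemma fact_neq_0_C (n : nat) : RtoC (INR (fact n)) <> 0.
Proof. intros E. apply (f_equal fst) in E. cbn in E. apply (INR_fact_neq_0 n E). Qed.

(** Valid for every [z]: where [rising] vanishes, both sides are 0 by the convention [/ 0 = 0]. *)
Lemma gauss_inv_eq (z : C) (n : nat) : gauss z n = (/ gauss_inv z n)%C.
Proof.
  unfold gauss, gauss_inv. rewrite !Cinv_mult'.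
  assert (E : (/ Cexp (- (z * RtoC (ln (INR n)))))%C = Cexp (z * RtoC (ln (INR n)))).
  { assert (H := Cexp_conj_cancel (z * RtoC (ln (INR n)))).
    assert (N := Cexp_neq_0 (- (z * RtoC (ln (INR n))))).
    rewrite <- (Cmult_1_l (/ _)), <- H. field. exact N. }
  rewrite E, RtoC_inv, Cinv_inv by apply INR_fact_neq_0. unfold Cdiv. ring.
Qed.

Lemma rising_nonpole (z : C) (n : nat) : nonpole z -> rising z n <> 0.
Proof.
  intros H. induction n as [|n IH]; [apply C1_neq_0|].
  simpl. apply Cmult_neq_0'; [exact IH | apply H].
Qed.

Lemma rising_pole (z : C) (k n : nat) : (z + RtoC (INR k))%C = 0 -> (k < n)%nat -> rising z n = 0.
Proof.
  intros H Hk. induction Hk as [|n Hk IH].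
  - simpl. rewrite H. ring.
  - cbn [rising]. rewrite IH. ring.
Qed.

Lemma gauss_inv_neq_0 (z : C) (n : nat) : nonpole z -> gauss_inv z n <> 0.
Proof.
  intros H. unfold gauss_inv.
  apply Cmult_neq_0'; [apply rising_nonpole, H|].
  apply Cmult_neq_0'; [apply Cexp_neq_0|].
  rewrite RtoC_inv by apply INR_fact_neq_0. apply Cinv_neq_0, fact_neq_0_C.
Qed.

(** That is, [(1 + z / (n + 1)) (n / (n + 1))^z - 1], the relative change from one term to the next.
    Its first-order parts cancel, leaving [O(1 / n^2)]. *)
Definition gauss_err (z : C) (n : nat) : C :=
  ((1 + z * RtoC (/ INR (S n))) * Cexp (- (z * RtoC (ln (INR (S n)) - ln (INR n)))) - 1)%C.

Lemma gauss_inv_S (z : C) (n : nat) :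
  gauss_inv z (S n) = (gauss_inv z n * (1 + gauss_err z n))%C.
Proof.
  unfold gauss_inv, gauss_err.
  replace (rising z (S (S n))) with (rising z (S n) * (z + RtoC (INR (S n))))%C by reflexivity.
  replace (Cexp (- (z * RtoC (ln (INR (S n)))))) with
    (Cexp (- (z * RtoC (ln (INR n)))) * Cexp (- (z * RtoC (ln (INR (S n)) - ln (INR n)))))%C.
  2:{ rewrite <- Cexp_plus, RtoC_minus. f_equal. ring. }
  assert (P : INR (S n) <> 0) by (apply not_0_INR; lia).
  assert (E : RtoC (/ INR (fact (S n))) = (RtoC (/ INR (fact n)) * RtoC (/ INR (S n)))%C).
  { rewrite <- RtoC_mult. f_equal. rewrite fact_simpl, mult_INR.
    rewrite Rinv_mult. ring. }
  rewrite E.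
  assert (E2 : (RtoC (INR (S n)) * RtoC (/ INR (S n)) = 1)%C)
    by (rewrite <- RtoC_mult, Rinv_r by exact P; reflexivity).
  transitivity ((rising z (S n) * (Cexp (- (z * RtoC (ln (INR n)))) * RtoC (/ INR (fact n)))) *
    ((z * RtoC (/ INR (S n)) + RtoC (INR (S n)) * RtoC (/ INR (S n))) *
      Cexp (- (z * RtoC (ln (INR (S n)) - ln (INR n))))))%C; [ring|].
  rewrite E2. ring.
Qed.

(** From [ln (1 + y) <= y] at [y = 1 / n] and at [y = - 1 / (n + 1)]; the resulting upper and lower
    bounds differ by [1 / (n (n + 1))]. *)
Lemma ln_step (n : nat) : (1 <= n)%nat ->
  0 <= ln (INR (S n)) - ln (INR n) - / INR (S n) <= / (INR n * INR n)
  /\ ln (INR (S n)) - ln (INR n) <= / INR n.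
Proof.
  intros Hn. assert (P : 1 <= INR n) by (apply (le_INR 1); exact Hn).
  rewrite S_INR. set (x := INR n) in *.
  assert (E1 : ln (x + 1) - ln x <= / x).
  { replace (x + 1) with (x * (1 + / x)) by (field; lra).
    assert (Q : 0 < / x) by (apply Rinv_0_lt_compat; lra).
    rewrite ln_mult by lra. ring_simplify.
    rewrite <- (ln_exp (/ x)) at 2. apply ln_le; [lra | apply exp_ineq1_le]. }
  assert (E2 : / (x + 1) <= ln (x + 1) - ln x).
  { assert (Q : 0 < / (x + 1) < 1).
    { split; [apply Rinv_0_lt_compat; lra|]. rewrite <- Rinv_1. apply Rinv_lt_contravar; lra. }
    assert (F : ln x = ln (x + 1) + ln (1 - / (x + 1))).
    { rewrite <- ln_mult by lra. f_equal. field. lra. }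
    rewrite F.
    assert (G : ln (1 - / (x + 1)) <= - / (x + 1)).
    { rewrite <- (ln_exp (- / (x + 1))). apply ln_le; [lra|].
      assert (T := exp_ineq1_le (- / (x + 1))). lra. }
    lra. }
  repeat split; try lra.
  apply Rle_trans with (/ x - / (x + 1)); [lra|].
  replace (/ x - / (x + 1)) with (/ (x * (x + 1))) by (field; lra).
  apply Rinv_le_contravar; [apply Rmult_lt_0_compat; lra|].
  apply Rmult_le_compat_l; lra.
Qed.

Lemma gauss_err_le (z : C) (rho : R) (n : nat) :
  0 < rho -> Cmod z <= rho -> 2 * rho + 1 <= INR n ->
  Cmod (gauss_err z n) <= (rho + 20 * rho * rho) / (INR n * INR n).
Proof.
  intros Hr Hz Hn.
  assert (Hn1 : (1 <= n)%nat) by (apply INR_le; cbn; lra).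
  destruct (ln_step n Hn1) as [[L1 L2] L3].
  assert (HS : INR (S n) = INR n + 1) by apply S_INR.
  set (la := ln (INR (S n)) - ln (INR n)) in *. set (x := INR n) in *.
  set (m := / INR (S n)) in *.
  assert (Pm : 0 < m) by (unfold m; apply Rinv_0_lt_compat; lra).
  assert (Pz := Cmod_ge_0 z). assert (Px : 0 < / x) by (apply Rinv_0_lt_compat; lra).
  assert (Hmx : m <= / x) by lra.
  assert (Hla : 0 <= la <= / x) by lra.
  assert (Hzl : Cmod (- (z * RtoC la)) <= rho * / x).
  { rewrite Cmod_opp, Cmod_mult, Cmod_R, Rabs_pos_eq by lra. apply Rmult_le_compat; lra. }
  assert (Hrx : rho * / x <= / 2).
  { apply Rmult_le_reg_r with x; [lra|]. rewrite Rmult_assoc, Rinv_l by lra. lra. }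
  assert (HQ := Cexp_quad (- (z * RtoC la)) ltac:(lra)).
  set (Q := (Cexp (- (z * RtoC la)) - 1 - - (z * RtoC la))%C) in *.
  assert (HQ' : Cmod Q <= 8 * (rho * / x * (rho * / x))).
  { eapply Rle_trans; [exact HQ|]. apply Rmult_le_compat_l; [lra|].
    apply Rmult_le_compat; try apply Cmod_ge_0; lra. }
  (* With [la] the step of the logarithm and [m = 1 / (n + 1)]: the first-order terms leave
     [la - m], their product leaves [z^2 la m], and [Q] is the remainder of the exponential. *)
  replace (gauss_err z n) with
    (- (z * RtoC (la - m)) + (- (z * z) * RtoC (la * m) + (1 + z * RtoC m) * Q))%C.
  2:{ unfold gauss_err, Q. fold x. fold la. fold m. rewrite (RtoC_minus la m), (RtoC_mult la m). ring. }
  assert (A1 : Cmod (- (z * RtoC (la - m))) <= rho * / (x * x)).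
  { rewrite Cmod_opp, Cmod_mult, Cmod_R, Rabs_pos_eq by lra. apply Rmult_le_compat; lra. }
  assert (A2 : Cmod (- (z * z) * RtoC (la * m)) <= rho * rho * (/ x * / x)).
  { rewrite Cmod_mult, Cmod_opp, Cmod_mult, Cmod_R, Rabs_pos_eq by (apply Rmult_le_pos; lra).
    apply Rmult_le_compat; try (apply Rmult_le_pos; lra); apply Rmult_le_compat; lra. }
  assert (A3 : Cmod ((1 + z * RtoC m) * Q) <= 2 * (8 * (rho * / x * (rho * / x)))).
  { apply Cmod_mult_le; [|exact HQ'].
    eapply Rle_trans; [apply Cmod_triangle|].
    rewrite Cmod_1, Cmod_mult, Cmod_R, Rabs_pos_eq by lra.
    assert (Cmod z * m <= rho * / x) by (apply Rmult_le_compat; lra). lra. }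
  eapply Rle_trans; [apply Cmod_plus_le; [exact A1 | apply Cmod_plus_le; [exact A2 | exact A3]]|].
  rewrite Rinv_mult. unfold Rdiv. rewrite Rinv_mult.
  assert (0 <= rho * rho * (/ x * / x)) by (repeat apply Rmult_le_pos; lra).
  lra.
Qed.

Lemma gauss_inv_tail (rho : R) : 0 < rho -> exists N A, (2 <= N)%nat /\ 0 <= A /\
  forall z n, Cmod z <= rho -> (N <= n)%nat -> Cmod (gauss_err z n) <= A / (INR n * INR n).
Proof.
  intros Hr. destruct (nfloor_ex (2 * rho + 1) ltac:(lra)) as (N & HN1 & HN2).
  exists (N + 2)%nat, (rho + 20 * rho * rho).
  split; [lia|]. split.
  { assert (0 <= rho * rho) by (apply Rmult_le_pos; lra). lra. }
  intros z n Hz Hn. apply gauss_err_le; [lra | exact Hz|].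
  apply le_INR in Hn. rewrite plus_INR in Hn. cbn in Hn. lra.
Qed.

Lemma gauss_inv_cv (z : C) : exists l, Ccv (gauss_inv z) l.
Proof.
  assert (P := Cmod_ge_0 z).
  destruct (gauss_inv_tail (Cmod z + 1) ltac:(lra)) as (N & A & HN & HA & H).
  destruct (product_converges (gauss_inv z) (gauss_err z) N A HN HA) as [_ [l Hl]].
  - intros n _. apply gauss_inv_S.
  - intros n Hn. apply H; [lra | exact Hn].
  - exists l. exact Hl.
Qed.

(** The factors are now [1 / (1 + err) = 1 - err / (1 + err)]; once [|err| <= 1/2] this doubles the
    constant [A]. Convergence of both [gauss] and its reciprocal is what shows that neither limit is
    0. *)
Lemma gauss_cv (z : C) : nonpole z -> exists l, Ccv (gauss z) l.
Proof.
  intros Hz. assert (P := Cmod_ge_0 z).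
  destruct (gauss_inv_tail (Cmod z + 1) ltac:(lra)) as (N & A & HN & HA & H).
  destruct (nfloor_ex (2 * A + 1) ltac:(lra)) as (N1 & HN1 & HN2).
  set (e := fun n => (- gauss_err z n / (1 + gauss_err z n))%C).
  assert (B : forall n, (N + N1 + 2 <= n)%nat -> Cmod (gauss_err z n) <= A / (INR n * INR n)
      /\ Cmod (gauss_err z n) <= / 2).
  { intros n Hn. assert (E := H z n ltac:(lra) ltac:(lia)). split; [exact E|].
    eapply Rle_trans; [exact E|]. apply le_INR in Hn. rewrite !plus_INR in Hn. cbn in Hn.
    assert (Q := pos_INR N). assert (Q1 : 2 * A + 1 <= INR n) by lra.
    apply Rmult_le_reg_r with (INR n * INR n); [apply Rmult_lt_0_compat; lra|].
    unfold Rdiv. rewrite Rmult_assoc, Rinv_l by (apply Rgt_not_eq, Rmult_lt_0_compat; lra). nra. }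
  destruct (product_converges (gauss z) e (N + N1 + 2) (2 * A)) as [_ [l Hl]]; [lia | lra | | |].
  - intros n Hn. rewrite !gauss_inv_eq, gauss_inv_S. unfold e.
    destruct (B n Hn) as [_ B2].
    assert (Nz : (1 + gauss_err z n)%C <> 0).
    { apply Cmod_gt_0. assert (T := Cmod_sub_ge 1 (- gauss_err z n)).
      rewrite Cmod_1, Cmod_opp in T.
      replace (1 - - gauss_err z n)%C with (1 + gauss_err z n)%C in T by ring. lra. }
    field. split; [exact Nz | apply gauss_inv_neq_0, Hz].
  - intros n Hn. destruct (B n Hn) as [B1 B2]. unfold e, Cdiv.
    assert (T := Cmod_sub_ge 1 (- gauss_err z n)).
    rewrite Cmod_1, Cmod_opp in T.
    replace (1 - - gauss_err z n)%C with (1 + gauss_err z n)%C in T by ring.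
    rewrite Cmod_mult, Cmod_opp, Cmod_inv by (apply Cmod_gt_0; lra).
    rewrite Rmult_comm. unfold Rdiv. rewrite Rmult_assoc.
    apply Rmult_le_compat; try apply Cmod_ge_0; [left; apply Rinv_0_lt_compat; lra | | exact B1].
    rewrite <- (Rinv_inv 2). apply Rinv_le_contravar; lra.
  - exists l. exact Hl.
Qed.

Definition rGamma (z : C) : C := (/ Gamma z)%C.

Lemma Gamma_rGamma (z : C) : Gamma z = (/ rGamma z)%C.
Proof. unfold rGamma. rewrite Cinv_inv. reflexivity. Qed.

Lemma Gamma_cv (z : C) : nonpole z -> Ccv (gauss z) (Gamma z).
Proof.
  intros H. destruct (gauss_cv z H) as [l Hl].
  replace (Gamma z) with l; [exact Hl|]. symmetry. apply Ccv_CLim. exact Hl.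
Qed.

Lemma Gamma_neq_0 (z : C) : nonpole z -> Gamma z <> 0.
Proof.
  intros H E. assert (H1 := Gamma_cv z H). destruct (gauss_inv_cv z) as [l Hl].
  assert (M := Ccv_mult _ _ _ _ H1 Hl). rewrite E in M.
  apply C1_neq_0. apply (Ccv_unique (fun n => gauss z n * gauss_inv z n)%C).
  - apply Ccv_ext_from with (fun _ => RtoC 1) 0%nat; [|apply Ccv_const].
    intros n _. rewrite gauss_inv_eq, Cinv_l; [reflexivity | apply gauss_inv_neq_0, H].
  - replace (RtoC 0) with (0 * l)%C by ring. exact M.
Qed.

Lemma pole_dec (z : C) : nonpole z \/ exists k, (z + RtoC (INR k))%C = 0.
Proof.
  destruct (Classical_Prop.classic (exists k, (z + RtoC (INR k))%C = 0)) as [H|H]; [right; exact H|].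
  left. intros n E. apply H. exists n. exact E.
Qed.

Lemma Gamma_pole (z : C) (k : nat) : (z + RtoC (INR k))%C = 0 -> Gamma z = 0.
Proof.
  intros H. apply Ccv_CLim. apply Ccv_ext_from with (fun _ => RtoC 0) k; [|apply Ccv_const].
  intros n Hn. rewrite (rising_pole z k (S n) H) by lia. unfold Cdiv. rewrite Cinv_0. ring.
Qed.

Lemma rGamma_pole (z : C) (k : nat) : (z + RtoC (INR k))%C = 0 -> rGamma z = 0.
Proof. intros H. unfold rGamma. rewrite (Gamma_pole z k H). apply Cinv_0. Qed.

Lemma rGamma_neq_0 (z : C) : nonpole z -> rGamma z <> 0.
Proof. intros H. apply Cinv_neq_0, Gamma_neq_0, H. Qed.

Lemma rGamma_cv (z : C) : Ccv (gauss_inv z) (rGamma z).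
Proof.
  destruct (pole_dec z) as [H|[k H]].
  - destruct (gauss_inv_cv z) as [l Hl]. replace (rGamma z) with l; [exact Hl|].
    assert (M := Ccv_mult _ _ _ _ (Gamma_cv z H) Hl).
    assert (E : (Gamma z * l = 1)%C).
    { apply (Ccv_unique _ _ _ M).
      apply Ccv_ext_from with (fun _ => RtoC 1) 0%nat; [|apply Ccv_const].
      intros n _. rewrite gauss_inv_eq, Cinv_l; [reflexivity | apply gauss_inv_neq_0, H]. }
    unfold rGamma. rewrite <- (Cmult_1_r (/ _)), <- E. field. apply Gamma_neq_0, H.
  - rewrite (rGamma_pole z k H).
    apply Ccv_ext_from with (fun _ => RtoC 0) k; [|apply Ccv_const].
    intros n Hn. unfold gauss_inv. rewrite (rising_pole z k (S n) H) by lia. ring.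
Qed.

Lemma rising_shift (z : C) (n : nat) : rising z (S n) = (z * rising (z + 1) n)%C.
Proof.
  induction n as [|n IH].
  - cbn [rising INR]. rewrite Cplus_0_r. ring.
  - replace (rising z (S (S n))) with (rising z (S n) * (z + RtoC (INR (S n))))%C by reflexivity.
    rewrite IH, S_INR, RtoC_plus. cbn [rising]. ring.
Qed.

(** The terms satisfy [z gauss_inv (z + 1) n = gauss_inv z n (1 + (z + 1) / n)], and the last factor
    tends to 1. Stated for [rGamma], the recursion holds at the poles as well. *)
Lemma rGamma_rec (z : C) : rGamma z = (z * rGamma (z + 1))%C.
Proof.
  apply (Ccv_unique (fun n => gauss_inv z n * (1 + (z + 1) * RtoC (/ INR n)))%C).
  - replace (rGamma z) with (rGamma z * (1 + (z + 1) * 0))%C by ring.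
    apply Ccv_mult; [apply rGamma_cv|]. apply Ccv_plus; [apply Ccv_const|].
    apply Ccv_mult; [apply Ccv_const|]. intros e He.
    destruct (inv_INR_small e He) as [N HN]. exists (N + 1)%nat. intros n Hn.
    assert (Q : 1 <= INR n) by (apply (le_INR 1); lia).
    replace (RtoC (/ INR n) - 0)%C with (RtoC (/ INR n)) by ring.
    rewrite Cmod_R, Rabs_pos_eq by (left; apply Rinv_0_lt_compat; lra).
    assert (E := HN (n - 1)%nat ltac:(lia)). rewrite minus_INR in E by lia. cbn in E.
    replace (INR n - 1 + 1) with (INR n) in E by ring. exact E.
  - apply Ccv_ext_from with (fun n => z * gauss_inv (z + 1) n)%C 1%nat.
    + intros n Hn. unfold gauss_inv.
      assert (Q : 1 <= INR n) by (apply (le_INR 1); lia).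
      assert (E : Cexp (- ((z + 1) * RtoC (ln (INR n)))) =
         (Cexp (- (z * RtoC (ln (INR n)))) * RtoC (/ INR n))%C).
      { replace (- ((z + 1) * RtoC (ln (INR n))))%C with
          (- (z * RtoC (ln (INR n))) + RtoC (- ln (INR n)))%C by (rewrite RtoC_opp; ring).
        rewrite Cexp_plus. f_equal. unfold Cexp, RtoC, Re, Im; cbn.
        rewrite exp_Ropp, exp_ln, cos_0, sin_0 by lra. f_equal; ring. }
      rewrite E, (rising_shift z n).
      replace (rising (z + 1) (S n)) with (rising (z + 1) n * ((z + 1) + RtoC (INR n)))%C by reflexivity.
      assert (E2 : (RtoC (INR n) * RtoC (/ INR n) = 1)%C)
        by (rewrite <- RtoC_mult, Rinv_r by lra; reflexivity).
      set (rr := rising (z + 1) n). set (ee := Cexp (- (z * RtoC (ln (INR n))))).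
      set (ii := RtoC (/ INR n)) in *. set (jj := RtoC (/ INR (fact n))). set (nn := RtoC (INR n)) in *.
      transitivity (z * rr * ee * jj * (nn * ii + (z + 1) * ii))%C; [ring | rewrite E2; ring].
    + apply Ccv_mult; [apply Ccv_const | apply rGamma_cv].
Qed.

Lemma Gamma_rec (z : C) : z <> 0 -> Gamma (z + 1) = (z * Gamma z)%C.
Proof.
  intros H. rewrite !Gamma_rGamma, (rGamma_rec z), Cinv_mult'.
  transitivity ((z * / z) * / rGamma (z + 1))%C; [rewrite Cinv_r by exact H; ring | ring].
Qed.

Lemma rising_bound (rho : R) (n : nat) : 0 <= rho -> exists M, 0 <= M /\
  forall z, Cmod z <= rho -> Cmod (rising z n) <= M.
Proof.
  intros Hr. induction n as [|n [M [HM IH]]].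
  - exists 1. split; [lra|]. intros. simpl. rewrite Cmod_1. lra.
  - exists (M * (rho + INR n)). assert (P := pos_INR n). split; [apply Rmult_le_pos; lra|].
    intros z Hz. cbn [rising]. apply Cmod_mult_le; [apply IH, Hz|].
    apply Cmod_plus_le; [exact Hz|]. rewrite Cmod_R, Rabs_pos_eq by lra. lra.
Qed.

Lemma rising_hol (n : nat) (z : C) : hol (fun z => rising z n) z.
Proof.
  induction n as [|n IH]; cbn [rising]; [apply hol_const|].
  apply hol_mult; [exact IH | apply hol_plus; [apply hol_id | apply hol_const]].
Qed.

(** The terms are entire and, from the index [N] on, bounded on a disc by the size of the [N]-th
    term times [exp A], so the limit theorem for bounded families applies. *)
Lemma rGamma_hol (z0 : C) : hol rGamma z0.
Proof.
  assert (P := Cmod_ge_0 z0). set (rho := Cmod z0 + 1).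
  destruct (gauss_inv_tail rho ltac:(unfold rho; lra)) as (N & A & HN & HA & H).
  destruct (rising_bound rho (S N) ltac:(unfold rho; lra)) as (M & HM & HB).
  assert (HNi : 1 <= INR N) by (apply (le_INR 1); lia).
  assert (Hln : 0 <= ln (INR N)) by (rewrite <- ln_1; apply ln_le; lra).
  apply hol_limit with (fun n z => gauss_inv z n) 1
    (M * (exp (rho * ln (INR N)) * / INR (fact N)) * exp A) N; [lra| |].
  - intros n z Hn Hz.
    assert (Hzr : Cmod z <= rho).
    { unfold rho. assert (E := Cmod_sub_ge z z0). lra. }
    split.
    + unfold gauss_inv. apply hol_mult; [apply rising_hol|]. apply hol_mult; [|apply hol_const].
      apply (hol_comp Cexp (fun z => - (z * RtoC (ln (INR n))))%C); [|apply Cexp_hol].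
      apply hol_opp, hol_mult; [apply hol_id | apply hol_const].
    + destruct (product_converges (gauss_inv z) (gauss_err z) N A HN HA) as [B _].
      * intros m _. apply gauss_inv_S.
      * intros m Hm. apply H; assumption.
      * eapply Rle_trans; [apply B, Hn|]. apply Rmult_le_compat_r; [left; apply exp_pos|].
        unfold gauss_inv. apply Cmod_mult_le; [apply HB, Hzr|]. apply Cmod_mult_le.
        -- rewrite Cmod_Cexp. set (y := rho * ln (INR N)).
           assert (L : Re (- (z * RtoC (ln (INR N)))) <= y).
           { eapply Rle_trans; [apply Rle_abs|]. eapply Rle_trans; [apply re_le_Cmod|].
             rewrite Cmod_opp, Cmod_mult, Cmod_R, Rabs_pos_eq by lra.
             unfold y. apply Rmult_le_compat_r; lra. }
           destruct (Rle_lt_or_eq_dec _ _ L) as [L'|L']; [left; apply exp_increasing, L' | right; f_equal; exact L'].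
        -- rewrite Cmod_R, Rabs_pos_eq; [lra|]. left. apply Rinv_0_lt_compat, INR_fact_lt_0.
  - intros z _. apply rGamma_cv.
Qed.

Lemma Gamma_hol (z0 : C) : nonpole z0 -> hol Gamma z0.
Proof.
  intros H. apply hol_ext with (fun z => / rGamma z)%C; [intros; symmetry; apply Gamma_rGamma|].
  apply hol_inv; [apply rGamma_neq_0, H | apply rGamma_hol].
Qed.

Lemma nonpole_Re (z : C) : (forall n : nat, Re z + INR n <> 0) -> nonpole z.
Proof. intros H n E. apply (H n). apply (f_equal fst) in E. exact E. Qed.

Lemma nonpole_pos (z : C) : 0 < Re z -> nonpole z.
Proof. intros H. apply nonpole_Re. intros n. assert (P := pos_INR n). lra. Qed.

(** * Growth of the Gamma function in vertical strips *)

Lemma Ccv_Cmod_le (u v : nat -> C) (a b : C) (K : R) (N : nat) : 0 <= K ->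
  Ccv u a -> Ccv v b -> (forall n, (N <= n)%nat -> Cmod (u n) <= K * Cmod (v n)) ->
  Cmod a <= K * Cmod b.
Proof.
  intros HK Hu Hv H. apply Rle_plus_epsilon. intros e He.
  destruct (Hu (e / 2) ltac:(lra)) as [N1 H1].
  destruct (Hv (e / (2 * (K + 1))) ltac:(apply Rdiv_lt_0_compat; lra)) as [N2 H2].
  set (n := (N + N1 + N2)%nat).
  specialize (H1 n ltac:(lia)). specialize (H2 n ltac:(lia)). specialize (H n ltac:(lia)).
  assert (T1 := Cmod_sub_ge a (u n)). rewrite Cmod_sub_sym in T1.
  assert (T2 := Cmod_sub_ge (v n) b).
  assert (K * Cmod (v n) <= K * (Cmod b + e / (2 * (K + 1)))) by (apply Rmult_le_compat_l; lra).
  assert (K * (e / (2 * (K + 1))) <= e / 2).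
  { apply Rle_trans with ((K + 1) * (e / (2 * (K + 1)))).
    - apply Rmult_le_compat_r; [left; apply Rdiv_lt_0_compat|]; lra.
    - right; field; lra. }
  lra.
Qed.

Lemma Cmod_gauss (z : C) (n : nat) :
  Cmod (gauss z n) = INR (fact n) * exp (Re z * ln (INR n)) * Cmod (/ rising z (S n))%C.
Proof.
  unfold gauss, Cdiv. rewrite !Cmod_mult, Cmod_R, Cmod_Cexp, Rabs_pos_eq by (left; apply INR_fact_lt_0).
  do 2 f_equal. unfold Cmult, RtoC, Re; cbn. f_equal. ring.
Qed.

Lemma Cmod_gauss_inv (z : C) (n : nat) :
  Cmod (gauss_inv z n) = Cmod (rising z (S n)) * (exp (- (Re z * ln (INR n))) * / INR (fact n)).
Proof.
  unfold gauss_inv. rewrite !Cmod_mult, Cmod_R, Cmod_Cexp, Rabs_pos_eq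
    by (left; apply Rinv_0_lt_compat, INR_fact_lt_0).
  do 3 f_equal. unfold Cmult, Copp, RtoC, Re; cbn. ring.
Qed.

Lemma Cmod_Re_le (z : C) : 0 <= Re z -> Re z <= Cmod z.
Proof. intros H. eapply Rle_trans; [apply Rle_abs | apply re_le_Cmod]. Qed.

Lemma Cmod_real_pos (x : R) : 0 <= x -> Cmod (RtoC x) = x.
Proof. intros H. rewrite Cmod_R, Rabs_pos_eq; lra. Qed.

Lemma rising_real_le (z : C) (n : nat) : 0 < Re z ->
  0 < Cmod (rising (RtoC (Re z)) n) <= Cmod (rising z n).
Proof.
  intros H. induction n as [|n IH]; cbn [rising]; [rewrite Cmod_1; lra|].
  rewrite !Cmod_mult. assert (P := pos_INR n).
  assert (E1 : Cmod (RtoC (Re z) + RtoC (INR n)) = Re z + INR n)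
    by (rewrite <- RtoC_plus; apply Cmod_real_pos; lra).
  assert (E2 : Re z + INR n <= Cmod (z + RtoC (INR n))).
  { apply (Cmod_Re_le (z + RtoC (INR n))). rewrite Re_plus. change (Re (RtoC (INR n))) with (INR n). lra. }
  rewrite E1. split; [apply Rmult_lt_0_compat; lra|]. apply Rmult_le_compat; lra.
Qed.

(** Factor by factor in Gauss's formula, [|z + k| >= Re z + k]. *)
Lemma Gamma_le_real (z : C) : 0 < Re z -> Cmod (Gamma z) <= Cmod (Gamma (RtoC (Re z))).
Proof.
  intros H. rewrite <- (Rmult_1_l (Cmod (Gamma (RtoC _)))).
  apply (Ccv_Cmod_le (gauss z) (gauss (RtoC (Re z))) _ _ 1 0); [lra | | |].
  - apply Gamma_cv, nonpole_pos, H.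
  - apply Gamma_cv, nonpole_pos. exact H.
  - intros n _. rewrite Rmult_1_l, !Cmod_gauss. change (Re (RtoC (Re z))) with (Re z).
    destruct (rising_real_le z (S n) H) as [L1 L2].
    apply Rmult_le_compat_l.
    + apply Rmult_le_pos; [left; apply INR_fact_lt_0 | left; apply exp_pos].
    + rewrite !Cmod_inv by (apply Cmod_gt_0; lra). apply Rinv_le_contravar; lra.
Qed.

Lemma hol_bounded_segment (g : C -> C) (a b : R) :
  (forall x : R, a <= x <= b -> hol g (RtoC x)) ->
  exists M, 0 <= M /\ forall x : R, a <= x <= b -> Cmod (g (RtoC x)) <= M.
Proof.
  intros H. destruct (Rle_lt_dec a b) as [Hab|Hab].
  2:{ exists 0. split; [lra|]. intros. lra. }
  destruct (continuity_ab_maj (fun x : R => Cmod (g (RtoC x))) a b Hab) as [c [Hc _]].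
  - intros x Hx. destruct (hol_lip _ _ (H x Hx)) as (r & K & Hr & HK & HL).
    intros e He. exists (Rmin r (e / (K + 1))).
    split; [apply Rmin_glb_lt; [lra | apply Rdiv_lt_0_compat; lra]|].
    intros y [_ Hy]. simpl in Hy. unfold Rdist in Hy. simpl. unfold Rdist.
    assert (M1 := Rmin_l r (e / (K + 1))). assert (M2 := Rmin_r r (e / (K + 1))).
    assert (Ed : Cmod (RtoC y - RtoC x) = Rabs (y - x)) by (rewrite <- RtoC_minus; apply Cmod_R).
    assert (L := HL (RtoC x) (RtoC y) ltac:(rewrite Cmod_zero_sub; lra) ltac:(rewrite Ed; lra)).
    rewrite Ed in L.
    assert (T1 := Cmod_sub_ge (g (RtoC y)) (g (RtoC x))).
    assert (T2 := Cmod_sub_ge (g (RtoC x)) (g (RtoC y))). rewrite Cmod_sub_sym in T2.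
    apply Rle_lt_trans with (K * Rabs (y - x)); [apply Rabs_le; lra|].
    assert (P := Rabs_pos (y - x)).
    apply Rle_lt_trans with (K * (e / (K + 1))); [apply Rmult_le_compat_l; lra|].
    apply Rmult_lt_reg_r with (K + 1); [lra|]. field_simplify; nra.
  - exists (Cmod (g (RtoC c))). split; [apply Cmod_ge_0 | exact Hc].
Qed.

Lemma Gamma_bounded (a b : R) : 0 < a ->
  exists M, 0 <= M /\ forall z, a <= Re z <= b -> Cmod (Gamma z) <= M.
Proof.
  intros Ha. destruct (hol_bounded_segment Gamma a b) as (M & HM & H).
  - intros x Hx. apply Gamma_hol, nonpole_pos. change (Re (RtoC x)) with x. lra.
  - exists M. split; [exact HM|]. intros z Hz.
    eapply Rle_trans; [apply Gamma_le_real; lra | apply H, Hz].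
Qed.

(* With [p = Re z + k], [w = |Im z|] the quotient of the squared moduli exceeds
   the real one by at most [1 + 2 B / (p + w)^2], a telescoping product. *)
Lemma rising_factor_le (z z' : C) (Th : R) (k : nat) :
  2 <= Re z <= Re z' -> 0 <= Th -> Rabs (Im z' - Im z) <= Th ->
  let B := Th * Th + 2 * Th * Rabs (Im z) in
  let a := Re z + INR k + Rabs (Im z) in
  Cmod (z' + RtoC (INR k)) * (Re z + INR k)
    <= Cmod (z + RtoC (INR k)) * (Re z' + INR k) * exp (B * (/ (a - 1) - / a)).
Proof.
  intros Hz HT HI B a. assert (Pk := pos_INR k).
  set (p := Re z + INR k) in *. set (p' := Re z' + INR k).
  set (v := Im z) in *. set (v' := Im z').
  assert (Pv := Rabs_pos v). assert (Pv' := Rabs_pos v').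
  assert (Hp : 2 <= p <= p') by (unfold p, p'; lra).
  assert (Hv' : Rabs v' <= Rabs v + Th).
  { replace v' with (v + (v' - v)) by ring. eapply Rle_trans; [apply Rabs_triang|]. fold v' in HI. lra. }
  assert (Sq : forall t, t * t = Rabs t * Rabs t)
    by (intros; rewrite <- Rabs_mult; symmetry; apply Rabs_pos_eq; nra).
  assert (Hv2 : v' * v' <= v * v + B).
  { rewrite (Sq v'), (Sq v). unfold B. nra. }
  assert (PB : 0 <= B) by (unfold B; nra).
  assert (Ha : 2 <= a) by (unfold a; lra).
  set (y := B * (/ (a - 1) - / a)).
  (* Here [(p + |v|)^2 <= 2 (p^2 + v^2)] turns the quotient into the telescoping difference in
     [a]. *)
  assert (Hy : B / (p * p + v * v) <= 2 * y).
  { unfold y. replace (/ (a - 1) - / a) with (/ ((a - 1) * a)) by (field; lra).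
    unfold Rdiv. replace (2 * (B * / ((a - 1) * a))) with (B * (2 * / ((a - 1) * a))) by ring.
    apply Rmult_le_compat_l; [exact PB|].
    replace (2 * / ((a - 1) * a)) with (/ ((a - 1) * a / 2)) by (field; lra).
    apply Rinv_le_contravar; [apply Rmult_lt_0_compat; [apply Rmult_lt_0_compat|]; lra|].
    rewrite (Sq v). unfold a.
    assert (S0 := Rle_0_sqr (p - Rabs v)). unfold Rsqr in S0. fold p. lra. }
  assert (Hey : 1 + B / (p * p + v * v) <= exp y * exp y).
  { rewrite <- exp_plus. eapply Rle_trans; [|apply exp_ineq1_le]. lra. }
  assert (M2 : forall x : C, Cmod x * Cmod x = Re x * Re x + Im x * Im x).
  { intros x. assert (E := Cmod2_alt x). simpl in E. rewrite !Rmult_1_r in E. exact E. }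
  assert (Ez : Cmod (z + RtoC (INR k)) * Cmod (z + RtoC (INR k)) = p * p + v * v).
  { rewrite M2, Re_plus, Im_plus. change (Re (RtoC (INR k))) with (INR k).
    change (Im (RtoC (INR k))) with 0. fold p v. ring. }
  assert (Ez' : Cmod (z' + RtoC (INR k)) * Cmod (z' + RtoC (INR k)) = p' * p' + v' * v').
  { rewrite M2, Re_plus, Im_plus. change (Re (RtoC (INR k))) with (INR k).
    change (Im (RtoC (INR k))) with 0. fold p' v'. ring. }
  assert (Pz := Cmod_ge_0 (z + RtoC (INR k))). assert (Pz' := Cmod_ge_0 (z' + RtoC (INR k))).
  assert (Pe := exp_pos y).
  apply Rsqr_incr_0; unfold Rsqr.
  - replace (Cmod (z' + RtoC (INR k)) * p * (Cmod (z' + RtoC (INR k)) * p))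
      with ((Cmod (z' + RtoC (INR k)) * Cmod (z' + RtoC (INR k))) * (p * p)) by ring.
    replace (Cmod (z + RtoC (INR k)) * p' * exp y * (Cmod (z + RtoC (INR k)) * p' * exp y))
      with ((Cmod (z + RtoC (INR k)) * Cmod (z + RtoC (INR k))) * (p' * p') * (exp y * exp y)) by ring.
    rewrite Ez, Ez'.
    assert (Hpv : 0 < p * p + v * v) by nra.
    apply Rle_trans with ((p * p + v * v) * (p' * p') * (1 + B / (p * p + v * v))).
    + replace ((p * p + v * v) * (p' * p') * (1 + B / (p * p + v * v)))
        with ((p' * p') * (p * p + (v * v + B))) by (assert (0 < p * p + v * v) by nra; field; lra).
      assert (p * p <= p' * p') by (apply Rmult_le_compat; lra).
      assert (v' * v' * (p * p) <= v' * v' * (p' * p')) by (apply Rmult_le_compat_l; [nra | lra]).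
      assert (p' * p' * (v' * v') <= p' * p' * (v * v + B)) by (apply Rmult_le_compat_l; [nra | lra]).
      lra.
    + apply Rmult_le_compat_l; [|exact Hey].
      apply Rmult_le_pos; [lra | nra].
  - apply Rmult_le_pos; lra.
  - repeat apply Rmult_le_pos; lra.
Qed.

(** The product of the factor estimates; the exponents telescope and so stay bounded in [m]. *)
Lemma rising_compare (z z' : C) (Th : R) (m : nat) :
  2 <= Re z <= Re z' -> 0 <= Th -> Rabs (Im z' - Im z) <= Th ->
  let B := Th * Th + 2 * Th * Rabs (Im z) in
  let a := Re z + Rabs (Im z) in
  Cmod (rising z' m) * Cmod (rising (RtoC (Re z)) m)
   <= Cmod (rising z m) * Cmod (rising (RtoC (Re z')) m)
        * exp (B * (/ (a - 1) - / (a + INR m - 1))).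
Proof.
  intros Hz HT HI B a. assert (Pv := Rabs_pos (Im z)).
  induction m as [|m IH].
  - cbn [rising INR]. rewrite Cmod_1. replace (a + 0 - 1) with (a - 1) by ring.
    rewrite Rminus_diag, Rmult_0_r, exp_0. lra.
  - cbn [rising]. rewrite !Cmod_mult. assert (Pm := pos_INR m).
    assert (F := rising_factor_le z z' Th m Hz HT HI). cbv zeta in F. fold B in F.
    rewrite S_INR.
    rewrite <- !RtoC_plus, !(Cmod_real_pos (_ + INR m)) by lra.
    replace (B * (/ (a - 1) - / (a + (INR m + 1) - 1))) with
      (B * (/ (a - 1) - / (a + INR m - 1)) + B * (/ (a + INR m - 1) - / (a + INR m)))
      by (replace (a + (INR m + 1) - 1) with (a + INR m) by ring; ring).
    replace (Re z + INR m + Rabs (Im z)) with (a + INR m) in F by (unfold a; ring).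
    rewrite exp_plus.
    set (e1 := exp (B * (/ (a - 1) - / (a + INR m - 1)))) in *.
    set (e2 := exp (B * (/ (a + INR m - 1) - / (a + INR m)))) in *.
    replace (Cmod (rising z' m) * Cmod (z' + RtoC (INR m)) * (Cmod (rising (RtoC (Re z)) m) * (Re z + INR m)))
      with ((Cmod (rising z' m) * Cmod (rising (RtoC (Re z)) m)) * (Cmod (z' + RtoC (INR m)) * (Re z + INR m))) by ring.
    replace (Cmod (rising z m) * Cmod (z + RtoC (INR m)) * (Cmod (rising (RtoC (Re z')) m) * (Re z' + INR m)) * (e1 * e2))
      with ((Cmod (rising z m) * Cmod (rising (RtoC (Re z')) m) * e1) * (Cmod (z + RtoC (INR m)) * (Re z' + INR m) * e2)) by ring.
    apply Rmult_le_compat; try assumption.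
    + apply Rmult_le_pos; apply Cmod_ge_0.
    + apply Rmult_le_pos; [apply Cmod_ge_0 | lra].
Qed.

(** [B] grows linearly in [|Im z|], but so does [a], and [B / (a - 1) <= Th^2 + 2 Th]. The
    comparison with the quotient at the real parts is therefore uniform in the height, with no
    asymptotic formula for Gamma. *)
Lemma Gamma_ratio_core (z z' : C) (Th : R) :
  2 <= Re z <= Re z' -> 0 <= Th -> Rabs (Im z' - Im z) <= Th ->
  Cmod (Gamma z * rGamma z') <=
    exp (Th * Th + 2 * Th) * Cmod (Gamma (RtoC (Re z)) * rGamma (RtoC (Re z'))).
Proof.
  intros Hz HT HI. assert (Pv := Rabs_pos (Im z)).
  apply (Ccv_Cmod_le (fun n => gauss z n * gauss_inv z' n)%C
     (fun n => gauss (RtoC (Re z)) n * gauss_inv (RtoC (Re z')) n)%C _ _ _ 0).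
  - left. apply exp_pos.
  - apply Ccv_mult; [apply Gamma_cv, nonpole_pos; lra | apply rGamma_cv].
  - apply Ccv_mult; [apply Gamma_cv, nonpole_pos; change (0 < Re z); lra | apply rGamma_cv].
  - intros n _. rewrite !Cmod_mult, !Cmod_gauss, !Cmod_gauss_inv.
    change (Re (RtoC (Re z))) with (Re z). change (Re (RtoC (Re z'))) with (Re z').
    assert (F := rising_compare z z' Th (S n) Hz HT HI). cbv zeta in F.
    set (B := Th * Th + 2 * Th * Rabs (Im z)) in *. set (a := Re z + Rabs (Im z)) in *.
    assert (Ha : 2 <= a) by (unfold a; lra).
    assert (PB : 0 <= B).
    { unfold B. assert (0 <= Th * Rabs (Im z)) by (apply Rmult_le_pos; lra). nra. }
    assert (G : exp (B * (/ (a - 1) - / (a + INR (S n) - 1))) <= exp (Th * Th + 2 * Th)).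
    { assert (Q : B * (/ (a - 1) - / (a + INR (S n) - 1)) <= Th * Th + 2 * Th).
      { apply Rle_trans with (B * / (a - 1)).
        - apply Rmult_le_compat_l; [exact PB|].
          assert (Ps := pos_INR (S n)).
          assert (0 < / (a + INR (S n) - 1)) by (apply Rinv_0_lt_compat; lra). lra.
        - apply Rmult_le_reg_r with (a - 1); [lra|].
          rewrite Rmult_assoc, Rinv_l, Rmult_1_r by lra.
          unfold B. assert (Q1 : 1 + Rabs (Im z) <= a - 1) by (unfold a; lra).
          assert ((Th * Th + 2 * Th) * (1 + Rabs (Im z)) <= (Th * Th + 2 * Th) * (a - 1))
            by (apply Rmult_le_compat_l; nra).
          assert (0 <= Th * Th * Rabs (Im z)) by (apply Rmult_le_pos; nra). lra. }
      destruct (Rle_lt_or_eq_dec _ _ Q) as [L|L]; [left; apply exp_increasing, L | right; f_equal; exact L]. }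
    destruct (rising_real_le z (S n) ltac:(lra)) as [L1 L2].
    assert (Pf := INR_fact_lt_0 n).
    rewrite !Cmod_inv by (apply Cmod_gt_0; lra).
    set (rz := Cmod (rising z (S n))) in *. set (rz' := Cmod (rising z' (S n))) in *.
    set (rx := Cmod (rising (RtoC (Re z)) (S n))) in *. set (rx' := Cmod (rising (RtoC (Re z')) (S n))) in *.
    assert (F2 : rz' * / rz <= exp (Th * Th + 2 * Th) * (rx' * / rx)).
    { apply Rmult_le_reg_r with (rz * rx); [apply Rmult_lt_0_compat; lra|].
      replace (rz' * / rz * (rz * rx)) with (rz' * rx) by (field; lra).
      replace (exp (Th * Th + 2 * Th) * (rx' * / rx) * (rz * rx)) with (rz * rx' * exp (Th * Th + 2 * Th)) by (field; lra).
      eapply Rle_trans; [exact F|]. apply Rmult_le_compat_l; [|exact G].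
      apply Rmult_le_pos; apply Cmod_ge_0. }
    set (c := exp (Re z * ln (INR n)) * exp (- (Re z' * ln (INR n)))).
    assert (Pc : 0 <= c) by (apply Rmult_le_pos; left; apply exp_pos).
    replace (INR (fact n) * exp (Re z * ln (INR n)) * / rz * (rz' * (exp (- (Re z' * ln (INR n))) * / INR (fact n))))
      with (c * (rz' * / rz)) by (unfold c; field; lra).
    replace (INR (fact n) * exp (Re z * ln (INR n)) * / rx * (rx' * (exp (- (Re z' * ln (INR n))) * / INR (fact n))))
      with (c * (rx' * / rx)) by (unfold c; field; lra).
    replace (exp (Th * Th + 2 * Th) * (c * (rx' * / rx))) with (c * (exp (Th * Th + 2 * Th) * (rx' * / rx))) by ring.
    apply Rmult_le_compat_l; assumption.
Qed.

Lemma rGamma_rising (z : C) (k : nat) : rGamma z = (rising z k * rGamma (z + RtoC (INR k)))%C.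
Proof.
  induction k as [|k IH]; [cbn [rising INR]; rewrite Cplus_0_r; ring|].
  rewrite IH, (rGamma_rec (z + RtoC (INR k))). cbn [rising]. rewrite S_INR, RtoC_plus, Cplus_assoc. ring.
Qed.

Lemma rising_Cmod_le (z : C) (k : nat) (c : R) : Cmod z + INR k <= c ->
  Cmod (rising z k) <= c ^ k.
Proof.
  intros H. assert (Pz := Cmod_ge_0 z). assert (Hc : 0 <= c) by (assert (P := pos_INR k); lra).
  assert (G : forall j, (j <= k)%nat -> Cmod (rising z j) <= c ^ j).
  { intros j. induction j as [|j IH]; intros Hj; [simpl; rewrite Cmod_1; lra|].
    cbn [rising pow]. rewrite Rmult_comm. apply Cmod_mult_le; [apply IH; lia|].
    eapply Rle_trans; [apply Cmod_triangle|]. rewrite Cmod_R, Rabs_pos_eq by apply pos_INR.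
    apply le_INR in Hj. rewrite S_INR in Hj. lra. }
  apply G. lia.
Qed.

(** Raising [z] by 2 and [z'] by [k] reaches the range of the core estimate. The recursion costs
    [1 / (z (z + 1))], of modulus at most [1 / A], and the polynomial [rising z' k], which is the
    source of the growth. *)
Lemma Gamma_ratio_bound (A B A' B' Th : R) : 0 < A ->
  exists M m, 0 <= M /\ forall z z', A <= Re z <= B -> A' <= Re z' <= B' ->
    Rabs (Im z' - Im z) <= Th -> Cmod (Gamma z * rGamma z') <= M * (1 + Cmod z) ^ m.
Proof.
  intros HA.
  assert (PB := Rabs_pos B). assert (PA' := Rabs_pos A'). assert (PB' := Rabs_pos B').
  (* Large enough that [Re z' + k >= Re z + 2] throughout the two ranges. *)
  destruct (nfloor_ex (Rabs B + Rabs A' + 4) ltac:(lra)) as (k & Hk1 & Hk2).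
  assert (LB := Rle_abs B). assert (LA := Rle_abs (- A')). rewrite Rabs_Ropp in LA.
  assert (LB' := Rle_abs B'). assert (Hkk := pos_INR k).
  destruct (hol_bounded_segment Gamma (A + 2) (B + 2)) as (M1 & HM1 & H1).
  { intros x Hx. apply Gamma_hol, nonpole_pos. change (Re (RtoC x)) with x. lra. }
  destruct (hol_bounded_segment rGamma (A' + INR k) (B' + INR k)) as (M2 & HM2 & H2).
  { intros x Hx. apply rGamma_hol. }
  set (T := Rabs Th). assert (PT : 0 <= T) by apply Rabs_pos. assert (LT : Th <= T) by apply Rle_abs.
  set (c := Rabs A' + Rabs B' + T + INR k + 1).
  set (M := / A * (exp (T * T + 2 * T) * (M1 * M2)) * c ^ k).
  assert (Pc : 0 < c) by (unfold c; lra).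
  assert (PM : 0 <= M).
  { unfold M. apply Rmult_le_pos; [|apply pow_le; lra].
    apply Rmult_le_pos; [left; apply Rinv_0_lt_compat; lra|].
    apply Rmult_le_pos; [left; apply exp_pos | apply Rmult_le_pos; lra]. }
  exists M, k. split; [exact PM|].
  intros z z' Hz Hz' HI.
  assert (Ez : (Gamma z = / (z * (z + 1)) * Gamma (z + 2))%C).
  { assert (N0 : z <> 0).
    { intros E. apply (f_equal fst) in E. cbn in E. change (fst z) with (Re z) in E. lra. }
    assert (N1 : (z + 1)%C <> 0).
    { intros E. apply (f_equal fst) in E. cbn in E. change (fst z) with (Re z) in E. lra. }
    replace (z + 2)%C with ((z + 1) + 1)%C by ring.
    rewrite (Gamma_rec (z + 1) N1), (Gamma_rec z N0). field. auto. }
  rewrite Ez, (rGamma_rising z' k).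
  replace (/ (z * (z + 1)) * Gamma (z + 2) * (rising z' k * rGamma (z' + RtoC (INR k))))%C
    with (/ (z * (z + 1)) * (Gamma (z + 2) * rGamma (z' + RtoC (INR k))) * rising z' k)%C by ring.
  assert (R2 : Re (z + 2) = Re z + 2) by reflexivity.
  assert (I2 : Im (z + 2) = Im z) by (rewrite Im_plus; cbn; ring).
  assert (Rk : Re (z' + RtoC (INR k)) = Re z' + INR k) by reflexivity.
  assert (Ik : Im (z' + RtoC (INR k)) = Im z') by (rewrite Im_plus; cbn; ring).
  assert (K1 : Cmod (/ (z * (z + 1))) <= / A).
  { assert (Q1 : A <= Cmod z) by (eapply Rle_trans; [|apply Cmod_Re_le; lra]; lra).
    assert (Q2 : 1 <= Cmod (z + 1)).
    { eapply Rle_trans; [|apply Cmod_Re_le; rewrite Re_plus; cbn; lra]. rewrite Re_plus; cbn; lra. }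
    assert (Q3 : A <= Cmod (z * (z + 1))).
    { rewrite Cmod_mult. rewrite <- (Rmult_1_r A). apply Rmult_le_compat; lra. }
    rewrite Cmod_inv by (apply Cmod_gt_0; lra). apply Rinv_le_contravar; lra. }
  assert (K2 : Cmod (Gamma (z + 2) * rGamma (z' + RtoC (INR k))) <= exp (T * T + 2 * T) * (M1 * M2)).
  { eapply Rle_trans; [apply (Gamma_ratio_core _ _ T); rewrite ?R2, ?Rk, ?I2, ?Ik; lra|].
    apply Rmult_le_compat_l; [left; apply exp_pos|].
    rewrite R2, Rk. apply Cmod_mult_le; [apply H1 | apply H2]; lra. }
  assert (K3 : Cmod (rising z' k) <= c ^ k * (1 + Cmod z) ^ k).
  { rewrite <- Rpow_mult_distr. apply rising_Cmod_le.
    assert (Q : Cmod z' <= (Rabs A' + Rabs B' + T) + Cmod z).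
    { eapply Rle_trans; [apply Cmod_le_abs|].
      assert (Rabs (Re z') <= Rabs A' + Rabs B') by (apply Rabs_le; lra).
      assert (Q2 : Rabs (Im z') <= Cmod z + T).
      { replace (Im z') with (Im z + (Im z' - Im z)) by ring.
        eapply Rle_trans; [apply Rabs_triang|]. assert (E := im_le_Cmod z). lra. }
      lra. }
    assert (Pz := Cmod_ge_0 z). unfold c. nra. }
  unfold M. rewrite Rmult_assoc with (r3 := (1 + Cmod z) ^ k).
  apply Cmod_mult_le; [|exact K3]. apply Cmod_mult_le; assumption.
Qed.

(** * Integrals over the real line *)

(** A total operator, so that integrals can be written before convergence is known. Symmetric
    intervals suffice because the integrands are dominated by [1 / (1 + t^2)]. *)
Definition line_int_R (phi : R -> R) : R :=
  real (Lim_seq (fun n => RInt phi (- INR n) (INR n))).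

Definition line_int (g : R -> C) : C :=
  (line_int_R (fun t => Re (g t)), line_int_R (fun t => Im (g t))).

(** A rate in both endpoints independently, that of the tails of [1 / (1 + t^2)]. It determines [I]
    and yields the two-sided improper limit. *)
Definition tail_bound (phi : R -> R) (I M : R) : Prop :=
  forall a b, a < 0 < b -> Rabs (RInt phi a b - I) <= M * (/ (- a) + / b).

Lemma continuous_neg (t : R) : continuous (fun t => - t) t.
Proof. apply (ex_derive_continuous (fun t => - t)). auto_derive. exact I. Qed.

Lemma RInt_inv_sq_le (phi : R -> R) (M a b : R) : 0 < a <= b ->
  (forall t, continuous phi t) ->
  (forall t, a <= t <= b -> Rabs (phi t) * (1 + t * t) <= M) ->
  Rabs (RInt phi a b) <= M * (/ a - / b).
Proof.
  intros Hab Hc Hb.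
  assert (HI : is_RInt (fun t => M * / (t * t)) a b (M * (/ a - / b))).
  { replace (M * (/ a - / b)) with (minus (- (M * / b)) (- (M * / a)))
      by (unfold minus, plus, opp; simpl; ring).
    apply (is_RInt_derive (fun t => - (M * / t)) (fun t => M * / (t * t))).
    - intros t Ht. rewrite Rmin_left, Rmax_right in Ht by lra.
      auto_derive; [lra | field; lra].
    - intros t Ht. rewrite Rmin_left, Rmax_right in Ht by lra.
      apply (ex_derive_continuous (fun t => M * / (t * t))).
      auto_derive. apply Rgt_not_eq, Rmult_lt_0_compat; lra. }
  assert (He : ex_RInt phi a b)
    by (apply (ex_RInt_continuous (V := R_CompleteNormedModule)); intros; apply Hc).
  eapply Rle_trans; [apply abs_RInt_le; [lra | exact He]|].
  rewrite <- (is_RInt_unique _ _ _ _ HI).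
  apply RInt_le; [lra | | exists (M * (/ a - / b)); exact HI |].
  - apply (ex_RInt_continuous (V := R_CompleteNormedModule)). intros t _.
    apply (continuous_comp phi Rabs); [apply Hc | apply continuous_Rabs].
  - intros t Ht. specialize (Hb t ltac:(lra)).
    apply Rmult_le_reg_r with (t * t); [nra|].
    rewrite Rmult_assoc, Rinv_l, Rmult_1_r by nra.
    assert (P := Rabs_pos (phi t)). nra.
Qed.

Lemma ex_RInt_cont (phi : R -> R) (a b : R) : (forall t, continuous phi t) -> ex_RInt phi a b.
Proof. intros Hc. apply (ex_RInt_continuous (V := R_CompleteNormedModule)). intros; apply Hc. Qed.

Lemma RInt_reflect (phi : R -> R) (a b : R) : (forall t, continuous phi t) ->
  RInt phi (- b) (- a) = RInt (fun t => phi (- t)) a b.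
Proof.
  intros Hc.
  assert (Hc' : forall t, continuous (fun t => phi (- t)) t).
  { intros t. apply (continuous_comp (fun t => - t) phi); [|apply Hc].
    apply continuous_neg. }
  assert (E := RInt_comp_lin (V := R_CompleteNormedModule) phi (-1) 0 a b).
  replace (-1 * a + 0) with (- a) in E by ring. replace (-1 * b + 0) with (- b) in E by ring.
  specialize (E (ex_RInt_cont _ _ _ Hc)).
  rewrite <- (opp_RInt_swap (V := R_CompleteNormedModule) phi (- a) (- b)) by (apply ex_RInt_cont, Hc).
  rewrite <- E.
  rewrite (RInt_ext _ (fun t => - phi (- t))).
  - rewrite (RInt_opp (V := R_CompleteNormedModule) (fun t => phi (- t))) by (apply ex_RInt_cont, Hc').
    unfold opp; simpl. ring.
  - intros t _. unfold scal; simpl. unfold mult; simpl.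
    replace (-1 * t + 0) with (- t) by ring. ring.
Qed.

Lemma RInt_tails (phi : R -> R) (M a b c d : R) :
  (forall t, continuous phi t) -> (forall t, Rabs (phi t) * (1 + t * t) <= M) ->
  c <= a < 0 -> 0 < b <= d ->
  Rabs (RInt phi c d - RInt phi a b) <= M * (/ (- a) + / b).
Proof.
  intros Hc Hb Ha Hbd.
  assert (HM : 0 <= M) by (eapply Rle_trans; [|apply (Hb 0)]; assert (P := Rabs_pos (phi 0)); nra).
  assert (E : RInt phi c d = RInt phi c a + (RInt phi a b + RInt phi b d)).
  { rewrite <- (RInt_Chasles phi c a d), <- (RInt_Chasles phi a b d) by (apply ex_RInt_cont, Hc).
    reflexivity. }
  rewrite E.
  replace (RInt phi c a + (RInt phi a b + RInt phi b d) - RInt phi a b)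
    with (RInt phi c a + RInt phi b d) by ring.
  eapply Rle_trans; [apply Rabs_triang|]. rewrite Rmult_plus_distr_l.
  apply Rplus_le_compat.
  - replace c with (- - c) by ring. replace a with (- - a) at 1 by ring.
    rewrite RInt_reflect by exact Hc.
    eapply Rle_trans; [apply (RInt_inv_sq_le _ M); [lra | |]|].
    + intros t. apply (continuous_comp (fun t => - t) phi); [|apply Hc].
      apply continuous_neg.
    + intros t _. assert (B := Hb (- t)). replace (- t * - t) with (t * t) in B by ring. exact B.
    + apply Rmult_le_compat_l; [exact HM|].
      assert (0 < / (- c)) by (apply Rinv_0_lt_compat; lra). lra.
  - eapply Rle_trans; [apply (RInt_inv_sq_le _ M); [lra | exact Hc | intros; apply Hb]|].
    apply Rmult_le_compat_l; [exact HM|].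
    assert (0 < / d) by (apply Rinv_0_lt_compat; lra). lra.
Qed.

Lemma line_int_R_of_tail (phi : R -> R) (I M : R) :
  tail_bound phi I M -> line_int_R phi = I.
Proof.
  intros H. unfold line_int_R.
  rewrite (is_lim_seq_unique _ (Finite I)); [reflexivity|].
  apply is_lim_seq_spec. intros e.
  destruct (inv_INR_small (e / (2 * (Rabs M + 1)))) as [N HN].
  { apply Rdiv_lt_0_compat; [apply cond_pos | assert (P := Rabs_pos M); lra]. }
  exists (N + 1)%nat. intros n Hn.
  assert (Hn1 : 1 <= INR n) by (apply (le_INR 1); lia).
  eapply Rle_lt_trans; [apply H; lra|].
  specialize (HN (n - 1)%nat ltac:(lia)). rewrite minus_INR in HN by lia. cbn [INR] in HN.
  replace (INR n - 1 + 1) with (INR n) in HN by ring.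
  rewrite Ropp_involutive.
  assert (P := Rabs_pos M). assert (L := Rle_abs M).
  assert (Pi : 0 < / INR n) by (apply Rinv_0_lt_compat; lra).
  apply Rle_lt_trans with ((Rabs M + 1) * (/ INR n + / INR n)).
  - apply Rmult_le_compat_r; lra.
  - assert (Hlt : / INR n + / INR n < e / (Rabs M + 1)).
    { replace (e / (Rabs M + 1)) with (e / (2 * (Rabs M + 1)) + e / (2 * (Rabs M + 1))) by (field; lra). lra. }
    apply Rmult_lt_reg_l with (/ (Rabs M + 1)); [apply Rinv_0_lt_compat; lra|].
    rewrite <- Rmult_assoc, Rinv_l, Rmult_1_l by lra. rewrite Rmult_comm. exact Hlt.
Qed.

Lemma line_int_R_tail (phi : R -> R) (M : R) :
  (forall t, continuous phi t) -> (forall t, Rabs (phi t) * (1 + t * t) <= M) ->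
  tail_bound phi (line_int_R phi) M.
Proof.
  intros Hc Hb.
  assert (HM : 0 <= M) by (eapply Rle_trans; [|apply (Hb 0)]; assert (P := Rabs_pos (phi 0)); nra).
  assert (Hcv : ex_finite_lim_seq (fun n => RInt phi (- INR n) (INR n))).
  { apply ex_lim_seq_cauchy_corr. intros e.
    destruct (inv_INR_small (e / (2 * (M + 1)))) as [N HN].
    { apply Rdiv_lt_0_compat; [apply cond_pos | lra]. }
    assert (key : forall n m, (N + 1 <= n)%nat -> (n <= m)%nat ->
       Rabs (RInt phi (- INR m) (INR m) - RInt phi (- INR n) (INR n)) < e).
    { intros n m Hn Hm.
      assert (Hn1 : 1 <= INR n) by (apply (le_INR 1); lia). apply le_INR in Hm.
      eapply Rle_lt_trans; [apply (RInt_tails phi M); [exact Hc | exact Hb | lra | lra]|].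
      specialize (HN (n - 1)%nat ltac:(lia)). rewrite minus_INR in HN by lia. cbn [INR] in HN.
      replace (INR n - 1 + 1) with (INR n) in HN by ring.
      rewrite Ropp_involutive.
      assert (Pi : 0 < / INR n) by (apply Rinv_0_lt_compat; lra).
      apply Rle_lt_trans with ((M + 1) * (/ INR n + / INR n)).
      - apply Rmult_le_compat_r; lra.
      - assert (Hlt : / INR n + / INR n < e / (M + 1)).
        { replace (e / (M + 1)) with (e / (2 * (M + 1)) + e / (2 * (M + 1))) by (field; lra). lra. }
        apply Rmult_lt_reg_l with (/ (M + 1)); [apply Rinv_0_lt_compat; lra|].
        rewrite <- Rmult_assoc, Rinv_l, Rmult_1_l by lra. rewrite Rmult_comm. exact Hlt. }
    exists (N + 1)%nat. intros n m Hn Hm.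
    destruct (Nat.le_ge_cases n m) as [L|L].
    - rewrite Rabs_minus_sym. apply key; assumption.
    - apply key; assumption. }
  destruct Hcv as [l Hl].
  assert (E : line_int_R phi = l) by (unfold line_int_R; rewrite (is_lim_seq_unique _ _ Hl); reflexivity).
  rewrite E. intros a b Hab.
  apply is_lim_seq_spec in Hl.
  apply Rle_plus_epsilon. intros e He.
  destruct (Hl (mkposreal e He)) as [N HN]. cbn [pos] in HN.
  destruct (nfloor_ex (- a + b) ltac:(lra)) as (k & Hk1 & Hk2).
  set (n := (N + k + 1)%nat).
  assert (Hn : - a + b < INR n).
  { unfold n. rewrite !plus_INR. cbn [INR]. assert (P := pos_INR N). lra. }
  specialize (HN n ltac:(lia)).
  assert (T := RInt_tails phi M a b (- INR n) (INR n) Hc Hb ltac:(lra) ltac:(lra)).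
  replace (RInt phi a b - l) with
    (- (RInt phi (- INR n) (INR n) - RInt phi a b) + (RInt phi (- INR n) (INR n) - l)) by ring.
  eapply Rle_trans; [apply Rabs_triang|]. rewrite Rabs_Ropp. lra.
Qed.

Definition decays (g : R -> C) (M : R) : Prop :=
  (forall t, continuous (fun t => Re (g t)) t /\ continuous (fun t => Im (g t)) t) /\
  (forall t, Cmod (g t) * (1 + t * t) <= M).

Lemma decays_cont_Re (g : R -> C) (M : R) : decays g M ->
  forall t, continuous (fun t => Re (g t)) t.
Proof. intros [H _] t. exact (proj1 (H t)). Qed.

Lemma decays_cont_Im (g : R -> C) (M : R) : decays g M ->
  forall t, continuous (fun t => Im (g t)) t.
Proof. intros [H _] t. exact (proj2 (H t)). Qed.

Lemma decays_Re (g : R -> C) (M : R) : decays g M ->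
  tail_bound (fun t => Re (g t)) (line_int_R (fun t => Re (g t))) M.
Proof.
  intros H. apply line_int_R_tail; [exact (decays_cont_Re g M H)|].
  intros t. eapply Rle_trans; [|apply (proj2 H)]. apply Rmult_le_compat_r; [nra | apply re_le_Cmod].
Qed.

Lemma decays_Im (g : R -> C) (M : R) : decays g M ->
  tail_bound (fun t => Im (g t)) (line_int_R (fun t => Im (g t))) M.
Proof.
  intros H. apply line_int_R_tail; [exact (decays_cont_Im g M H)|].
  intros t. eapply Rle_trans; [|apply (proj2 H)]. apply Rmult_le_compat_r; [nra | apply im_le_Cmod].
Qed.

Lemma tail_filterlim (phi : R -> R) (I M : R) : tail_bound phi I M ->
  filterlim (fun ab : R * R => RInt phi (fst ab) (snd ab))
    (filter_prod (Rbar_locally m_infty) (Rbar_locally p_infty)) (locally I).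
Proof.
  intros H P [e He].
  assert (PM := Rabs_pos M). assert (LM := Rle_abs M).
  set (L := 2 * (Rabs M + 1) / e).
  assert (PL : 0 < L) by (apply Rdiv_lt_0_compat; [lra | apply cond_pos]).
  exists (fun a => a < - L) (fun b => L < b).
  - exists (- L). auto.
  - exists L. auto.
  - intros a b Ha Hb. apply He. cbn [fst snd].
    change (Rabs (RInt phi a b - I) < e).
    eapply Rle_lt_trans; [apply H; lra|].
    assert (I1 : / (- a) < / L) by (apply Rinv_lt_contravar; [apply Rmult_lt_0_compat|]; lra).
    assert (I2 : / b < / L) by (apply Rinv_lt_contravar; [apply Rmult_lt_0_compat|]; lra).
    assert (I3 : 0 < / (- a)) by (apply Rinv_0_lt_compat; lra).
    assert (I4 : 0 < / b) by (apply Rinv_0_lt_compat; lra).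
    apply Rle_lt_trans with ((Rabs M + 1) * (/ (- a) + / b)); [apply Rmult_le_compat_r; lra|].
    apply Rlt_le_trans with ((Rabs M + 1) * (/ L + / L)); [apply Rmult_lt_compat_l; lra|].
    right. unfold L. field. assert (Q := cond_pos e). lra.
Qed.

(** The link between [line_int] and the improper integral in [is_apply]: the rates for the real and
    imaginary parts combine into convergence of the pair. *)
Lemma line_int_correct (g : R -> C) (M : R) : decays g M ->
  is_RInt_gen (V := C_R_NormedModule) g (Rbar_locally m_infty) (Rbar_locally p_infty) (line_int g).
Proof.
  intros H.
  assert (H1 := tail_filterlim _ _ _ (decays_Re g M H)).
  assert (H2 := tail_filterlim _ _ _ (decays_Im g M H)).
  intros P [e He].
  assert (F1 := H1 (fun y => ball (line_int_R (fun t => Re (g t))) e y) (ex_intro _ e (fun y h => h))).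
  assert (F2 := H2 (fun y => ball (line_int_R (fun t => Im (g t))) e y) (ex_intro _ e (fun y h => h))).
  unfold filtermap in F1, F2. assert (F := filter_and _ _ F1 F2).
  revert F. unfold filtermapi. apply filter_imp. intros [a b] [B1 B2]. cbn [fst snd] in *.
  exists (RInt (fun t => Re (g t)) a b, RInt (fun t => Im (g t)) a b). split.
  - apply (is_RInt_ext (V := C_R_NormedModule) (fun t => (Re (g t), Im (g t)))).
    + intros t _. destruct (g t); reflexivity.
    + apply (is_RInt_fct_extend_pair (U := R_NormedModule) (V := R_NormedModule)).
      * apply (RInt_correct (V := R_CompleteNormedModule)), ex_RInt_cont, (decays_cont_Re g M H).
      * apply (RInt_correct (V := R_CompleteNormedModule)), ex_RInt_cont, (decays_cont_Im g M H).
  - apply He. split; assumption.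
Qed.

(** If [I] and [J] differed, an interval of length proportional to [1 / |I - J|] would contradict
    the three bounds of order [1 / L]. *)
Lemma tail_bound_eq (phi psi : R -> R) (I J M M' c : R) :
  tail_bound phi I M -> tail_bound psi J M' ->
  (forall L, 1 < L -> Rabs (RInt phi (- L) L - RInt psi (- L) L) <= c * / L) -> I = J.
Proof.
  intros H1 H2 H3. apply Rminus_diag_uniq.
  destruct (Req_dec (I - J) 0) as [E|E]; [exact E|]. exfalso.
  apply Rabs_pos_lt in E.
  set (q := Rabs c + 2 * Rabs M + 2 * Rabs M' + 1).
  assert (P1 := Rabs_pos M). assert (P2 := Rabs_pos M'). assert (P3 := Rabs_pos c).
  assert (L1 := Rle_abs M). assert (L2 := Rle_abs M'). assert (L3 := Rle_abs c).
  set (L := 1 + 1 + q / Rabs (I - J)).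
  assert (Pq : 0 < q / Rabs (I - J)) by (apply Rdiv_lt_0_compat; unfold q; lra).
  assert (HL : 1 < L) by (unfold L; lra).
  specialize (H1 (- L) L ltac:(lra)). specialize (H2 (- L) L ltac:(lra)). specialize (H3 L HL).
  rewrite Ropp_involutive in H1, H2.
  assert (PiL : 0 < / L) by (apply Rinv_0_lt_compat; lra).
  assert (T : Rabs (I - J) <= q * / L).
  { replace (I - J) with (- (RInt phi (- L) L - I) + ((RInt phi (- L) L - RInt psi (- L) L) + (RInt psi (- L) L - J))) by ring.
    eapply Rle_trans; [apply Rabs_triang|]. rewrite Rabs_Ropp.
    assert (Q := Rabs_triang (RInt phi (- L) L - RInt psi (- L) L) (RInt psi (- L) L - J)).
    assert (M * (/ L + / L) <= 2 * Rabs M * / L) by nra.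
    assert (M' * (/ L + / L) <= 2 * Rabs M' * / L) by nra.
    assert (c * / L <= Rabs c * / L) by nra.
    unfold q. lra. }
  assert (T2 : Rabs (I - J) * L <= q).
  { apply Rmult_le_reg_r with (/ L); [exact PiL|]. rewrite Rmult_assoc, Rinv_r by lra. lra. }
  assert (T3 : Rabs (I - J) * L = 2 * Rabs (I - J) + q) by (unfold L; field; lra).
  lra.
Qed.

Lemma decays_plus (g h : R -> C) (M N : R) : decays g M -> decays h N ->
  decays (fun t => g t + h t)%C (M + N).
Proof.
  intros [Hg1 Hg2] [Hh1 Hh2]. split.
  - intros t. split.
    + apply (continuous_plus (fun t => Re (g t)) (fun t => Re (h t)));
        [exact (proj1 (Hg1 t)) | exact (proj1 (Hh1 t))].
    + apply (continuous_plus (fun t => Im (g t)) (fun t => Im (h t)));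
        [exact (proj2 (Hg1 t)) | exact (proj2 (Hh1 t))].
  - intros t. specialize (Hg2 t). specialize (Hh2 t).
    assert (T := Cmod_triangle (g t) (h t)).
    assert (Cmod (g t + h t) * (1 + t * t) <= (Cmod (g t) + Cmod (h t)) * (1 + t * t))
      by (apply Rmult_le_compat_r; [nra | exact T]). lra.
Qed.

Lemma decays_scal (c : C) (g : R -> C) (M : R) : decays g M ->
  decays (fun t => c * g t)%C (Cmod c * M).
Proof.
  intros [H1 H2]. split.
  - intros t. destruct (H1 t) as [A B]. split.
    + apply (continuous_minus (fun t => Re c * Re (g t)) (fun t => Im c * Im (g t))).
      * apply (continuous_scal_r (Re c) (fun t => Re (g t))), A.
      * apply (continuous_scal_r (Im c) (fun t => Im (g t))), B.
    + apply (continuous_plus (fun t => Re c * Im (g t)) (fun t => Im c * Re (g t))).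
      * apply (continuous_scal_r (Re c) (fun t => Im (g t))), B.
      * apply (continuous_scal_r (Im c) (fun t => Re (g t))), A.
  - intros t. rewrite Cmod_mult, Rmult_assoc. apply Rmult_le_compat_l; [apply Cmod_ge_0 | apply H2].
Qed.

Lemma line_int_plus (g h : R -> C) (M N : R) : decays g M -> decays h N ->
  line_int (fun t => g t + h t)%C = (line_int g + line_int h)%C.
Proof.
  intros Hg Hh.
  unfold line_int, Cplus. cbn [fst snd]. f_equal.
  - apply line_int_R_of_tail with (M + N). intros a b Hab.
    rewrite (RInt_ext _ (fun t => Re (g t) + Re (h t))) by (intros; reflexivity).
    rewrite (RInt_plus (V := R_CompleteNormedModule) (fun t => Re (g t)) (fun t => Re (h t)));
      [|apply ex_RInt_cont, (decays_cont_Re g M Hg) | apply ex_RInt_cont, (decays_cont_Re h N Hh)].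
    assert (A := decays_Re g M Hg a b Hab). assert (B := decays_Re h N Hh a b Hab).
    rewrite Rmult_plus_distr_r. eapply Rle_trans; [|apply Rplus_le_compat; [exact A | exact B]].
    eapply Rle_trans; [|apply Rabs_triang]. right. f_equal. unfold plus; simpl. ring.
  - apply line_int_R_of_tail with (M + N). intros a b Hab.
    rewrite (RInt_ext _ (fun t => Im (g t) + Im (h t))) by (intros; reflexivity).
    rewrite (RInt_plus (V := R_CompleteNormedModule) (fun t => Im (g t)) (fun t => Im (h t)));
      [|apply ex_RInt_cont, (decays_cont_Im g M Hg) | apply ex_RInt_cont, (decays_cont_Im h N Hh)].
    assert (A := decays_Im g M Hg a b Hab). assert (B := decays_Im h N Hh a b Hab).
    rewrite Rmult_plus_distr_r. eapply Rle_trans; [|apply Rplus_le_compat; [exact A | exact B]].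
    eapply Rle_trans; [|apply Rabs_triang]. right. f_equal. unfold plus; simpl. ring.
Qed.

Lemma RInt_lin (f g : R -> R) (p q a b : R) :
  (forall t, continuous f t) -> (forall t, continuous g t) ->
  RInt (fun t => p * f t + q * g t) a b = p * RInt f a b + q * RInt g a b.
Proof.
  intros Hf Hg.
  rewrite (RInt_plus (V := R_CompleteNormedModule) (fun t => p * f t) (fun t => q * g t)).
  - rewrite (RInt_scal (V := R_CompleteNormedModule) f) by (apply ex_RInt_cont, Hf).
    rewrite (RInt_scal (V := R_CompleteNormedModule) g) by (apply ex_RInt_cont, Hg).
    reflexivity.
  - apply ex_RInt_cont. intros t. apply (continuous_scal_r p f), Hf.
  - apply ex_RInt_cont. intros t. apply (continuous_scal_r q g), Hg.
Qed.

Lemma tail_bound_lin (f g : R -> R) (p q I J M N : R) :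
  (forall t, continuous f t) -> (forall t, continuous g t) ->
  tail_bound f I M -> tail_bound g J N ->
  tail_bound (fun t => p * f t + q * g t) (p * I + q * J) (Rabs p * M + Rabs q * N).
Proof.
  intros Hf Hg H1 H2 a b Hab. rewrite RInt_lin by assumption.
  replace (p * RInt f a b + q * RInt g a b - (p * I + q * J))
    with (p * (RInt f a b - I) + q * (RInt g a b - J)) by ring.
  eapply Rle_trans; [apply Rabs_triang|]. rewrite !Rabs_mult, Rmult_plus_distr_r, !Rmult_assoc.
  apply Rplus_le_compat; apply Rmult_le_compat_l; auto using Rabs_pos.
Qed.

Lemma line_int_scal (c : C) (g : R -> C) (M : R) : decays g M ->
  line_int (fun t => c * g t)%C = (c * line_int g)%C.
Proof.
  intros Hg. unfold line_int.
  assert (F : forall a b : R, (c * (a, b))%C = (Re c * a - Im c * b, Re c * b + Im c * a)) by reflexivity.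
  rewrite F. clear F.
  assert (H1 := decays_Re g M Hg). assert (H2 := decays_Im g M Hg).
  assert (C1 : forall t, continuous (fun t => Re (g t)) t) by exact (decays_cont_Re g M Hg).
  assert (C2 : forall t, continuous (fun t => Im (g t)) t) by exact (decays_cont_Im g M Hg).
  f_equal.
  - assert (T := tail_bound_lin _ _ (Re c) (- Im c) _ _ _ _ C1 C2 H1 H2).
    apply line_int_R_of_tail in T.
    transitivity (line_int_R (fun t => Re c * Re (g t) + - Im c * Im (g t))).
    + f_equal. apply functional_extensionality. intros t. rewrite Re_mult. ring.
    + rewrite T. ring.
  - assert (T := tail_bound_lin _ _ (Im c) (Re c) _ _ _ _ C1 C2 H1 H2).
    apply line_int_R_of_tail in T.
    transitivity (line_int_R (fun t => Im c * Re (g t) + Re c * Im (g t))).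
    + f_equal. apply functional_extensionality. intros t. rewrite Im_mult. ring.
    + rewrite T. ring.
Qed.

Lemma line_int_R_le (phi : R -> R) (M : R) :
  (forall t, continuous phi t) -> (forall t, Rabs (phi t) * (1 + t * t) <= M) ->
  Rabs (line_int_R phi) <= 4 * M.
Proof.
  intros Hc Hb. assert (T := line_int_R_tail phi M Hc Hb (-1) 1 ltac:(lra)).
  replace (/ - -1 + / 1) with 2 in T by field.
  assert (HM : 0 <= M) by (eapply Rle_trans; [|apply (Hb 0)]; assert (P := Rabs_pos (phi 0)); nra).
  assert (B : Rabs (RInt phi (-1) 1) <= (1 - -1) * M).
  { apply abs_RInt_le_const; [lra | apply ex_RInt_cont, Hc|].
    intros t _. specialize (Hb t). assert (P := Rabs_pos (phi t)). nra. }
  replace (line_int_R phi) with (RInt phi (-1) 1 + - (RInt phi (-1) 1 - line_int_R phi)) by ring.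
  eapply Rle_trans; [apply Rabs_triang|]. rewrite Rabs_Ropp. lra.
Qed.

Lemma line_int_le (g : R -> C) (M : R) : decays g M -> Cmod (line_int g) <= 8 * M.
Proof.
  intros H. assert (Hb := proj2 H). eapply Rle_trans; [apply Cmod_le_abs|].
  assert (A : Rabs (line_int_R (fun t => Re (g t))) <= 4 * M).
  { apply line_int_R_le; [exact (decays_cont_Re g M H)|].
    intros t. eapply Rle_trans; [|apply Hb]. apply Rmult_le_compat_r; [nra | apply re_le_Cmod]. }
  assert (B : Rabs (line_int_R (fun t => Im (g t))) <= 4 * M).
  { apply line_int_R_le; [exact (decays_cont_Im g M H)|].
    intros t. eapply Rle_trans; [|apply Hb]. apply Rmult_le_compat_r; [nra | apply im_le_Cmod]. }
  change (Re (line_int g)) with (line_int_R (fun t => Re (g t))).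
  change (Im (line_int g)) with (line_int_R (fun t => Im (g t))). lra.
Qed.

Lemma Im_as_Re (z : C) : Im z = Re (- Ci * z).
Proof. unfold Ci, Copp, Cmult, Re, Im; cbn. ring. Qed.

Lemma line_hol_cont (h : C -> C) (c : C) :
  (forall t : R, hol h (RtoC t + c)%C) ->
  forall t, continuous (fun t : R => Re (h (RtoC t + c)%C)) t /\
            continuous (fun t : R => Im (h (RtoC t + c)%C)) t.
Proof.
  intros H.
  assert (E : forall u t, continuous (fun t : R => Re (u * h (c + RtoC t * 1)%C)) t).
  { intros u t. apply (ex_derive_continuous (fun t : R => Re (u * h (c + RtoC t * 1)%C))).
    eexists. apply hol_C_derive_along.
    replace (c + RtoC t * 1)%C with (RtoC t + c)%C by ring. apply H. }
  intros t. split.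
  - apply (continuous_ext (fun t : R => Re (1 * h (c + RtoC t * 1)%C))); [|apply E].
    intros x. replace (c + RtoC x * 1)%C with (RtoC x + c)%C by ring. rewrite Cmult_1_l. reflexivity.
  - apply (continuous_ext (fun t : R => Re (- Ci * h (c + RtoC t * 1)%C))); [|apply E].
    intros x. replace (c + RtoC x * 1)%C with (RtoC x + c)%C by ring. rewrite <- Im_as_Re. reflexivity.
Qed.

Lemma decays_hol (h : C -> C) (c : C) (M : R) :
  (forall t : R, hol h (RtoC t + c)%C) ->
  (forall t : R, Cmod (h (RtoC t + c)%C) * (1 + t * t) <= M) ->
  decays (fun t : R => h (RtoC t + c)%C) M.
Proof. intros H1 H2. split; [apply line_hol_cont, H1 | exact H2]. Qed.

(** Displacement of the contour without closed curves: the derivative in [s] of the integral over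
    the shifted segment consists of two boundary terms at [t = L] and [t = - L], of order [1 / L] by
    decay. *)
Lemma shift_contour_part (h : C -> C) (u c v : C) (d M : R) : 0 < d ->
  (forall s t : R, - d < s < 1 + d -> hol h (c + RtoC s * v + RtoC t * 1)%C) ->
  (forall s t : R, 0 <= s <= 1 -> Cmod (h (c + RtoC s * v + RtoC t * 1)%C) * (1 + t * t) <= M) ->
  forall L, 1 < L ->
  Rabs (RInt (fun t : R => Re (u * h (c + RtoC 1 * v + RtoC t * 1)%C)) (- L) L
      - RInt (fun t : R => Re (u * h (c + RtoC 0 * v + RtoC t * 1)%C)) (- L) L)
    <= (2 * (Cmod u * Cmod v * M)) * / L.
Proof.
  intros Hd Hh Hb L HL.
  set (I := fun s : R => RInt (fun t : R => Re (u * h (c + RtoC s * v + RtoC t * 1)%C)) (- L) L).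
  change (Rabs (I 1 - I 0) <= 2 * (Cmod u * Cmod v * M) * / L).
  set (dI := fun s : R => Re (u * v * h (c + RtoC s * v + RtoC L * 1)%C)
     - Re (u * v * h (c + RtoC s * v + RtoC (- L) * 1)%C)).
  assert (Pu := Cmod_ge_0 u). assert (Pv := Cmod_ge_0 v).
  assert (Puv : 0 <= Cmod u * Cmod v) by (apply Rmult_le_pos; lra).
  assert (HM : 0 <= M).
  { eapply Rle_trans; [|apply (Hb 0 0); lra]. apply Rmult_le_pos; [apply Cmod_ge_0 | lra]. }
  assert (Hder : forall s, 0 <= s <= 1 -> is_derive I s (dI s)).
  { intros s Hs. apply (is_derive_segment_RInt h u c v 1 v (- L) L s d Hd); [ring|].
    intros s' t Hs' _. apply Hh. apply Rabs_lt_between in Hs'. lra. }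
  assert (Hle : forall s, 0 <= s <= 1 -> Rabs (dI s) <= 2 * (Cmod u * Cmod v * M) * / L).
  { intros s Hs. unfold dI.
    assert (B : forall t, Rabs t = L -> Rabs (Re (u * v * h (c + RtoC s * v + RtoC t * 1)%C)) <= Cmod u * Cmod v * M * / L).
    { intros t Ht. eapply Rle_trans; [apply re_le_Cmod|]. rewrite !Cmod_mult, !Rmult_assoc.
      apply Rmult_le_compat_l; [lra|]. apply Rmult_le_compat_l; [lra|].
      apply Rmult_le_reg_r with L; [lra|]. rewrite Rmult_assoc, Rinv_l, Rmult_1_r by lra.
      eapply Rle_trans; [|apply (Hb s t Hs)]. apply Rmult_le_compat_l; [apply Cmod_ge_0|].
      replace (t * t) with (Rabs t * Rabs t) by (rewrite <- Rabs_mult; apply Rabs_pos_eq; nra).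
      rewrite Ht. nra. }
    assert (B1 := B L ltac:(apply Rabs_pos_eq; lra)).
    assert (B2 := B (- L) ltac:(rewrite Rabs_Ropp; apply Rabs_pos_eq; lra)).
    unfold Rminus. eapply Rle_trans; [apply Rabs_triang|]. rewrite Rabs_Ropp. lra. }
  destruct (MVT_gen I 0 1 dI) as (x & Hx & E).
  - intros s Hs. rewrite Rmin_left, Rmax_right in Hs by lra. apply Hder. lra.
  - intros s Hs. rewrite Rmin_left, Rmax_right in Hs by lra.
    apply continuity_pt_filterlim, (ex_derive_continuous I). eexists. apply Hder. lra.
  - rewrite Rmin_left, Rmax_right in Hx by lra.
    rewrite E, Rminus_0_r, Rmult_1_r. apply Hle, Hx.
Qed.

Lemma line_int_shift_aux (h : C -> C) (c v : C) (d M : R) : 0 < d ->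
  (forall s t : R, - d < s < 1 + d -> hol h (c + RtoC s * v + RtoC t * 1)%C) ->
  (forall s t : R, 0 <= s <= 1 -> Cmod (h (c + RtoC s * v + RtoC t * 1)%C) * (1 + t * t) <= M) ->
  line_int (fun t : R => h (RtoC t + c)%C) = line_int (fun t : R => h (RtoC t + (c + v))%C).
Proof.
  intros Hd Hh Hb.
  assert (D0 : decays (fun t : R => h (RtoC t + c)%C) M).
  { apply decays_hol.
    - intros t. replace (RtoC t + c)%C with (c + RtoC 0 * v + RtoC t * 1)%C by ring. apply Hh. lra.
    - intros t. replace (RtoC t + c)%C with (c + RtoC 0 * v + RtoC t * 1)%C by ring. apply Hb. lra. }
  assert (D1 : decays (fun t : R => h (RtoC t + (c + v))%C) M).
  { apply decays_hol.
    - intros t. replace (RtoC t + (c + v))%C with (c + RtoC 1 * v + RtoC t * 1)%C by ring. apply Hh. lra.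
    - intros t. replace (RtoC t + (c + v))%C with (c + RtoC 1 * v + RtoC t * 1)%C by ring. apply Hb. lra. }
  assert (key : forall u L, 1 < L ->
    Rabs (RInt (fun t : R => Re (u * h (RtoC t + c)%C)) (- L) L
      - RInt (fun t : R => Re (u * h (RtoC t + (c + v))%C)) (- L) L) <= (2 * (Cmod u * Cmod v * M)) * / L).
  { intros u L HL. rewrite Rabs_minus_sym.
    rewrite (RInt_ext (fun t : R => Re (u * h (RtoC t + c)%C))
       (fun t : R => Re (u * h (c + RtoC 0 * v + RtoC t * 1)%C))).
    2:{ intros t _. do 3 f_equal. ring. }
    rewrite (RInt_ext (fun t : R => Re (u * h (RtoC t + (c + v))%C))
       (fun t : R => Re (u * h (c + RtoC 1 * v + RtoC t * 1)%C))).
    2:{ intros t _. do 3 f_equal. ring. }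
    apply shift_contour_part with d; assumption. }
  unfold line_int. f_equal.
  - apply (tail_bound_eq _ _ _ _ M M (2 * (Cmod 1 * Cmod v * M)) (decays_Re _ _ D0) (decays_Re _ _ D1)).
    intros L HL. specialize (key 1%C L HL).
    rewrite (RInt_ext _ (fun t : R => Re (h (RtoC t + c)%C))) in key by (intros; rewrite Cmult_1_l; reflexivity).
    rewrite (RInt_ext (fun t : R => Re (1 * h (RtoC t + (c + v))%C)) (fun t : R => Re (h (RtoC t + (c + v))%C))) in key
      by (intros; rewrite Cmult_1_l; reflexivity).
    exact key.
  - apply (tail_bound_eq _ _ _ _ M M (2 * (Cmod (- Ci) * Cmod v * M)) (decays_Im _ _ D0) (decays_Im _ _ D1)).
    intros L HL. specialize (key (- Ci)%C L HL).
    rewrite (RInt_ext _ (fun t : R => Im (h (RtoC t + c)%C))) in key by (intros; symmetry; apply Im_as_Re).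
    rewrite (RInt_ext (fun t : R => Re (- Ci * h (RtoC t + (c + v))%C)) (fun t : R => Im (h (RtoC t + (c + v))%C))) in key
      by (intros; symmetry; apply Im_as_Re).
    exact key.
Qed.

Lemma weight_le (t : R) (c : C) (k : R) : Cmod c <= k ->
  1 + t * t <= (1 + k) * (1 + k) * (1 + Cmod (RtoC t + c)) ^ 2.
Proof.
  intros H. assert (P := Cmod_ge_0 c).
  assert (E : Rabs t <= Cmod (RtoC t + c) + k).
  { assert (T := Cmod_sub_ge (RtoC t) (- c)). rewrite Cmod_R, Cmod_opp in T.
    replace (RtoC t - - c)%C with (RtoC t + c)%C in T by ring. lra. }
  replace (t * t) with (Rabs t * Rabs t) by (rewrite <- Rabs_mult; apply Rabs_pos_eq; nra).
  assert (Pt := Rabs_pos t). set (m := Cmod (RtoC t + c)) in *.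
  assert (Pm : 0 <= m) by apply Cmod_ge_0.
  assert (A : Rabs t * Rabs t <= (m + k) * (m + k)) by (apply Rmult_le_compat; lra).
  assert (B : 1 + (m + k) * (m + k) <= ((1 + k) * (1 + m)) * ((1 + k) * (1 + m))).
  { assert (0 <= m * k) by (apply Rmult_le_pos; lra). nra. }
  replace ((1 + k) * (1 + k) * (1 + m) ^ 2) with (((1 + k) * (1 + m)) * ((1 + k) * (1 + m))) by ring. lra.
Qed.

Lemma line_int_shift (h : C -> C) (c c' : C) (lo hi y1 y2 M : R) :
  lo < y1 -> y2 < hi -> y1 <= Im c <= y2 -> y1 <= Im c' <= y2 ->
  (forall x, lo < Im x < hi -> hol h x) ->
  (forall x, y1 <= Im x <= y2 -> Cmod (h x) * (1 + Cmod x) ^ 2 <= M) ->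
  line_int (fun t : R => h (RtoC t + c)%C) = line_int (fun t : R => h (RtoC t + c')%C).
Proof.
  intros Hlo Hhi Hc Hc' Hh Hb.
  assert (HIm : forall s t : R, Im (c + RtoC s * (c' - c) + RtoC t * 1) = (1 - s) * Im c + s * Im c').
  { intros s t. destruct c as [a b], c' as [a' b']. unfold RtoC, Cplus, Cmult, Cminus, Copp, Im; cbn. ring. }
  replace (fun t : R => h (RtoC t + c')%C) with (fun t : R => h (RtoC t + (c + (c' - c)))%C)
    by (apply functional_extensionality; intros; f_equal; ring).
  (* Derivatives at [s = 0] and [s = 1] need room on both sides: for [s] beyond the interval by less
     than [gap / w], the height stays in the open strip. *)
  set (gap := Rmin (y1 - lo) (hi - y2)).
  assert (Pg : 0 < gap) by (apply Rmin_glb_lt; lra).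
  assert (G1 : gap <= y1 - lo) by apply Rmin_l. assert (G2 : gap <= hi - y2) by apply Rmin_r.
  set (w := Rabs (Im c' - Im c) + 1).
  assert (Pw : 1 <= w) by (assert (P := Rabs_pos (Im c' - Im c)); unfold w; lra).
  apply (line_int_shift_aux h c (c' - c) (gap / w)
     ((1 + (Cmod c + Cmod c')) * (1 + (Cmod c + Cmod c')) * M)).
  - apply Rdiv_lt_0_compat; lra.
  - intros s t Hs. apply Hh. rewrite HIm.
    set (dl := Im c' - Im c) in *. replace (Im c') with (Im c + dl) in * by (unfold dl; ring).
    assert (Q : gap / w * Rabs dl < gap).
    { apply Rlt_le_trans with (gap / w * w).
      - apply Rmult_lt_compat_l; [apply Rdiv_lt_0_compat; lra | unfold w; lra].
      - right. field. lra. }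
    assert (Hd := Rabs_pos dl).
    destruct (Rle_lt_dec 0 dl) as [Hp|Hn].
    + rewrite Rabs_pos_eq in Q by lra.
      assert (A1 : - (gap / w) * dl <= s * dl) by (apply Rmult_le_compat_r; lra).
      assert (A2 : s * dl <= (1 + gap / w) * dl) by (apply Rmult_le_compat_r; lra). nra.
    + rewrite Rabs_left in Q by lra.
      assert (A1 : (gap / w) * dl <= - s * dl) by nra.
      assert (A2 : - s * dl <= - (1 + gap / w) * dl) by nra. nra.
  - intros s t Hs.
    assert (Hin : y1 <= Im (c + RtoC s * (c' - c) + RtoC t * 1) <= y2) by (rewrite HIm; nra).
    assert (B := Hb _ Hin).
    replace (c + RtoC s * (c' - c) + RtoC t * 1)%C with (RtoC t + (c + RtoC s * (c' - c)))%C in * by ring.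
    set (e := (c + RtoC s * (c' - c))%C) in *.
    assert (He : Cmod e <= Cmod c + Cmod c').
    { replace e with (RtoC (1 - s) * c + RtoC s * c')%C by (unfold e; rewrite RtoC_minus; ring).
      eapply Rle_trans; [apply Cmod_triangle|]. rewrite !Cmod_mult, !Cmod_R, !Rabs_pos_eq by lra.
      assert (P1 := Cmod_ge_0 c). assert (P2 := Cmod_ge_0 c'). nra. }
    assert (W := weight_le t e _ He).
    eapply Rle_trans; [apply Rmult_le_compat_l; [apply Cmod_ge_0 | exact W]|].
    set (k := (1 + (Cmod c + Cmod c')) * (1 + (Cmod c + Cmod c'))) in *.
    replace (Cmod (h (RtoC t + e)%C) * (k * (1 + Cmod (RtoC t + e)) ^ 2))
      with (k * (Cmod (h (RtoC t + e)%C) * (1 + Cmod (RtoC t + e)) ^ 2)) by ring.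
    apply Rmult_le_compat_l; [unfold k; apply Rle_0_sqr | exact B].
Qed.

(** The comparison of difference quotients is linear, so it can be integrated: for each [t] its
    constant is proportional to [M / (1 + t^2)], which has a finite integral. *)
Lemma hol_line_int (g : C -> R -> C) (z0 : C) (R0 M : R) : 0 < R0 ->
  (forall z t, Cmod (z - z0) < R0 -> hol (fun z => g z t) z) ->
  (forall z, Cmod (z - z0) < R0 -> decays (g z) M) ->
  hol (fun z => line_int (g z)) z0.
Proof.
  intros HR Hh Hd.
  assert (HM : 0 <= M).
  { destruct (Hd z0) as [_ B]; [rewrite Cmod_zero_sub; lra|].
    eapply Rle_trans; [|apply (B 0)]. apply Rmult_le_pos; [apply Cmod_ge_0 | lra]. }
  assert (PR : 0 < R0 * R0) by (apply Rmult_lt_0_compat; lra).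
  set (K := 108 * M / (R0 * R0)).
  assert (PK : 0 <= K) by (apply Rmult_le_pos; [lra | left; apply Rinv_0_lt_compat; lra]).
  apply hol_of_diff_quot with (R0 / 8) (8 * K); [lra | lra|].
  intros z h k Hz Hzh Hzk.
  assert (D0 := Hd z ltac:(lra)). assert (D1 := Hd (z + h)%C ltac:(lra)). assert (D2 := Hd (z + k)%C ltac:(lra)).
  assert (E1 := decays_plus _ _ _ _ (decays_scal k _ _ D1) (decays_scal (- k) _ _ D0)).
  assert (E2 := decays_plus _ _ _ _ (decays_scal (- h) _ _ D2) (decays_scal h _ _ D0)).
  assert (E3 := decays_plus _ _ _ _ E1 E2).
  replace (k * (line_int (g (z + h)%C) - line_int (g z)) - h * (line_int (g (z + k)%C) - line_int (g z)))%C
    with (line_int (fun t => (k * g (z + h)%C t + - k * g z t) + (- h * g (z + k)%C t + h * g z t))%C).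
  2:{ rewrite (line_int_plus _ _ _ _ E1 E2).
      rewrite (line_int_plus _ _ _ _ (decays_scal k _ _ D1) (decays_scal (- k) _ _ D0)).
      rewrite (line_int_plus _ _ _ _ (decays_scal (- h) _ _ D2) (decays_scal h _ _ D0)).
      rewrite (line_int_scal k _ _ D1), (line_int_scal (- k) _ _ D0),
        (line_int_scal (- h) _ _ D2), (line_int_scal h _ _ D0). ring. }
  rewrite Rmult_assoc. apply line_int_le. split; [exact (proj1 E3)|].
  intros t.
  assert (Pt : 0 < 1 + t * t) by nra.
  assert (Q := hol_diff_quot (fun z => g z t) z0 R0 (M / (1 + t * t)) HR).
  replace (k * g (z + h)%C t + - k * g z t + (- h * g (z + k)%C t + h * g z t))%C with
    (k * (g (z + h)%C t - g z t) - h * (g (z + k)%C t - g z t))%C by ring.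
  apply Rmult_le_reg_r with (/ (1 + t * t)); [apply Rinv_0_lt_compat, Pt|].
  rewrite Rmult_assoc, Rinv_r, Rmult_1_r by lra.
  eapply Rle_trans; [apply Q; try assumption|].
  - intros w Hw. split; [apply Hh, Hw|].
    apply Rmult_le_reg_r with (1 + t * t); [exact Pt|]. unfold Rdiv.
    rewrite Rmult_assoc, Rinv_l, Rmult_1_r by lra. apply (Hd w Hw).
  - right. unfold K. field. lra.
Qed.

(** * Functions on the tube *)

(** Holomorphy in three variables is recorded as closure under substitution of holomorphic curves,
    the form needed when all three arguments depend on the integration variable or on one [tau]. *)
Definition tube_hol (w : R) (f : fun3) : Prop :=
  (forall (l1 l2 l3 : C -> C) (z0 : C), hol l1 z0 -> hol l2 z0 -> hol l3 z0 ->
     tube w (l1 z0) (l2 z0) (l3 z0) -> hol (fun z => f (l1 z) (l2 z) (l3 z)) z0) /\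
  (forall (w' : R) (N : nat), w' < w -> exists M, forall a b c,
     Rabs (Im a) <= w' -> Rabs (Im b) <= w' -> Rabs (Im c) <= w' ->
     (1 + Cmod a + Cmod b + Cmod c) ^ N * Cmod (f a b c) <= M).

Lemma taylor_increment (g g1 g2 : C -> C) (P : C -> Prop) (K : R) (a a' : C) :
  (forall t, 0 <= t <= 1 -> P (a + RtoC t * (a' - a))%C) ->
  (forall z, P z -> is_derive g z (g1 z) /\ is_derive g1 z (g2 z) /\ Cmod (g2 z) <= K) ->
  Cmod (g a' - g a - g1 a * (a' - a)) <= K * (Cmod (a' - a) * Cmod (a' - a)).
Proof.
  intros HP H.
  assert (P0 := Cmod_ge_0 (a' - a)).
  assert (HK : 0 <= K).
  { eapply Rle_trans; [apply Cmod_ge_0 | apply (H _ (HP 0 ltac:(lra)))]. }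
  assert (E := C_mean_value (fun x => g x - g a - g1 a * (x - a))%C (fun x => g1 x - g1 a)%C a a'
     (K * Cmod (a' - a))).
  replace (g a' - g a - g1 a * (a' - a))%C
    with (g a' - g a - g1 a * (a' - a) - (g a - g a - g1 a * (a - a)))%C by ring.
  rewrite <- Rmult_assoc. apply E. intros t Ht. split.
  - apply is_derive_affine_sub, H, HP, Ht.
  - eapply Rle_trans; [apply (C_mean_value g1 g2 a _ K)|].
    + intros s Hs.
      replace (a + s * (a + t * (a' - a) - a))%C with (a + RtoC (s * t) * (a' - a))%C
        by (rewrite RtoC_mult; ring).
      apply (H (a + RtoC (s * t) * (a' - a))%C), HP. nra.
    + apply Rmult_le_compat_l; [exact HK|].
      replace (a + t * (a' - a) - a)%C with (RtoC t * (a' - a))%C by ring.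
      rewrite Cmod_mult, Cmod_R, Rabs_pos_eq by lra. nra.
Qed.

Lemma Im_segment (a a' : C) (t w : R) : 0 <= t <= 1 -> Rabs (Im a) <= w -> Rabs (Im a') <= w ->
  Rabs (Im (a + RtoC t * (a' - a))) <= w.
Proof.
  intros Ht Ha Ha'.
  replace (Im (a + RtoC t * (a' - a))) with ((1 - t) * Im a + t * Im a').
  2:{ destruct a, a'. unfold RtoC, Cplus, Cmult, Cminus, Copp, Im; cbn. ring. }
  apply Rabs_le_between in Ha, Ha'. apply Rabs_le. nra.
Qed.

(** Derivatives up to order two are bounded on a slightly smaller tube, which gives a joint Taylor
    estimate; composed with the three curves it becomes a quadratic remainder in [z]. *)
Lemma schwartz_tube_hol (w : R) (f : fun3) : schwartz_tube w f -> tube_hol w f.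
Proof.
  intros (d & Hf & Hd & Hb). split.
  - intros l1 l2 l3 z0 H1 H2 H3 (T1 & T2 & T3).
    set (w0 := Rmax (Rabs (Im (l1 z0))) (Rmax (Rabs (Im (l2 z0))) (Rabs (Im (l3 z0))))).
    assert (W1 : Rabs (Im (l1 z0)) <= w0) by apply Rmax_l.
    assert (W2 : Rabs (Im (l2 z0)) <= w0) by (eapply Rle_trans; [apply Rmax_l | apply Rmax_r]).
    assert (W3 : Rabs (Im (l3 z0)) <= w0) by (eapply Rle_trans; [apply Rmax_r | apply Rmax_r]).
    assert (W0 : w0 < w) by (unfold w0; repeat apply Rmax_lub_lt; assumption).
    set (w1 := (w0 + w) / 2). assert (Hw1 : w0 < w1 < w) by (unfold w1; lra).
    assert (HB : exists K, 0 <= K /\ forall i j k, (i + j + k <= 2)%nat -> forall a b c,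
       Rabs (Im a) <= w1 -> Rabs (Im b) <= w1 -> Rabs (Im c) <= w1 -> Cmod (d i j k a b c) <= K).
    { assert (B : forall i j k, exists K, 0 <= K /\ forall a b c,
         Rabs (Im a) <= w1 -> Rabs (Im b) <= w1 -> Rabs (Im c) <= w1 -> Cmod (d i j k a b c) <= K).
      { intros i j k. destruct (Hb w1 i j k 0%nat ltac:(lra)) as [M HM].
        exists (Rabs M). split; [apply Rabs_pos|]. intros a b c A1 A2 A3.
        specialize (HM a b c A1 A2 A3). simpl in HM. assert (L := Rle_abs M). lra. }
      destruct (B 0 0 0)%nat as (K1 & P1 & B1). destruct (B 1 0 0)%nat as (K2 & P2 & B2).
      destruct (B 0 1 0)%nat as (K3 & P3 & B3). destruct (B 0 0 1)%nat as (K4 & P4 & B4).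
      destruct (B 2 0 0)%nat as (K5 & P5 & B5). destruct (B 0 2 0)%nat as (K6 & P6 & B6).
      destruct (B 0 0 2)%nat as (K7 & P7 & B7). destruct (B 1 1 0)%nat as (K8 & P8 & B8).
      destruct (B 1 0 1)%nat as (K9 & P9 & B9). destruct (B 0 1 1)%nat as (K10 & P10 & B10).
      exists (K1 + K2 + K3 + K4 + K5 + K6 + K7 + K8 + K9 + K10). split; [lra|].
      intros i j k Hijk a b c A1 A2 A3.
      specialize (B1 a b c A1 A2 A3). specialize (B2 a b c A1 A2 A3). specialize (B3 a b c A1 A2 A3).
      specialize (B4 a b c A1 A2 A3). specialize (B5 a b c A1 A2 A3). specialize (B6 a b c A1 A2 A3).
      specialize (B7 a b c A1 A2 A3). specialize (B8 a b c A1 A2 A3). specialize (B9 a b c A1 A2 A3).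
      specialize (B10 a b c A1 A2 A3).
      destruct i as [|[|[|i]]]; [| | |exfalso; lia];
        (destruct j as [|[|[|j]]]; [| | |exfalso; lia]);
        (destruct k as [|[|[|k]]]; [| | |exfalso; lia]); try (exfalso; lia); lra. }
    destruct HB as (K & HK & HB).
    assert (Tw : forall a b c, Rabs (Im a) <= w1 -> Rabs (Im b) <= w1 -> Rabs (Im c) <= w1 -> tube w a b c)
      by (intros; repeat split; lra).
    (* The variables are changed one at a time. The pure second derivatives control the three
       increments, and the mixed ones move the first derivatives back to the common base point
       [(a, b, c)]. *)
    assert (HT : forall a b c a' b' c',
       Rabs (Im a) <= w1 -> Rabs (Im b) <= w1 -> Rabs (Im c) <= w1 ->
       Rabs (Im a') <= w1 -> Rabs (Im b') <= w1 -> Rabs (Im c') <= w1 ->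
       Cmod (f a' b' c' - f a b c - (d 1%nat 0%nat 0%nat a b c * (a' - a)
          + d 0%nat 1%nat 0%nat a b c * (b' - b) + d 0%nat 0%nat 1%nat a b c * (c' - c)))
       <= K * ((Cmod (a' - a) + Cmod (b' - b) + Cmod (c' - c)) * (Cmod (a' - a) + Cmod (b' - b) + Cmod (c' - c)))).
    { intros a b c a' b' c' A B C0 A' B' C'.
      rewrite <- (Hf a' b' c'), <- (Hf a b c) by (apply Tw; assumption).
      assert (E1 := taylor_increment (fun z => d 0 0 0 z b' c')%nat (fun z => d 1 0 0 z b' c')%nat
         (fun z => d 2 0 0 z b' c')%nat (fun z => Rabs (Im z) <= w1) K a a').
      assert (E2 := taylor_increment (fun z => d 0 0 0 a z c')%nat (fun z => d 0 1 0 a z c')%nat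
         (fun z => d 0 2 0 a z c')%nat (fun z => Rabs (Im z) <= w1) K b b').
      assert (E3 := taylor_increment (fun z => d 0 0 0 a b z)%nat (fun z => d 0 0 1 a b z)%nat
         (fun z => d 0 0 2 a b z)%nat (fun z => Rabs (Im z) <= w1) K c c').
      cbv beta in E1, E2, E3.
      specialize (E1 (fun t Ht => Im_segment a a' t w1 Ht A A')).
      specialize (E2 (fun t Ht => Im_segment b b' t w1 Ht B B')).
      specialize (E3 (fun t Ht => Im_segment c c' t w1 Ht C0 C')).
      lapply E1; clear E1; [intros E1|].
      2:{ intros z Hz. split; [|split].
          - apply (Hd 0%nat 0%nat 0%nat z b' c'). apply Tw; assumption.
          - apply (Hd 1%nat 0%nat 0%nat z b' c'). apply Tw; assumption.
          - apply HB; auto. }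
      lapply E2; clear E2; [intros E2|].
      2:{ intros z Hz. split; [|split].
          - apply (Hd 0%nat 0%nat 0%nat a z c'). apply Tw; assumption.
          - apply (Hd 0%nat 1%nat 0%nat a z c'). apply Tw; assumption.
          - apply HB; auto. }
      lapply E3; clear E3; [intros E3|].
      2:{ intros z Hz. split; [|split].
          - apply (Hd 0%nat 0%nat 0%nat a b z). apply Tw; assumption.
          - apply (Hd 0%nat 0%nat 1%nat a b z). apply Tw; assumption.
          - apply HB; auto. }
      assert (L1 : Cmod (d 1%nat 0%nat 0%nat a b' c' - d 1%nat 0%nat 0%nat a b c') <= K * Cmod (b' - b)).
      { apply (C_mean_value (fun z => d 1 0 0 a z c')%nat (fun z => d 1 1 0 a z c')%nat b b' K).
        intros t Ht. assert (S := Im_segment b b' t w1 Ht B B'). split.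
        - apply (Hd 1%nat 0%nat 0%nat a _ c'). apply Tw; assumption.
        - apply HB; auto. }
      assert (L2 : Cmod (d 1%nat 0%nat 0%nat a b c' - d 1%nat 0%nat 0%nat a b c) <= K * Cmod (c' - c)).
      { apply (C_mean_value (fun z => d 1 0 0 a b z)%nat (fun z => d 1 0 1 a b z)%nat c c' K).
        intros t Ht. assert (S := Im_segment c c' t w1 Ht C0 C'). split.
        - apply (Hd 1%nat 0%nat 0%nat a b _). apply Tw; assumption.
        - apply HB; auto. }
      assert (L3 : Cmod (d 0%nat 1%nat 0%nat a b c' - d 0%nat 1%nat 0%nat a b c) <= K * Cmod (c' - c)).
      { apply (C_mean_value (fun z => d 0 1 0 a b z)%nat (fun z => d 0 1 1 a b z)%nat c c' K).
        intros t Ht. assert (S := Im_segment c c' t w1 Ht C0 C'). split.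
        - apply (Hd 0%nat 1%nat 0%nat a b _). apply Tw; assumption.
        - apply HB; auto. }
      set (x := Cmod (a' - a)) in *. set (y := Cmod (b' - b)) in *. set (s := Cmod (c' - c)) in *.
      assert (Px : 0 <= x) by apply Cmod_ge_0. assert (Py : 0 <= y) by apply Cmod_ge_0.
      assert (Ps : 0 <= s) by apply Cmod_ge_0.
      replace (d 0%nat 0%nat 0%nat a' b' c' - d 0%nat 0%nat 0%nat a b c - (d 1%nat 0%nat 0%nat a b c * (a' - a)
          + d 0%nat 1%nat 0%nat a b c * (b' - b) + d 0%nat 0%nat 1%nat a b c * (c' - c)))%C
        with ((d 0%nat 0%nat 0%nat a' b' c' - d 0%nat 0%nat 0%nat a b' c' - d 1%nat 0%nat 0%nat a b' c' * (a' - a))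
          + ((d 0%nat 0%nat 0%nat a b' c' - d 0%nat 0%nat 0%nat a b c' - d 0%nat 1%nat 0%nat a b c' * (b' - b))
          + ((d 0%nat 0%nat 0%nat a b c' - d 0%nat 0%nat 0%nat a b c - d 0%nat 0%nat 1%nat a b c * (c' - c))
          + ((d 1%nat 0%nat 0%nat a b' c' - d 1%nat 0%nat 0%nat a b c') * (a' - a)
          + ((d 1%nat 0%nat 0%nat a b c' - d 1%nat 0%nat 0%nat a b c) * (a' - a)
          + (d 0%nat 1%nat 0%nat a b c' - d 0%nat 1%nat 0%nat a b c) * (b' - b))))))%C by ring.
      eapply Rle_trans.
      { apply Cmod_plus_le; [exact E1|]. apply Cmod_plus_le; [exact E2|]. apply Cmod_plus_le; [exact E3|].
        apply Cmod_plus_le; [apply (Cmod_mult_le _ _ (K * y) x); [exact L1 | apply Rle_refl]|].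
        apply Cmod_plus_le; [apply (Cmod_mult_le _ _ (K * s) x); [exact L2 | apply Rle_refl]|].
        apply (Cmod_mult_le _ _ (K * s) y); [exact L3 | apply Rle_refl]. }
      assert (0 <= K * (x * y)) by (repeat apply Rmult_le_pos; lra).
      assert (0 <= K * (x * s)) by (repeat apply Rmult_le_pos; lra).
      assert (0 <= K * (y * s)) by (repeat apply Rmult_le_pos; lra).
      lra. }
    destruct (hol_lip _ _ H1) as (r1 & L1 & Hr1 & HL1 & Lip1).
    destruct (hol_lip _ _ H2) as (r2 & L2 & Hr2 & HL2 & Lip2).
    destruct (hol_lip _ _ H3) as (r3 & L3 & Hr3 & HL3 & Lip3).
    destruct (hol_quad _ _ H1) as (q1 & K1 & Hq1 & HK1 & Q1).
    destruct (hol_quad _ _ H2) as (q2 & K2 & Hq2 & HK2 & Q2).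
    destruct (hol_quad _ _ H3) as (q3 & K3 & Hq3 & HK3 & Q3).
    set (L := L1 + L2 + L3).
    set (r := Rmin (Rmin (Rmin r1 r2) (Rmin r3 q1)) (Rmin (Rmin q2 q3) ((w1 - w0) / (L + 1)))).
    assert (Pg : 0 < (w1 - w0) / (L + 1)) by (apply Rdiv_lt_0_compat; unfold L; lra).
    assert (Pr : 0 < r) by (unfold r; repeat apply Rmin_glb_lt; lra).
    assert (R1 : r <= r1) by (unfold r; eapply Rle_trans; [apply Rmin_l|]; eapply Rle_trans; [apply Rmin_l|]; apply Rmin_l).
    assert (R2 : r <= r2) by (unfold r; eapply Rle_trans; [apply Rmin_l|]; eapply Rle_trans; [apply Rmin_l|]; apply Rmin_r).
    assert (R3 : r <= r3) by (unfold r; eapply Rle_trans; [apply Rmin_l|]; eapply Rle_trans; [apply Rmin_r|]; apply Rmin_l).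
    assert (R4 : r <= q1) by (unfold r; eapply Rle_trans; [apply Rmin_l|]; eapply Rle_trans; [apply Rmin_r|]; apply Rmin_r).
    assert (R5 : r <= q2) by (unfold r; eapply Rle_trans; [apply Rmin_r|]; eapply Rle_trans; [apply Rmin_l|]; apply Rmin_l).
    assert (R6 : r <= q3) by (unfold r; eapply Rle_trans; [apply Rmin_r|]; eapply Rle_trans; [apply Rmin_l|]; apply Rmin_r).
    assert (R7 : r <= (w1 - w0) / (L + 1)) by (unfold r; eapply Rle_trans; [apply Rmin_r | apply Rmin_r]).
    assert (Hz00 : Cmod (z0 - z0) < r) by (rewrite Cmod_zero_sub; lra).
    assert (Hnear : forall (l : C -> C) (L' : R), 0 <= L' <= L -> Rabs (Im (l z0)) <= w0 ->
       (forall z, Cmod (z - z0) < r -> Cmod (l z - l z0) <= L' * Cmod (z - z0)) ->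
       forall z, Cmod (z - z0) < r -> Rabs (Im (l z)) <= w1).
    { intros l L' HL' Hl Hlip z Hz.
      assert (E : Cmod (l z - l z0) <= w1 - w0).
      { eapply Rle_trans; [apply Hlip, Hz|].
        assert (P := Cmod_ge_0 (z - z0)).
        apply Rle_trans with ((L + 1) * ((w1 - w0) / (L + 1))).
        - apply Rmult_le_compat; lra.
        - right. field. lra. }
      replace (Im (l z)) with (Im (l z0) + Im (l z - l z0)) by (rewrite Im_minus; ring).
      eapply Rle_trans; [apply Rabs_triang|]. assert (F := im_le_Cmod (l z - l z0)). lra. }
    assert (N1 := Hnear l1 L1 ltac:(unfold L; lra) W1 (fun z Hz => Lip1 z0 z ltac:(lra) ltac:(lra))).
    assert (N2 := Hnear l2 L2 ltac:(unfold L; lra) W2 (fun z Hz => Lip2 z0 z ltac:(lra) ltac:(lra))).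
    assert (N3 := Hnear l3 L3 ltac:(unfold L; lra) W3 (fun z Hz => Lip3 z0 z ltac:(lra) ltac:(lra))).
    apply hol_intro with (fun z => (d 1%nat 0%nat 0%nat (l1 z) (l2 z) (l3 z) * C_derive l1 z
       + d 0%nat 1%nat 0%nat (l1 z) (l2 z) (l3 z) * C_derive l2 z
       + d 0%nat 0%nat 1%nat (l1 z) (l2 z) (l3 z) * C_derive l3 z)%C) r (K * (L * L) + K * (K1 + K2 + K3));
      [exact Pr|].
    intros z v Hz Hv.
    specialize (HT (l1 z) (l2 z) (l3 z) (l1 v) (l2 v) (l3 v) (N1 z Hz) (N2 z Hz) (N3 z Hz) (N1 v Hv) (N2 v Hv) (N3 v Hv)).
    specialize (Lip1 z v ltac:(lra) ltac:(lra)). specialize (Lip2 z v ltac:(lra) ltac:(lra)).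
    specialize (Lip3 z v ltac:(lra) ltac:(lra)).
    specialize (Q1 z v ltac:(lra) ltac:(lra)). specialize (Q2 z v ltac:(lra) ltac:(lra)).
    specialize (Q3 z v ltac:(lra) ltac:(lra)).
    assert (B1 := HB 1%nat 0%nat 0%nat ltac:(lia) _ _ _ (N1 z Hz) (N2 z Hz) (N3 z Hz)).
    assert (B2 := HB 0%nat 1%nat 0%nat ltac:(lia) _ _ _ (N1 z Hz) (N2 z Hz) (N3 z Hz)).
    assert (B3 := HB 0%nat 0%nat 1%nat ltac:(lia) _ _ _ (N1 z Hz) (N2 z Hz) (N3 z Hz)).
    set (D1 := d 1%nat 0%nat 0%nat (l1 z) (l2 z) (l3 z)) in *.
    set (D2 := d 0%nat 1%nat 0%nat (l1 z) (l2 z) (l3 z)) in *.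
    set (D3 := d 0%nat 0%nat 1%nat (l1 z) (l2 z) (l3 z)) in *.
    set (F1 := f (l1 v) (l2 v) (l3 v)) in *. set (F0 := f (l1 z) (l2 z) (l3 z)) in *.
    set (h := Cmod (v - z)) in *. assert (Ph : 0 <= h) by apply Cmod_ge_0.
    replace (F1 - F0 - (D1 * C_derive l1 z + D2 * C_derive l2 z + D3 * C_derive l3 z) * (v - z))%C with
      ((F1 - F0 - (D1 * (l1 v - l1 z) + D2 * (l2 v - l2 z) + D3 * (l3 v - l3 z)))
       + (D1 * (l1 v - l1 z - C_derive l1 z * (v - z)) + (D2 * (l2 v - l2 z - C_derive l2 z * (v - z))
       + D3 * (l3 v - l3 z - C_derive l3 z * (v - z)))))%C by ring.
    eapply Rle_trans.
    { apply Cmod_plus_le; [exact HT|].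
      apply Cmod_plus_le; [apply Cmod_mult_le; [exact B1 | exact Q1]|].
      apply Cmod_plus_le; [apply Cmod_mult_le; [exact B2 | exact Q2]|].
      apply Cmod_mult_le; [exact B3 | exact Q3]. }
    assert (S : (Cmod (l1 v - l1 z) + Cmod (l2 v - l2 z) + Cmod (l3 v - l3 z)) *
       (Cmod (l1 v - l1 z) + Cmod (l2 v - l2 z) + Cmod (l3 v - l3 z)) <= (L * h) * (L * h)).
    { assert (G1 := Cmod_ge_0 (l1 v - l1 z)). assert (G2 := Cmod_ge_0 (l2 v - l2 z)).
      assert (G3 := Cmod_ge_0 (l3 v - l3 z)).
      apply Rmult_le_compat; unfold L; lra. }
    apply (Rmult_le_compat_l K) in S; [|exact HK]. lra.
  - intros w' N Hw. destruct (Hb w' 0%nat 0%nat 0%nat N Hw) as [M HM].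
    exists M. intros a b c A B C0. rewrite <- Hf by (repeat split; lra). apply HM; assumption.
Qed.

(** * Mellin-Barnes integrals *)

Lemma Re_Ci_mult (x : C) : Re (Ci * x) = - Im x.
Proof. unfold Ci, Cmult, Re, Im; cbn. ring. Qed.
Lemma Im_Ci_mult (x : C) : Im (Ci * x) = Re x.
Proof. unfold Ci, Cmult, Re, Im; cbn. ring. Qed.
Lemma Re_opp (x : C) : Re (- x) = - Re x. Proof. reflexivity. Qed.
Lemma Im_opp (x : C) : Im (- x) = - Im x. Proof. reflexivity. Qed.
Lemma Re_RtoC (x : R) : Re (RtoC x) = x. Proof. reflexivity. Qed.
Lemma Im_RtoC (x : R) : Im (RtoC x) = 0. Proof. reflexivity. Qed.
Lemma Re_Ci : Re Ci = 0. Proof. reflexivity. Qed.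
Lemma Im_Ci : Im Ci = 1. Proof. reflexivity. Qed.

Ltac reim := repeat (rewrite ?Re_plus, ?Im_plus, ?Re_minus, ?Im_minus, ?Re_opp, ?Im_opp,
  ?Re_Ci_mult, ?Im_Ci_mult, ?Re_RtoC, ?Im_RtoC, ?Re_Ci, ?Im_Ci, ?Re_mult, ?Im_mult).

(** It depends on [Re x] alone, hence is unchanged by vertical shifts. Being itself the modulus of a
    value of 1/Gamma, it is compared with Gamma factors through [Gamma_ratio_bound]. *)
Definition decay_weight (x : C) : R := Cmod (rGamma (1 - Ci * RtoC (Re x))).

(* Rapid decrease relative to [decay_weight], which is of exponential growth
   and is compensated by one factor Gamma; this is the growth of 1/Gamma times
   a Schwartz function. *)
Definition test (lo hi : R) (Phi : C -> C) : Prop :=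
  (forall x, lo < Im x < hi -> hol Phi x) /\
  (forall c d N, lo < c -> d < hi -> exists M, 0 <= M /\ forall x, c <= Im x <= d ->
     Cmod (Phi x) * (1 + Cmod x) ^ N <= M * decay_weight x).

Lemma decay_weight_pos (x : C) : 0 < decay_weight x.
Proof. apply Cmod_gt_0, rGamma_neq_0, nonpole_pos. reim. lra. Qed.

Lemma decay_weight_shift (x c : C) : Re c = 0 -> decay_weight (x + c) = decay_weight x.
Proof. intros H. unfold decay_weight. rewrite Re_plus, H, Rplus_0_r. reflexivity. Qed.

Lemma test_weaken (lo hi lo' hi' : R) (Phi : C -> C) : lo <= lo' -> hi' <= hi ->
  test lo hi Phi -> test lo' hi' Phi.
Proof.
  intros H1 H2 [Hh Hb]. split.
  - intros x Hx. apply Hh. lra.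
  - intros c d N Hc Hd. apply Hb; lra.
Qed.

Lemma test_plus (lo hi : R) (Phi Psi : C -> C) :
  test lo hi Phi -> test lo hi Psi -> test lo hi (fun x => Phi x + Psi x)%C.
Proof.
  intros [H1 B1] [H2 B2]. split.
  - intros x Hx. apply hol_plus; auto.
  - intros c d N Hc Hd. destruct (B1 c d N Hc Hd) as (M1 & P1 & E1). destruct (B2 c d N Hc Hd) as (M2 & P2 & E2).
    exists (M1 + M2). split; [lra|]. intros x Hx. specialize (E1 x Hx). specialize (E2 x Hx).
    assert (P : 0 <= (1 + Cmod x) ^ N) by (apply pow_le; assert (Q := Cmod_ge_0 x); lra).
    assert (T := Rmult_le_compat_r _ _ _ P (Cmod_triangle (Phi x) (Psi x))). lra.
Qed.

Lemma test_affine (lo hi : R) (a b : C) (Phi : C -> C) :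
  test lo hi Phi -> test lo hi (fun x => (a + b * x) * Phi x)%C.
Proof.
  intros [H1 B1]. split.
  - intros x Hx. apply hol_mult; [|auto].
    apply hol_plus; [apply hol_const | apply hol_scal, hol_id].
  - intros c d N Hc Hd. destruct (B1 c d (S N) Hc Hd) as (M & P & E).
    assert (Pa := Cmod_ge_0 a). assert (Pb := Cmod_ge_0 b).
    exists ((Cmod a + Cmod b) * M). split; [apply Rmult_le_pos; lra|].
    intros x Hx. specialize (E x Hx). simpl in E.
    assert (Px := Cmod_ge_0 x). assert (PP := Cmod_ge_0 (Phi x)).
    assert (P2 : 0 <= (1 + Cmod x) ^ N) by (apply pow_le; lra).
    assert (Q : Cmod (a + b * x) <= (Cmod a + Cmod b) * (1 + Cmod x)).
    { eapply Rle_trans; [apply Cmod_triangle|]. rewrite Cmod_mult. nra. }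
    rewrite Cmod_mult.
    apply Rle_trans with ((Cmod a + Cmod b) * (Cmod (Phi x) * ((1 + Cmod x) * (1 + Cmod x) ^ N))).
    + replace ((Cmod a + Cmod b) * (Cmod (Phi x) * ((1 + Cmod x) * (1 + Cmod x) ^ N)))
        with (((Cmod a + Cmod b) * (1 + Cmod x)) * (Cmod (Phi x) * (1 + Cmod x) ^ N)) by ring.
      rewrite Rmult_assoc. apply Rmult_le_compat_r; [apply Rmult_le_pos; lra | exact Q].
    + rewrite Rmult_assoc. apply Rmult_le_compat_l; [lra | exact E].
Qed.

Lemma test_ext (lo hi : R) (Phi Psi : C -> C) :
  (forall x, Phi x = Psi x) -> test lo hi Phi -> test lo hi Psi.
Proof. intros E. replace Psi with Phi; [auto | apply functional_extensionality, E]. Qed.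

Lemma test_scal (lo hi : R) (a : C) (Phi : C -> C) :
  test lo hi Phi -> test lo hi (fun x => a * Phi x)%C.
Proof.
  intros H. apply test_ext with (fun x => (a + 0 * x) * Phi x)%C; [intros; ring|].
  apply test_affine, H.
Qed.

Lemma test_shift (lo hi : R) (Phi : C -> C) :
  test lo hi Phi -> test (lo - 1) (hi - 1) (fun x => Phi (x + Ci)%C).
Proof.
  intros [H1 B1]. split.
  - intros x Hx. apply (hol_comp Phi (fun x => x + Ci)%C).
    + apply hol_plus; [apply hol_id | apply hol_const].
    + apply H1. reim. lra.
  - intros c d N Hc Hd. destruct (B1 (c + 1) (d + 1) N ltac:(lra) ltac:(lra)) as (M & P & E).
    exists (2 ^ N * M). split; [apply Rmult_le_pos; [apply pow_le; lra | lra]|].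
    intros x Hx. specialize (E (x + Ci)%C ltac:(reim; lra)).
    rewrite decay_weight_shift in E by reflexivity. rewrite Rmult_assoc.
    eapply Rle_trans; [|apply Rmult_le_compat_l; [apply pow_le; lra | exact E]].
    rewrite <- Rmult_assoc, (Rmult_comm (2 ^ N)), Rmult_assoc, <- Rpow_mult_distr.
    apply Rmult_le_compat_l; [apply Cmod_ge_0|]. assert (Q := Cmod_ge_0 x). apply pow_incr. split; [lra|].
    assert (T := Cmod_sub_ge x (- Ci)). rewrite Cmod_opp, Cmod_Ci in T.
    replace (x - - Ci)%C with (x + Ci)%C in T by ring. assert (Q2 := Cmod_ge_0 (x + Ci)). lra.
Qed.

(** [Gamma z * rGamma (e - Ci * x)] with [z = 1 - Ci * Re x] grows polynomially, because the
    imaginary parts of the two arguments differ by the constant [Im e]. *)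
Lemma rGamma_le_weight (e : C) (c d : R) : exists M m, 0 <= M /\ forall x, c <= Im x <= d ->
  Cmod (rGamma (e - Ci * x)) <= M * (1 + Cmod x) ^ m * decay_weight x.
Proof.
  destruct (Gamma_ratio_bound 1 1 (Re e + c) (Re e + d) (Rabs (Im e)) ltac:(lra)) as (M & m & PM & H).
  exists (M * 2 ^ m), m. split; [apply Rmult_le_pos; [lra | apply pow_le; lra]|].
  intros x Hx. set (z := (1 - Ci * RtoC (Re x))%C).
  assert (Hz : Re z = 1) by (unfold z; reim; lra).
  assert (B := H z (e - Ci * x)%C ltac:(lra) ltac:(reim; lra)).
  lapply B; clear B; [intros B|].
  2:{ unfold z. reim. right. f_equal. ring. }
  unfold decay_weight. fold z.
  assert (Nz : nonpole z) by (apply nonpole_pos; lra).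
  replace (rGamma (e - Ci * x)) with ((Gamma z * rGamma (e - Ci * x)) * rGamma z)%C.
  2:{ unfold rGamma at 2. field. apply Gamma_neq_0, Nz. }
  apply Cmod_mult_le; [|apply Rle_refl].
  eapply Rle_trans; [exact B|]. rewrite Rmult_assoc. apply Rmult_le_compat_l; [lra|].
  rewrite <- Rpow_mult_distr. apply pow_incr. assert (Q := Cmod_ge_0 z). split; [lra|].
  assert (T : Cmod z <= 1 + Cmod x).
  { unfold z, Cminus. eapply Rle_trans; [apply Cmod_triangle|].
    rewrite Cmod_opp, Cmod_mult, Cmod_Ci, Cmod_1, Cmod_R.
    assert (F := re_le_Cmod x). lra. }
  assert (Q2 := Cmod_ge_0 x). lra.
Qed.

(** The six inequalities place [o1 - x], [o2 + x] and [o3 + x] in the tube for every [x] of the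
    strip. The polynomial loss from 1/Gamma is paid for by the rapid decrease of [f]. *)
Lemma test_tube (w : R) (f : fun3) (e o1 o2 o3 : C) (lo hi : R) : tube_hol w f ->
  Im o1 - w <= lo -> hi <= Im o1 + w -> - w - Im o2 <= lo -> hi <= w - Im o2 ->
  - w - Im o3 <= lo -> hi <= w - Im o3 ->
  test lo hi (fun x => rGamma (e - Ci * x) * f (o1 - x) (o2 + x) (o3 + x))%C.
Proof.
  intros [Hf Hb] A1 A2 A3 A4 A5 A6. split.
  - intros x Hx. apply hol_mult.
    + apply (hol_comp rGamma (fun x => e - Ci * x)%C); [|apply rGamma_hol].
      apply hol_minus; [apply hol_const | apply hol_scal, hol_id].
    + apply (Hf (fun x => o1 - x)%C (fun x => o2 + x)%C (fun x => o3 + x)%C).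
      * apply hol_minus; [apply hol_const | apply hol_id].
      * apply hol_plus; [apply hol_const | apply hol_id].
      * apply hol_plus; [apply hol_const | apply hol_id].
      * repeat split; reim; apply Rabs_def1; lra.
  - intros c d N Hc Hd.
    destruct (rGamma_le_weight e c d) as (M1 & m & PM1 & H1).
    set (gap := Rmin (c - lo) (hi - d)).
    assert (Pg : 0 < gap) by (apply Rmin_glb_lt; lra).
    assert (G1 : gap <= c - lo) by apply Rmin_l. assert (G2 : gap <= hi - d) by apply Rmin_r.
    destruct (Hb (w - gap) (m + N)%nat ltac:(lra)) as (M2 & H2).
    assert (Po := Cmod_ge_0 o1).
    set (k := (1 + Cmod o1) ^ (m + N)).
    assert (Pk : 0 <= k) by (apply pow_le; lra).
    exists (M1 * k * Rabs M2). split; [apply Rmult_le_pos; [apply Rmult_le_pos; lra | apply Rabs_pos]|].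
    intros x Hx. specialize (H1 x Hx).
    assert (F := H2 (o1 - x)%C (o2 + x)%C (o3 + x)%C
      ltac:(reim; apply Rabs_le; lra) ltac:(reim; apply Rabs_le; lra) ltac:(reim; apply Rabs_le; lra)).
    assert (Px := Cmod_ge_0 x). assert (Pw := decay_weight_pos x).
    set (fx := Cmod (f (o1 - x)%C (o2 + x)%C (o3 + x)%C)) in *.
    assert (Pfx : 0 <= fx) by apply Cmod_ge_0.
    assert (F2 : (1 + Cmod x) ^ (m + N) * fx <= k * Rabs M2).
    { apply Rle_trans with (k * ((1 + Cmod (o1 - x) + Cmod (o2 + x) + Cmod (o3 + x)) ^ (m + N) * fx)).
      - rewrite <- Rmult_assoc. apply Rmult_le_compat_r; [exact Pfx|].
        unfold k. rewrite <- Rpow_mult_distr. apply pow_incr. split; [lra|].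
        assert (T := Cmod_sub_ge x o1). rewrite Cmod_sub_sym in T.
        assert (Q1 := Cmod_ge_0 (o1 - x)). assert (Q2 := Cmod_ge_0 (o2 + x)). assert (Q3 := Cmod_ge_0 (o3 + x)).
        nra.
      - apply Rmult_le_compat_l; [exact Pk|]. eapply Rle_trans; [exact F | apply Rle_abs]. }
    rewrite Cmod_mult. fold fx.
    apply Rle_trans with (M1 * (1 + Cmod x) ^ m * decay_weight x * fx * (1 + Cmod x) ^ N).
    { apply Rmult_le_compat_r; [apply pow_le; lra|]. apply Rmult_le_compat_r; [exact Pfx | exact H1]. }
    replace (M1 * (1 + Cmod x) ^ m * decay_weight x * fx * (1 + Cmod x) ^ N)
      with (M1 * decay_weight x * ((1 + Cmod x) ^ (m + N) * fx)) by (rewrite pow_add; ring).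
    replace (M1 * k * Rabs M2 * decay_weight x) with (M1 * decay_weight x * (k * Rabs M2)) by ring.
    apply Rmult_le_compat_l; [apply Rmult_le_pos; lra | exact F2].
Qed.

Definition mb_integrand (a1 a2 b : C) (Phi : C -> C) (x : C) : C :=
  (Gamma (a1 - Ci * x) * Gamma (a2 - Ci * x) * Gamma (b + Ci * x) * Phi x)%C.

Definition mb_int (c a1 a2 b : C) (Phi : C -> C) : C :=
  line_int (fun t : R => mb_integrand a1 a2 b Phi (RtoC t + c)%C).

(* The contour [Im x = y] separates the poles of the two kinds of Gammas. *)
Definition separates (y : R) (a1 a2 b : C) : Prop :=
  0 < Re a1 + y /\ 0 < Re a2 + y /\ 0 < Re b - y.

Lemma mb_hol (a1 a2 b : C) (Phi : C -> C) (x : C) :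
  separates (Im x) a1 a2 b -> hol Phi x -> hol (mb_integrand a1 a2 b Phi) x.
Proof.
  intros (A1 & A2 & A3) H. unfold mb_integrand.
  apply hol_mult; [|exact H]. apply hol_mult; [apply hol_mult|].
  - apply (hol_comp Gamma (fun x => a1 - Ci * x)%C).
    + apply hol_minus; [apply hol_const | apply hol_scal, hol_id].
    + apply Gamma_hol, nonpole_pos. reim. lra.
  - apply (hol_comp Gamma (fun x => a2 - Ci * x)%C).
    + apply hol_minus; [apply hol_const | apply hol_scal, hol_id].
    + apply Gamma_hol, nonpole_pos. reim. lra.
  - apply (hol_comp Gamma (fun x => b + Ci * x)%C).
    + apply hol_plus; [apply hol_const | apply hol_scal, hol_id].
    + apply Gamma_hol, nonpole_pos. reim. lra.
Qed.

(** One Gamma is spent on [decay_weight], with a polynomial loss; the other two are bounded in the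
    strip. The rapid decrease in [test] covers the loss and the weight [(1 + |x|)^2]. *)
Lemma mb_bound (lo hi y1 y2 : R) (a1 a2 b : C) (Phi : C -> C) :
  test lo hi Phi -> lo < y1 -> y2 < hi -> separates y1 a1 a2 b -> separates y2 a1 a2 b ->
  exists M, 0 <= M /\ forall x, y1 <= Im x <= y2 ->
    Cmod (mb_integrand a1 a2 b Phi x) * (1 + Cmod x) ^ 2 <= M.
Proof.
  intros [_ HT] Hlo Hhi (A1 & A2 & A3) (B1 & B2 & B3).
  destruct (Gamma_ratio_bound (Re a1 + y1) (Re a1 + y2) 1 1 (Rabs (Im a1)) A1) as (M1 & m & PM1 & H1).
  destruct (Gamma_bounded (Re a2 + y1) (Re a2 + y2) A2) as (M2 & PM2 & H2).
  destruct (Gamma_bounded (Re b - y2) (Re b - y1) B3) as (M3 & PM3 & H3).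
  destruct (HT y1 y2 (m + 2)%nat Hlo Hhi) as (M4 & PM4 & H4).
  assert (Pa := Cmod_ge_0 a1).
  exists (M1 * (1 + Cmod a1) ^ m * M2 * M3 * M4).
  assert (Pk : 0 <= (1 + Cmod a1) ^ m) by (apply pow_le; lra).
  split; [repeat apply Rmult_le_pos; lra|].
  intros x Hx. assert (Px := Cmod_ge_0 x).
  specialize (H2 (a2 - Ci * x)%C ltac:(reim; lra)). specialize (H3 (b + Ci * x)%C ltac:(reim; lra)).
  specialize (H4 x Hx).
  set (z := (1 - Ci * RtoC (Re x))%C).
  assert (Hz : Re z = 1) by (unfold z; reim; lra).
  specialize (H1 (a1 - Ci * x)%C z ltac:(reim; lra) ltac:(lra)).
  lapply H1; clear H1; [intros H1|].
  2:{ unfold z. reim. right. rewrite <- Rabs_Ropp. f_equal. ring. }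
  rewrite Cmod_mult in H1. change (Cmod (rGamma z)) with (decay_weight x) in H1.
  assert (L : 1 + Cmod (a1 - Ci * x) <= (1 + Cmod a1) * (1 + Cmod x)).
  { assert (T := Cmod_triangle a1 (- (Ci * x))). rewrite Cmod_opp, Cmod_mult, Cmod_Ci in T.
    change (a1 + - (Ci * x))%C with (a1 - Ci * x)%C in T. nra. }
  assert (L2 : (1 + Cmod (a1 - Ci * x)) ^ m <= (1 + Cmod a1) ^ m * (1 + Cmod x) ^ m).
  { rewrite <- Rpow_mult_distr. apply pow_incr. split; [|exact L].
    assert (Q := Cmod_ge_0 (a1 - Ci * x)). lra. }
  unfold mb_integrand. rewrite !Cmod_mult.
  set (g1 := Cmod (Gamma (a1 - Ci * x))) in *. set (g2 := Cmod (Gamma (a2 - Ci * x))) in *.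
  set (g3 := Cmod (Gamma (b + Ci * x))) in *. set (ph := Cmod (Phi x)) in *.
  assert (P1 : 0 <= g1) by apply Cmod_ge_0. assert (P2 : 0 <= g2) by apply Cmod_ge_0.
  assert (P3 : 0 <= g3) by apply Cmod_ge_0. assert (P4 : 0 <= ph) by apply Cmod_ge_0.
  assert (Pw := decay_weight_pos x). set (q := 1 + Cmod x) in *. assert (Pq : 1 <= q) by (unfold q; lra).
  assert (Pqm : 0 < q ^ m) by (apply pow_lt; lra).
  assert (H1' : g1 * decay_weight x <= M1 * (1 + Cmod a1) ^ m * q ^ m).
  { eapply Rle_trans; [exact H1|]. rewrite Rmult_assoc. apply Rmult_le_compat_l; [lra | exact L2]. }
  assert (E : g1 * (ph * q ^ 2) <= M1 * (1 + Cmod a1) ^ m * M4).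
  { apply Rmult_le_reg_r with (q ^ m * decay_weight x); [apply Rmult_lt_0_compat; lra|].
    replace (g1 * (ph * q ^ 2) * (q ^ m * decay_weight x)) with
      ((g1 * decay_weight x) * (ph * q ^ (m + 2))) by (rewrite pow_add; ring).
    replace (M1 * (1 + Cmod a1) ^ m * M4 * (q ^ m * decay_weight x)) with
      ((M1 * (1 + Cmod a1) ^ m * q ^ m) * (M4 * decay_weight x)) by ring.
    apply Rmult_le_compat; [apply Rmult_le_pos; lra | | exact H1' | exact H4].
    apply Rmult_le_pos; [lra | apply pow_le; lra]. }
  replace (g1 * g2 * g3 * ph * q ^ 2) with ((g1 * (ph * q ^ 2)) * (g2 * g3)) by ring.
  replace (M1 * (1 + Cmod a1) ^ m * M2 * M3 * M4) with ((M1 * (1 + Cmod a1) ^ m * M4) * (M2 * M3)) by ring.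
  apply Rmult_le_compat; [| apply Rmult_le_pos; lra | exact E | apply Rmult_le_compat; lra].
  apply Rmult_le_pos; [lra|]. apply Rmult_le_pos; [lra | apply pow_le; lra].
Qed.

Lemma Im_line (t : R) (c : C) : Im (RtoC t + c) = Im c.
Proof. reim. ring. Qed.

Lemma mb_decays (lo hi : R) (c a1 a2 b : C) (Phi : C -> C) :
  test lo hi Phi -> lo < Im c < hi -> separates (Im c) a1 a2 b ->
  exists M, decays (fun t : R => mb_integrand a1 a2 b Phi (RtoC t + c)%C) M.
Proof.
  intros HT Hc HS.
  destruct (mb_bound lo hi (Im c) (Im c) a1 a2 b Phi HT (proj1 Hc) (proj2 Hc) HS HS) as (M & PM & H).
  exists ((1 + Cmod c) * (1 + Cmod c) * M). apply decays_hol.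
  - intros t. apply mb_hol; rewrite ?Im_line; [exact HS|]. apply HT. rewrite Im_line. exact Hc.
  - intros t. assert (W := weight_le t c (Cmod c) (Rle_refl _)).
    specialize (H (RtoC t + c)%C ltac:(rewrite Im_line; lra)).
    eapply Rle_trans; [apply Rmult_le_compat_l; [apply Cmod_ge_0 | exact W]|].
    rewrite (Rmult_comm ((1 + Cmod c) * (1 + Cmod c))), <- Rmult_assoc, Rmult_comm.
    apply Rmult_le_compat_l; [apply Rle_0_sqr | exact H].
Qed.

Lemma mb_move (lo hi : R) (c c' a1 a2 b : C) (Phi : C -> C) :
  test lo hi Phi -> lo < Im c < hi -> lo < Im c' < hi ->
  separates (Im c) a1 a2 b -> separates (Im c') a1 a2 b ->
  mb_int c a1 a2 b Phi = mb_int c' a1 a2 b Phi.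
Proof.
  intros HT Hc Hc' HS HS'. unfold mb_int.
  set (y1 := Rmin (Im c) (Im c')). set (y2 := Rmax (Im c) (Im c')).
  assert (L1 : y1 <= Im c) by apply Rmin_l. assert (L2 : y1 <= Im c') by apply Rmin_r.
  assert (L3 : Im c <= y2) by apply Rmax_l. assert (L4 : Im c' <= y2) by apply Rmax_r.
  assert (D1 : y1 = Im c \/ y1 = Im c') by (unfold y1, Rmin; destruct Rle_dec; auto).
  assert (D2 : y2 = Im c \/ y2 = Im c') by (unfold y2, Rmax; destruct Rle_dec; auto).
  assert (S1 : separates y1 a1 a2 b) by (destruct D1 as [->| ->]; assumption).
  assert (S2 : separates y2 a1 a2 b) by (destruct D2 as [->| ->]; assumption).
  assert (B1 : lo < y1) by (destruct D1; lra). assert (B2 : y2 < hi) by (destruct D2; lra).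
  destruct (mb_bound lo hi y1 y2 a1 a2 b Phi HT B1 B2 S1 S2) as (M & PM & H).
  destruct S1 as (U1 & U2 & U3), S2 as (V1 & V2 & V3).
  (* The open strip between the nearest poles, cut down to the domain of [Phi]. *)
  set (l := Rmax lo (Rmax (- Re a1) (- Re a2))). set (h := Rmin hi (Re b)).
  assert (Q1 : lo <= l) by apply Rmax_l.
  assert (Q2 : - Re a1 <= l) by (eapply Rle_trans; [apply Rmax_l | apply Rmax_r]).
  assert (Q3 : - Re a2 <= l) by (eapply Rle_trans; [apply Rmax_r | apply Rmax_r]).
  assert (Q4 : h <= hi) by apply Rmin_l. assert (Q5 : h <= Re b) by apply Rmin_r.
  apply (line_int_shift _ c c' l h y1 y2 M); try lra.
  - unfold l. repeat apply Rmax_lub_lt; lra.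
  - unfold h. apply Rmin_glb_lt; lra.
  - intros x Hx. apply mb_hol; [repeat split; lra|]. apply HT. lra.
  - exact H.
Qed.

Lemma mb_plus (lo hi : R) (c a1 a2 b : C) (Phi Psi : C -> C) :
  test lo hi Phi -> test lo hi Psi -> lo < Im c < hi -> separates (Im c) a1 a2 b ->
  mb_int c a1 a2 b (fun x => Phi x + Psi x)%C = (mb_int c a1 a2 b Phi + mb_int c a1 a2 b Psi)%C.
Proof.
  intros H1 H2 Hc HS.
  destruct (mb_decays _ _ _ _ _ _ _ H1 Hc HS) as [M1 D1].
  destruct (mb_decays _ _ _ _ _ _ _ H2 Hc HS) as [M2 D2].
  unfold mb_int. rewrite <- (line_int_plus _ _ _ _ D1 D2). f_equal.
  apply functional_extensionality. intros t. unfold mb_integrand. ring.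
Qed.

Lemma mb_scal (lo hi : R) (c a1 a2 b k : C) (Phi : C -> C) :
  test lo hi Phi -> lo < Im c < hi -> separates (Im c) a1 a2 b ->
  mb_int c a1 a2 b (fun x => k * Phi x)%C = (k * mb_int c a1 a2 b Phi)%C.
Proof.
  intros H1 Hc HS.
  destruct (mb_decays _ _ _ _ _ _ _ H1 Hc HS) as [M1 D1].
  unfold mb_int. rewrite <- (line_int_scal k _ _ D1). f_equal.
  apply functional_extensionality. intros t. unfold mb_integrand. ring.
Qed.

Lemma mb_ext (c a1 a2 b a1' a2' b' : C) (Phi Psi : C -> C) :
  (forall x, Im x = Im c -> mb_integrand a1 a2 b Phi x = mb_integrand a1' a2' b' Psi x) ->
  mb_int c a1 a2 b Phi = mb_int c a1' a2' b' Psi.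
Proof.
  intros H. unfold mb_int. f_equal. apply functional_extensionality. intros t.
  apply H, Im_line.
Qed.

Lemma mb_swap (c a1 a2 b : C) (Phi : C -> C) : mb_int c a1 a2 b Phi = mb_int c a2 a1 b Phi.
Proof. apply mb_ext. intros x _. unfold mb_integrand. ring. Qed.

Lemma C_neq_0_Re (z : C) : Re z <> 0 -> z <> 0.
Proof. intros H E. apply H. rewrite E. reflexivity. Qed.

Lemma mb_raise1 (c a1 a2 b : C) (Phi : C -> C) : 0 < Re a1 + Im c ->
  mb_int c (a1 + 1) a2 b Phi = mb_int c a1 a2 b (fun x => (a1 - Ci * x) * Phi x)%C.
Proof.
  intros H. apply mb_ext. intros x Hx. unfold mb_integrand.
  replace (a1 + 1 - Ci * x)%C with ((a1 - Ci * x) + 1)%C by ring.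
  rewrite Gamma_rec; [ring|]. apply C_neq_0_Re. reim. lra.
Qed.

Lemma mb_raise2 (c a1 a2 b : C) (Phi : C -> C) : 0 < Re a2 + Im c ->
  mb_int c a1 (a2 + 1) b Phi = mb_int c a1 a2 b (fun x => (a2 - Ci * x) * Phi x)%C.
Proof. intros H. rewrite mb_swap, mb_raise1 by exact H. apply mb_swap. Qed.

Lemma mb_raise3 (c a1 a2 b : C) (Phi : C -> C) : 0 < Re b - Im c ->
  mb_int c a1 a2 (b + 1) Phi = mb_int c a1 a2 b (fun x => (b + Ci * x) * Phi x)%C.
Proof.
  intros H. apply mb_ext. intros x Hx. unfold mb_integrand.
  replace (b + 1 + Ci * x)%C with ((b + Ci * x) + 1)%C by ring.
  rewrite Gamma_rec; [ring|]. apply C_neq_0_Re. reim. lra.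
Qed.

(** The contour is raised by [Ci], which [b + 1] permits since its poles start at height
    [Re b + 1 > Im c + 1]. Substituting [x + Ci] for [x] then raises both [a] parameters and lowers
    [b + 1] to [b]. *)
Lemma mb_shift (lo hi : R) (c a1 a2 b : C) (Phi : C -> C) :
  test lo hi Phi -> lo < Im c -> Im c + 1 < hi -> separates (Im c) a1 a2 b ->
  mb_int c a1 a2 (b + 1) Phi = mb_int c (a1 + 1) (a2 + 1) b (fun x => Phi (x + Ci)%C).
Proof.
  intros HT H1 H2 (S1 & S2 & S3).
  assert (Hi : Im (c + Ci) = Im c + 1) by reflexivity.
  rewrite (mb_move lo hi c (c + Ci) a1 a2 (b + 1) Phi HT); rewrite ?Hi; try lra.
  - unfold mb_int. f_equal. apply functional_extensionality. intros t. unfold mb_integrand.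
    assert (E : (Ci * Ci)%C = (- (1))%C) by (unfold Ci, Cmult, Copp, RtoC; cbn; f_equal; ring).
    replace (a1 - Ci * (RtoC t + (c + Ci)))%C with (a1 + 1 - Ci * (RtoC t + c))%C by ring [E].
    replace (a2 - Ci * (RtoC t + (c + Ci)))%C with (a2 + 1 - Ci * (RtoC t + c))%C by ring [E].
    replace (b + 1 + Ci * (RtoC t + (c + Ci)))%C with (b + Ci * (RtoC t + c))%C by ring [E].
    replace (RtoC t + (c + Ci))%C with (RtoC t + c + Ci)%C by ring. reflexivity.
  - repeat split; reim; lra.
  - repeat split; reim; lra.
Qed.

Lemma test_affine' (lo hi : R) (q : C -> C) (a b : C) (Phi : C -> C) :
  (forall x, q x = (a + b * x)%C) -> test lo hi Phi -> test lo hi (fun x => q x * Phi x)%C.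
Proof.
  intros E H. apply test_ext with (fun x => (a + b * x) * Phi x)%C.
  - intros x. rewrite E. reflexivity.
  - apply test_affine, H.
Qed.

Lemma test_up (lo hi : R) (Phi : C -> C) :
  test lo hi Phi -> test lo (hi - 1) (fun x => Phi (x + Ci)%C).
Proof. intros H. apply test_weaken with (lo - 1) (hi - 1); [lra | lra|]. apply test_shift, H. Qed.

(** Splitting [a1 + b = (a1 - Ci x) + (b + Ci x)]: the first summand raises [a1], the second raises
    [b] and is converted by the contour shift. *)
Lemma mb_step1 (lo hi : R) (c a1 a2 b : C) (Phi : C -> C) :
  test lo hi Phi -> lo < Im c -> Im c + 1 < hi -> separates (Im c) a1 a2 b ->
  ((a1 + b) * mb_int c a1 a2 b Phi =
    mb_int c (a1 + 1) a2 b Phi + mb_int c (a1 + 1) (a2 + 1) b (fun x => Phi (x + Ci)%C))%C.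
Proof.
  intros HT H1 H2 HS. assert (HS' := HS). destruct HS' as (S1 & S2 & S3).
  rewrite <- (mb_shift lo hi c a1 a2 b Phi HT H1 H2 HS).
  rewrite mb_raise1, mb_raise3 by assumption.
  rewrite <- (mb_scal lo hi c a1 a2 b (a1 + b) Phi HT ltac:(lra) HS).
  rewrite <- (mb_plus lo hi).
  - apply mb_ext. intros x _. unfold mb_integrand. ring.
  - apply test_affine' with a1 (- Ci)%C; [intros; ring | exact HT].
  - apply test_affine' with b Ci; [intros; ring | exact HT].
  - lra.
  - exact HS.
Qed.

Lemma mb_step2 (lo hi : R) (c a1 a2 b : C) (Phi : C -> C) :
  test lo hi Phi -> lo < Im c -> Im c + 1 < hi -> separates (Im c) a1 a2 b ->
  ((a2 + b) * mb_int c a1 a2 b Phi =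
    mb_int c a1 (a2 + 1) b Phi + mb_int c (a1 + 1) (a2 + 1) b (fun x => Phi (x + Ci)%C))%C.
Proof.
  intros HT H1 H2 (S1 & S2 & S3).
  rewrite (mb_swap c a1 a2), (mb_swap c a1 (a2 + 1)), (mb_swap c (a1 + 1)).
  apply (mb_step1 lo hi); try assumption. repeat split; assumption.
Qed.

(** One step in [a1] and one in [a2], collected at [(a1 + 1, a2 + 1)]: the coefficient of
    [Phi (x + Ci)] is [(a1 + 1 - Ci x) + (a2 + b)]. *)
Definition level1_fun (a1 a2 b : C) (Phi : C -> C) (x : C) : C :=
  (Phi x + (a1 + a2 + b + 1 - Ci * x) * Phi (x + Ci))%C.

(** [level1_fun] for [(a1 + 1, a2 + 1)] applied to [level1_fun] for [(a1, a2)]; the two coefficients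
    of [Phi (x + Ci)] add up to [2 (a1 + a2 + b + 2 - Ci x)]. *)
Definition level2_fun (a1 a2 b : C) (Phi : C -> C) (x : C) : C :=
  (Phi x + 2 * (a1 + a2 + b + 2 - Ci * x) * Phi (x + Ci)
    + (a1 + a2 + b + 3 - Ci * x) * (a1 + a2 + b + 2 - Ci * x) * Phi (x + Ci + Ci))%C.

(* [level1] continues [(a1 + b) (a2 + b) mb_int] to [Re aj + Im c > -1], and
   [level2] continues [(a1 + b) (a1 + b + 1) (a2 + b) (a2 + b + 1) mb_int] to
   [Re aj + Im c > -2]. *)
Definition level1 (c a1 a2 b : C) (Phi : C -> C) : C :=
  mb_int c (a1 + 1) (a2 + 1) b (level1_fun a1 a2 b Phi).

Definition level2 (c a1 a2 b : C) (Phi : C -> C) : C :=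
  mb_int c (a1 + 2) (a2 + 2) b (level2_fun a1 a2 b Phi).

Lemma test_level1 (lo hi : R) (a1 a2 b : C) (Phi : C -> C) :
  test lo hi Phi -> test lo (hi - 1) (level1_fun a1 a2 b Phi).
Proof.
  intros H. apply test_plus; [apply test_weaken with lo hi; [lra | lra | exact H]|].
  apply test_affine' with (a1 + a2 + b + 1)%C (- Ci)%C; [intros; ring|]. apply test_up, H.
Qed.

Lemma test_level2 (lo hi : R) (a1 a2 b : C) (Phi : C -> C) :
  test lo hi Phi -> test lo (hi - 2) (level2_fun a1 a2 b Phi).
Proof.
  intros H. assert (H1 := test_up _ _ _ H). assert (H2 := test_up _ _ _ H1). cbv beta in H2.
  apply test_plus; [apply test_plus|].
  - apply test_weaken with lo hi; [lra | lra | exact H].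
  - apply test_weaken with lo (hi - 1); [lra | lra|].
    apply test_affine' with (2 * (a1 + a2 + b + 2))%C (- (2 * Ci))%C; [intros; ring | exact H1].
  - apply test_weaken with lo (hi - 1 - 1); [lra | lra|].
    apply test_ext with (fun x => (a1 + a2 + b + 3 - Ci * x) * ((a1 + a2 + b + 2 - Ci * x) * Phi (x + Ci + Ci)))%C;
      [intros; ring|].
    apply test_affine' with (a1 + a2 + b + 3)%C (- Ci)%C; [intros; ring|].
    apply test_affine' with (a1 + a2 + b + 2)%C (- Ci)%C; [intros; ring | exact H2].
Qed.

(** The intermediate stage with the step in [a1] kept and the one in [a2] undone, for points where
    one [tau_2j] is shifted and the other stays real. *)
Lemma level1_of_10 (lo hi : R) (c a1 a2 b : C) (Phi : C -> C) :
  test lo hi Phi -> lo < Im c -> Im c + 1 < hi -> separates (Im c) (a1 + 1) a2 b ->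
  level1 c a1 a2 b Phi =
  ((a2 + b) * (mb_int c (a1 + 1) a2 b Phi + mb_int c (a1 + 1) (a2 + 1) b (fun x => Phi (x + Ci)%C)))%C.
Proof.
  intros HT H1 H2 HS. assert (HS' := HS). destruct HS' as (S1 & S2 & S3).
  assert (R1 : Re (a1 + 1) = Re a1 + 1) by reflexivity.
  assert (R2 : Re (a2 + 1) = Re a2 + 1) by reflexivity.
  assert (HT1 := test_up _ _ _ HT).
  rewrite Cmult_plus_distr_l, (mb_step2 lo hi) by (first [assumption | lra]).
  rewrite (mb_raise1 c (a1 + 1) (a2 + 1) b) by lra.
  assert (HS2 : separates (Im c) (a1 + 1) (a2 + 1) b) by (repeat split; lra).
  rewrite <- (mb_scal lo (hi - 1) c (a1 + 1) (a2 + 1) b (a2 + b)) by (first [assumption | lra]).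
  rewrite <- Cplus_assoc, <- (mb_plus lo (hi - 1)).
  - rewrite <- (mb_plus lo (hi - 1)).
    + unfold level1. apply mb_ext. intros x _. unfold mb_integrand, level1_fun. ring.
    + apply test_weaken with lo hi; [lra | lra | exact HT].
    + apply test_plus; [|apply test_scal, HT1].
      apply test_affine' with (a1 + 1)%C (- Ci)%C; [intros; ring | exact HT1].
    + lra.
    + exact HS2.
  - apply test_affine' with (a1 + 1)%C (- Ci)%C; [intros; ring | exact HT1].
  - apply test_scal, HT1.
  - lra.
  - exact HS2.
Qed.

Lemma level1_swap (c a1 a2 b : C) (Phi : C -> C) : level1 c a1 a2 b Phi = level1 c a2 a1 b Phi.
Proof.
  unfold level1. rewrite mb_swap. apply mb_ext. intros x _. unfold mb_integrand, level1_fun. ring.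
Qed.

Lemma level1_of_0 (lo hi : R) (c a1 a2 b : C) (Phi : C -> C) :
  test lo hi Phi -> lo < Im c -> Im c + 1 < hi -> separates (Im c) a1 a2 b ->
  level1 c a1 a2 b Phi = ((a1 + b) * (a2 + b) * mb_int c a1 a2 b Phi)%C.
Proof.
  intros HT H1 H2 HS. assert (HS' := HS). destruct HS' as (S1 & S2 & S3).
  rewrite (level1_of_10 lo hi); [|assumption|assumption|assumption|repeat split; reim; lra].
  rewrite <- (mb_step1 lo hi) by (first [assumption | lra]). ring.
Qed.

(** [level2] is [level1] for the raised parameters with [level1_fun] as its test function. *)
Lemma level2_of_1 (lo hi : R) (c a1 a2 b : C) (Phi : C -> C) :
  test lo hi Phi -> lo < Im c -> Im c + 2 < hi -> separates (Im c) (a1 + 1) (a2 + 1) b ->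
  level2 c a1 a2 b Phi = ((a1 + b + 1) * (a2 + b + 1) * level1 c a1 a2 b Phi)%C.
Proof.
  intros HT H1 H2 HS. unfold level1.
  assert (E := level1_of_0 lo (hi - 1) c (a1 + 1) (a2 + 1) b (level1_fun a1 a2 b Phi)
    (test_level1 _ _ a1 a2 b _ HT) H1 ltac:(lra) HS).
  transitivity ((a1 + 1 + b) * (a2 + 1 + b) * mb_int c (a1 + 1) (a2 + 1) b (level1_fun a1 a2 b Phi))%C; [|ring].
  rewrite <- E. unfold level1, level2. apply mb_ext. intros x _.
  unfold mb_integrand, level2_fun, level1_fun.
  replace (a1 + 1 + 1)%C with (a1 + 2)%C by ring. replace (a2 + 1 + 1)%C with (a2 + 2)%C by ring.
  assert (E2 : (Ci * Ci)%C = (- (1))%C) by (unfold Ci, Cmult, Copp, RtoC; cbn; f_equal; ring).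
  ring [E2].
Qed.

Lemma level1_move (lo hi : R) (c c' a1 a2 b : C) (Phi : C -> C) :
  test lo hi Phi -> lo < Im c < hi - 1 -> lo < Im c' < hi - 1 ->
  separates (Im c) (a1 + 1) (a2 + 1) b -> separates (Im c') (a1 + 1) (a2 + 1) b ->
  level1 c a1 a2 b Phi = level1 c' a1 a2 b Phi.
Proof. intros HT H1 H2. apply (mb_move lo (hi - 1)); try assumption. apply test_level1, HT. Qed.

Lemma level2_move (lo hi : R) (c c' a1 a2 b : C) (Phi : C -> C) :
  test lo hi Phi -> lo < Im c < hi - 2 -> lo < Im c' < hi - 2 ->
  separates (Im c) (a1 + 2) (a2 + 2) b -> separates (Im c') (a1 + 2) (a2 + 2) b ->
  level2 c a1 a2 b Phi = level2 c' a1 a2 b Phi.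
Proof. intros HT H1 H2. apply (mb_move lo (hi - 2)); try assumption. apply test_level2, HT. Qed.

(** * Contiguity relations *)

Lemma Ci_sq : (Ci * Ci)%C = (- (1))%C.
Proof. unfold Ci, Cmult, Copp, RtoC; cbn. f_equal; ring. Qed.

Definition affine (q : C -> C) : Prop := exists a b, forall x, q x = (a + b * x)%C.

Lemma affine_const (k : C) : affine (fun _ => k).
Proof. exists k, 0%C. intros. ring. Qed.

Lemma affine_lin (k : C) : affine (fun x => k * x)%C.
Proof. exists 0%C, k. intros. ring. Qed.

Lemma affine_plus (p q : C -> C) : affine p -> affine q -> affine (fun x => p x + q x)%C.
Proof.
  intros (a & b & E) (c & d & F). exists (a + c)%C, (b + d)%C.
  intros. rewrite E, F. ring.
Qed.

Lemma affine_minus (p q : C -> C) : affine p -> affine q -> affine (fun x => p x - q x)%C.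
Proof.
  intros (a & b & E) (c & d & F). exists (a - c)%C, (b - d)%C.
  intros. rewrite E, F. ring.
Qed.

Lemma test_affine_mult (lo hi : R) (q Phi : C -> C) :
  affine q -> test lo hi Phi -> test lo hi (fun x => q x * Phi x)%C.
Proof. intros (a & b & E) H. apply test_affine' with a b; assumption. Qed.

Ltac aff := repeat first
  [apply affine_const | apply affine_lin | apply affine_minus | apply affine_plus].
Ltac tst := first
  [ assumption
  | apply test_plus; tst
  | apply test_affine_mult; [solve [aff] | tst] ].

Lemma test_zero (lo hi : R) : test lo hi (fun _ => RtoC 0).
Proof.
  split.
  - intros. apply hol_const.
  - intros c d N _ _. exists 0. split; [lra|]. intros x _. rewrite Cmod_0. lra.
Qed.

Definition lincomb (l : list (C * (C -> C))) (x : C) : C :=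
  fold_right (fun p s => (fst p * snd p x + s)%C) (RtoC 0) l.

(** The certificate for a contiguity relation is a list of coefficients and test functions whose
    combination vanishes identically in [x], which [ring] can check. *)
Lemma mb_lincomb (lo hi : R) (c a1 a2 b : C) (l : list (C * (C -> C))) :
  lo < Im c < hi -> separates (Im c) a1 a2 b ->
  Forall (fun p => test lo hi (snd p)) l -> (forall x, lincomb l x = 0) ->
  fold_right (fun p s => (fst p * mb_int c a1 a2 b (snd p) + s)%C) (RtoC 0) l = 0.
Proof.
  intros Hc HS HT H0.
  assert (G : test lo hi (lincomb l) /\ mb_int c a1 a2 b (lincomb l) =
    fold_right (fun p s => (fst p * mb_int c a1 a2 b (snd p) + s)%C) (RtoC 0) l).
  { clear H0. induction HT as [|p l Hp HT [IH1 IH2]]; cbn [fold_right lincomb].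
    - split; [apply test_zero|].
      assert (E := mb_scal lo hi c a1 a2 b 0 (fun _ => RtoC 0) (test_zero lo hi) Hc HS).
      rewrite Cmult_0_l in E. rewrite <- E. apply mb_ext. intros x _. unfold mb_integrand, lincomb. cbn. ring.
    - assert (Tp := test_scal lo hi (fst p) _ Hp). split.
      + apply (test_plus lo hi (fun x => fst p * snd p x)%C (lincomb l)); assumption.
      + rewrite <- IH2, <- (mb_scal lo hi) by assumption.
        rewrite <- (mb_plus lo hi) by assumption. reflexivity. }
  destruct G as [_ G]. rewrite <- G.
  assert (E := mb_scal lo hi c a1 a2 b 0 (fun _ => RtoC 0) (test_zero lo hi) Hc HS).
  rewrite Cmult_0_l in E. rewrite <- E. apply mb_ext. intros x _. unfold mb_integrand. rewrite H0. ring.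
Qed.

Lemma Cminus_diag_uniq (a b : C) : (a - b)%C = 0 -> a = b.
Proof. intros H. replace a with ((a - b) + b)%C by ring. rewrite H. ring. Qed.

(** [(a1 - a2) (H + a1 + a2 - Ci x) = (H + a1) (a1 - Ci x) - (H + a2) (a2 - Ci x)]; no contour is
    moved. *)
Lemma rel32 (lo hi : R) (c a1 a2 b H : C) (Phi : C -> C) :
  test lo hi Phi -> lo < Im c < hi -> separates (Im c) a1 a2 b ->
  ((a1 - a2) * mb_int c a1 a2 b (fun x => (H + a1 + a2 - Ci * x) * Phi x)
   = (H + a1) * mb_int c (a1 + 1) a2 b Phi - (H + a2) * mb_int c a1 (a2 + 1) b Phi)%C.
Proof.
  intros HT Hc HS. assert (HS' := HS). destruct HS' as (S1 & S2 & S3).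
  rewrite mb_raise1, mb_raise2 by assumption.
  assert (Z := mb_lincomb lo hi c a1 a2 b
    (((a1 - a2)%C, fun x => ((H + a1 + a2 - Ci * x) * Phi x)%C) ::
     ((- (H + a1))%C, fun x => ((a1 - Ci * x) * Phi x)%C) ::
     ((H + a2)%C, fun x => ((a2 - Ci * x) * Phi x)%C) :: nil) Hc HS).
  apply Cminus_diag_uniq. rewrite <- Z.
  - cbn [fold_right fst snd]. ring.
  - repeat (apply Forall_cons; [cbn [snd]; tst|]). apply Forall_nil.
  - intros x. unfold lincomb; cbn [fold_right fst snd]. ring.
Qed.

(** The test function occurs at [x] and at [x + Ci], so algebra at fixed [x] does not suffice. The
    contour shift adds that [(b + Ci x) Phi x] and [(a1 - Ci x) (a2 - Ci x) Phi (x + Ci)] have equal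
    integrals. *)
Lemma rel23 (lo hi : R) (c a1 a2 b e G : C) (Phi : C -> C) :
  test lo hi Phi -> lo < Im c -> Im c + 1 < hi -> separates (Im c) a1 a2 b ->
  ((a2 - a1) * mb_int c a1 a2 b
     (fun x => (G - Ci * x) * ((e - Ci * x) * Phi (x + Ci)) + (e + G - a1 - a2 - b - Ci * x) * Phi x)
   = (G - a1) * (e - a1) * (mb_int c a1 a2 b Phi + mb_int c a1 (a2 + 1) b (fun x => Phi (x + Ci)))
     - (G - a2) * (e - a2) * (mb_int c a1 a2 b Phi + mb_int c (a1 + 1) a2 b (fun x => Phi (x + Ci))))%C.
Proof.
  intros HT H1 H2 HS. assert (HS' := HS). destruct HS' as (S1 & S2 & S3).
  assert (E := mb_shift lo hi c a1 a2 b Phi HT H1 H2 HS).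
  rewrite mb_raise3 in E by assumption. rewrite mb_raise1 in E by assumption.
  rewrite mb_raise2 in E by assumption. cbv beta in E.
  rewrite mb_raise1, mb_raise2 by assumption.
  assert (T1 : test lo (hi - 1) Phi) by (apply test_weaken with lo hi; [lra | lra | exact HT]).
  assert (T2 : test lo (hi - 1) (fun x => Phi (x + Ci)%C)) by (apply test_up, HT).
  (* The second and third entries cancel after integration by [E]; with them the combination
     vanishes pointwise. *)
  assert (Z := mb_lincomb lo (hi - 1) c a1 a2 b
    (((a2 - a1)%C, fun x => ((G - Ci * x) * ((e - Ci * x) * Phi (x + Ci)) + (e + G - a1 - a2 - b - Ci * x) * Phi x)%C) ::
     ((a2 - a1)%C, fun x => ((b + Ci * x) * Phi x)%C) ::
     ((a1 - a2)%C, fun x => ((a2 - Ci * x) * ((a1 - Ci * x) * Phi (x + Ci)))%C) ::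
     ((- ((G - a1) * (e - a1) - (G - a2) * (e - a2)))%C, fun x => Phi x) ::
     ((- ((G - a1) * (e - a1)))%C, fun x => ((a2 - Ci * x) * Phi (x + Ci))%C) ::
     ((G - a2) * (e - a2)%C, fun x => ((a1 - Ci * x) * Phi (x + Ci))%C) :: nil)%C ltac:(lra) HS).
  apply Cminus_diag_uniq. rewrite <- Z; clear Z.
  - cbn [fold_right fst snd].
    rewrite E. replace (mb_int c a1 a2 b (fun x : C => Phi x)) with (mb_int c a1 a2 b Phi) by reflexivity. ring.
  - repeat (apply Forall_cons; [cbn [snd]; tst|]). apply Forall_nil.
  - intros x. unfold lincomb; cbn [fold_right fst snd]. ring.
Qed.

(** The contour shift together with [(e - a1) (e - a2) - (e - a1 - a2 + Ci x) (e - Ci x) = (a1 - Ci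
    x) (a2 - Ci x)]. *)
Lemma rel21R (lo hi : R) (c a1 a2 b e : C) (Phi : C -> C) :
  test lo hi Phi -> lo < Im c -> Im c + 1 < hi -> separates (Im c) a1 a2 b ->
  ((e - a1) * (e - a2) * mb_int c a1 a2 b (fun x => Phi (x + Ci))
   = mb_int c a1 a2 b
       (fun x => (b + Ci * x) * Phi x + (e - a1 - a2 + Ci * x) * ((e - Ci * x) * Phi (x + Ci))))%C.
Proof.
  intros HT H1 H2 HS. assert (HS' := HS). destruct HS' as (S1 & S2 & S3).
  assert (E := mb_shift lo hi c a1 a2 b Phi HT H1 H2 HS).
  rewrite mb_raise3 in E by assumption. rewrite mb_raise1 in E by assumption.
  rewrite mb_raise2 in E by assumption. cbv beta in E.
  assert (T1 : test lo (hi - 1) Phi) by (apply test_weaken with lo hi; [lra | lra | exact HT]).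
  assert (T2 : test lo (hi - 1) (fun x => Phi (x + Ci)%C)) by (apply test_up, HT).
  assert (Z := mb_lincomb lo (hi - 1) c a1 a2 b
    (((e - a1) * (e - a2), fun x => Phi (x + Ci)%C) ::
     (- (1), fun x => ((b + Ci * x) * Phi x + (e - a1 - a2 + Ci * x) * ((e - Ci * x) * Phi (x + Ci)))) ::
     (RtoC 1, fun x => ((b + Ci * x) * Phi x)) ::
     (- (1), fun x => ((a2 - Ci * x) * ((a1 - Ci * x) * Phi (x + Ci)))) :: nil)%C ltac:(lra) HS).
  apply Cminus_diag_uniq. rewrite <- Z; clear Z.
  - cbn [fold_right fst snd].
    rewrite E. replace (mb_int c a1 a2 b (fun x : C => Phi (x + Ci)%C)) with (mb_int c a1 a2 b (fun x => Phi (x + Ci)%C)) by reflexivity. ring.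
  - repeat (apply Forall_cons; [cbn [snd]; tst|]). apply Forall_nil.
  - intros x. unfold lincomb; cbn [fold_right fst snd]. ring.
Qed.

(** [(a2 - a1) (G - Ci x) = (G - a1) (a2 - Ci x) - (G - a2) (a1 - Ci x)]. As no contour is moved,
    [Phi] and [Th] may be unrelated; they will be a test function and its shift. *)
Lemma rel13R (lo hi : R) (c a1 a2 b G : C) (Phi Th : C -> C) :
  test lo hi Phi -> test lo hi Th -> lo < Im c < hi -> separates (Im c) a1 a2 b ->
  ((a2 - a1) * mb_int c a1 a2 b (fun x => Phi x + (G - Ci * x) * Th x)
   = (G - a1) * (mb_int c a1 a2 b Phi + mb_int c a1 (a2 + 1) b Th)
     - (G - a2) * (mb_int c a1 a2 b Phi + mb_int c (a1 + 1) a2 b Th))%C.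
Proof.
  intros T1 T2 Hc HS. assert (HS' := HS). destruct HS' as (S1 & S2 & S3).
  rewrite mb_raise1, mb_raise2 by assumption.
  assert (Z := mb_lincomb lo hi c a1 a2 b
    ((a2 - a1, fun x => (Phi x + (G - Ci * x) * Th x)) ::
     (- (a2 - a1), fun x => Phi x) ::
     (- (G - a1), fun x => ((a2 - Ci * x) * Th x)) ::
     (G - a2, fun x => ((a1 - Ci * x) * Th x)) :: nil)%C Hc HS).
  apply Cminus_diag_uniq. rewrite <- Z; clear Z.
  - cbn [fold_right fst snd].
    replace (mb_int c a1 a2 b (fun x : C => Phi x)) with (mb_int c a1 a2 b Phi) by reflexivity. ring.
  - repeat (apply Forall_cons; [cbn [snd]; tst|]). apply Forall_nil.
  - intros x. unfold lincomb; cbn [fold_right fst snd]. ring.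
Qed.

(** After the contour shift everything multiplies [Phi (x + Ci)]. The difference [(G - Ci x) (e - Ci
    x) - (a1 - Ci x) (a2 - Ci x)] is affine in [x], and the right side is its Lagrange interpolation
    at [Ci x = a1] and [Ci x = a2]. *)
Lemma rel13L (lo hi : R) (c a1 a2 b e G : C) (Phi : C -> C) :
  test lo hi Phi -> lo < Im c -> Im c + 1 < hi -> separates (Im c) a1 a2 b ->
  ((a2 - a1) * mb_int c a1 a2 b
      (fun x => (G - Ci * x) * ((e - Ci * x) * Phi (x + Ci)) - (b + Ci * x) * Phi x)
   = (G - a1) * (e - a1) * mb_int c a1 (a2 + 1) b (fun x => Phi (x + Ci))
     - (G - a2) * (e - a2) * mb_int c (a1 + 1) a2 b (fun x => Phi (x + Ci)))%C.
Proof.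
  intros HT H1 H2 HS. assert (HS' := HS). destruct HS' as (S1 & S2 & S3).
  assert (E := mb_shift lo hi c a1 a2 b Phi HT H1 H2 HS).
  rewrite mb_raise3 in E by assumption. rewrite mb_raise1 in E by assumption.
  rewrite mb_raise2 in E by assumption. cbv beta in E.
  rewrite mb_raise1, mb_raise2 by assumption.
  assert (T1 : test lo (hi - 1) Phi) by (apply test_weaken with lo hi; [lra | lra | exact HT]).
  assert (T2 : test lo (hi - 1) (fun x => Phi (x + Ci)%C)) by (apply test_up, HT).
  assert (Z := mb_lincomb lo (hi - 1) c a1 a2 b
    ((a2 - a1, fun x => ((G - Ci * x) * ((e - Ci * x) * Phi (x + Ci)) + (0 - b - Ci * x) * Phi x)) ::
     (a2 - a1, fun x => ((b + Ci * x) * Phi x)) ::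
     (a1 - a2, fun x => ((a2 - Ci * x) * ((a1 - Ci * x) * Phi (x + Ci)))) ::
     (- ((G - a1) * (e - a1)), fun x => ((a2 - Ci * x) * Phi (x + Ci))) ::
     ((G - a2) * (e - a2), fun x => ((a1 - Ci * x) * Phi (x + Ci))) :: nil)%C ltac:(lra) HS).
  apply Cminus_diag_uniq. rewrite <- Z; clear Z.
  - cbn [fold_right fst snd].
    rewrite E. replace (mb_int c a1 a2 b (fun x => (G - Ci * x) * ((e - Ci * x) * Phi (x + Ci)) - (b + Ci * x) * Phi x)%C)
        with (mb_int c a1 a2 b (fun x => (G - Ci * x) * ((e - Ci * x) * Phi (x + Ci)) + (0 - b - Ci * x) * Phi x)%C).
      + ring.
      + apply mb_ext. intros x _. unfold mb_integrand. ring.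
  - repeat (apply Forall_cons; [cbn [snd]; tst|]). apply Forall_nil.
  - intros x. unfold lincomb; cbn [fold_right fst snd]. ring.
Qed.

(** Again the contour shift followed by interpolation at [Ci x = a1] and [Ci x = a2], now of [(a1 -
    Ci x) (a2 - Ci x) - (H + a1 + a2 - Ci x) (e - Ci x)]. *)
Lemma rel31R (lo hi : R) (c a1 a2 b e H : C) (Phi : C -> C) :
  test lo hi Phi -> lo < Im c -> Im c + 1 < hi -> separates (Im c) a1 a2 b ->
  ((a2 - a1) * mb_int c a1 a2 b
      (fun x => (b + Ci * x) * Phi x - (H + a1 + a2 - Ci * x) * ((e - Ci * x) * Phi (x + Ci)))
   = (H + a1) * (e - a2) * mb_int c (a1 + 1) a2 b (fun x => Phi (x + Ci))
     - (H + a2) * (e - a1) * mb_int c a1 (a2 + 1) b (fun x => Phi (x + Ci)))%C.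
Proof.
  intros HT H1 H2 HS. assert (HS' := HS). destruct HS' as (S1 & S2 & S3).
  assert (E := mb_shift lo hi c a1 a2 b Phi HT H1 H2 HS).
  rewrite mb_raise3 in E by assumption. rewrite mb_raise1 in E by assumption.
  rewrite mb_raise2 in E by assumption. cbv beta in E.
  rewrite mb_raise1, mb_raise2 by assumption.
  assert (T1 : test lo (hi - 1) Phi) by (apply test_weaken with lo hi; [lra | lra | exact HT]).
  assert (T2 : test lo (hi - 1) (fun x => Phi (x + Ci)%C)) by (apply test_up, HT).
  assert (Z := mb_lincomb lo (hi - 1) c a1 a2 b
    ((a2 - a1, fun x => ((b + Ci * x) * Phi x + (Ci * x - (H + a1 + a2)) * ((e - Ci * x) * Phi (x + Ci)))) ::
     (a1 - a2, fun x => ((b + Ci * x) * Phi x)) ::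
     (a2 - a1, fun x => ((a2 - Ci * x) * ((a1 - Ci * x) * Phi (x + Ci)))) ::
     (- ((H + a1) * (e - a2)), fun x => ((a1 - Ci * x) * Phi (x + Ci))) ::
     ((H + a2) * (e - a1), fun x => ((a2 - Ci * x) * Phi (x + Ci))) :: nil)%C ltac:(lra) HS).
  apply Cminus_diag_uniq. rewrite <- Z; clear Z.
  - cbn [fold_right fst snd].
    rewrite E. replace (mb_int c a1 a2 b (fun x => (b + Ci * x) * Phi x - (H + a1 + a2 - Ci * x) * ((e - Ci * x) * Phi (x + Ci)))%C)
        with (mb_int c a1 a2 b (fun x => (b + Ci * x) * Phi x + (Ci * x - (H + a1 + a2)) * ((e - Ci * x) * Phi (x + Ci)))%C).
      + ring.
      + apply mb_ext. intros x _. unfold mb_integrand. ring.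
  - repeat (apply Forall_cons; [cbn [snd]; tst|]). apply Forall_nil.
  - intros x. unfold lincomb; cbn [fold_right fst snd]. ring.
Qed.

(** A change of variable only: both sides are the same integral. In contrast to [mb_shift] the
    contour is not deformed, and [b] drops by 1. *)
Lemma mb_translate (c a1 a2 b : C) (Phi : C -> C) :
  mb_int (c + Ci) a1 a2 b Phi = mb_int c (a1 + 1) (a2 + 1) (b - 1) (fun x => Phi (x + Ci)%C).
Proof.
  unfold mb_int. f_equal. apply functional_extensionality. intros t. unfold mb_integrand.
  replace (a1 - Ci * (RtoC t + (c + Ci)))%C with (a1 + 1 - Ci * (RtoC t + c))%C by ring [Ci_sq].
  replace (a2 - Ci * (RtoC t + (c + Ci)))%C with (a2 + 1 - Ci * (RtoC t + c))%C by ring [Ci_sq].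
  replace (b + Ci * (RtoC t + (c + Ci)))%C with (b - 1 + Ci * (RtoC t + c))%C by ring [Ci_sq].
  replace (RtoC t + (c + Ci))%C with (RtoC t + c + Ci)%C by ring. reflexivity.
Qed.

(** The parameters [(a1 + 1, a2 + 1, b - 1)] of this [level1] are those that translation by [Ci]
    produces from [(a1, a2, b)], so a continued value becomes a plain integral at height
    [Im c + 1]. *)
Lemma rel21L (c a1 a2 b : C) (Phi : C -> C) :
  level1 c a1 a2 (b - 1) (fun x => Phi (x + Ci)%C) =
  mb_int (c + Ci) a1 a2 b (fun x => Phi x + (a1 + a2 + b - 1 - Ci * x) * Phi (x + Ci))%C.
Proof.
  rewrite mb_translate. apply mb_ext. intros x _. unfold mb_integrand, level1_fun. ring [Ci_sq].
Qed.

Lemma rel31L (lo hi : R) (c a1 a2 b H : C) (Phi : C -> C) :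
  test lo hi Phi -> lo < Im c + 1 -> Im c + 2 < hi -> separates (Im c) (a1 + 1) (a2 + 1) (b - 1) ->
  ((a2 - a1) * mb_int (c + Ci) a1 a2 b
      (fun x => - Phi x - (H + a1 + a2 - Ci * x) * Phi (x + Ci))
   = (H + a1) * (mb_int c (a1 + 1) (a2 + 1) (b - 1) (fun x => Phi (x + Ci))
                 + mb_int c (a1 + 2) (a2 + 1) (b - 1) (fun x => Phi (x + Ci + Ci)))
     - (H + a2) * (mb_int c (a1 + 1) (a2 + 1) (b - 1) (fun x => Phi (x + Ci))
                 + mb_int c (a1 + 1) (a2 + 2) (b - 1) (fun x => Phi (x + Ci + Ci))))%C.
Proof.
  intros HT H1 H2 HS. assert (HS' := HS). destruct HS' as (S1 & S2 & S3).
  rewrite mb_translate.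
  replace (a1 + 2)%C with (a1 + 1 + 1)%C by ring. replace (a2 + 2)%C with (a2 + 1 + 1)%C by ring.
  rewrite (mb_raise1 c (a1 + 1)), (mb_raise2 c (a1 + 1) (a2 + 1)) by assumption.
  assert (T1 := test_shift _ _ _ HT). assert (T2 := test_shift _ _ _ T1).
  cbv beta in T2.
  assert (T3 : test (lo - 1) (hi - 2) (fun x => Phi (x + Ci)%C)) by (apply test_weaken with (lo - 1) (hi - 1); [lra | lra | exact T1]).
  assert (T4 : test (lo - 1) (hi - 2) (fun x => Phi (x + Ci + Ci)%C)) by (apply test_weaken with (lo - 1 - 1) (hi - 1 - 1); [lra | lra | exact T2]).
  assert (Z := mb_lincomb (lo - 1) (hi - 2) c (a1 + 1) (a2 + 1) (b - 1)
    ((a2 - a1, fun x => ((0 - 1 - 0 * x) * Phi (x + Ci) + (Ci * x - (H + a1 + a2 + 1)) * Phi (x + Ci + Ci))) ::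
     (- (a1 - a2), fun x => Phi (x + Ci)%C) ::
     (- (H + a1), fun x => ((a1 + 1 - Ci * x) * Phi (x + Ci + Ci))) ::
     (H + a2, fun x => ((a2 + 1 - Ci * x) * Phi (x + Ci + Ci))) :: nil)%C ltac:(lra) HS).
  apply Cminus_diag_uniq. rewrite <- Z; clear Z.
  - cbn [fold_right fst snd].
    replace (mb_int c (a1 + 1) (a2 + 1) (b - 1) (fun x => - Phi (x + Ci) - (H + a1 + a2 - Ci * (x + Ci)) * Phi (x + Ci + Ci))%C)
      with (mb_int c (a1 + 1) (a2 + 1) (b - 1) (fun x => (0 - 1 - 0 * x) * Phi (x + Ci) + (Ci * x - (H + a1 + a2 + 1)) * Phi (x + Ci + Ci))%C).
    + ring.
    + apply mb_ext. intros x _. unfold mb_integrand. ring [Ci_sq].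
  - repeat (apply Forall_cons; [cbn [snd]; tst|]). apply Forall_nil.
  - intros x. unfold lincomb; cbn [fold_right fst snd]. ring.
Qed.

(** * Regularity in several variables *)

(** Separate holomorphy with a bound on bounded ranges of the real parts. This is stable under
    products, composition and integration, and Cauchy estimates recover the joint continuity in
    [holomorphic_tube]. *)
Definition regular (r : R) (G : fun3) : Prop :=
  (forall a b c, tube r a b c ->
     hol (fun z => G z b c) a /\ hol (fun z => G a z c) b /\ hol (fun z => G a b z) c) /\
  (forall B, exists M, forall a b c, tube r a b c ->
     Rabs (Re a) <= B -> Rabs (Re b) <= B -> Rabs (Re c) <= B -> Cmod (G a b c) <= M).

Lemma regular_const (r : R) (k : C) : regular r (fun _ _ _ => k).
Proof.
  split.
  - intros. repeat split; apply hol_const.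
  - intros B. exists (Cmod k). intros. lra.
Qed.

Lemma regular_var1 (r : R) : regular r (fun a _ _ => a).
Proof.
  split.
  - intros. split; [apply hol_id | split; apply hol_const].
  - intros B. exists (B + r). intros a b c (T1 & T2 & T3) H1 _ _.
    eapply Rle_trans; [apply Cmod_le_abs | lra].
Qed.

Lemma regular_var2 (r : R) : regular r (fun _ b _ => b).
Proof.
  split.
  - intros. split; [apply hol_const | split; [apply hol_id | apply hol_const]].
  - intros B. exists (B + r). intros a b c (T1 & T2 & T3) _ H1 _.
    eapply Rle_trans; [apply Cmod_le_abs | lra].
Qed.

Lemma regular_var3 (r : R) : regular r (fun _ _ c => c).
Proof.
  split.
  - intros. split; [apply hol_const | split; [apply hol_const | apply hol_id]].
  - intros B. exists (B + r). intros a b c (T1 & T2 & T3) _ _ H1.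
    eapply Rle_trans; [apply Cmod_le_abs | lra].
Qed.

Lemma regular_plus (r : R) (F G : fun3) : regular r F -> regular r G ->
  regular r (fun a b c => F a b c + G a b c)%C.
Proof.
  intros [F1 F2] [G1 G2]. split.
  - intros a b c HT. destruct (F1 a b c HT) as (A1 & A2 & A3). destruct (G1 a b c HT) as (B1 & B2 & B3).
    split; [|split].
    + apply (hol_plus (fun z => F z b c) (fun z => G z b c)); assumption.
    + apply (hol_plus (fun z => F a z c) (fun z => G a z c)); assumption.
    + apply (hol_plus (fun z => F a b z) (fun z => G a b z)); assumption.
  - intros B. destruct (F2 B) as [M1 H1]. destruct (G2 B) as [M2 H2]. exists (M1 + M2).
    intros. apply Cmod_plus_le; auto.
Qed.

Lemma regular_mult (r : R) (F G : fun3) : regular r F -> regular r G ->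
  regular r (fun a b c => F a b c * G a b c)%C.
Proof.
  intros [F1 F2] [G1 G2]. split.
  - intros a b c HT. destruct (F1 a b c HT) as (A1 & A2 & A3). destruct (G1 a b c HT) as (B1 & B2 & B3).
    split; [|split].
    + apply (hol_mult (fun z => F z b c) (fun z => G z b c)); assumption.
    + apply (hol_mult (fun z => F a z c) (fun z => G a z c)); assumption.
    + apply (hol_mult (fun z => F a b z) (fun z => G a b z)); assumption.
  - intros B. destruct (F2 B) as [M1 H1]. destruct (G2 B) as [M2 H2]. exists (M1 * M2).
    intros. apply Cmod_mult_le; auto.
Qed.

Lemma regular_minus (r : R) (F G : fun3) : regular r F -> regular r G ->
  regular r (fun a b c => F a b c - G a b c)%C.
Proof.
  intros HF HG.
  assert (H := regular_plus r _ _ HF (regular_mult r _ _ (regular_const r (- (1))) HG)).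
  replace (fun a b c => (F a b c - G a b c)%C) with (fun a b c => (F a b c + - (1) * G a b c)%C); [exact H|].
  do 3 (apply functional_extensionality; intros ?). ring.
Qed.

(** Comparison with Gamma at [1 + Ci Im z] reduces the disc to a one-dimensional segment, where
    continuity gives a bound. *)
Lemma rGamma_bounded (B : R) : exists M, forall z, Cmod z <= B -> Cmod (rGamma z) <= M.
Proof.
  destruct (Gamma_ratio_bound 1 1 (- Rabs B) (Rabs B) 0 ltac:(lra)) as (M & m & PM & H).
  destruct (hol_bounded_segment (fun x => rGamma (1 + Ci * x)) (- Rabs B) (Rabs B)) as (M2 & PM2 & H2).
  { intros x _. apply (hol_comp rGamma (fun x => 1 + Ci * x)%C); [|apply rGamma_hol].
    apply hol_plus; [apply hol_const | apply hol_scal, hol_id]. }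
  exists (M * (2 + Rabs B) ^ m * M2). intros z Hz.
  assert (LB := Rle_abs B). assert (PB := Rabs_pos B).
  assert (Hr := re_le_Cmod z). assert (Hi := im_le_Cmod z).
  set (z1 := (1 + Ci * RtoC (Im z))%C).
  assert (R1 : Re z1 = 1) by (unfold z1; reim; lra).
  assert (I1 : Im z1 = Im z) by (unfold z1; reim; lra).
  assert (Br : - Rabs B <= Re z <= Rabs B) by (apply Rabs_le_between; lra).
  assert (Bi : - Rabs B <= Im z <= Rabs B) by (apply Rabs_le_between; lra).
  specialize (H z1 z ltac:(lra) Br ltac:(rewrite I1, Rminus_diag, Rabs_R0; lra)).
  replace (rGamma z) with ((Gamma z1 * rGamma z) * rGamma z1)%C.
  2:{ unfold rGamma at 2. field. apply Gamma_neq_0, nonpole_pos. lra. }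
  apply Cmod_mult_le; [|apply H2, Bi].
  eapply Rle_trans; [exact H|]. apply Rmult_le_compat_l; [exact PM|].
  assert (Q := Cmod_ge_0 z1). apply pow_incr. split; [lra|].
  assert (T := Cmod_triangle 1 (Ci * RtoC (Im z))). rewrite Cmod_1, Cmod_mult, Cmod_Ci, Cmod_R in T.
  fold z1 in T. lra.
Qed.

Lemma regular_comp (r : R) (h : C -> C) (G : fun3) : (forall z, hol h z) ->
  (forall B, exists M, forall z, Cmod z <= B -> Cmod (h z) <= M) ->
  regular r G -> regular r (fun a b c => h (G a b c)).
Proof.
  intros Hh Hb [G1 G2]. split.
  - intros a b c HT. destruct (G1 a b c HT) as (B1 & B2 & B3). split; [|split].
    + apply (hol_comp h (fun z => G z b c)); auto.
    + apply (hol_comp h (fun z => G a z c)); auto.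
    + apply (hol_comp h (fun z => G a b z)); auto.
  - intros B. destruct (G2 B) as [M1 H1]. destruct (Hb M1) as [M H]. exists M. intros. apply H. auto.
Qed.

Lemma regular_rGamma (r : R) (G : fun3) : regular r G -> regular r (fun a b c => rGamma (G a b c)).
Proof. apply regular_comp; [apply rGamma_hol | apply rGamma_bounded]. Qed.

Lemma regular_Cexp (r : R) (G : fun3) : regular r G -> regular r (fun a b c => Cexp (G a b c)).
Proof.
  apply regular_comp; [apply Cexp_hol|]. intros B. exists (exp B). intros z Hz. rewrite Cmod_Cexp.
  assert (L : Re z <= B) by (eapply Rle_trans; [apply Rle_abs|]; eapply Rle_trans; [apply re_le_Cmod | exact Hz]).
  destruct (Rle_lt_or_eq_dec _ _ L) as [L'|L']; [left; apply exp_increasing, L' | right; f_equal; exact L'].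
Qed.

Lemma tube_near (r : R) (a b c : C) : tube r a b c ->
  exists d, 0 < d /\ d <= 1 /\ forall a' b' c',
    Cmod (a' - a) < d -> Cmod (b' - b) < d -> Cmod (c' - c) < d -> tube r a' b' c'.
Proof.
  intros (H1 & H2 & H3).
  set (d := Rmin 1 (Rmin (r - Rabs (Im a)) (Rmin (r - Rabs (Im b)) (r - Rabs (Im c))))).
  assert (P : 0 < d) by (unfold d; repeat apply Rmin_glb_lt; lra).
  assert (D0 : d <= 1) by apply Rmin_l.
  assert (D1 : d <= r - Rabs (Im a)) by (eapply Rle_trans; [apply Rmin_r | apply Rmin_l]).
  assert (D2 : d <= r - Rabs (Im b)) by (eapply Rle_trans; [apply Rmin_r|]; eapply Rle_trans; [apply Rmin_r | apply Rmin_l]).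
  assert (D3 : d <= r - Rabs (Im c)) by (eapply Rle_trans; [apply Rmin_r|]; eapply Rle_trans; [apply Rmin_r | apply Rmin_r]).
  assert (G : forall x x', Cmod (x' - x) < d -> Rabs (Im x') < Rabs (Im x) + d).
  { intros x x' Hx. replace (Im x') with (Im x + Im (x' - x)) by (rewrite Im_minus; ring).
    eapply Rle_lt_trans; [apply Rabs_triang|]. assert (E := im_le_Cmod (x' - x)). lra. }
  exists d. split; [exact P|]. split; [exact D0|].
  intros a' b' c' A B C0. apply G in A, B, C0. repeat split; lra.
Qed.

Lemma Re_near (x x' : C) (d B : R) : Cmod (x' - x) < d -> d <= 1 -> Rabs (Re x) <= B -> Rabs (Re x') <= B + 1.
Proof.
  intros H Hd HB. replace (Re x') with (Re x + Re (x' - x)) by (rewrite Re_minus; ring).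
  eapply Rle_trans; [apply Rabs_triang|]. assert (E := re_le_Cmod (x' - x)). lra.
Qed.

Lemma hol_lip_of_bound (g : C -> C) (z0 : C) (d M : R) : 0 < d ->
  (forall z, Cmod (z - z0) < d -> hol g z /\ Cmod (g z) <= M) ->
  forall z, Cmod (z - z0) < d / 2 -> Cmod (g z - g z0) <= 6 * M / d * Cmod (z - z0).
Proof.
  intros Hd H z Hz.
  apply (C_mean_value g (C_derive g) z0 z). intros t Ht.
  assert (Hs : Cmod (z0 + RtoC t * (z - z0) - z0) < d / 2).
  { apply segment_in_ball; [exact Ht | rewrite Cmod_zero_sub; lra | exact Hz]. }
  split; [apply hol_is_derive, H; lra|].
  assert (E := cauchy_deriv g (z0 + RtoC t * (z - z0))%C (d / 2) M (d / 3)).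
  apply Rmult_le_reg_r with (d / 3); [lra|].
  replace (6 * M / d * (d / 3)) with (2 * M) by (field; lra).
  apply E; [|lra]. intros w Hw. apply H.
  assert (T := Cmod_tri3 w (z0 + RtoC t * (z - z0)) z0). lra.
Qed.

(** For joint continuity the variables are changed one at a time; the Cauchy estimate gives each
    change the same Lipschitz constant [6 M / d]. *)
Lemma regular_holomorphic (r : R) (G : fun3) : regular r G -> holomorphic_tube r G.
Proof.
  intros [HG HB] a b c HT. split.
  - destruct (tube_near r a b c HT) as (d & Pd & Pd1 & Hd).
    set (B := Rabs (Re a) + Rabs (Re b) + Rabs (Re c)).
    assert (P1 := Rabs_pos (Re a)). assert (P2 := Rabs_pos (Re b)). assert (P3 := Rabs_pos (Re c)).
    destruct (HB (B + 1)) as [M HM].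
    assert (HM' : forall a' b' c', Cmod (a' - a) < d -> Cmod (b' - b) < d -> Cmod (c' - c) < d ->
       tube r a' b' c' /\ Cmod (G a' b' c') <= M).
    { intros a' b' c' A1 A2 A3. split; [apply Hd; assumption|].
      apply HM; [apply Hd; assumption | | |]; eapply Re_near; try eassumption; unfold B; lra. }
    assert (Z : forall x : C, Cmod (x - x) < d) by (intros; rewrite Cmod_zero_sub; exact Pd).
    assert (PM : 0 <= M) by (eapply Rle_trans; [apply Cmod_ge_0 | apply (HM' a b c); apply Z]).
    set (L := 6 * M / d).
    assert (PL : 0 <= L) by (apply Rmult_le_pos; [lra | left; apply Rinv_0_lt_compat; exact Pd]).
    assert (Lip : forall a' b' c', Cmod (a' - a) < d / 2 -> Cmod (b' - b) < d / 2 -> Cmod (c' - c) < d / 2 ->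
       Cmod (G a' b' c' - G a b c) <= L * Cmod (a' - a) + (L * Cmod (b' - b) + L * Cmod (c' - c))).
    { intros a' b' c' A1 A2 A3.
      replace (G a' b' c' - G a b c)%C with
        ((G a' b' c' - G a b' c') + ((G a b' c' - G a b c') + (G a b c' - G a b c)))%C by ring.
      apply Cmod_plus_le; [|apply Cmod_plus_le].
      - apply (hol_lip_of_bound (fun z => G z b' c') a d M Pd); [|exact A1].
        intros z Hz. destruct (HM' z b' c' Hz ltac:(lra) ltac:(lra)) as [T1 T2]. split; [apply (HG z b' c' T1) | exact T2].
      - apply (hol_lip_of_bound (fun z => G a z c') b d M Pd); [|exact A2].
        intros z Hz. destruct (HM' a z c' (Z a) Hz ltac:(lra)) as [T1 T2]. split; [apply (HG a z c' T1) | exact T2].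
      - apply (hol_lip_of_bound (fun z => G a b z) c d M Pd); [|exact A3].
        intros z Hz. destruct (HM' a b z (Z a) (Z b) Hz) as [T1 T2]. split; [apply (HG a b z T1) | exact T2]. }
    intros P [e He].
    set (d1 := Rmin (d / 2) (e / (3 * (L + 1)))).
    assert (Pe := cond_pos e).
    assert (Pd' : 0 < d1) by (apply Rmin_glb_lt; [lra | apply Rdiv_lt_0_compat; lra]).
    assert (D1 : d1 <= d / 2) by apply Rmin_l. assert (D2 : d1 <= e / (3 * (L + 1))) by apply Rmin_r.
    assert (Pd2 : 0 < d1 / 2) by lra.
    exists (mkposreal _ Pd2). intros [[a' b'] c'] [[A1 A2] A3]. cbn [fst snd] in *.
    assert (Bl : forall x x' : C, ball x (d1 / 2) x' -> Cmod (x' - x) < d1).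
    { intros x x' [X1 X2]. eapply Rle_lt_trans; [apply Cmod_le_abs|].
      rewrite Re_minus, Im_minus. change (Rabs (fst x' - fst x) < d1 / 2) in X1.
      change (Rabs (snd x' - snd x) < d1 / 2) in X2. unfold Re, Im. lra. }
    apply Bl in A1, A2, A3.
    apply He. apply C_NormedModule_mixin_compat1. change (Cmod (G a' b' c' - G a b c) < e).
    eapply Rle_lt_trans; [apply Lip; lra|].
    apply Rle_lt_trans with (L * (e / (3 * (L + 1))) + (L * (e / (3 * (L + 1))) + L * (e / (3 * (L + 1))))).
    + assert (forall x, x <= e / (3 * (L + 1)) -> L * x <= L * (e / (3 * (L + 1)))) by (intros; apply Rmult_le_compat_l; lra).
      repeat apply Rplus_le_compat; apply H; lra.
    + apply Rmult_lt_reg_r with (L + 1); [lra|]. field_simplify; [|lra]. nra.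
  - destruct (HG a b c HT) as (H1 & H2 & H3). split; [|split]; apply hol_ex_derive; assumption.
Qed.

Lemma regular_line_int (r : R) (G : C -> C -> C -> R -> C) :
  (forall a b c t, tube r a b c ->
     hol (fun z => G z b c t) a /\ hol (fun z => G a z c t) b /\ hol (fun z => G a b z t) c) ->
  (forall B, exists M, forall a b c, tube r a b c ->
     Rabs (Re a) <= B -> Rabs (Re b) <= B -> Rabs (Re c) <= B -> decays (G a b c) M) ->
  regular r (fun a b c => line_int (G a b c)).
Proof.
  intros Hh HD. split.
  - intros a b c HT.
    destruct (tube_near r a b c HT) as (d & Pd & Pd1 & Hd).
    set (B := Rabs (Re a) + Rabs (Re b) + Rabs (Re c)).
    assert (P1 := Rabs_pos (Re a)). assert (P2 := Rabs_pos (Re b)). assert (P3 := Rabs_pos (Re c)).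
    destruct (HD (B + 1)) as [M HM].
    assert (HM' : forall a' b' c', Cmod (a' - a) < d -> Cmod (b' - b) < d -> Cmod (c' - c) < d ->
       tube r a' b' c' /\ decays (G a' b' c') M).
    { intros a' b' c' A1 A2 A3. split; [apply Hd; assumption|].
      apply HM; [apply Hd; assumption | | |]; eapply Re_near; try eassumption; unfold B; lra. }
    assert (Z : forall x : C, Cmod (x - x) < d) by (intros; rewrite Cmod_zero_sub; exact Pd).
    split; [|split].
    + apply (hol_line_int (fun z => G z b c) a d M Pd).
      * intros z t Hz. apply Hh, Hd; auto.
      * intros z Hz. apply HM'; auto.
    + apply (hol_line_int (fun z => G a z c) b d M Pd).
      * intros z t Hz. apply Hh, Hd; auto.
      * intros z Hz. apply HM'; auto.
    + apply (hol_line_int (fun z => G a b z) c d M Pd).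
      * intros z t Hz. apply Hh, Hd; auto.
      * intros z Hz. apply HM'; auto.
  - intros B. destruct (HD B) as [M HM]. exists (8 * M). intros a b c T H1 H2 H3.
    apply line_int_le. auto.
Qed.

(** The test function of the transforms once the delta-functions have removed [s11] and [s22]: [f]
    is read at [s11 = o1 - x], [s21 = o2 + x], [s22 = o3 + x], and the 1/Gamma stems from the
    kernel. *)
Definition psi (f : fun3) (e o1 o2 o3 x : C) : C :=
  (rGamma (e - Ci * x) * f (o1 - x) (o2 + x) (o3 + x))%C.

Lemma fun3_ext (f : fun3) (a b c a' b' c' : C) : a = a' -> b = b' -> c = c' -> f a b c = f a' b' c'.
Proof. intros -> -> ->. reflexivity. Qed.

(** Translation in [x] is traded for offsets, so that values of [f] at different shifts can be
    matched by comparing parameters. *)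
Lemma psi_shift (f : fun3) (e o1 o2 o3 x : C) :
  psi f e o1 o2 o3 (x + Ci) = psi f (e + 1) (o1 - Ci) (o2 + Ci) (o3 + Ci) x.
Proof.
  unfold psi. f_equal.
  - f_equal. ring [Ci_sq].
  - apply fun3_ext; ring.
Qed.

(** Aligns the parameter [e] of two shifted values at the price of an affine factor in [x]. *)
Lemma psi_lower (f : fun3) (e o1 o2 o3 x : C) :
  psi f e o1 o2 o3 x = ((e - Ci * x) * psi f (e + 1) o1 o2 o3 x)%C.
Proof.
  unfold psi. rewrite rGamma_rec. replace (e - Ci * x + 1)%C with (e + 1 - Ci * x)%C by ring. ring.
Qed.

(** * Uniform bounds and the explicit continuations of B f *)

Definition box (A B w : R) (a1 a2 b e o1 o2 o3 x : C) : Prop :=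
  (A <= Re (a1 - Ci * x) <= B /\ A <= Re (a2 - Ci * x) <= B /\ A <= Re (b + Ci * x) <= B) /\
  (- B <= Re (e - Ci * x) <= B /\ Rabs (Im a1) <= B /\ Rabs (Im e) <= B /\ Cmod o1 <= B) /\
  Rabs (Im (o1 - x)) <= w /\ Rabs (Im (o2 + x)) <= w /\ Rabs (Im (o3 + x)) <= w.

(** Uniformity in the parameters is what regularity in [tau] asks for. Here [Gamma (a1 - Ci x)] is
    paired directly with the 1/Gamma of [psi], the difference of their imaginary parts being
    bounded. *)
Lemma mb_uniform (f : fun3) (A B w : R) (N : nat) : tube_hol 3 f -> 0 < A -> w < 3 ->
  exists M, 0 <= M /\ forall a1 a2 b e o1 o2 o3 x, box A B w a1 a2 b e o1 o2 o3 x ->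
    Cmod (mb_integrand a1 a2 b (psi f e o1 o2 o3) x) * (1 + Cmod x) ^ N <= M.
Proof.
  intros [_ Hb] HA Hw.
  destruct (Gamma_ratio_bound A B (- B) B (2 * B) HA) as (M1 & m & PM1 & H1).
  destruct (Gamma_bounded A B HA) as (M2 & PM2 & H2).
  destruct (Hb w (m + N)%nat Hw) as (M3 & H3).
  assert (PB := Rabs_pos B). assert (LB := Rle_abs B).
  set (k := 1 + 2 * Rabs B).
  exists (M1 * k ^ m * M2 * M2 * (k ^ (m + N) * Rabs M3)).
  assert (Pk : 0 < k) by (unfold k; lra).
  assert (Pkm : 0 < k ^ m) by (apply pow_lt; lra).
  assert (Pkn : 0 < k ^ (m + N)) by (apply pow_lt; lra).
  split; [repeat apply Rmult_le_pos; try lra; apply Rabs_pos|].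
  intros a1 a2 b e o1 o2 o3 x ((A1 & A2 & A3) & (B1 & B2 & B3 & B4) & C1 & C2 & C3).
  specialize (H1 (a1 - Ci * x)%C (e - Ci * x)%C A1 B1).
  lapply H1; clear H1; [intros H1|].
  2:{ reim. apply Rabs_le. apply Rabs_le_between in B2, B3. lra. }
  assert (H2' := H2 _ A3). specialize (H2 _ A2). specialize (H3 _ _ _ C1 C2 C3).
  assert (Px := Cmod_ge_0 x). assert (Po := Cmod_ge_0 o1).
  assert (E1 : (1 + Cmod (a1 - Ci * x)) ^ m <= k ^ m * (1 + Cmod x) ^ m).
  { rewrite <- Rpow_mult_distr. apply pow_incr. assert (Q := Cmod_ge_0 (a1 - Ci * x)). split; [lra|].
    assert (L : Cmod (a1 - Ci * x) <= 2 * Rabs B + Cmod x).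
    { eapply Rle_trans; [apply Cmod_le_abs|].
      assert (Q1 : Rabs (Re (a1 - Ci * x)) <= Rabs B) by (rewrite Rabs_pos_eq; lra).
      assert (Q2 : Rabs (Im (a1 - Ci * x)) <= Rabs B + Cmod x).
      { reim. eapply Rle_trans; [apply Rabs_triang|]. rewrite Rabs_Ropp. assert (F := re_le_Cmod x). lra. }
      lra. }
    unfold k. assert (0 <= Rabs B * Cmod x) by (apply Rmult_le_pos; lra). lra. }
  set (fx := f (o1 - x)%C (o2 + x)%C (o3 + x)%C) in *.
  assert (E2 : (1 + Cmod x) ^ (m + N) * Cmod fx <= k ^ (m + N) * Rabs M3).
  { apply Rle_trans with (k ^ (m + N) * ((1 + Cmod (o1 - x) + Cmod (o2 + x) + Cmod (o3 + x)) ^ (m + N) * Cmod fx)).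
    - rewrite <- Rmult_assoc. apply Rmult_le_compat_r; [apply Cmod_ge_0|].
      rewrite <- Rpow_mult_distr. apply pow_incr. split; [lra|].
      assert (T := Cmod_sub_ge x o1). rewrite Cmod_sub_sym in T.
      assert (Q1 := Cmod_ge_0 (o1 - x)). assert (Q2 := Cmod_ge_0 (o2 + x)). assert (Q3 := Cmod_ge_0 (o3 + x)).
      assert (T2 : Cmod x <= Cmod (o1 - x) + Rabs B) by lra. unfold k. nra.
    - apply Rmult_le_compat_l; [lra|]. eapply Rle_trans; [exact H3 | apply Rle_abs]. }
  unfold mb_integrand, psi. fold fx.
  replace (Gamma (a1 - Ci * x) * Gamma (a2 - Ci * x) * Gamma (b + Ci * x) * (rGamma (e - Ci * x) * fx))%C
    with ((Gamma (a1 - Ci * x) * rGamma (e - Ci * x)) * Gamma (a2 - Ci * x) * Gamma (b + Ci * x) * fx)%C by ring.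
  rewrite (Cmod_mult _ fx), (Cmod_mult _ (Gamma (b + Ci * x))), (Cmod_mult _ (Gamma (a2 - Ci * x))).
  set (g := Cmod (Gamma (a1 - Ci * x) * rGamma (e - Ci * x))) in *.
  assert (Pg : 0 <= g) by apply Cmod_ge_0.
  assert (P2 := Cmod_ge_0 (Gamma (a2 - Ci * x))). assert (P3 := Cmod_ge_0 (Gamma (b + Ci * x))).
  assert (Pf := Cmod_ge_0 fx).
  assert (Pq : 0 < (1 + Cmod x) ^ m) by (apply pow_lt; lra).
  assert (PqN : 0 < (1 + Cmod x) ^ N) by (apply pow_lt; lra).
  assert (Hg : g <= M1 * k ^ m * (1 + Cmod x) ^ m).
  { eapply Rle_trans; [exact H1|]. rewrite Rmult_assoc. apply Rmult_le_compat_l; lra. }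
  apply Rle_trans with ((M1 * k ^ m * (1 + Cmod x) ^ m) * M2 * M2 * Cmod fx * (1 + Cmod x) ^ N).
  - apply Rmult_le_compat_r; [lra|]. apply Rmult_le_compat_r; [lra|].
    apply Rmult_le_compat; [apply Rmult_le_pos; lra | lra | | lra].
    apply Rmult_le_compat; lra.
  - replace (M1 * k ^ m * (1 + Cmod x) ^ m * M2 * M2 * Cmod fx * (1 + Cmod x) ^ N)
      with (M1 * k ^ m * M2 * M2 * ((1 + Cmod x) ^ (m + N) * Cmod fx)) by (rewrite pow_add; ring).
    apply Rmult_le_compat_l; [|exact E2]. repeat apply Rmult_le_pos; lra.
Qed.

Lemma Cmod_affine_le (s : C) (S : R) (x : C) : Cmod s <= S ->
  Cmod (s - Ci * x) <= (S + 1) * (1 + Cmod x).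
Proof.
  intros H. assert (T := Cmod_triangle s (- (Ci * x))). rewrite Cmod_opp, Cmod_mult, Cmod_Ci in T.
  change (s + - (Ci * x))%C with (s - Ci * x)%C in T.
  assert (P := Cmod_ge_0 s). assert (Q := Cmod_ge_0 x).
  assert (0 <= S * Cmod x) by (apply Rmult_le_pos; lra). lra.
Qed.

(** The affine coefficient of the shifted term costs one power of [1 + |x|], hence the exponents 2
    and 3. *)
Lemma level1_uniform (f : fun3) (A B w S : R) : tube_hol 3 f -> 0 < A -> w < 3 ->
  exists M, 0 <= M /\ forall a1 a2 b e o1 o2 o3 x,
    box A B w (a1 + 1) (a2 + 1) b e o1 o2 o3 x ->
    box A B w (a1 + 1) (a2 + 1) b (e + 1) (o1 - Ci) (o2 + Ci) (o3 + Ci) x ->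
    Cmod (a1 + a2 + b + 1) <= S ->
    Cmod (mb_integrand (a1 + 1) (a2 + 1) b (level1_fun a1 a2 b (psi f e o1 o2 o3)) x) * (1 + Cmod x) ^ 2 <= M.
Proof.
  intros Hf HA Hw.
  destruct (mb_uniform f A B w 2 Hf HA Hw) as (M0 & P0 & H0).
  destruct (mb_uniform f A B w 3 Hf HA Hw) as (M1 & P1 & H1).
  exists (M0 + (Rabs S + 1) * M1). assert (PS := Rabs_pos S). assert (LS := Rle_abs S).
  split; [assert (0 <= (Rabs S + 1) * M1) by (apply Rmult_le_pos; lra); lra|].
  intros a1 a2 b e o1 o2 o3 x X0 X1 HS.
  specialize (H0 _ _ _ _ _ _ _ _ X0). specialize (H1 _ _ _ _ _ _ _ _ X1).
  assert (Px := Cmod_ge_0 x).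
  replace (mb_integrand (a1 + 1) (a2 + 1) b (level1_fun a1 a2 b (psi f e o1 o2 o3)) x) with
    (mb_integrand (a1 + 1) (a2 + 1) b (psi f e o1 o2 o3) x + (a1 + a2 + b + 1 - Ci * x) *
     mb_integrand (a1 + 1) (a2 + 1) b (psi f (e + 1) (o1 - Ci) (o2 + Ci) (o3 + Ci)) x)%C
    by (unfold mb_integrand, level1_fun; rewrite psi_shift; ring).
  set (t0 := mb_integrand (a1 + 1) (a2 + 1) b (psi f e o1 o2 o3) x) in *.
  set (t1 := mb_integrand (a1 + 1) (a2 + 1) b (psi f (e + 1) (o1 - Ci) (o2 + Ci) (o3 + Ci)) x) in *.
  assert (L := Cmod_affine_le _ (Rabs S) x (Rle_trans _ _ _ HS LS)).
  assert (Pt := Cmod_ge_0 t1). assert (Pq : 0 < (1 + Cmod x) ^ 2) by (apply pow_lt; lra).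
  apply Rle_trans with (Cmod t0 * (1 + Cmod x) ^ 2 + (Rabs S + 1) * (Cmod t1 * (1 + Cmod x) ^ 3)).
  - replace ((Rabs S + 1) * (Cmod t1 * (1 + Cmod x) ^ 3)) with
      (((Rabs S + 1) * (1 + Cmod x)) * Cmod t1 * (1 + Cmod x) ^ 2) by ring.
    rewrite <- Rmult_plus_distr_r. apply Rmult_le_compat_r; [lra|].
    eapply Rle_trans; [apply Cmod_triangle|]. apply Rplus_le_compat_l. rewrite Cmod_mult.
    apply Rmult_le_compat_r; assumption.
  - apply Rplus_le_compat; [exact H0|]. apply Rmult_le_compat_l; [lra | exact H1].
Qed.

Lemma level2_uniform (f : fun3) (A B w S : R) : tube_hol 3 f -> 0 < A -> w < 3 ->
  exists M, 0 <= M /\ forall a1 a2 b e o1 o2 o3 x,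
    box A B w (a1 + 2) (a2 + 2) b e o1 o2 o3 x ->
    box A B w (a1 + 2) (a2 + 2) b (e + 1) (o1 - Ci) (o2 + Ci) (o3 + Ci) x ->
    box A B w (a1 + 2) (a2 + 2) b (e + 1 + 1) (o1 - Ci - Ci) (o2 + Ci + Ci) (o3 + Ci + Ci) x ->
    Cmod (a1 + a2 + b + 2) <= S -> Cmod (a1 + a2 + b + 3) <= S ->
    Cmod (mb_integrand (a1 + 2) (a2 + 2) b (level2_fun a1 a2 b (psi f e o1 o2 o3)) x) * (1 + Cmod x) ^ 2 <= M.
Proof.
  intros Hf HA Hw.
  destruct (mb_uniform f A B w 2 Hf HA Hw) as (M0 & P0 & H0).
  destruct (mb_uniform f A B w 3 Hf HA Hw) as (M1 & P1 & H1).
  destruct (mb_uniform f A B w 4 Hf HA Hw) as (M2 & P2 & H2).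
  assert (PS := Rabs_pos S). assert (LS := Rle_abs S).
  set (s := Rabs S + 1). assert (Ps : 1 <= s) by (unfold s; lra).
  exists (M0 + (2 * s * M1 + s * s * M2)).
  split.
  { assert (0 <= s * M1) by (apply Rmult_le_pos; lra).
    assert (0 <= s * s * M2) by (repeat apply Rmult_le_pos; lra). lra. }
  intros a1 a2 b e o1 o2 o3 x X0 X1 X2 HS HS'.
  specialize (H0 _ _ _ _ _ _ _ _ X0). specialize (H1 _ _ _ _ _ _ _ _ X1). specialize (H2 _ _ _ _ _ _ _ _ X2).
  assert (Px := Cmod_ge_0 x).
  replace (mb_integrand (a1 + 2) (a2 + 2) b (level2_fun a1 a2 b (psi f e o1 o2 o3)) x) with
    (mb_integrand (a1 + 2) (a2 + 2) b (psi f e o1 o2 o3) x + (2 * (a1 + a2 + b + 2 - Ci * x) *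
     mb_integrand (a1 + 2) (a2 + 2) b (psi f (e + 1) (o1 - Ci) (o2 + Ci) (o3 + Ci)) x
     + (a1 + a2 + b + 3 - Ci * x) * (a1 + a2 + b + 2 - Ci * x) *
     mb_integrand (a1 + 2) (a2 + 2) b (psi f (e + 1 + 1) (o1 - Ci - Ci) (o2 + Ci + Ci) (o3 + Ci + Ci)) x))%C
    by (unfold mb_integrand, level2_fun; rewrite !psi_shift; ring).
  set (t0 := mb_integrand (a1 + 2) (a2 + 2) b (psi f e o1 o2 o3) x) in *.
  set (t1 := mb_integrand (a1 + 2) (a2 + 2) b (psi f (e + 1) (o1 - Ci) (o2 + Ci) (o3 + Ci)) x) in *.
  set (t2 := mb_integrand (a1 + 2) (a2 + 2) b (psi f (e + 1 + 1) (o1 - Ci - Ci) (o2 + Ci + Ci) (o3 + Ci + Ci)) x) in *.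
  assert (L := Cmod_affine_le _ (Rabs S) x (Rle_trans _ _ _ HS LS)).
  assert (L' := Cmod_affine_le _ (Rabs S) x (Rle_trans _ _ _ HS' LS)). fold s in L, L'.
  assert (Pt := Cmod_ge_0 t1). assert (Pt2 := Cmod_ge_0 t2). assert (Pq : 0 < (1 + Cmod x) ^ 2) by (apply pow_lt; lra).
  set (q := 1 + Cmod x) in *.
  apply Rle_trans with (Cmod t0 * q ^ 2 + (2 * s * (Cmod t1 * q ^ 3) + s * s * (Cmod t2 * q ^ 4))).
  - replace (2 * s * (Cmod t1 * q ^ 3) + s * s * (Cmod t2 * q ^ 4)) with
      ((2 * (s * q) * Cmod t1 + (s * q) * (s * q) * Cmod t2) * q ^ 2) by ring.
    rewrite <- Rmult_plus_distr_r. apply Rmult_le_compat_r; [lra|].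
    apply Cmod_plus_le; [apply Rle_refl|]. apply Cmod_plus_le.
    + apply Cmod_mult_le; [|apply Rle_refl]. apply Cmod_mult_le; [|exact L].
      change (RtoC 2) with (RtoC 2). rewrite Cmod_R, Rabs_pos_eq; lra.
    + apply Cmod_mult_le; [|apply Rle_refl]. apply Cmod_mult_le; assumption.
  - apply Rplus_le_compat; [exact H0|]. apply Rplus_le_compat.
    + apply Rmult_le_compat_l; [lra | exact H1].
    + apply Rmult_le_compat_l; [|exact H2]. apply Rmult_le_pos; lra.
Qed.

(* The contour has to move with [t1 + t2] for the arguments of [f] to stay in
   its tube while [Im t1], [Im t2] range over [-1, 1]. *)
Definition contour (y mu : R) (t1 t2 : C) : C := (Ci * RtoC y - RtoC mu * (t1 + t2))%C.

Lemma Im_contour (y mu : R) (t1 t2 : C) :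
  Im (contour y mu t1 t2) = y - (mu * Im t1 + mu * Im t2).
Proof. unfold contour. reim. ring. Qed.

Ltac hol_step := match goal with
  | |- hol (fun z => contour _ _ _ _) _ => unfold contour
  | |- hol (fun z => Cplus _ _) _ => apply hol_plus
  | |- hol (fun z => Cminus _ _) _ => apply hol_minus
  | |- hol (fun z => Copp _) _ => apply hol_opp
  | |- hol (fun z => Cmult _ _) _ => apply hol_mult
  | |- hol (fun z => Gamma _) _ => apply (hol_comp Gamma)
  | |- hol (fun z => rGamma _) _ => apply (hol_comp rGamma); [|apply rGamma_hol]
  | |- hol (fun z => z) _ => apply hol_id
  | |- hol (Cmult ?k) ?p => apply (hol_scal k (fun z => z) p), hol_id
  | |- hol (Cplus ?k) ?p => apply (hol_plus (fun _ => k) (fun z => z) p); [apply hol_const | apply hol_id]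
  | |- hol (Cminus ?k) ?p => apply (hol_minus (fun _ => k) (fun z => z) p); [apply hol_const | apply hol_id]
  | |- hol (contour ?y ?m ?t) ?p =>
      change (hol (fun z => Ci * RtoC y - RtoC m * (t + z))%C p)
  | |- hol (fun _ => ?k) _ => apply hol_const
  end.

Lemma decays_of_bound (h : C -> C) (c : C) (k M : R) :
  (forall t : R, hol h (RtoC t + c)%C) -> Cmod c <= k ->
  (forall t : R, Cmod (h (RtoC t + c)%C) * (1 + Cmod (RtoC t + c)) ^ 2 <= M) ->
  decays (fun t : R => h (RtoC t + c)%C) ((1 + k) * (1 + k) * M).
Proof.
  intros Hh Hk Hb. apply decays_hol; [exact Hh|].
  intros t. assert (W := weight_le t c k Hk).
  eapply Rle_trans; [apply Rmult_le_compat_l; [apply Cmod_ge_0 | exact W]|].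
  replace (Cmod (h (RtoC t + c)%C) * ((1 + k) * (1 + k) * (1 + Cmod (RtoC t + c)) ^ 2)) with
    ((1 + k) * (1 + k) * (Cmod (h (RtoC t + c)%C) * (1 + Cmod (RtoC t + c)) ^ 2)) by ring.
  apply Rmult_le_compat_l; [apply Rle_0_sqr | apply Hb].
Qed.

(** One continuation step suffices: [Re b = 1/2 + eps] is fixed, and at [Im t_j = -1] the raised
    parameters admit heights between 0 and [1/2 + eps]. *)
Definition contR (f : fun3) (g1 g2 : C) (mu : R) : fun3 := fun T t1 t2 =>
  level1 (contour (1 / 8) mu t1 t2) (- (Ci * t1)) (- (Ci * t2)) (half + Ci * g2)
    (psi f (half - Ci * T) (- g1) T (t1 + t2 - g2)).

(** Two steps, because [Re b = 1/2 - Im T] falls to [kap - 1/2 < 0] at [Im T = 1 - kap], while one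
    step demands a positive height at [Im t_j = -1]; two steps lower this demand to a height above
    -1. *)
Definition contL (f : fun3) (g1 g2 : C) (eps mu : R) : fun3 := fun T t1 t2 =>
  level2 (contour (-1 + eps) mu t1 t2) (- (Ci * t1)) (- (Ci * t2)) (half + Ci * T)
    (psi f (half - Ci * g2) (- g1) T (t1 + t2 - g2)).

Ltac hol_auto Hf :=
  repeat first [hol_step | match goal with |- hol (fun z => _ _ _ _) _ => apply (proj1 Hf) end].
(** At [t1 = t2 = - Ci] the height is [3/8 + eps], below the poles at [1/2 + eps]. At [t1 = t2 = Ci]
    it is [- 1/8 - eps], which keeps the third argument of [f], raised once by the continuation
    step, below 3. *)
Definition muR (eps : R) : R := (eps + 1 / 4) / 2.

Lemma contourR_bounds (eps kap : R) (t1 t2 : C) : 0 < eps < 1 / 2 -> 0 < kap < 1 / 2 ->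
  Rabs (Im t1) < 1 + eps * kap / 8 -> Rabs (Im t2) < 1 + eps * kap / 8 ->
  let y := Im (contour (1 / 8) (muR eps) t1 t2) in
  1 / 20 <= 1 + Im t1 + y /\ 1 / 20 <= 1 + Im t2 + y /\ 1 / 20 <= 1 / 2 + eps - y /\
  -1 < y < 1 /\ -3 + 1 / 20 <= Im t1 + Im t2 + eps + y <= 2 - 1 / 20 /\
  Rabs (Im t1) < 33 / 32 /\ Rabs (Im t2) < 33 / 32 /\
  y < 18 / 20.
Proof.
  intros He Hk H1 H2 y. unfold y. rewrite Im_contour.
  assert (D0 : eps * kap <= / 4) by nra.
  set (d := eps * kap / 8) in *. assert (Pd : 0 < d <= / 32) by (unfold d; nra).
  set (mu := muR eps). assert (Hmu : 2 * mu = eps + 1 / 4) by (unfold mu, muR; field).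
  assert (A1 := proj1 (Rabs_lt_between _ _) H1). assert (A2 := proj1 (Rabs_lt_between _ _) H2).
  (* Products of the bounds on [Im t1] and [Im t2] with [mu] and [1 - mu]; over these atoms the
     claims are linear. *)
  assert (Q1 : 0 <= mu * (1 + d + Im t1)) by (apply Rmult_le_pos; lra).
  assert (Q2 : 0 <= mu * (1 + d - Im t1)) by (apply Rmult_le_pos; lra).
  assert (Q3 : 0 <= mu * (1 + d + Im t2)) by (apply Rmult_le_pos; lra).
  assert (Q4 : 0 <= mu * (1 + d - Im t2)) by (apply Rmult_le_pos; lra).
  assert (Q5 : 0 <= (1 - mu) * (1 + d + Im t1)) by (apply Rmult_le_pos; lra).
  assert (Q6 : 0 <= (1 - mu) * (1 + d - Im t1)) by (apply Rmult_le_pos; lra).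
  assert (Q7 : 0 <= (1 - mu) * (1 + d + Im t2)) by (apply Rmult_le_pos; lra).
  assert (Q8 : 0 <= (1 - mu) * (1 + d - Im t2)) by (apply Rmult_le_pos; lra).
  assert (Q9 : 0 <= mu * d <= 3 / 8 * d) by (split; [apply Rmult_le_pos; lra | apply Rmult_le_compat_r; lra]).
  repeat split; lra.
Qed.

(** The tube asks for a height below [-1 + eps] at [t1 = t2 = Ci] and above it at [t1 = t2 = - Ci].
    A small positive slope about [-1 + eps] meets both, and [kap / 4] keeps the height below
    [kap - 1/2]. *)
Definition muL (kap : R) : R := kap / 4.

(** The enlargement [d] of the unit range is also the common margin: it is small against [eps],
    which measures the distance from the poles of the [a] Gammas, and against [kap], which measures
    the distance from the edge of the tube. *)
Lemma contourL_bounds (eps kap : R) (t1 t2 : C) : 0 < eps < 1 / 2 -> 0 < kap < 1 / 2 ->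
  Rabs (Im t1) < 1 + eps * kap / 8 -> Rabs (Im t2) < 1 + eps * kap / 8 ->
  let y := Im (contour (-1 + eps) (muL kap) t1 t2) in let d := eps * kap / 8 in
  0 < d /\ d < / 32 /\ d <= 2 + Im t1 + y /\ d <= 2 + Im t2 + y /\
  d <= 1 / 2 - (1 + d - kap) - y /\
  -5 / 4 - / 32 <= y <= 0 /\ - 3 / 2 < y - eps + 1 / 4 /\ y - eps - 1 / 4 <= 0 /\
  - (3 - d) <= Im t1 + Im t2 - eps + y <= 1 - d /\
  Rabs (Im t1) < 33 / 32 /\ Rabs (Im t2) < 33 / 32.
Proof.
  intros He Hk H1 H2 y. cbv zeta. unfold y. rewrite Im_contour.
  assert (D0 : eps * kap < / 4) by nra.
  assert (D1 : eps * kap < eps / 2) by nra. assert (D2 : eps * kap < kap / 2) by nra.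
  assert (D3 : 0 < eps * kap) by nra.
  set (d := eps * kap / 8) in *. assert (Pd : 0 < d < / 32) by (unfold d; lra).
  assert (Pd1 : d < eps / 16) by (unfold d; lra). assert (Pd2 : d < kap / 16) by (unfold d; lra).
  set (mu := muL kap). assert (Hmu : mu = kap / 4) by (unfold mu, muL; field).
  assert (A1 := proj1 (Rabs_lt_between _ _) H1). assert (A2 := proj1 (Rabs_lt_between _ _) H2).
  assert (Q1 : 0 <= mu * (1 + d + Im t1)) by (apply Rmult_le_pos; lra).
  assert (Q2 : 0 <= mu * (1 + d - Im t1)) by (apply Rmult_le_pos; lra).
  assert (Q3 : 0 <= mu * (1 + d + Im t2)) by (apply Rmult_le_pos; lra).
  assert (Q4 : 0 <= mu * (1 + d - Im t2)) by (apply Rmult_le_pos; lra).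
  assert (Q5 : 0 <= (1 - mu) * (1 + d + Im t1)) by (apply Rmult_le_pos; lra).
  assert (Q6 : 0 <= (1 - mu) * (1 + d - Im t1)) by (apply Rmult_le_pos; lra).
  assert (Q7 : 0 <= (1 - mu) * (1 + d + Im t2)) by (apply Rmult_le_pos; lra).
  assert (Q8 : 0 <= (1 - mu) * (1 + d - Im t2)) by (apply Rmult_le_pos; lra).
  assert (Q9 : 0 <= mu * d <= 1 / 8 * d) by (split; [apply Rmult_le_pos; lra | apply Rmult_le_compat_r; lra]).
  repeat split; lra.
Qed.

Lemma contR_regular (f : fun3) (g1 g2 : C) (eps kap : R) : tube_hol 3 f ->
  0 < eps < 1 / 2 -> 0 < kap < 1 / 2 -> Im g1 = eps -> Im g2 = - eps ->
  regular (1 + eps * kap / 8) (fun t11 t1 t2 => contR f g1 g2 (muR eps) (t11 - Ci * RtoC kap)%C t1 t2).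
Proof.
  intros Hf He Hk E1 E2.
  unfold contR, level1, mb_int. apply regular_line_int.
  - intros t11 t1 t2 t (T0 & T1 & T2).
    destruct (contourR_bounds eps kap t1 t2 He Hk T1 T2) as (B1 & B2 & B3 & B4 & B5 & B6 & B7 & B8).
    set (y := Im (contour (1 / 8) (muR eps) t1 t2)) in *.
    assert (T0' : Rabs (Im t11) < 33 / 32) by nra.
    apply Rabs_lt_between in T0', B6, B7.
    split; [|split]; unfold mb_integrand, level1_fun, psi; hol_auto Hf;
      try (apply Gamma_hol, nonpole_pos); try (split; [|split]); cbv beta;
      try (apply Rabs_def1); unfold half; reim; fold y; rewrite ?E1, ?E2; lra.
  - intros B.
    set (Bd := 20 + Rabs B + Cmod g1 + Cmod g2).
    destruct (level1_uniform f (1 / 20) Bd (3 - 1 / 20) (3 * Bd) Hf ltac:(lra) ltac:(lra)) as (M & PM & H).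
    exists ((1 + 3 * Bd) * (1 + 3 * Bd) * M).
    intros t11 t1 t2 (T0 & T1 & T2) R0 R1 R2.
    destruct (contourR_bounds eps kap t1 t2 He Hk T1 T2) as (B1 & B2 & B3 & B4 & B5 & B6 & B7 & B8).
    set (y := Im (contour (1 / 8) (muR eps) t1 t2)) in *.
    assert (T0' : Rabs (Im t11) < 33 / 32) by nra.
    assert (LB := Rle_abs B). assert (PB := Rabs_pos B).
    assert (G1 := Cmod_ge_0 g1). assert (G2 := Cmod_ge_0 g2). assert (I2 := re_le_Cmod g2).
    assert (C1 : Cmod t1 <= Rabs B + 2) by (eapply Rle_trans; [apply Cmod_le_abs | lra]).
    assert (C2 : Cmod t2 <= Rabs B + 2) by (eapply Rle_trans; [apply Cmod_le_abs | lra]).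
    assert (Hmu : 0 <= muR eps <= 1) by (unfold muR; lra).
    assert (Hc : Cmod (contour (1 / 8) (muR eps) t1 t2) <= 3 * Bd).
    { unfold contour, Cminus. eapply Rle_trans; [apply Cmod_triangle|].
      rewrite Cmod_opp, !Cmod_mult, Cmod_Ci, !Cmod_R, !Rabs_pos_eq by lra.
      assert (T := Cmod_triangle t1 t2). assert (P := Cmod_ge_0 (t1 + t2)).
      assert (muR eps * Cmod (t1 + t2) <= 1 * Cmod (t1 + t2)) by (apply Rmult_le_compat_r; lra).
      unfold Bd. lra. }
    assert (Hs : Cmod (- (Ci * t1) + - (Ci * t2) + (half + Ci * g2) + 1) <= 3 * Bd).
    { eapply Rle_trans; [repeat apply Cmod_plus_le; [| | |apply Rle_refl | apply Rle_refl]|].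
      - rewrite Cmod_opp, Cmod_mult, Cmod_Ci, Rmult_1_l. exact C1.
      - rewrite Cmod_opp, Cmod_mult, Cmod_Ci, Rmult_1_l. exact C2.
      - unfold half. rewrite Cmod_R, Rabs_pos_eq by lra. apply Rle_refl.
      - rewrite Cmod_mult, Cmod_Ci, Cmod_1, Rmult_1_l. unfold Bd. lra. }
    apply Rabs_lt_between in T0', B6, B7. apply Rabs_le_between in R0, R1, R2, I2.
    apply decays_of_bound; [|exact Hc|].
    + intros t. apply mb_hol.
      * repeat split; unfold half; reim; fold y; rewrite ?E1, ?E2; lra.
      * match goal with |- hol (level1_fun ?a ?b ?c ?P) ?p => change (hol (fun x => level1_fun a b c P x) p) end.
        unfold level1_fun, psi; hol_auto Hf; try (split; [|split]); cbv beta;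
          apply Rabs_def1; reim; fold y; rewrite ?E1, ?E2; lra.
    + intros t. apply H; [| |exact Hs].
      * repeat split; unfold half; try (apply Rabs_le); reim; fold y; rewrite ?E1, ?E2;
          try (rewrite Cmod_opp); unfold Bd; lra.
      * assert (Cmod (- g1 - Ci) <= 1 + Cmod g1).
        { eapply Rle_trans; [apply Cmod_triangle|]. rewrite !Cmod_opp, Cmod_Ci. lra. }
        repeat split; unfold half; try (apply Rabs_le); reim; fold y; rewrite ?E1, ?E2;
          unfold Bd; lra.
Qed.

Lemma contL_regular (f : fun3) (g1 g2 : C) (eps kap : R) : tube_hol 3 f ->
  0 < eps < 1 / 2 -> 0 < kap < 1 / 2 -> Im g1 = - eps -> Im g2 = eps ->
  regular (1 + eps * kap / 8) (fun t11 t1 t2 => contL f g1 g2 eps (muL kap) (t11 - Ci * RtoC kap)%C t1 t2).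
Proof.
  intros Hf He Hk E1 E2.
  unfold contL, level2, mb_int. apply regular_line_int.
  - intros t11 t1 t2 t (T0 & T1 & T2).
    destruct (contourL_bounds eps kap t1 t2 He Hk T1 T2) as (D1 & D2 & B1 & B2 & B3 & B4 & B5 & B5' & B8 & B6 & B7).
    set (d := eps * kap / 8) in *. apply Rabs_lt_between in T0.
    set (y := Im (contour (-1 + eps) (muL kap) t1 t2)) in *.
    apply Rabs_lt_between in B6, B7.
    split; [|split]; unfold mb_integrand, level2_fun, psi; hol_auto Hf;
      try (apply Gamma_hol, nonpole_pos); try (split; [|split]); cbv beta;
      try (apply Rabs_def1); unfold half; reim; fold y; rewrite ?E1, ?E2; lra.
  - intros B.
    set (Bd := 30 + Rabs B + Cmod g1 + Cmod g2).
    destruct (level2_uniform f (eps * kap / 8) Bd (3 - eps * kap / 8) (4 * Bd) Hf ltac:(nra) ltac:(nra)) as (M & PM & H).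
    exists ((1 + 4 * Bd) * (1 + 4 * Bd) * M).
    intros t11 t1 t2 (T0 & T1 & T2) R0 R1 R2.
    destruct (contourL_bounds eps kap t1 t2 He Hk T1 T2) as (D1 & D2 & B1 & B2 & B3 & B4 & B5 & B5' & B8 & B6 & B7).
    set (d := eps * kap / 8) in *. apply Rabs_lt_between in T0.
    set (y := Im (contour (-1 + eps) (muL kap) t1 t2)) in *.
    assert (LB := Rle_abs B). assert (PB := Rabs_pos B).
    assert (G1 := Cmod_ge_0 g1). assert (G2 := Cmod_ge_0 g2). assert (I2 := re_le_Cmod g2).
    assert (C1 : Cmod t1 <= Rabs B + 2) by (eapply Rle_trans; [apply Cmod_le_abs | lra]).
    assert (C2 : Cmod t2 <= Rabs B + 2) by (eapply Rle_trans; [apply Cmod_le_abs | lra]).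
    assert (Hmu : 0 <= muL kap <= 1) by (unfold muL; lra).
    assert (Hc : Cmod (contour (-1 + eps) (muL kap) t1 t2) <= 4 * Bd).
    { unfold contour, Cminus. eapply Rle_trans; [apply Cmod_triangle|].
      rewrite Cmod_opp, !Cmod_mult, Cmod_Ci, !Cmod_R, (Rabs_pos_eq (muL kap)) by lra.
      assert (Rabs (-1 + eps) <= 1) by (apply Rabs_le; lra).
      assert (T := Cmod_triangle t1 t2). assert (P := Cmod_ge_0 (t1 + t2)).
      assert (muL kap * Cmod (t1 + t2) <= 1 * Cmod (t1 + t2)) by (apply Rmult_le_compat_r; lra).
      unfold Bd. lra. }
    assert (C0 : Cmod (t11 - Ci * RtoC kap) <= Rabs B + 3).
    { eapply Rle_trans; [apply Cmod_le_abs|]. reim.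
      replace (Re t11 - - 0) with (Re t11) by ring.
      assert (Rabs (Im t11 - kap) <= 3) by (apply Rabs_le; lra). lra. }
    assert (Hs : forall k : R, 0 <= k <= 3 ->
      Cmod (- (Ci * t1) + - (Ci * t2) + (half + Ci * (t11 - Ci * RtoC kap)) + RtoC k) <= 4 * Bd).
    { intros k Hk'. eapply Rle_trans; [repeat apply Cmod_plus_le; [| | |apply Rle_refl | apply Rle_refl]|].
      - rewrite Cmod_opp, Cmod_mult, Cmod_Ci, Rmult_1_l. exact C1.
      - rewrite Cmod_opp, Cmod_mult, Cmod_Ci, Rmult_1_l. exact C2.
      - unfold half. rewrite Cmod_R, Rabs_pos_eq by lra. apply Rle_refl.
      - rewrite Cmod_mult, Cmod_Ci, Rmult_1_l, (Cmod_R k), (Rabs_pos_eq k) by lra. unfold Bd. lra. }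
    apply Rabs_lt_between in B6, B7. apply Rabs_le_between in R0, R1, R2, I2.
    apply decays_of_bound; [|exact Hc|].
    + intros t. apply mb_hol.
      * repeat split; unfold half; reim; fold y; rewrite ?E1, ?E2; lra.
      * match goal with |- hol (level2_fun ?a ?b ?c ?P) ?p => change (hol (fun x => level2_fun a b c P x) p) end.
        unfold level2_fun, psi; hol_auto Hf; try (split; [|split]); cbv beta;
          apply Rabs_def1; reim; fold y; rewrite ?E1, ?E2; lra.
    + intros t. apply H; [| | |apply (Hs 2); lra | apply (Hs 3); lra].
      * repeat split; unfold half; try (apply Rabs_le); reim; fold y; rewrite ?E1, ?E2;
          try (rewrite Cmod_opp); unfold Bd; lra.
      * assert (Cmod (- g1 - Ci) <= 1 + Cmod g1).
        { eapply Rle_trans; [apply Cmod_triangle|]. rewrite !Cmod_opp, Cmod_Ci. lra. }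
        repeat split; unfold half; try (apply Rabs_le); reim; fold y; rewrite ?E1, ?E2;
          unfold Bd; lra.
      * assert (Cmod (- g1 - Ci - Ci) <= 2 + Cmod g1).
        { eapply Rle_trans; [apply Cmod_triangle|]. rewrite Cmod_opp, Cmod_Ci.
          assert (T := Cmod_triangle (- g1) (- Ci)). rewrite !Cmod_opp, Cmod_Ci in T.
          change (- g1 + - Ci)%C with (- g1 - Ci)%C in T. lra. }
        repeat split; unfold half; try (apply Rabs_le); reim; fold y; rewrite ?E1, ?E2;
          unfold Bd; lra.
Qed.

(** * The Gauss-Givental operators on test functions *)

Lemma C_plus_minus (a b : C) : (a + b - b)%C = a. Proof. ring. Qed.
Lemma C_minus_plus (a b : C) : (a - b + b)%C = a. Proof. ring. Qed.

(** The four products of the commutator pair up by equal shifts of the arguments. In each pair one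
    coefficient changes by exactly 1 under the shift, so a single term remains. *)
Lemma GG13_eq (g1 g2 g3 : C) (f : fun3) (a b c : C) :
  GG g1 g2 g3 1 3 f a b c =
  ((Ci * a + half) * f (a - Ci) b c - (Ci * b + half) * f a (b - Ci) (c - Ci))%C.
Proof.
  cbn [GG]. unfold comm, GG12, GG23. rewrite C_plus_minus, C_minus_plus. ring [Ci_sq].
Qed.

Lemma GG31_eq (g1 g2 g3 : C) (f : fun3) (a b c : C) :
  GG g1 g2 g3 3 1 f a b c =
  ((Ci * (g2 - g1 - a) + half) * f (a + Ci) b c
   - (Ci * (g3 - g2 - c) + half) * f a (b + Ci) (c + Ci))%C.
Proof.
  cbn [GG]. unfold comm, GG32, GG21. rewrite C_plus_minus, C_minus_plus. ring [Ci_sq].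
Qed.


(** Here and below, [e] and [x] stay fixed and each shift of [f] moves an offset, so an operator
    acts by affine factors in [x]. *)
Lemma psi_GG12 (g1 g2 g3 : C) (f : fun3) (e o1 o2 o3 x : C) :
  psi (GG g1 g2 g3 1 2 f) e o1 o2 o3 x =
  ((Ci * (o2 + x) + half) * psi f e o1 (o2 - Ci) o3 x)%C.
Proof.
  unfold psi. cbn [GG]; unfold GG12.
  replace (o1 - x - Ci)%C with (o1 - Ci - x)%C by ring.
  replace (o1 - x + Ci)%C with (o1 + Ci - x)%C by ring.
  replace (o2 + x - Ci)%C with (o2 - Ci + x)%C by ring.
  replace (o2 + x + Ci)%C with (o2 + Ci + x)%C by ring.
  replace (o3 + x - Ci)%C with (o3 - Ci + x)%C by ring.
  replace (o3 + x + Ci)%C with (o3 + Ci + x)%C by ring.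
  ring.
Qed.

Lemma psi_GG23 (g1 g2 g3 : C) (f : fun3) (e o1 o2 o3 x : C) :
  psi (GG g1 g2 g3 2 3 f) e o1 o2 o3 x =
  ((Ci * (o1 - x) + half) * psi f e (o1 - Ci) (o2 + Ci) o3 x
   + (Ci * (o1 - o2 + o3 - x) + half) * psi f e o1 o2 (o3 - Ci) x)%C.
Proof.
  unfold psi. cbn [GG]; unfold GG23.
  replace (o1 - x - Ci)%C with (o1 - Ci - x)%C by ring.
  replace (o1 - x + Ci)%C with (o1 + Ci - x)%C by ring.
  replace (o2 + x - Ci)%C with (o2 - Ci + x)%C by ring.
  replace (o2 + x + Ci)%C with (o2 + Ci + x)%C by ring.
  replace (o3 + x - Ci)%C with (o3 - Ci + x)%C by ring.
  replace (o3 + x + Ci)%C with (o3 + Ci + x)%C by ring.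
  ring.
Qed.

Lemma psi_GG21 (g1 g2 g3 : C) (f : fun3) (e o1 o2 o3 x : C) :
  psi (GG g1 g2 g3 2 1 f) e o1 o2 o3 x =
  ((Ci * (g2 - g1 - o1 + x) + half) * psi f e (o1 + Ci) o2 (o3 - Ci) x
   + (Ci * (g2 - g1 - o1 - o2 + o3 + x) + half) * psi f e o1 (o2 + Ci) o3 x)%C.
Proof.
  unfold psi. cbn [GG]; unfold GG21.
  replace (o1 - x - Ci)%C with (o1 - Ci - x)%C by ring.
  replace (o1 - x + Ci)%C with (o1 + Ci - x)%C by ring.
  replace (o2 + x - Ci)%C with (o2 - Ci + x)%C by ring.
  replace (o2 + x + Ci)%C with (o2 + Ci + x)%C by ring.
  replace (o3 + x - Ci)%C with (o3 - Ci + x)%C by ring.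
  replace (o3 + x + Ci)%C with (o3 + Ci + x)%C by ring.
  ring.
Qed.

Lemma psi_GG32 (g1 g2 g3 : C) (f : fun3) (e o1 o2 o3 x : C) :
  psi (GG g1 g2 g3 3 2 f) e o1 o2 o3 x =
  ((Ci * (g3 - g2 - o3 - x) + half) * psi f e o1 o2 (o3 + Ci) x)%C.
Proof.
  unfold psi. cbn [GG]; unfold GG32.
  replace (o1 - x - Ci)%C with (o1 - Ci - x)%C by ring.
  replace (o1 - x + Ci)%C with (o1 + Ci - x)%C by ring.
  replace (o2 + x - Ci)%C with (o2 - Ci + x)%C by ring.
  replace (o2 + x + Ci)%C with (o2 + Ci + x)%C by ring.
  replace (o3 + x - Ci)%C with (o3 - Ci + x)%C by ring.
  replace (o3 + x + Ci)%C with (o3 + Ci + x)%C by ring.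
  ring.
Qed.

Lemma psi_GG13 (g1 g2 g3 : C) (f : fun3) (e o1 o2 o3 x : C) :
  psi (GG g1 g2 g3 1 3 f) e o1 o2 o3 x =
  ((Ci * (o1 - x) + half) * psi f e (o1 - Ci) o2 o3 x
   - (Ci * (o2 + x) + half) * psi f e o1 (o2 - Ci) (o3 - Ci) x)%C.
Proof.
  unfold psi. rewrite GG13_eq.
  replace (o1 - x - Ci)%C with (o1 - Ci - x)%C by ring.
  replace (o1 - x + Ci)%C with (o1 + Ci - x)%C by ring.
  replace (o2 + x - Ci)%C with (o2 - Ci + x)%C by ring.
  replace (o2 + x + Ci)%C with (o2 + Ci + x)%C by ring.
  replace (o3 + x - Ci)%C with (o3 - Ci + x)%C by ring.
  replace (o3 + x + Ci)%C with (o3 + Ci + x)%C by ring.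
  ring.
Qed.

Lemma psi_GG31 (g1 g2 g3 : C) (f : fun3) (e o1 o2 o3 x : C) :
  psi (GG g1 g2 g3 3 1 f) e o1 o2 o3 x =
  ((Ci * (g2 - g1 - o1 + x) + half) * psi f e (o1 + Ci) o2 o3 x
   - (Ci * (g3 - g2 - o3 - x) + half) * psi f e o1 (o2 + Ci) (o3 + Ci) x)%C.
Proof.
  unfold psi. rewrite GG31_eq.
  replace (o1 - x - Ci)%C with (o1 - Ci - x)%C by ring.
  replace (o1 - x + Ci)%C with (o1 + Ci - x)%C by ring.
  replace (o2 + x - Ci)%C with (o2 - Ci + x)%C by ring.
  replace (o2 + x + Ci)%C with (o2 + Ci + x)%C by ring.
  replace (o3 + x - Ci)%C with (o3 - Ci + x)%C by ring.
  replace (o3 + x + Ci)%C with (o3 + Ci + x)%C by ring.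
  ring.
Qed.

Lemma psi_GG11 (g1 g2 g3 : C) (f : fun3) (e o1 o2 o3 x : C) :
  psi (GG g1 g2 g3 1 1 f) e o1 o2 o3 x =
  (- Ci * (g1 + o1 + o2) * psi f e o1 o2 o3 x)%C.
Proof.
  unfold psi. cbn [GG].
  replace (o1 - x - Ci)%C with (o1 - Ci - x)%C by ring.
  replace (o1 - x + Ci)%C with (o1 + Ci - x)%C by ring.
  replace (o2 + x - Ci)%C with (o2 - Ci + x)%C by ring.
  replace (o2 + x + Ci)%C with (o2 + Ci + x)%C by ring.
  replace (o3 + x - Ci)%C with (o3 - Ci + x)%C by ring.
  replace (o3 + x + Ci)%C with (o3 + Ci + x)%C by ring.
  ring.
Qed.

Lemma psi_GG22 (g1 g2 g3 : C) (f : fun3) (e o1 o2 o3 x : C) :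
  psi (GG g1 g2 g3 2 2 f) e o1 o2 o3 x =
  (Ci * (- g2 + o2 - o3) * psi f e o1 o2 o3 x)%C.
Proof.
  unfold psi. cbn [GG].
  replace (o1 - x - Ci)%C with (o1 - Ci - x)%C by ring.
  replace (o1 - x + Ci)%C with (o1 + Ci - x)%C by ring.
  replace (o2 + x - Ci)%C with (o2 - Ci + x)%C by ring.
  replace (o2 + x + Ci)%C with (o2 + Ci + x)%C by ring.
  replace (o3 + x - Ci)%C with (o3 - Ci + x)%C by ring.
  replace (o3 + x + Ci)%C with (o3 + Ci + x)%C by ring.
  ring.
Qed.

Lemma psi_GG33 (g1 g2 g3 : C) (f : fun3) (e o1 o2 o3 x : C) :
  psi (GG g1 g2 g3 3 3 f) e o1 o2 o3 x =
  (Ci * (- g3 + o1 + o3) * psi f e o1 o2 o3 x)%C.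
Proof.
  unfold psi. cbn [GG].
  replace (o1 - x - Ci)%C with (o1 - Ci - x)%C by ring.
  replace (o1 - x + Ci)%C with (o1 + Ci - x)%C by ring.
  replace (o2 + x - Ci)%C with (o2 - Ci + x)%C by ring.
  replace (o2 + x + Ci)%C with (o2 + Ci + x)%C by ring.
  replace (o3 + x - Ci)%C with (o3 - Ci + x)%C by ring.
  replace (o3 + x + Ci)%C with (o3 + Ci + x)%C by ring.
  ring.
Qed.

Lemma psi_test (f : fun3) (e o1 o2 o3 : C) (lo hi : R) : tube_hol 3 f ->
  Im o1 - 3 <= lo -> hi <= Im o1 + 3 -> - 3 - Im o2 <= lo -> hi <= 3 - Im o2 ->
  - 3 - Im o3 <= lo -> hi <= 3 - Im o3 -> test lo hi (psi f e o1 o2 o3).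
Proof. exact (test_tube 3 f e o1 o2 o3 lo hi). Qed.

Lemma test_minus (lo hi : R) (Phi Psi : C -> C) :
  test lo hi Phi -> test lo hi Psi -> test lo hi (fun x => Phi x - Psi x)%C.
Proof.
  intros H1 H2. apply test_ext with (fun x => Phi x + - (1) * Psi x)%C; [intros; ring|].
  apply test_plus; [exact H1 | apply test_scal, H2].
Qed.

Ltac solve_affine := match goal with |- affine ?q =>
  exists (q 0), (q 1 - q 0)%C; intros x; cbv beta; ring end.

(** The widths add up to that of the tube: offsets up to 1/2, operator shifts up to 1, and the strip
    3/2. *)
Lemma GG_test (f : fun3) (g1 g2 g3 : C) (i j : nat) (e o1 o2 o3 : C) : tube_hol 3 f ->
  (1 <= i <= 3)%nat -> (1 <= j <= 3)%nat ->
  Rabs (Im o1) <= 1 / 2 -> Rabs (Im o2) <= 1 / 2 -> Rabs (Im o3) <= 1 / 2 ->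
  test (- (3 / 2)) (3 / 2) (psi (GG g1 g2 g3 i j f) e o1 o2 o3).
Proof.
  intros Hf Hi Hj H1 H2 H3. apply Rabs_le_between in H1, H2, H3.
  destruct i as [|[|[|[|i]]]]; try lia; destruct j as [|[|[|[|j]]]]; try lia;
    (eapply test_ext; [intros x; symmetry;
      first [apply psi_GG11 | apply psi_GG12 | apply psi_GG13 | apply psi_GG21 | apply psi_GG22
        | apply psi_GG23 | apply psi_GG31 | apply psi_GG32 | apply psi_GG33] | cbv beta]);
    repeat first [apply test_minus | apply test_plus];
    (apply test_affine_mult; [solve_affine | apply psi_test; try exact Hf; reim; lra]).
Qed.

(** * Prefactor and intertwining relations for B_R *)

Lemma Cexp_lower (T : C) : Cexp (RtoC PI * T / 2) = (Ci * Cexp (RtoC PI * (T - Ci) / 2))%C.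
Proof.
  assert (E : Cexp (Ci * RtoC (PI / 2)) = Ci).
  { unfold Cexp. rewrite Re_Ci_mult, Im_Ci_mult. cbn [Re Im RtoC fst snd].
    rewrite Ropp_0, exp_0, cos_PI2, sin_PI2. unfold Ci. f_equal; ring. }
  rewrite <- E at 1. rewrite <- Cexp_plus. f_equal.
  rewrite RtoC_div by lra. field.
Qed.

(** The factors of [KR] free of the integration variable, in terms of [T]; the remaining ones form
    the integrand together with [f]. *)
Definition preR (g3 : C) : fun3 := fun T t1 t2 =>
  (RtoC (1 / (2 * PI)) * (Cexp (RtoC PI * T / 2) * rGamma (Ci * t1 - Ci * t2))
   * (Gamma (Ci * (t1 - T) + half) * Gamma (Ci * (g3 - t1) + half)
      * (Gamma (Ci * (t2 - T) + half) * Gamma (Ci * (g3 - t2) + half))))%C.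

(** The difference equations of the prefactor come from the Gamma recursion; the hypotheses avoid
    its argument 0, where [Gamma 0 = 0] would contradict [Gamma 1 = 1]. *)
Lemma preR_T (g3 T t1 t2 : C) :
  (Ci * (t1 - T) + half - 1 <> 0)%C -> (Ci * (t2 - T) + half - 1 <> 0)%C ->
  preR g3 T t1 t2 = (Ci * (Ci * (t1 - T) + half - 1) * (Ci * (t2 - T) + half - 1)
    * preR g3 (T - Ci) t1 t2)%C.
Proof.
  intros H1 H2. unfold preR. rewrite (Cexp_lower T).
  replace (Ci * (t1 - (T - Ci)) + half)%C with (Ci * (t1 - T) + half - 1)%C by ring [Ci_sq].
  replace (Ci * (t2 - (T - Ci)) + half)%C with (Ci * (t2 - T) + half - 1)%C by ring [Ci_sq].
  rewrite <- (C_minus_plus (Ci * (t1 - T) + half) 1) at 1. rewrite (Gamma_rec _ H1).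
  rewrite <- (C_minus_plus (Ci * (t2 - T) + half) 1) at 1. rewrite (Gamma_rec _ H2).
  ring.
Qed.

Lemma preR_t1 (g3 T t1 t2 : C) :
  (Ci * (t1 - T) + half <> 0)%C -> (Ci * (g3 - t1) + half - 1 <> 0)%C ->
  ((Ci * t1 - Ci * t2) * (Ci * (g3 - t1) + half - 1) * preR g3 T (t1 - Ci) t2
   = (Ci * (t1 - T) + half) * preR g3 T t1 t2)%C.
Proof.
  intros H1 H2. unfold preR.
  replace (Ci * (t1 - Ci) - Ci * t2)%C with (Ci * t1 - Ci * t2 + 1)%C by ring [Ci_sq].
  replace (Ci * (t1 - Ci - T) + half)%C with (Ci * (t1 - T) + half + 1)%C by ring [Ci_sq].
  replace (Ci * (g3 - (t1 - Ci)) + half)%C with (Ci * (g3 - t1) + half - 1)%C by ring [Ci_sq].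
  rewrite (Gamma_rec _ H1), (rGamma_rec (Ci * t1 - Ci * t2)).
  rewrite <- (C_minus_plus (Ci * (g3 - t1) + half) 1) at 3. rewrite (Gamma_rec _ H2).
  ring.
Qed.

Lemma preR_t2 (g3 T t1 t2 : C) :
  (Ci * (t2 - T) + half <> 0)%C -> (Ci * (g3 - t2) + half - 1 <> 0)%C ->
  ((Ci * (g3 - t2) + half - 1) * preR g3 T t1 (t2 - Ci)
   = (Ci * t1 - Ci * t2 - 1) * (Ci * (t2 - T) + half) * preR g3 T t1 t2)%C.
Proof.
  intros H1 H2. unfold preR.
  replace (Ci * t1 - Ci * (t2 - Ci))%C with (Ci * t1 - Ci * t2 - 1)%C by ring [Ci_sq].
  replace (Ci * (t2 - Ci - T) + half)%C with (Ci * (t2 - T) + half + 1)%C by ring [Ci_sq].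
  replace (Ci * (g3 - (t2 - Ci)) + half)%C with (Ci * (g3 - t2) + half - 1)%C by ring [Ci_sq].
  rewrite (Gamma_rec _ H1), (rGamma_rec (Ci * t1 - Ci * t2 - 1)), C_minus_plus.
  rewrite <- (C_minus_plus (Ci * (g3 - t2) + half) 1) at 3. rewrite (Gamma_rec _ H2).
  ring.
Qed.

(** Dividing by [(a1 + b) (a2 + b)] undoes the normalisation of [level1]. The zeros of the divisor
    lie at [Im t_j = - 1/2 - eps], strictly between -1 and 0. *)
Definition valR (f : fun3) (g1 g2 g3 : C) (mu : R) : fun3 := fun T t1 t2 =>
  (preR g3 T t1 t2 * contR f g1 g2 mu T t1 t2
   / ((Ci * (g2 - t1) + half) * (Ci * (g2 - t2) + half)))%C.

(** At the points met in the relations, the contour depending on [tau] can be replaced by the height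
    [kap] of the kernel. [hi] is the height up to which the arguments of [f] stay in the tube. *)
Lemma contR_level1 (f : fun3) (g1 g2 : C) (eps kap : R) (c T t1 t2 : C) :
  tube_hol 3 f -> 0 < eps < 1 / 2 -> 0 < kap < 1 / 2 -> Im g1 = eps -> Im g2 = - eps ->
  Im c = kap -> - kap - 1 <= Im T <= 1 - kap -> -1 <= Im t1 <= 1 -> -1 <= Im t2 <= 1 ->
  -1 <= Im t1 + Im t2 <= 1 ->
  exists hi, kap + 1 < hi /\
    test (- (3 / 2)) hi (psi f (half - Ci * T) (- g1) T (t1 + t2 - g2)) /\
    contR f g1 g2 (muR eps) T t1 t2 =
      level1 c (- (Ci * t1)) (- (Ci * t2)) (half + Ci * g2)
        (psi f (half - Ci * T) (- g1) T (t1 + t2 - g2)).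
Proof.
  intros Hf He Hk E1 E2 Ec HT H1 H2 H12.
  set (hi := Rmin (3 - eps) (Rmin (3 - Im T) (3 - (Im t1 + Im t2 + eps)))).
  assert (L1 : hi <= 3 - eps) by apply Rmin_l.
  assert (L23 : hi <= Rmin (3 - Im T) (3 - (Im t1 + Im t2 + eps))) by apply Rmin_r.
  assert (L2 := Rle_trans _ _ _ L23 (Rmin_l _ _)). assert (L3 := Rle_trans _ _ _ L23 (Rmin_r _ _)).
  assert (G : forall y, y < 3 - eps -> y < 3 - Im T -> y < 3 - (Im t1 + Im t2 + eps) -> y < hi).
  { intros y K1 K2 K3. repeat apply Rmin_glb_lt; assumption. }
  clearbody hi.
  assert (Ht : test (- (3 / 2)) hi (psi f (half - Ci * T) (- g1) T (t1 + t2 - g2))).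
  { apply psi_test; try exact Hf; reim; rewrite ?E1, ?E2; lra. }
  exists hi. split; [apply G; lra|]. split; [exact Ht|].
  assert (P : 0 < eps * kap) by nra.
  destruct (contourR_bounds eps kap t1 t2 He Hk) as (B1 & B2 & B3 & B4 & B5 & B6 & B7 & B8);
    [apply Rabs_def1; lra ..|].
  assert (K1 : kap + 1 < hi) by (apply G; lra).
  assert (K2 : Im (contour (1 / 8) (muR eps) t1 t2) + 1 < hi) by (apply G; lra).
  unfold contR. apply level1_move with (- (3 / 2)) hi; [exact Ht | lra | lra | |];
    repeat split; unfold half; reim; rewrite ?Ec, ?E2; lra.
Qed.

Definition paramsR (f : fun3) (g1 g2 g3 : C) (eps kap : R) : Prop :=
  tube_hol 3 f /\ 0 < eps < 1 / 2 /\ 0 < kap < 1 / 2 /\ Im g1 = eps /\ Im g2 = - eps /\ Im g3 = 0.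

Lemma valR_0 (f : fun3) (g1 g2 g3 : C) (eps kap : R) (c T t1 t2 : C) :
  paramsR f g1 g2 g3 eps kap -> Im c = kap -> - kap - 1 <= Im T <= 1 - kap ->
  0 <= Im t1 -> 0 <= Im t2 -> Im t1 + Im t2 <= 1 ->
  valR f g1 g2 g3 (muR eps) T t1 t2 =
  (preR g3 T t1 t2 * mb_int c (- (Ci * t1)) (- (Ci * t2)) (half + Ci * g2)
     (psi f (half - Ci * T) (- g1) T (t1 + t2 - g2)))%C.
Proof.
  intros (Hf & He & Hk & E1 & E2 & E3) Ec HT H1 H2 H12.
  destruct (contR_level1 f g1 g2 eps kap c T t1 t2) as (hi & Hhi & Ht & E); try assumption; try lra.
  unfold valR. rewrite E, (level1_of_0 (- (3 / 2)) hi); try exact Ht; try lra.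
  - field. split; apply C_neq_0_Re; unfold half; reim; rewrite E2; lra.
  - repeat split; unfold half; reim; rewrite ?Ec, ?E2; lra.
Qed.

(** At [t1 - Ci] the unraised integral has no contour, which would have to pass above 1 and below
    [1/2 + eps]. The step in [a1] is kept, and the factor belonging to [a2] cancels. *)
Lemma valR_1 (f : fun3) (g1 g2 g3 : C) (eps kap : R) (c T t1 t2 : C) :
  paramsR f g1 g2 g3 eps kap -> Im c = kap -> - kap - 1 <= Im T <= 1 - kap ->
  Im t1 = 0 -> Im t2 = 0 ->
  ((Ci * (g2 - t1) + half - 1) * valR f g1 g2 g3 (muR eps) T (t1 - Ci) t2 =
   preR g3 T (t1 - Ci) t2 *
     (mb_int c (- (Ci * t1)) (- (Ci * t2)) (half + Ci * g2)
        (psi f (half - Ci * T) (- g1) T (t1 + t2 - g2 - Ci))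
      + mb_int c (- (Ci * t1)) (- (Ci * t2) + 1) (half + Ci * g2)
        (fun x => psi f (half - Ci * T) (- g1) T (t1 + t2 - g2 - Ci) (x + Ci))))%C.
Proof.
  intros (Hf & He & Hk & E1 & E2 & E3) Ec HT H1 H2.
  destruct (contR_level1 f g1 g2 eps kap c T (t1 - Ci) t2) as (hi & Hhi & Ht & E);
    try assumption; try (reim; lra).
  assert (A : (- (Ci * (t1 - Ci)) = - (Ci * t1) - 1)%C) by ring [Ci_sq].
  assert (O : (t1 - Ci + t2 - g2 = t1 + t2 - g2 - Ci)%C) by ring.
  rewrite O in Ht. unfold valR. rewrite E, O, A, (level1_of_10 (- (3 / 2)) hi); try exact Ht; try lra.
  - rewrite C_minus_plus.
    replace (Ci * (g2 - (t1 - Ci)) + half)%C with (Ci * (g2 - t1) + half - 1)%C by ring [Ci_sq].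
    field. split; apply C_neq_0_Re; unfold half; reim; rewrite ?H1, ?H2, E2; lra.
  - rewrite C_minus_plus. repeat split; unfold half; reim; rewrite ?Ec, ?E2; lra.
Qed.

Lemma valR_2 (f : fun3) (g1 g2 g3 : C) (eps kap : R) (c T t1 t2 : C) :
  paramsR f g1 g2 g3 eps kap -> Im c = kap -> - kap - 1 <= Im T <= 1 - kap ->
  Im t1 = 0 -> Im t2 = 0 ->
  ((Ci * (g2 - t2) + half - 1) * valR f g1 g2 g3 (muR eps) T t1 (t2 - Ci) =
   preR g3 T t1 (t2 - Ci) *
     (mb_int c (- (Ci * t1)) (- (Ci * t2)) (half + Ci * g2)
        (psi f (half - Ci * T) (- g1) T (t1 + t2 - g2 - Ci))
      + mb_int c (- (Ci * t1) + 1) (- (Ci * t2)) (half + Ci * g2)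
        (fun x => psi f (half - Ci * T) (- g1) T (t1 + t2 - g2 - Ci) (x + Ci))))%C.
Proof.
  intros (Hf & He & Hk & E1 & E2 & E3) Ec HT H1 H2.
  destruct (contR_level1 f g1 g2 eps kap c T t1 (t2 - Ci)) as (hi & Hhi & Ht & E);
    try assumption; try (reim; lra).
  assert (A : (- (Ci * (t2 - Ci)) = - (Ci * t2) - 1)%C) by ring [Ci_sq].
  assert (O : (t1 + (t2 - Ci) - g2 = t1 + t2 - g2 - Ci)%C) by ring.
  rewrite O in Ht. unfold valR.
  rewrite E, O, A, level1_swap, (level1_of_10 (- (3 / 2)) hi); try exact Ht; try lra.
  - rewrite C_minus_plus, (mb_swap c (- (Ci * t2)) (- (Ci * t1))), (mb_swap c (- (Ci * t2)) (- (Ci * t1) + 1)).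
    replace (Ci * (g2 - (t2 - Ci)) + half)%C with (Ci * (g2 - t2) + half - 1)%C by ring [Ci_sq].
    field. split; apply C_neq_0_Re; unfold half; reim; rewrite ?H1, ?H2, E2; lra.
  - rewrite C_minus_plus. repeat split; unfold half; reim; rewrite ?Ec, ?E2; lra.
Qed.

Lemma preR_T_up (g3 T t1 t2 : C) :
  (Ci * (t1 - T) + half <> 0)%C -> (Ci * (t2 - T) + half <> 0)%C ->
  (preR g3 (T + Ci) t1 t2 = Ci * (Ci * (t1 - T) + half) * (Ci * (t2 - T) + half) * preR g3 T t1 t2)%C.
Proof.
  intros H1 H2.
  assert (A1 : (Ci * (t1 - (T + Ci)) + half - 1 = Ci * (t1 - T) + half)%C) by ring [Ci_sq].
  assert (A2 : (Ci * (t2 - (T + Ci)) + half - 1 = Ci * (t2 - T) + half)%C) by ring [Ci_sq].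
  rewrite (preR_T g3 (T + Ci)%C), A1, A2, C_plus_minus; [reflexivity | rewrite A1 | rewrite A2]; assumption.
Qed.

Lemma preR_t1_up (g3 T t1 t2 : C) :
  (Ci * (t1 - T) + half - 1 <> 0)%C -> (Ci * (g3 - t1) + half <> 0)%C ->
  ((Ci * (t1 - T) + half - 1) * preR g3 T (t1 + Ci) t2
   = (Ci * t1 - Ci * t2 - 1) * (Ci * (g3 - t1) + half) * preR g3 T t1 t2)%C.
Proof.
  intros H1 H2.
  assert (A1 : (Ci * (t1 + Ci - T) + half = Ci * (t1 - T) + half - 1)%C) by ring [Ci_sq].
  assert (A2 : (Ci * (g3 - (t1 + Ci)) + half - 1 = Ci * (g3 - t1) + half)%C) by ring [Ci_sq].
  assert (A3 : (Ci * (t1 + Ci) - Ci * t2 = Ci * t1 - Ci * t2 - 1)%C) by ring [Ci_sq].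
  assert (Q := preR_t1 g3 T (t1 + Ci)%C t2). rewrite A1, A2, A3, C_plus_minus in Q.
  symmetry. auto.
Qed.

Lemma preR_t2_up (g3 T t1 t2 : C) :
  (Ci * (t2 - T) + half - 1 <> 0)%C -> (Ci * (g3 - t2) + half <> 0)%C ->
  ((Ci * t1 - Ci * t2) * (Ci * (t2 - T) + half - 1) * preR g3 T t1 (t2 + Ci)
   = (Ci * (g3 - t2) + half) * preR g3 T t1 t2)%C.
Proof.
  intros H1 H2.
  assert (A1 : (Ci * (t2 + Ci - T) + half = Ci * (t2 - T) + half - 1)%C) by ring [Ci_sq].
  assert (A2 : (Ci * (g3 - (t2 + Ci)) + half - 1 = Ci * (g3 - t2) + half)%C) by ring [Ci_sq].
  assert (A3 : (Ci * t1 - Ci * (t2 + Ci) - 1 = Ci * t1 - Ci * t2)%C) by ring [Ci_sq].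
  assert (Q := preR_t2 g3 T t1 (t2 + Ci)%C). rewrite A1, A2, A3, C_plus_minus in Q.
  symmetry. auto.
Qed.

Lemma half_eq : half = (/ 2)%C.
Proof. unfold half. rewrite RtoC_div by lra. field. Qed.

Ltac cfield := rewrite ?half_eq; field [Ci_sq].

Lemma psi_ext (f : fun3) (e o1 o2 o3 e' o1' o2' o3' x : C) :
  e = e' -> o1 = o1' -> o2 = o2' -> o3 = o3' -> psi f e o1 o2 o3 x = psi f e' o1' o2' o3' x.
Proof. intros -> -> -> ->. reflexivity. Qed.

Lemma div_of_eq (a b c : C) : a <> 0 -> (a * b = c)%C -> b = (c / a)%C.
Proof. intros H <-. field. exact H. Qed.

(* The intertwining relation at [T = tau_11 - i kap]: [V] is the continuation of
   B f, and [pre] times the Mellin-Barnes integral is the value of B. *)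
Definition relates (g1 g2 g3 : C) (f : fun3) (pre V : fun3) (c T t1 t2 b e : C) (i j : nat) : Prop :=
  GT g1 g2 g3 i j V T t1 t2 =
  (pre T t1 t2 * mb_int c (- (Ci * t1)) (- (Ci * t2)) b
     (psi (GG g1 g2 g3 i j f) e (- g1) T (t1 + t2 - g2)))%C.

Definition generic (c T t1 t2 : C) (y kap : R) : Prop :=
  Im c = y /\ Im T = - kap /\ Im t1 = 0 /\ Im t2 = 0 /\ t1 <> t2.

Lemma generic_neq (c T t1 t2 : C) (y kap : R) : generic c T t1 t2 y kap ->
  (Ci * t1 - Ci * t2 <> 0)%C /\ (t1 - t2 <> 0)%C /\ (t2 - t1 <> 0)%C /\
  (- (Ci * t1) - - (Ci * t2) <> 0)%C /\ (- (Ci * t2) - - (Ci * t1) <> 0)%C /\ Ci <> 0.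
Proof.
  intros (_ & _ & H1 & H2 & H).
  assert (K : Ci <> 0) by (intros E; apply (f_equal Im) in E; cbn in E; lra).
  assert (K1 : (t1 - t2 <> 0)%C) by (intros E; apply H, Cminus_diag_uniq, E).
  assert (K2 : (t2 - t1 <> 0)%C) by (intros E; apply H; symmetry; apply Cminus_diag_uniq, E).
  repeat split; try assumption.
  - replace (Ci * t1 - Ci * t2)%C with (Ci * (t1 - t2))%C by ring. apply Cmult_neq_0'; assumption.
  - replace (- (Ci * t1) - - (Ci * t2))%C with (Ci * (t2 - t1))%C by ring. apply Cmult_neq_0'; assumption.
  - replace (- (Ci * t2) - - (Ci * t1))%C with (Ci * (t1 - t2))%C by ring. apply Cmult_neq_0'; assumption.
Qed.

Ltac nz := cbv beta; apply C_neq_0_Re; unfold half; reim;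
  repeat match goal with H : Im _ = _ |- _ => rewrite H end; lra.
Ltac nzs := cbv beta; repeat (apply Cmult_neq_0' || split); first [assumption | nz].
Ltac separate := repeat split; unfold half; reim;
  repeat match goal with H : Im _ = _ |- _ => rewrite H end; lra.

Lemma relR_12 f g1 g2 g3 eps kap c T t1 t2 : paramsR f g1 g2 g3 eps kap -> generic c T t1 t2 kap kap ->
  relates g1 g2 g3 f (preR g3) (valR f g1 g2 g3 (muR eps)) c T t1 t2 (half + Ci * g2) (half - Ci * T) 1 2.
Proof.
  intros HP HG. assert (HP' := HP). destruct HP' as (Hf & He & Hk & E1 & E2 & E3).
  destruct HG as (Ec & ET & H1 & H2 & _).
  unfold relates. cbn [GT]. unfold GT12.
  rewrite (valR_0 f g1 g2 g3 eps kap c) by (first [assumption | reim; lra]).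
  rewrite (preR_T g3 T t1 t2) by nz.
  assert (Ht : test (-3/2) (3/2) (psi f (half - Ci * (T - Ci)) (- g1) (T - Ci) (t1 + t2 - g2))).
  { apply psi_test; try exact Hf; reim; lra. }
  (* The coefficient [Ci s21 + 1/2] is minus the factor that the recursion of 1/Gamma yields when
     [T] is lowered by [Ci]. *)
  assert (E : mb_int c (- (Ci * t1)) (- (Ci * t2)) (half + Ci * g2) (psi (GG g1 g2 g3 1 2 f) (half - Ci * T) (- g1) T (t1 + t2 - g2))
    = (- (1) * mb_int c (- (Ci * t1)) (- (Ci * t2)) (half + Ci * g2) (psi f (half - Ci * (T - Ci)) (- g1) (T - Ci) (t1 + t2 - g2)))%C).
  { rewrite <- (mb_scal (-3/2) (3/2)).
    - apply mb_ext. intros x _. unfold mb_integrand. rewrite psi_GG12, (psi_lower f (half - Ci * (T - Ci))%C).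
      replace (half - Ci * (T - Ci) + 1)%C with (half - Ci * T)%C by ring [Ci_sq].
      cfield.
    - exact Ht.
    - lra.
    - repeat split; unfold half; reim; lra. }
  rewrite E. cfield.
Qed.

Lemma mb_scal_psi (c a1 a2 b k e o1 o2 o3 : C) (f h : fun3) :
  test (-3 / 2) (3 / 2) (psi f e o1 o2 o3) -> -3 / 2 < Im c < 3 / 2 -> separates (Im c) a1 a2 b ->
  (forall x, psi h e o1 o2 o3 x = (k * psi f e o1 o2 o3 x)%C) ->
  mb_int c a1 a2 b (psi h e o1 o2 o3) = (k * mb_int c a1 a2 b (psi f e o1 o2 o3))%C.
Proof.
  intros Ht Hc Hs E. rewrite <- (mb_scal (-3 / 2) (3 / 2)) by assumption.
  apply mb_ext. intros x _. unfold mb_integrand. rewrite E. ring.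
Qed.

(** On the support of the delta-functions the diagonal coefficients do not depend on [x]:
    [s11 + s21], [s11 + s22] and [s21 - s22] are fixed by [tau]. *)
Lemma relates_diag (f : fun3) (g1 g2 g3 : C) (pre V : fun3) (c T t1 t2 b e : C) (i : nat) :
  tube_hol 3 f -> (1 <= i <= 3)%nat -> Rabs (Im g1) <= 1 / 2 -> Rabs (Im T) <= 1 / 2 ->
  Rabs (Im (t1 + t2 - g2)) <= 1 / 2 -> -3 / 2 < Im c < 3 / 2 ->
  separates (Im c) (- (Ci * t1)) (- (Ci * t2)) b ->
  V T t1 t2 = (pre T t1 t2 * mb_int c (- (Ci * t1)) (- (Ci * t2)) b (psi f e (- g1) T (t1 + t2 - g2)))%C ->
  relates g1 g2 g3 f pre V c T t1 t2 b e i i.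
Proof.
  intros Hf Hi K1 K2 K3 Hc Hs HV. apply Rabs_le_between in K1, K2, K3.
  assert (Ht : test (-3 / 2) (3 / 2) (psi f e (- g1) T (t1 + t2 - g2))).
  { apply psi_test; try exact Hf; try (rewrite Im_opp); lra. }
  unfold relates. destruct i as [|[|[|[|i]]]]; try lia; cbn [GT]; rewrite HV.
  - rewrite (mb_scal_psi _ _ _ _ (- Ci * T) _ _ _ _ f (GG g1 g2 g3 1 1 f) Ht Hc Hs); [ring|].
    intros x. rewrite psi_GG11. ring.
  - rewrite (mb_scal_psi _ _ _ _ (Ci * T - Ci * (t1 + t2)) _ _ _ _ f (GG g1 g2 g3 2 2 f) Ht Hc Hs); [ring|].
    intros x. rewrite psi_GG22. ring.
  - rewrite (mb_scal_psi _ _ _ _ (Ci * (t1 + t2) - Ci * (g1 + g2 + g3)) _ _ _ _ f (GG g1 g2 g3 3 3 f) Ht Hc Hs); [ring|].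
    intros x. rewrite psi_GG33. ring.
Qed.

(** Up to affine factors, both terms of the Gauss-Givental operator are values, at [x] and [x + Ci],
    of the one test function fed to [rel21R], which turns their sum into a single integral. *)
Lemma relR_21 f g1 g2 g3 eps kap c T t1 t2 : paramsR f g1 g2 g3 eps kap -> generic c T t1 t2 kap kap ->
  relates g1 g2 g3 f (preR g3) (valR f g1 g2 g3 (muR eps)) c T t1 t2 (half + Ci * g2) (half - Ci * T) 2 1.
Proof.
  intros HP HG. assert (HP' := HP). destruct HP' as (Hf & He & Hk & E1 & E2 & E3).
  destruct HG as (Ec & ET & H1 & H2 & _).
  unfold relates. cbn [GT]. unfold GT21.
  rewrite (valR_0 f g1 g2 g3 eps kap c) by (first [assumption | reim; lra]).
  rewrite (preR_T g3 (T + Ci) t1 t2), C_plus_minus by nz.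
  assert (R := rel21R (-3/2) (3/2) c (- (Ci * t1)) (- (Ci * t2)) (half + Ci * g2) (half - Ci * T)
    (psi f (half - Ci * T) (- g1 + Ci) T (t1 + t2 - g2 - Ci))).
  rewrite (mb_ext _ _ _ _ (- (Ci * t1)) (- (Ci * t2)) (half + Ci * g2) (psi (GG g1 g2 g3 2 1 f) _ _ _ _)
     (fun x => (half + Ci * g2 + Ci * x) * psi f (half - Ci * T) (- g1 + Ci) T (t1 + t2 - g2 - Ci) x
      + (half - Ci * T - - (Ci * t1) - - (Ci * t2) + Ci * x) * ((half - Ci * T - Ci * x)
      * psi f (half - Ci * T) (- g1 + Ci) T (t1 + t2 - g2 - Ci) (x + Ci)))%C).
  - rewrite <- R.
    + rewrite (mb_ext c (- (Ci * t1)) (- (Ci * t2)) (half + Ci * g2)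
        (- (Ci * t1)) (- (Ci * t2)) (half + Ci * g2) (psi f (half - Ci * (T + Ci)) (- g1) (T + Ci) (t1 + t2 - g2))
        (fun x => psi f (half - Ci * T) (- g1 + Ci) T (t1 + t2 - g2 - Ci) (x + Ci))).
      * ring [Ci_sq].
      * intros x _. unfold mb_integrand. f_equal. rewrite psi_shift. apply psi_ext; ring [Ci_sq].
    + apply psi_test; try exact Hf; reim; lra.
    + lra.
    + lra.
    + repeat split; unfold half; reim; lra.
  - intros x _. unfold mb_integrand. f_equal. rewrite psi_GG21, psi_shift, C_plus_minus, C_minus_plus.
    rewrite (psi_lower f _ _ (T + Ci)). ring.
Qed.

(** The pattern of the relations with denominators: the prefactor equations [Q1], [Q2] and the
    contiguity relation [R] are solved as quotients and substituted, after which the claim is an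
    identity of rational functions. *)
Lemma relR_32 f g1 g2 g3 eps kap c T t1 t2 : paramsR f g1 g2 g3 eps kap -> generic c T t1 t2 kap kap ->
  relates g1 g2 g3 f (preR g3) (valR f g1 g2 g3 (muR eps)) c T t1 t2 (half + Ci * g2) (half - Ci * T) 3 2.
Proof.
  intros HP HG. assert (HP' := HP). destruct HP' as (Hf & He & Hk & E1 & E2 & E3).
  destruct (generic_neq _ _ _ _ _ _ HG) as (N1 & N2 & N3 & N4 & N5 & N6).
  destruct HG as (Ec & ET & H1 & H2 & _).
  unfold relates. cbn [GT]. unfold GT32.
  rewrite !(valR_0 f g1 g2 g3 eps kap c) by (first [assumption | reim; lra]).
  replace (- (Ci * (t1 + Ci)))%C with (- (Ci * t1) + 1)%C by ring [Ci_sq].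
  replace (- (Ci * (t2 + Ci)))%C with (- (Ci * t2) + 1)%C by ring [Ci_sq].
  replace (t1 + Ci + t2 - g2)%C with (t1 + t2 - g2 + Ci)%C by ring.
  replace (t1 + (t2 + Ci) - g2)%C with (t1 + t2 - g2 + Ci)%C by ring.
  assert (R := rel32 (-3/2) (3/2) c (- (Ci * t1)) (- (Ci * t2)) (half + Ci * g2) (half + Ci * g3)
    (psi f (half - Ci * T) (- g1) T (t1 + t2 - g2 + Ci))).
  rewrite (mb_ext _ _ _ _ (- (Ci * t1)) (- (Ci * t2)) (half + Ci * g2) (psi (GG g1 g2 g3 3 2 f) _ _ _ _)
     (fun x => (half + Ci * g3 + - (Ci * t1) + - (Ci * t2) - Ci * x)
       * psi f (half - Ci * T) (- g1) T (t1 + t2 - g2 + Ci) x)%C).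
  2:{ intros x _. unfold mb_integrand. f_equal. rewrite psi_GG32. ring. }
  assert (Q1 := preR_t1_up g3 T t1 t2). assert (Q2 := preR_t2_up g3 T t1 t2).
  apply div_of_eq in Q1; [|nzs ..]. apply div_of_eq in Q2; [|nzs ..].
  apply div_of_eq in R; [|nzs | apply psi_test; try exact Hf; reim; lra | lra | separate].
  rewrite R, Q1, Q2, half_eq. field [Ci_sq]. nzs.
Qed.

(** The shifts [t_j - Ci] leave the range of the plain integral, so the continued values [V1] and
    [V2] enter; their two-term form is that of the right side of [rel23]. *)
Lemma relR_23 f g1 g2 g3 eps kap c T t1 t2 : paramsR f g1 g2 g3 eps kap -> generic c T t1 t2 kap kap ->
  relates g1 g2 g3 f (preR g3) (valR f g1 g2 g3 (muR eps)) c T t1 t2 (half + Ci * g2) (half - Ci * T) 2 3.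
Proof.
  intros HP HG. assert (HP' := HP). destruct HP' as (Hf & He & Hk & E1 & E2 & E3).
  destruct (generic_neq _ _ _ _ _ _ HG) as (N1 & N2 & N3 & N4 & N5 & N6).
  destruct HG as (Ec & ET & H1 & H2 & _).
  unfold relates. cbn [GT]. unfold GT23, prod3.
  assert (V1 := valR_1 f g1 g2 g3 eps kap c T t1 t2 HP Ec ltac:(lra) H1 H2).
  assert (V2 := valR_2 f g1 g2 g3 eps kap c T t1 t2 HP Ec ltac:(lra) H1 H2).
  assert (R := rel23 (-3/2) (3/2) c (- (Ci * t1)) (- (Ci * t2)) (half + Ci * g2) (half - Ci * T)
    (half - Ci * g1) (psi f (half - Ci * T) (- g1) T (t1 + t2 - g2 - Ci))).
  rewrite (mb_ext _ _ _ _ (- (Ci * t1)) (- (Ci * t2)) (half + Ci * g2) (psi (GG g1 g2 g3 2 3 f) _ _ _ _)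
     (fun x => (half - Ci * g1 - Ci * x) * ((half - Ci * T - Ci * x)
         * psi f (half - Ci * T) (- g1) T (t1 + t2 - g2 - Ci) (x + Ci))
       + (half - Ci * T + (half - Ci * g1) - - (Ci * t1) - - (Ci * t2) - (half + Ci * g2) - Ci * x)
         * psi f (half - Ci * T) (- g1) T (t1 + t2 - g2 - Ci) x)%C).
  2:{ intros x _. unfold mb_integrand. f_equal. rewrite psi_GG23, psi_shift, C_minus_plus.
      rewrite (psi_lower f _ (- g1 - Ci)). ring. }
  assert (Q1 := preR_t1 g3 T t1 t2). assert (Q2 := preR_t2 g3 T t1 t2).
  apply div_of_eq in V1; [|nzs]. apply div_of_eq in V2; [|nzs].
  apply div_of_eq in Q1; [|nzs ..]. apply div_of_eq in Q2; [|nzs ..].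
  apply div_of_eq in R; [|nzs | apply psi_test; try exact Hf; reim; lra | lra | lra | separate].
  rewrite R, V1, V2, Q1, Q2, half_eq. field [Ci_sq]. nzs.
Qed.

(** Both orders of the product in the commutator meet the same two values, at [T - Ci] with one
    [t_j] lowered; they differ only in the coefficients. *)
Lemma relR_13 f g1 g2 g3 eps kap c T t1 t2 : paramsR f g1 g2 g3 eps kap -> generic c T t1 t2 kap kap ->
  relates g1 g2 g3 f (preR g3) (valR f g1 g2 g3 (muR eps)) c T t1 t2 (half + Ci * g2) (half - Ci * T) 1 3.
Proof.
  intros HP HG. assert (HP' := HP). destruct HP' as (Hf & He & Hk & E1 & E2 & E3).
  destruct (generic_neq _ _ _ _ _ _ HG) as (N1 & N2 & N3 & N4 & N5 & N6).
  destruct HG as (Ec & ET & H1 & H2 & _).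
  unfold relates. cbn [GT]. unfold comm, GT12, GT23, prod3.
  assert (V1 := valR_1 f g1 g2 g3 eps kap c (T - Ci) t1 t2 HP Ec ltac:(reim; lra) H1 H2).
  assert (V2 := valR_2 f g1 g2 g3 eps kap c (T - Ci) t1 t2 HP Ec ltac:(reim; lra) H1 H2).
  assert (R := rel13R (-3/2) (3/2) c (- (Ci * t1)) (- (Ci * t2)) (half + Ci * g2) (half - Ci * g1)
    (psi f (half - Ci * (T - Ci)) (- g1) (T - Ci) (t1 + t2 - g2 - Ci))
    (fun x => psi f (half - Ci * (T - Ci)) (- g1) (T - Ci) (t1 + t2 - g2 - Ci) (x + Ci))).
  rewrite (mb_ext _ _ _ _ (- (Ci * t1)) (- (Ci * t2)) (half + Ci * g2) (psi (GG g1 g2 g3 1 3 f) _ _ _ _)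
     (fun x => psi f (half - Ci * (T - Ci)) (- g1) (T - Ci) (t1 + t2 - g2 - Ci) x
       + (half - Ci * g1 - Ci * x)
         * psi f (half - Ci * (T - Ci)) (- g1) (T - Ci) (t1 + t2 - g2 - Ci) (x + Ci))%C).
  2:{ intros x _. unfold mb_integrand. f_equal. rewrite psi_GG13, psi_shift, !C_minus_plus.
      rewrite (psi_lower f (half - Ci * (T - Ci))%C (- g1)).
      replace (half - Ci * (T - Ci) + 1)%C with (half - Ci * T)%C by ring [Ci_sq]. cfield. }
  assert (Q1 := preR_t1 g3 (T - Ci) t1 t2). assert (Q2 := preR_t2 g3 (T - Ci) t1 t2).
  apply div_of_eq in V1; [|nzs]. apply div_of_eq in V2; [|nzs].
  apply div_of_eq in Q1; [|nzs ..]. apply div_of_eq in Q2; [|nzs ..].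
  apply div_of_eq in R; [|nzs | apply psi_test; try exact Hf; reim; lra | | lra | separate].
  2:{ eapply test_ext; [intros x; symmetry; apply psi_shift|].
      apply psi_test; try exact Hf; reim; lra. }
  rewrite R, V1, V2, Q1, Q2, (preR_T g3 T t1 t2), half_eq by nzs. field [Ci_sq]. nzs.
Qed.

Lemma relR_31 f g1 g2 g3 eps kap c T t1 t2 : paramsR f g1 g2 g3 eps kap -> generic c T t1 t2 kap kap ->
  relates g1 g2 g3 f (preR g3) (valR f g1 g2 g3 (muR eps)) c T t1 t2 (half + Ci * g2) (half - Ci * T) 3 1.
Proof.
  intros HP HG. assert (HP' := HP). destruct HP' as (Hf & He & Hk & E1 & E2 & E3).
  destruct (generic_neq _ _ _ _ _ _ HG) as (N1 & N2 & N3 & N4 & N5 & N6).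
  destruct HG as (Ec & ET & H1 & H2 & _).
  unfold relates. cbn [GT]. unfold comm, GT32, GT21.
  rewrite !(valR_0 f g1 g2 g3 eps kap c) by (first [assumption | reim; lra]).
  replace (- (Ci * (t1 + Ci)))%C with (- (Ci * t1) + 1)%C by ring [Ci_sq].
  replace (- (Ci * (t2 + Ci)))%C with (- (Ci * t2) + 1)%C by ring [Ci_sq].
  replace (t1 + Ci + t2 - g2)%C with (t1 + t2 - g2 + Ci)%C by ring.
  replace (t1 + (t2 + Ci) - g2)%C with (t1 + t2 - g2 + Ci)%C by ring.
  assert (R := rel31R (-3/2) (3/2) c (- (Ci * t1)) (- (Ci * t2)) (half + Ci * g2) (half - Ci * T) (half + Ci * g3)
    (psi f (half - Ci * T) (- g1 + Ci) T (t1 + t2 - g2))).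
  rewrite (mb_ext _ _ _ _ (- (Ci * t1)) (- (Ci * t2)) (half + Ci * g2) (psi (GG g1 g2 g3 3 1 f) _ _ _ _)
     (fun x => (half + Ci * g2 + Ci * x) * psi f (half - Ci * T) (- g1 + Ci) T (t1 + t2 - g2) x
       - (half + Ci * g3 + - (Ci * t1) + - (Ci * t2) - Ci * x) * ((half - Ci * T - Ci * x)
       * psi f (half - Ci * T) (- g1 + Ci) T (t1 + t2 - g2) (x + Ci)))%C).
  2:{ intros x _. unfold mb_integrand. f_equal. rewrite psi_GG31, psi_shift, C_plus_minus.
      rewrite (psi_lower f _ _ (T + Ci)). ring. }
  assert (S : (fun x => psi f (half - Ci * T) (- g1 + Ci) T (t1 + t2 - g2) (x + Ci))%C
    = psi f (half - Ci * (T + Ci)) (- g1) (T + Ci) (t1 + t2 - g2 + Ci)).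
  { apply functional_extensionality. intros x. rewrite psi_shift. apply psi_ext; ring [Ci_sq]. }
  rewrite S in R.
  assert (Q1 := preR_t1_up g3 (T + Ci) t1 t2). assert (Q2 := preR_t2_up g3 (T + Ci) t1 t2).
  apply div_of_eq in Q1; [|nzs ..]. apply div_of_eq in Q2; [|nzs ..].
  apply div_of_eq in R; [|nzs | apply psi_test; try exact Hf; reim; lra | lra | lra | separate].
  rewrite R, Q1, Q2, preR_T_up, half_eq by nzs. field [Ci_sq]. nzs.
Qed.

Lemma relR (f : fun3) (g1 g2 g3 : C) (eps kap : R) (c T t1 t2 : C) (i j : nat) :
  paramsR f g1 g2 g3 eps kap -> generic c T t1 t2 kap kap -> (1 <= i <= 3)%nat -> (1 <= j <= 3)%nat ->
  relates g1 g2 g3 f (preR g3) (valR f g1 g2 g3 (muR eps)) c T t1 t2 (half + Ci * g2) (half - Ci * T) i j.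
Proof.
  intros HP HG Hi Hj.
  assert (D : i = j -> relates g1 g2 g3 f (preR g3) (valR f g1 g2 g3 (muR eps)) c T t1 t2
    (half + Ci * g2) (half - Ci * T) i j).
  { intros <-. assert (HP' := HP). destruct HP' as (Hf & He & Hk & E1 & E2 & E3).
    destruct HG as (Ec & ET & H1 & H2 & _).
    apply relates_diag; try assumption; try (apply Rabs_le; reim; lra); try lra; try separate.
    apply valR_0 with kap; try assumption; lra. }
  destruct i as [|[|[|[|i]]]]; try lia; destruct j as [|[|[|[|j]]]]; try lia;
    first [apply D; reflexivity | clear D].
  - apply relR_12 with kap; assumption.
  - apply relR_13 with kap; assumption.
  - apply relR_21 with kap; assumption.
  - apply relR_23 with kap; assumption.
  - apply relR_31 with kap; assumption.
  - apply relR_32 with kap; assumption.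
Qed.

Lemma is_RInt_gen_mb (lo hi : R) (P c a1 a2 b : C) (Phi : C -> C) (h : R -> C) :
  test lo hi Phi -> lo < Im c < hi -> separates (Im c) a1 a2 b ->
  (forall s : R, h s = (P * mb_integrand a1 a2 b Phi (RtoC s + c))%C) ->
  is_RInt_gen (V := C_R_NormedModule) h (Rbar_locally m_infty) (Rbar_locally p_infty)
    (P * mb_int c a1 a2 b Phi)%C.
Proof.
  intros Ht Hc Hs E. destruct (mb_decays lo hi c a1 a2 b Phi Ht Hc Hs) as [M HM].
  replace h with (fun s : R => P * mb_integrand a1 a2 b Phi (RtoC s + c))%C
    by (apply functional_extensionality; intros s; symmetry; apply E).
  unfold mb_int. rewrite <- (line_int_scal P _ M HM).
  exact (line_int_correct _ _ (decays_scal P _ M HM)).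
Qed.

(** Real [s21 = x + T] means the contour [- T], of height [kap]. For real [tau] the poles of the [a]
    Gammas start at height 0, so it is the shift by [kap] that separates the poles. *)
Lemma is_BR_value (f : fun3) (g1 g2 g3 : C) (eps kap t11 t1 t2 lo hi : R) :
  0 < eps < 1 / 2 -> 0 < kap < 1 / 2 -> Im g2 = - eps -> lo < kap < hi ->
  let T := (RtoC t11 - Ci * RtoC kap)%C in
  test lo hi (psi f (half - Ci * T) (- g1) T (t1 + t2 - g2)) ->
  is_BR kap g1 g2 g3 f t11 t1 t2
    (preR g3 T t1 t2 * mb_int (- T) (- (Ci * t1)) (- (Ci * t2)) (half + Ci * g2)
       (psi f (half - Ci * T) (- g1) T (t1 + t2 - g2)))%C.
Proof.
  intros He Hk E2 Hlh T Ht. unfold is_BR, is_apply.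
  assert (ET : Im T = - kap) by (unfold T; reim; lra).
  apply (is_RInt_gen_mb lo hi); [exact Ht | reim; lra | repeat split; unfold half; reim; lra |].
  intros s. unfold delta_int, KR, prod2, preR, mb_integrand, psi.
  replace (t11 - Ci * kap - g1 - s)%C with (- g1 - (s + - T))%C by (unfold T; ring).
  replace (t1 + t2 - g1 - g2 - (- g1 - (s + - T)))%C with (t1 + t2 - g2 + (s + - T))%C by ring.
  replace (T + (s + - T))%C with (RtoC s) by ring.
  replace (Ci * (g2 - g1 - (- g1 - (s + - T))) + half)%C with (half + Ci * g2 + Ci * (s + - T))%C by ring.
  replace (- Ci * s + half)%C with (half - Ci * T - Ci * (s + - T))%C by ring.
  replace (Ci * (t11 - t1 - s) + kap)%C with (- (Ci * t1) - Ci * (s + - T))%C by (unfold T; ring [Ci_sq]).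
  replace (Ci * (t11 - t2 - s) + kap)%C with (- (Ci * t2) - Ci * (s + - T))%C by (unfold T; ring [Ci_sq]).
  replace (Ci * (t1 - t11) - kap + half)%C with (Ci * (t1 - T) + half)%C by (unfold T; ring [Ci_sq]).
  replace (Ci * (t2 - t11) - kap + half)%C with (Ci * (t2 - T) + half)%C by (unfold T; ring [Ci_sq]).
  fold T. unfold rGamma, Cdiv. ring.
Qed.

(** The shift of the argument in [kGT] cancels the one in the continuation, so the relations are to
    be proved for [GT] at the point [T]. *)
Lemma kGT_shifted (kap : R) (g1 g2 g3 : C) (i j : nat) (V : fun3) (t11 t1 t2 : C) :
  kGT kap g1 g2 g3 i j (fun a b c => V (a - Ci * RtoC kap)%C b c) t11 t1 t2
  = GT g1 g2 g3 i j V (t11 - Ci * RtoC kap)%C t1 t2.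
Proof.
  unfold kGT, shift_arg. f_equal.
  do 3 (apply functional_extensionality; intros ?). rewrite C_plus_minus. reflexivity.
Qed.

Lemma nonpole_shift (z : C) (r : R) : 0 < r < 1 ->
  Re z = r - 2 \/ Re z = r - 1 \/ Re z = r \/ Re z = r + 1 \/ Re z = r + 2 -> nonpole z.
Proof.
  intros Hr H. apply nonpole_Re. intros [|[|[|n]]].
  - cbn. lra.
  - cbn. lra.
  - cbn. lra.
  - rewrite !S_INR. assert (P := pos_INR n). lra.
Qed.

(** The Gammas of the prefactor become reciprocal Gammas in the denominator. At unit shifts their
    arguments have real parts [1/2 - kap] or [1/2] modulo 1, and the affine factors [1/2 + eps]
    modulo 1, so nothing vanishes. *)
Lemma valR_meromorphic (f : fun3) (g1 g2 g3 : C) (eps kap : R) : paramsR f g1 g2 g3 eps kap ->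
  meromorphic_unit_tube (fun t11 t1 t2 => valR f g1 g2 g3 (muR eps) (t11 - Ci * RtoC kap)%C t1 t2).
Proof.
  intros (Hf & He & Hk & E1 & E2 & E3).
  set (r := 1 + eps * kap / 8).
  set (T := fun t11 : C => (t11 - Ci * RtoC kap)%C).
  assert (RT : regular r (fun t11 _ _ => T t11)).
  { apply regular_minus; [apply regular_var1 | apply regular_const]. }
  exists r,
    (fun t11 t1 t2 => RtoC (1 / (2 * PI)) * (Cexp (RtoC PI * T t11 * / 2) * rGamma (Ci * t1 - Ci * t2))
      * contR f g1 g2 (muR eps) (T t11) t1 t2)%C,
    (fun t11 t1 t2 => rGamma (Ci * (t1 - T t11) + half) * rGamma (Ci * (g3 - t1) + half)
      * (rGamma (Ci * (t2 - T t11) + half) * rGamma (Ci * (g3 - t2) + half))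
      * ((Ci * (g2 - t1) + half) * (Ci * (g2 - t2) + half)))%C.
  assert (V2 := regular_var2 r). assert (V3 := regular_var3 r).
  assert (HC := contR_regular f g1 g2 eps kap Hf He Hk E1 E2).
  split; [unfold r; nra|]. split; [|split; [|split]].
  - apply regular_holomorphic.
    repeat first [exact HC | exact RT | exact V2 | exact V3 | apply regular_mult | apply regular_minus
      | apply regular_rGamma | apply regular_Cexp | apply regular_const].
  - apply regular_holomorphic.
    repeat first [exact RT | exact V2 | exact V3 | apply regular_mult | apply regular_minus
      | apply regular_plus | apply regular_rGamma | apply regular_const].
  - intros a b c Ha Hb Hc. unfold T.
    assert (Pe : 0 < 1 / 2 + eps < 1) by lra. assert (Pk : 0 < 1 / 2 - kap < 1) by lra.
    unfold unit_shift in *.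
    repeat apply Cmult_neq_0';
      try (apply rGamma_neq_0; first
        [apply (nonpole_shift _ (1 / 2 - kap)); [lra | unfold half; reim; lra]
        |apply (nonpole_shift _ (1 / 2)); [lra | unfold half; reim; lra]]);
      apply C_neq_0_Re; unfold half; reim; lra.
  - intros a b c _ _. unfold valR, preR. fold (T a). rewrite !Gamma_rGamma. unfold Cdiv.
    rewrite !Cinv_mult'. ring.
Qed.

Lemma intertwines_R (l1 l2 l3 eps kap : R) : 0 < eps < 1 / 2 -> 0 < kap < 1 / 2 ->
  let g1 := (RtoC l1 + Ci * RtoC eps)%C in let g2 := (RtoC l2 - Ci * RtoC eps)%C in let g3 := RtoC l3 in
  intertwines (is_BR kap g1 g2 g3) (kGT kap g1 g2 g3) (GG g1 g2 g3).
Proof.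
  intros He Hk g1 g2 g3 f Hf.
  assert (E1 : Im g1 = eps) by (unfold g1; reim; lra).
  assert (E2 : Im g2 = - eps) by (unfold g2; reim; lra).
  assert (E3 : Im g3 = 0) by reflexivity.
  apply schwartz_tube_hol in Hf.
  assert (HP : paramsR f g1 g2 g3 eps kap) by (repeat split; first [assumption | lra | apply Hf]).
  exists (fun t11 t1 t2 => valR f g1 g2 g3 (muR eps) (t11 - Ci * RtoC kap)%C t1 t2).
  split; [apply valR_meromorphic, HP|]. split.
  - intros t11 t1 t2. set (T := (RtoC t11 - Ci * RtoC kap)%C).
    assert (ET : Im T = - kap) by (unfold T; reim; lra).
    rewrite (valR_0 f g1 g2 g3 eps kap (- T) T) by (first [assumption | reim; lra]).
    apply (is_BR_value f g1 g2 g3 eps kap t11 t1 t2 (-3 / 2) (3 / 2)); try assumption; [lra|].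
    fold T. apply psi_test; try exact Hf; reim; lra.
  - intros i j Hi Hj t11 t1 t2 Hne. rewrite kGT_shifted. set (T := (RtoC t11 - Ci * RtoC kap)%C).
    assert (ET : Im T = - kap) by (unfold T; reim; lra).
    rewrite (relR f g1 g2 g3 eps kap (- T) T); try assumption.
    + apply (is_BR_value (GG g1 g2 g3 i j f) g1 g2 g3 eps kap t11 t1 t2 (- (3 / 2)) (3 / 2)); try assumption; [lra|].
      fold T. apply GG_test; try assumption; apply Rabs_le; reim; lra.
    + repeat split; try (reim; lra). intros E. apply Hne. apply (f_equal Re) in E. exact E.
Qed.

(** * Prefactor and intertwining relations for B_L *)

Definition preL (k g3 : C) : fun3 := fun T t1 t2 =>
  (RtoC (1 / (2 * PI)) * (Cexp (- (RtoC PI * T / 2)) * rGamma (Ci * t1 - Ci * t2))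
   * (rGamma (Ci * (T - t1) + half + k) * rGamma (Ci * (t1 - g3) + half)
      * (rGamma (Ci * (T - t2) + half + k) * rGamma (Ci * (t2 - g3) + half))))%C.

(** [k] counts the continuation steps absorbed by the prefactor: since
    [a_j + b = Ci (T - t_j) + 1/2], the recursion of 1/Gamma produces exactly the factors of
    [level1] and [level2]. *)
Lemma preL_rec (k g3 T t1 t2 : C) : preL k g3 T t1 t2 =
  ((Ci * (T - t1) + half + k) * (Ci * (T - t2) + half + k) * preL (k + 1) g3 T t1 t2)%C.
Proof.
  unfold preL. rewrite (rGamma_rec (Ci * (T - t1) + half + k)), (rGamma_rec (Ci * (T - t2) + half + k)).
  rewrite !Cplus_assoc. ring.
Qed.

Lemma preL_T (k g3 T t1 t2 : C) : preL k g3 (T - Ci)%C t1 t2 = (Ci * preL (k + 1) g3 T t1 t2)%C.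
Proof.
  unfold preL.
  assert (E : Cexp (- (RtoC PI * (T - Ci) / 2)) = (Ci * Cexp (- (RtoC PI * T / 2)))%C).
  { replace (- (RtoC PI * (T - Ci) / 2))%C with (RtoC PI * (Ci - T) / 2)%C by field.
    replace (- (RtoC PI * T / 2))%C with (RtoC PI * (Ci - T - Ci) / 2)%C by field. apply Cexp_lower. }
  rewrite E.
  replace (Ci * (T - Ci - t1) + half + k)%C with (Ci * (T - t1) + half + (k + 1))%C by ring [Ci_sq].
  replace (Ci * (T - Ci - t2) + half + k)%C with (Ci * (T - t2) + half + (k + 1))%C by ring [Ci_sq].
  ring.
Qed.

Lemma preL_T_up (g3 T t1 t2 : C) : preL 1 g3 (T + Ci)%C t1 t2 = (- Ci * preL 0 g3 T t1 t2)%C.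
Proof.
  assert (E := preL_T 0 g3 (T + Ci) t1 t2). rewrite C_plus_minus, Cplus_0_l in E. rewrite E. ring [Ci_sq].
Qed.

Lemma preL_t1 (g3 T t1 t2 : C) :
  ((Ci * t1 - Ci * t2) * (Ci * (t1 - g3) + half) * (Ci * (T - t2) + half) * preL 1 g3 T (t1 - Ci) t2
   = preL 0 g3 T t1 t2)%C.
Proof.
  unfold preL. rewrite !Cplus_0_r.
  rewrite (rGamma_rec (Ci * t1 - Ci * t2)), (rGamma_rec (Ci * (t1 - g3) + half)), (rGamma_rec (Ci * (T - t2) + half)).
  replace (Ci * (t1 - Ci) - Ci * t2)%C with (Ci * t1 - Ci * t2 + 1)%C by ring [Ci_sq].
  replace (Ci * (T - (t1 - Ci)) + half + 1)%C with (Ci * (T - t1) + half)%C by ring [Ci_sq].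
  replace (Ci * (t1 - Ci - g3) + half)%C with (Ci * (t1 - g3) + half + 1)%C by ring [Ci_sq].
  ring.
Qed.

Lemma preL_t2 (g3 T t1 t2 : C) :
  ((Ci * (t2 - g3) + half) * (Ci * (T - t1) + half) * preL 1 g3 T t1 (t2 - Ci)
   = (Ci * t1 - Ci * t2 - 1) * preL 0 g3 T t1 t2)%C.
Proof.
  unfold preL. rewrite !Cplus_0_r.
  replace (Ci * t1 - Ci * (t2 - Ci))%C with (Ci * t1 - Ci * t2 - 1)%C by ring [Ci_sq].
  rewrite (rGamma_rec (Ci * t1 - Ci * t2 - 1)), (rGamma_rec (Ci * (t2 - g3) + half)), (rGamma_rec (Ci * (T - t1) + half)).
  replace (Ci * (T - (t2 - Ci)) + half + 1)%C with (Ci * (T - t2) + half)%C by ring [Ci_sq].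
  replace (Ci * (t2 - Ci - g3) + half)%C with (Ci * (t2 - g3) + half + 1)%C by ring [Ci_sq].
  rewrite C_minus_plus. ring.
Qed.

Lemma preL_t1_up (g3 T t1 t2 : C) :
  ((Ci * (T - t1) + half) * preL 0 g3 T (t1 + Ci) t2
   = (Ci * t1 - Ci * t2 - 1) * (Ci * (t1 - g3) + half - 1) * preL 0 g3 T t1 t2)%C.
Proof.
  unfold preL. rewrite !Cplus_0_r.
  replace (Ci * (t1 + Ci) - Ci * t2)%C with (Ci * t1 - Ci * t2 - 1)%C by ring [Ci_sq].
  replace (Ci * (T - (t1 + Ci)) + half)%C with (Ci * (T - t1) + half + 1)%C by ring [Ci_sq].
  replace (Ci * (t1 + Ci - g3) + half)%C with (Ci * (t1 - g3) + half - 1)%C by ring [Ci_sq].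
  rewrite (rGamma_rec (Ci * t1 - Ci * t2 - 1)), (rGamma_rec (Ci * (t1 - g3) + half - 1)), (rGamma_rec (Ci * (T - t1) + half)).
  rewrite !C_minus_plus. ring.
Qed.

Lemma preL_t2_up (g3 T t1 t2 : C) :
  ((Ci * t1 - Ci * t2) * (Ci * (T - t2) + half) * preL 0 g3 T t1 (t2 + Ci)
   = (Ci * (t2 - g3) + half - 1) * preL 0 g3 T t1 t2)%C.
Proof.
  unfold preL. rewrite !Cplus_0_r.
  replace (Ci * t1 - Ci * (t2 + Ci))%C with (Ci * t1 - Ci * t2 + 1)%C by ring [Ci_sq].
  replace (Ci * (T - (t2 + Ci)) + half)%C with (Ci * (T - t2) + half + 1)%C by ring [Ci_sq].
  replace (Ci * (t2 + Ci - g3) + half)%C with (Ci * (t2 - g3) + half - 1)%C by ring [Ci_sq].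
  rewrite (rGamma_rec (Ci * t1 - Ci * t2)), (rGamma_rec (Ci * (t2 - g3) + half - 1)), (rGamma_rec (Ci * (T - t2) + half)).
  rewrite !C_minus_plus. ring.
Qed.

(** No division as in the case of R: [k = 2] in the prefactor accounts for the four factors carried
    by [level2], so this continuation is holomorphic. *)
Definition valL (f : fun3) (g1 g2 g3 : C) (eps mu : R) : fun3 := fun T t1 t2 =>
  (preL 2 g3 T t1 t2 * contL f g1 g2 eps mu T t1 t2)%C.

Definition paramsL (f : fun3) (g1 g2 g3 : C) (eps kap : R) : Prop :=
  tube_hol 3 f /\ 0 < eps < 1 / 2 /\ 0 < kap < 1 / 2 /\ Im g1 = - eps /\ Im g2 = eps /\ Im g3 = 0.

(* [Im c] is an admissible contour height for the continuation at [(T, t1, t2)]. *)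
Definition heightL (eps kap : R) (c T t1 t2 : C) : Prop :=
  (- kap - 1 <= Im T <= 1 - kap /\ -1 <= Im t1 <= 1 /\ -1 <= Im t2 <= 1 /\ -1 <= Im t1 + Im t2 <= 1) /\
  (-3 + eps < Im c < 1 + eps /\ -3 < Im T + Im c < 1 /\ -3 < Im t1 + Im t2 - eps + Im c < 1) /\
  (0 < 1 + Im t1 + Im c /\ 0 < 1 + Im t2 + Im c /\ 0 < 1 / 2 - Im T - Im c).

(** Passage from the contour depending on [tau] at level 2 to a chosen height at level 1, one pair
    of factors returning to the prefactor. In the strip [(lo, hi)] the arguments of [f] stay in the
    tube. *)
Lemma valL_1 (f : fun3) (g1 g2 g3 : C) (eps kap : R) (c T t1 t2 : C) :
  paramsL f g1 g2 g3 eps kap -> heightL eps kap c T t1 t2 ->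
  exists lo hi, lo < Im c /\ Im c + 2 < hi /\
    test lo hi (psi f (half - Ci * g2) (- g1) T (t1 + t2 - g2)) /\
    valL f g1 g2 g3 eps (muL kap) T t1 t2 =
      (preL 1 g3 T t1 t2 * level1 c (- (Ci * t1)) (- (Ci * t2)) (half + Ci * T)
        (psi f (half - Ci * g2) (- g1) T (t1 + t2 - g2)))%C.
Proof.
  intros (Hf & He & Hk & E1 & E2 & E3) ((HT & H1 & H2 & H12) & (C1 & C2 & C3) & (S1 & S2 & S3)).
  set (hi := Rmin (3 + eps) (Rmin (3 - Im T) (3 - (Im t1 + Im t2 - eps)))).
  assert (L1 : hi <= 3 + eps) by apply Rmin_l.
  assert (L23 : hi <= Rmin (3 - Im T) (3 - (Im t1 + Im t2 - eps))) by apply Rmin_r.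
  assert (L2 := Rle_trans _ _ _ L23 (Rmin_l _ _)). assert (L3 := Rle_trans _ _ _ L23 (Rmin_r _ _)).
  assert (G : forall y, y < 3 + eps -> y < 3 - Im T -> y < 3 - (Im t1 + Im t2 - eps) -> y < hi).
  { intros y K1 K2 K3. repeat apply Rmin_glb_lt; assumption. }
  clearbody hi.
  set (lo := Rmax (eps - 3) (Rmax (-3 - Im T) (-3 - (Im t1 + Im t2 - eps)))).
  assert (M1 : eps - 3 <= lo) by apply Rmax_l.
  assert (M23 : Rmax (-3 - Im T) (-3 - (Im t1 + Im t2 - eps)) <= lo) by apply Rmax_r.
  assert (M2 := Rle_trans _ _ _ (Rmax_l _ _) M23). assert (M3 := Rle_trans _ _ _ (Rmax_r _ _) M23).
  assert (G' : forall y, eps - 3 < y -> -3 - Im T < y -> -3 - (Im t1 + Im t2 - eps) < y -> lo < y).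
  { intros y K1 K2 K3. repeat apply Rmax_lub_lt; assumption. }
  clearbody lo.
  assert (Ht : test lo hi (psi f (half - Ci * g2) (- g1) T (t1 + t2 - g2))).
  { apply psi_test; try exact Hf; reim; rewrite ?E1, ?E2; lra. }
  assert (K1 : lo < Im c) by (apply G'; lra). assert (K2 : Im c + 2 < hi) by (apply G; lra).
  exists lo, hi. do 3 (split; [assumption|]).
  assert (P : 0 < eps * kap) by nra.
  destruct (contourL_bounds eps kap t1 t2 He Hk) as (D1 & D2 & B1 & B2 & B3 & B4 & B5 & B5' & B8 & B6 & B7);
    [apply Rabs_def1; lra ..|].
  set (d := eps * kap / 8) in *.
  assert (K3 : lo < Im (contour (-1 + eps) (muL kap) t1 t2)) by (apply G'; lra).
  assert (K4 : Im (contour (-1 + eps) (muL kap) t1 t2) + 2 < hi) by (apply G; lra).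
  unfold valL, contL. rewrite (level2_move lo hi _ c); [|exact Ht | lra | lra | |].
  - rewrite (level2_of_1 lo hi); [|exact Ht | lra | lra |].
    + rewrite (preL_rec 1). replace (1 + 1)%C with (RtoC 2) by (rewrite <- RtoC_plus; f_equal; lra).
      ring.
    + separate.
  - separate.
  - separate.
Qed.

Lemma valL_0 (f : fun3) (g1 g2 g3 : C) (eps kap : R) (c T t1 t2 : C) :
  paramsL f g1 g2 g3 eps kap -> heightL eps kap c T t1 t2 -> 0 < Im t1 + Im c -> 0 < Im t2 + Im c ->
  valL f g1 g2 g3 eps (muL kap) T t1 t2 =
  (preL 0 g3 T t1 t2 * mb_int c (- (Ci * t1)) (- (Ci * t2)) (half + Ci * T)
     (psi f (half - Ci * g2) (- g1) T (t1 + t2 - g2)))%C.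
Proof.
  intros HP HH H1 H2. destruct (valL_1 f g1 g2 g3 eps kap c T t1 t2 HP HH) as (lo & hi & K1 & K2 & Ht & E).
  destruct HH as (_ & _ & S1 & S2 & S3).
  rewrite E, (level1_of_0 lo hi); try exact Ht; try lra.
  - rewrite (preL_rec 0), Cplus_0_l. ring.
  - separate.
Qed.

Lemma valL_10 (f : fun3) (g1 g2 g3 : C) (eps kap : R) (c T t1 t2 : C) :
  paramsL f g1 g2 g3 eps kap -> heightL eps kap c T t1 t2 -> 0 < Im t2 + Im c ->
  valL f g1 g2 g3 eps (muL kap) T t1 t2 =
  (preL 1 g3 T t1 t2 * (Ci * (T - t2) + half) *
    (mb_int c (- (Ci * t1) + 1) (- (Ci * t2)) (half + Ci * T)
       (psi f (half - Ci * g2) (- g1) T (t1 + t2 - g2))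
     + mb_int c (- (Ci * t1) + 1) (- (Ci * t2) + 1) (half + Ci * T)
       (fun x => psi f (half - Ci * g2) (- g1) T (t1 + t2 - g2) (x + Ci))))%C.
Proof.
  intros HP HH H2. destruct (valL_1 f g1 g2 g3 eps kap c T t1 t2 HP HH) as (lo & hi & K1 & K2 & Ht & E).
  destruct HH as (_ & _ & S1 & S2 & S3).
  rewrite E, (level1_of_10 lo hi); try exact Ht; try lra.
  - ring.
  - separate.
Qed.

Lemma valL_01 (f : fun3) (g1 g2 g3 : C) (eps kap : R) (c T t1 t2 : C) :
  paramsL f g1 g2 g3 eps kap -> heightL eps kap c T t1 t2 -> 0 < Im t1 + Im c ->
  valL f g1 g2 g3 eps (muL kap) T t1 t2 =
  (preL 1 g3 T t1 t2 * (Ci * (T - t1) + half) *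
    (mb_int c (- (Ci * t1)) (- (Ci * t2) + 1) (half + Ci * T)
       (psi f (half - Ci * g2) (- g1) T (t1 + t2 - g2))
     + mb_int c (- (Ci * t1) + 1) (- (Ci * t2) + 1) (half + Ci * T)
       (fun x => psi f (half - Ci * g2) (- g1) T (t1 + t2 - g2) (x + Ci))))%C.
Proof.
  intros HP HH H1. destruct (valL_1 f g1 g2 g3 eps kap c T t1 t2 HP HH) as (lo & hi & K1 & K2 & Ht & E).
  destruct HH as (_ & _ & S1 & S2 & S3).
  rewrite E, level1_swap, (level1_of_10 lo hi); try exact Ht; try lra.
  - rewrite (mb_swap c (- (Ci * t2) + 1) (- (Ci * t1))), (mb_swap c (- (Ci * t2) + 1) (- (Ci * t1) + 1)). ring.
  - separate.
Qed.

Definition relatesL f g1 g2 g3 eps kap c T t1 t2 i j : Prop :=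
  relates g1 g2 g3 f (preL 0 g3) (valL f g1 g2 g3 eps (muL kap)) c T t1 t2 (half + Ci * T) (half - Ci * g2) i j.

(** [eps * kap] is the contour height in the relations for L: positive, and below both [eps] and
    [kap]. At height [kap] itself, the two continuation steps at [t1 + Ci] would take [f] out of the
    tube when [kap >= eps]. *)
Lemma mult_half_bound (eps kap : R) : 0 < eps < 1 / 2 -> 0 < kap < 1 / 2 ->
  0 < eps * kap /\ eps * kap < eps / 2 /\ eps * kap < kap / 2.
Proof. intros He Hk. repeat split; nra. Qed.

Ltac startL HP HG :=
  assert (HP' := HP); destruct HP' as (Hf & He & Hk & E1 & E2 & E3);
  destruct (generic_neq _ _ _ _ _ _ HG) as (N1 & N2 & N3 & N4 & N5 & N6);
  destruct HG as (Ec & ET & H1 & H2 & _);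
  destruct (mult_half_bound _ _ He Hk) as (Y0 & Y1 & Y2).
Ltac height := unfold heightL; reim;
  repeat match goal with H : Im _ = _ |- _ => rewrite H end; repeat split; lra.

(** For L the parameter [b = 1/2 + Ci T] moves with [T]: lowering [T] raises [b], and the resulting
    factor [b + Ci x] is the coefficient [Ci s21 + 1/2]. *)
Lemma relL_12 f g1 g2 g3 eps kap c T t1 t2 :
  paramsL f g1 g2 g3 eps kap -> generic c T t1 t2 (eps * kap) kap ->
  relatesL f g1 g2 g3 eps kap c T t1 t2 1 2.
Proof.
  intros HP HG. startL HP HG.
  unfold relatesL, relates. cbn [GT]. unfold GT12.
  rewrite (valL_0 f g1 g2 g3 eps kap c) by (first [assumption | height | reim; lra]).
  rewrite preL_T, (preL_rec 0 g3 T t1 t2), Cplus_0_l.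
  replace (half + Ci * (T - Ci))%C with (half + Ci * T + 1)%C by ring [Ci_sq].
  rewrite mb_raise3 by (unfold half; reim; lra).
  rewrite (mb_ext _ _ _ _ (- (Ci * t1)) (- (Ci * t2)) (half + Ci * T) (psi (GG g1 g2 g3 1 2 f) _ _ _ _)
     (fun x => (half + Ci * T + Ci * x) * psi f (half - Ci * g2) (- g1) (T - Ci) (t1 + t2 - g2) x)%C).
  - ring [Ci_sq].
  - intros x _. unfold mb_integrand. rewrite psi_GG12. ring.
Qed.

(** Raising [T] gives [b - 1], of real part [kap - 1/2 < 0], and no positive height is admissible.
    The value is taken at height [Im c - 1] on level 1 and translated back by [Ci]. *)
Lemma relL_21 f g1 g2 g3 eps kap c T t1 t2 :
  paramsL f g1 g2 g3 eps kap -> generic c T t1 t2 (eps * kap) kap ->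
  relatesL f g1 g2 g3 eps kap c T t1 t2 2 1.
Proof.
  intros HP HG. startL HP HG.
  unfold relatesL, relates. cbn [GT]. unfold GT21.
  destruct (valL_1 f g1 g2 g3 eps kap (c - Ci) (T + Ci) t1 t2) as (lo & hi & _ & _ & _ & E);
    [exact HP | height |].
  rewrite E, preL_T_up. clear E lo hi.
  assert (R := rel21L (c - Ci) (- (Ci * t1)) (- (Ci * t2)) (half + Ci * T)
    (psi f (half - Ci * g2 - 1) (- g1 + Ci) T (t1 + t2 - g2 - Ci))).
  replace (half + Ci * (T + Ci))%C with (half + Ci * T - 1)%C by ring [Ci_sq].
  assert (S : (fun x => psi f (half - Ci * g2 - 1) (- g1 + Ci) T (t1 + t2 - g2 - Ci) (x + Ci))%C
    = psi f (half - Ci * g2) (- g1) (T + Ci) (t1 + t2 - g2)).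
  { apply functional_extensionality. intros x. rewrite psi_shift. apply psi_ext; ring. }
  rewrite S in R. rewrite R, C_minus_plus.
  assert (M : forall Phi, (forall x, psi (GG g1 g2 g3 2 1 f) (half - Ci * g2) (- g1) T (t1 + t2 - g2) x = (- (1) * Phi x)%C) ->
    mb_int c (- (Ci * t1)) (- (Ci * t2)) (half + Ci * T) Phi =
    (- (1) * mb_int c (- (Ci * t1)) (- (Ci * t2)) (half + Ci * T)
      (psi (GG g1 g2 g3 2 1 f) (half - Ci * g2) (- g1) T (t1 + t2 - g2)))%C).
  { intros Phi HPhi. rewrite <- (mb_scal (- (3 / 2)) (3 / 2)).
    - apply mb_ext. intros x _. unfold mb_integrand. rewrite HPhi. ring.
    - apply GG_test; try exact Hf; try lia; apply Rabs_le; reim; lra.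
    - lra.
    - separate. }
  rewrite M.
  - ring [Ci_sq].
  - intros x. rewrite psi_GG21, psi_shift.
    rewrite (psi_lower f (half - Ci * g2 - 1)), !C_minus_plus, C_plus_minus. cfield.
Qed.

Lemma relL_32 f g1 g2 g3 eps kap c T t1 t2 :
  paramsL f g1 g2 g3 eps kap -> generic c T t1 t2 (eps * kap) kap ->
  relatesL f g1 g2 g3 eps kap c T t1 t2 3 2.
Proof.
  intros HP HG. startL HP HG.
  unfold relatesL, relates. cbn [GT]. unfold GT32.
  rewrite !(valL_0 f g1 g2 g3 eps kap c) by (first [assumption | height | reim; lra]).
  replace (- (Ci * (t1 + Ci)))%C with (- (Ci * t1) + 1)%C by ring [Ci_sq].
  replace (- (Ci * (t2 + Ci)))%C with (- (Ci * t2) + 1)%C by ring [Ci_sq].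
  replace (t1 + Ci + t2 - g2)%C with (t1 + t2 - g2 + Ci)%C by ring.
  replace (t1 + (t2 + Ci) - g2)%C with (t1 + t2 - g2 + Ci)%C by ring.
  assert (R := rel32 (-3/2) (3/2) c (- (Ci * t1)) (- (Ci * t2)) (half + Ci * T) (half + Ci * g3)
    (psi f (half - Ci * g2) (- g1) T (t1 + t2 - g2 + Ci))).
  rewrite (mb_ext _ _ _ _ (- (Ci * t1)) (- (Ci * t2)) (half + Ci * T) (psi (GG g1 g2 g3 3 2 f) _ _ _ _)
     (fun x => (half + Ci * g3 + - (Ci * t1) + - (Ci * t2) - Ci * x)
       * psi f (half - Ci * g2) (- g1) T (t1 + t2 - g2 + Ci) x)%C).
  2:{ intros x _. unfold mb_integrand. f_equal. rewrite psi_GG32. ring. }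
  assert (Q1 := preL_t1_up g3 T t1 t2). assert (Q2 := preL_t2_up g3 T t1 t2).
  apply div_of_eq in Q1; [|nzs]. apply div_of_eq in Q2; [|nzs].
  apply div_of_eq in R; [|nzs | apply psi_test; try exact Hf; reim; lra | lra | separate].
  rewrite R, Q1, Q2, half_eq. field [Ci_sq]. nzs.
Qed.

Lemma relL_23 f g1 g2 g3 eps kap c T t1 t2 :
  paramsL f g1 g2 g3 eps kap -> generic c T t1 t2 (eps * kap) kap ->
  relatesL f g1 g2 g3 eps kap c T t1 t2 2 3.
Proof.
  intros HP HG. startL HP HG.
  unfold relatesL, relates. cbn [GT]. unfold GT23, prod3.
  rewrite (valL_10 f g1 g2 g3 eps kap c T (t1 - Ci) t2) by (first [assumption | height | reim; lra]).
  rewrite (valL_01 f g1 g2 g3 eps kap c T t1 (t2 - Ci)) by (first [assumption | height | reim; lra]).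
  replace (- (Ci * (t1 - Ci)) + 1)%C with (- (Ci * t1))%C by ring [Ci_sq].
  replace (- (Ci * (t2 - Ci)) + 1)%C with (- (Ci * t2))%C by ring [Ci_sq].
  replace (t1 - Ci + t2 - g2)%C with (t1 + t2 - g2 - Ci)%C by ring.
  replace (t1 + (t2 - Ci) - g2)%C with (t1 + t2 - g2 - Ci)%C by ring.
  assert (R := rel23 (-3/2) (3/2) c (- (Ci * t1)) (- (Ci * t2)) (half + Ci * T) (half - Ci * g2)
    (half - Ci * g1) (psi f (half - Ci * g2) (- g1) T (t1 + t2 - g2 - Ci))).
  rewrite (mb_ext _ _ _ _ (- (Ci * t1)) (- (Ci * t2)) (half + Ci * T) (psi (GG g1 g2 g3 2 3 f) _ _ _ _)
     (fun x => (half - Ci * g1 - Ci * x) * ((half - Ci * g2 - Ci * x)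
         * psi f (half - Ci * g2) (- g1) T (t1 + t2 - g2 - Ci) (x + Ci))
       + (half - Ci * g2 + (half - Ci * g1) - - (Ci * t1) - - (Ci * t2) - (half + Ci * T) - Ci * x)
         * psi f (half - Ci * g2) (- g1) T (t1 + t2 - g2 - Ci) x)%C).
  2:{ intros x _. unfold mb_integrand. f_equal. rewrite psi_GG23, psi_shift, C_minus_plus.
      rewrite (psi_lower f _ (- g1 - Ci)). ring. }
  assert (Q1 := preL_t1 g3 T t1 t2). assert (Q2 := preL_t2 g3 T t1 t2).
  apply div_of_eq in R; [|nzs | apply psi_test; try exact Hf; reim; lra | lra | lra | separate].
  apply div_of_eq in Q1; [|nzs]. apply div_of_eq in Q2; [|nzs].
  rewrite R, Q1, Q2, half_eq. field [Ci_sq]. nzs.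
Qed.

(** [T] and one [t_j] are lowered together; the height [Im c + 1] then admits the plain integral,
    and translation by [Ci] brings both values to the parameters of [rel13L]. *)
Lemma relL_13 f g1 g2 g3 eps kap c T t1 t2 :
  paramsL f g1 g2 g3 eps kap -> generic c T t1 t2 (eps * kap) kap ->
  relatesL f g1 g2 g3 eps kap c T t1 t2 1 3.
Proof.
  intros HP HG. startL HP HG.
  unfold relatesL, relates. cbn [GT]. unfold comm, GT12, GT23, prod3.
  rewrite (valL_0 f g1 g2 g3 eps kap (c + Ci) (T - Ci) (t1 - Ci) t2) by (first [assumption | height | reim; lra]).
  rewrite (valL_0 f g1 g2 g3 eps kap (c + Ci) (T - Ci) t1 (t2 - Ci)) by (first [assumption | height | reim; lra]).
  rewrite !mb_translate, !preL_T, !Cplus_0_l.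
  replace (- (Ci * (t1 - Ci)) + 1)%C with (- (Ci * t1))%C by ring [Ci_sq].
  replace (- (Ci * (t2 - Ci)) + 1)%C with (- (Ci * t2))%C by ring [Ci_sq].
  replace (t1 - Ci + t2 - g2)%C with (t1 + t2 - g2 - Ci)%C by ring.
  replace (t1 + (t2 - Ci) - g2)%C with (t1 + t2 - g2 - Ci)%C by ring.
  replace (half + Ci * (T - Ci) - 1)%C with (half + Ci * T)%C by ring [Ci_sq].
  assert (R := rel13L (-3/2) (3/2) c (- (Ci * t1)) (- (Ci * t2)) (half + Ci * T) (half - Ci * g2)
    (half - Ci * g1) (psi f (half - Ci * g2) (- g1) (T - Ci) (t1 + t2 - g2 - Ci))).
  rewrite (mb_ext _ _ _ _ (- (Ci * t1)) (- (Ci * t2)) (half + Ci * T) (psi (GG g1 g2 g3 1 3 f) _ _ _ _)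
     (fun x => (half - Ci * g1 - Ci * x) * ((half - Ci * g2 - Ci * x)
         * psi f (half - Ci * g2) (- g1) (T - Ci) (t1 + t2 - g2 - Ci) (x + Ci))
       - (half + Ci * T + Ci * x) * psi f (half - Ci * g2) (- g1) (T - Ci) (t1 + t2 - g2 - Ci) x)%C).
  2:{ intros x _. unfold mb_integrand. f_equal. rewrite psi_GG13, psi_shift, !C_minus_plus.
      rewrite (psi_lower f _ (- g1 - Ci)). ring. }
  assert (Q1 := preL_t1 g3 T t1 t2). assert (Q2 := preL_t2 g3 T t1 t2).
  apply div_of_eq in R; [|nzs | apply psi_test; try exact Hf; reim; lra | lra | lra | separate].
  apply div_of_eq in Q1; [|nzs]. apply div_of_eq in Q2; [|nzs].
  rewrite R, Q1, Q2, half_eq. field [Ci_sq]. nzs.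
Qed.

(** At height [Im c - 1] the raised [t_j] needs no continuation step but the real one does, so each
    value has the half-raised form; [rel31L] compares these with the Gauss-Givental side at height
    [Im c]. *)
Lemma relL_31 f g1 g2 g3 eps kap c T t1 t2 :
  paramsL f g1 g2 g3 eps kap -> generic c T t1 t2 (eps * kap) kap ->
  relatesL f g1 g2 g3 eps kap c T t1 t2 3 1.
Proof.
  intros HP HG. startL HP HG.
  unfold relatesL, relates. cbn [GT]. unfold comm, GT32, GT21.
  rewrite (valL_01 f g1 g2 g3 eps kap (c - Ci) (T + Ci) (t1 + Ci) t2) by (first [assumption | height | reim; lra]).
  rewrite (valL_10 f g1 g2 g3 eps kap (c - Ci) (T + Ci) t1 (t2 + Ci)) by (first [assumption | height | reim; lra]).
  rewrite !preL_T_up.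
  replace (- (Ci * (t1 + Ci)))%C with (- (Ci * t1) + 1)%C by ring [Ci_sq].
  replace (- (Ci * (t2 + Ci)))%C with (- (Ci * t2) + 1)%C by ring [Ci_sq].
  replace (t1 + Ci + t2 - g2)%C with (t1 + t2 - g2 + Ci)%C by ring.
  replace (t1 + (t2 + Ci) - g2)%C with (t1 + t2 - g2 + Ci)%C by ring.
  replace (half + Ci * (T + Ci))%C with (half + Ci * T - 1)%C by ring [Ci_sq].
  assert (R := rel31L (-3/2) (3/2) (c - Ci) (- (Ci * t1)) (- (Ci * t2)) (half + Ci * T) (half + Ci * g3)
    (psi f (half - Ci * g2 - 1) (- g1 + Ci) T (t1 + t2 - g2))).
  rewrite (mb_ext _ _ _ _ (- (Ci * t1)) (- (Ci * t2)) (half + Ci * T) (psi (GG g1 g2 g3 3 1 f) _ _ _ _)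
     (fun x => - psi f (half - Ci * g2 - 1) (- g1 + Ci) T (t1 + t2 - g2) x
       - (half + Ci * g3 + - (Ci * t1) + - (Ci * t2) - Ci * x)
       * psi f (half - Ci * g2 - 1) (- g1 + Ci) T (t1 + t2 - g2) (x + Ci))%C).
  2:{ intros x _. unfold mb_integrand. f_equal. rewrite psi_GG31, psi_shift, C_plus_minus, C_minus_plus.
      rewrite (psi_lower f (half - Ci * g2 - 1)), C_minus_plus. cfield. }
  assert (S : forall x, psi f (half - Ci * g2 - 1) (- g1 + Ci) T (t1 + t2 - g2) (x + Ci)
    = psi f (half - Ci * g2) (- g1) (T + Ci) (t1 + t2 - g2 + Ci) x).
  { intros x. rewrite psi_shift. apply psi_ext; ring. }
  assert (S1 : (fun x => psi f (half - Ci * g2 - 1) (- g1 + Ci) T (t1 + t2 - g2) (x + Ci))%C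
    = psi f (half - Ci * g2) (- g1) (T + Ci) (t1 + t2 - g2 + Ci)).
  { apply functional_extensionality. intros x. apply S. }
  assert (S2 : (fun x => psi f (half - Ci * g2 - 1) (- g1 + Ci) T (t1 + t2 - g2) (x + Ci + Ci))%C
    = (fun x => psi f (half - Ci * g2) (- g1) (T + Ci) (t1 + t2 - g2 + Ci) (x + Ci)%C)).
  { apply functional_extensionality. intros x. apply S. }
  rewrite S1, S2, C_minus_plus in R.
  replace (- (Ci * t1) + 2)%C with (- (Ci * t1) + 1 + 1)%C in R by ring.
  replace (- (Ci * t2) + 2)%C with (- (Ci * t2) + 1 + 1)%C in R by ring.
  assert (Q1 := preL_t1_up g3 T t1 t2). assert (Q2 := preL_t2_up g3 T t1 t2).
  apply div_of_eq in R; [|nzs | apply psi_test; try exact Hf; reim; lra | reim; lra | reim; lra | separate].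
  apply div_of_eq in Q1; [|nzs]. apply div_of_eq in Q2; [|nzs].
  rewrite R, Q1, Q2, half_eq. field [Ci_sq]. nzs.
Qed.

Lemma relL (f : fun3) (g1 g2 g3 : C) (eps kap : R) (c T t1 t2 : C) (i j : nat) :
  paramsL f g1 g2 g3 eps kap -> generic c T t1 t2 (eps * kap) kap ->
  (1 <= i <= 3)%nat -> (1 <= j <= 3)%nat -> relatesL f g1 g2 g3 eps kap c T t1 t2 i j.
Proof.
  intros HP HG Hi Hj.
  assert (D : i = j -> relatesL f g1 g2 g3 eps kap c T t1 t2 i j).
  { intros <-. startL HP HG. unfold relatesL.
    apply relates_diag; try assumption; try (apply Rabs_le; reim; lra); try lra; try separate.
    apply valL_0; try assumption; first [height | lra]. }
  destruct i as [|[|[|[|i]]]]; try lia; destruct j as [|[|[|[|j]]]]; try lia;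
    first [apply D; reflexivity | clear D].
  - apply relL_12; assumption.
  - apply relL_13; assumption.
  - apply relL_21; assumption.
  - apply relL_23; assumption.
  - apply relL_31; assumption.
  - apply relL_32; assumption.
Qed.

Lemma is_BL_value (f : fun3) (g1 g2 g3 c : C) (eps kap t11 t1 t2 : R) :
  0 < eps < 1 / 2 -> 0 < kap < 1 / 2 -> Im c = eps * kap ->
  let T := (RtoC t11 - Ci * RtoC kap)%C in
  let h1 := Cconj g1 in let h2 := Cconj g2 in
  test (- (3 / 2)) (3 / 2) (psi f (half - Ci * h2) (- h1) T (t1 + t2 - h2)) ->
  is_BL kap g1 g2 g3 f t11 t1 t2
    (preL 0 g3 T t1 t2 * mb_int c (- (Ci * t1)) (- (Ci * t2)) (half + Ci * T)
       (psi f (half - Ci * h2) (- h1) T (t1 + t2 - h2)))%C.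
Proof.
  intros He Hk Ec T h1 h2 Ht. unfold is_BL, is_apply.
  destruct (mult_half_bound _ _ He Hk) as (Y0 & Y1 & Y2).
  assert (ET : Im T = - kap) by (unfold T; reim; lra).
  (* The integral in [is_BL] runs at height [kap], the relations at [eps * kap]; there is no pole in
     between. *)
  rewrite (mb_move _ _ c (- T) _ _ _ _ Ht) by first [separate | reim; lra].
  apply (is_RInt_gen_mb (- (3 / 2)) (3 / 2)); [exact Ht | reim; lra | separate |].
  intros s. unfold delta_int, KL, prod2, preL, mb_integrand, psi. fold h1 h2. rewrite !Cplus_0_r.
  replace (t11 - Ci * kap - h1 - s)%C with (- h1 - (s + - T))%C by (unfold T; ring).
  replace (t1 + t2 - h1 - h2 - (- h1 - (s + - T)))%C with (t1 + t2 - h2 + (s + - T))%C by ring.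
  replace (T + (s + - T))%C with (RtoC s) by ring.
  replace (Ci * (h1 - h2 + (- h1 - (s + - T))) + half)%C with (half - Ci * h2 - Ci * (s + - T))%C by ring.
  replace (Ci * s + half)%C with (half + Ci * T + Ci * (s + - T))%C by ring.
  replace (Ci * (t11 - t1 - s) + kap)%C with (- (Ci * t1) - Ci * (s + - T))%C by (unfold T; ring [Ci_sq]).
  replace (Ci * (t11 - t2 - s) + kap)%C with (- (Ci * t2) - Ci * (s + - T))%C by (unfold T; ring [Ci_sq]).
  replace (Ci * (t11 - t1) + kap + half)%C with (Ci * (T - t1) + half)%C by (unfold T; ring [Ci_sq]).
  replace (Ci * (t11 - t2) + kap + half)%C with (Ci * (T - t2) + half)%C by (unfold T; ring [Ci_sq]).
  fold T. unfold rGamma, Cdiv. rewrite !Cinv_mult'. ring.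
Qed.

Lemma valL_meromorphic (f : fun3) (g1 g2 g3 : C) (eps kap : R) : paramsL f g1 g2 g3 eps kap ->
  meromorphic_unit_tube (fun t11 t1 t2 => valL f g1 g2 g3 eps (muL kap) (t11 - Ci * RtoC kap)%C t1 t2).
Proof.
  intros (Hf & He & Hk & E1 & E2 & E3).
  set (r := 1 + eps * kap / 8).
  exists r, (fun t11 t1 t2 => valL f g1 g2 g3 eps (muL kap) (t11 - Ci * RtoC kap)%C t1 t2),
    (fun _ _ _ => RtoC 1).
  assert (V1 := regular_var1 r). assert (V2 := regular_var2 r). assert (V3 := regular_var3 r).
  assert (RT : regular r (fun t11 _ _ => t11 - Ci * RtoC kap)%C).
  { apply regular_minus; [exact V1 | apply regular_const]. }
  assert (HC := contL_regular f g1 g2 eps kap Hf He Hk E1 E2).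
  split; [unfold r; nra|]. split; [|split; [|split]].
  - apply regular_holomorphic. unfold valL. apply regular_mult; [|exact HC].
    unfold preL.
    assert (RE : regular r (fun t11 _ _ => Cexp (- (RtoC PI * (t11 - Ci * RtoC kap) / 2)))%C).
    { apply (regular_Cexp r (fun t11 _ _ => - (RtoC PI * (t11 - Ci * RtoC kap) / 2))%C).
      replace (fun t11 _ _ => - (RtoC PI * (t11 - Ci * RtoC kap) / 2))%C with
        (fun t11 _ _ : C => - RtoC PI * (t11 - Ci * RtoC kap) * / 2)%C
        by (do 3 (apply functional_extensionality; intros ?); field).
      repeat first [exact RT | apply regular_mult | apply regular_const]. }
    repeat first [exact RE | exact RT | exact V2 | exact V3 | apply regular_mult | apply regular_minus
      | apply regular_plus | apply regular_rGamma | apply regular_const].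
  - apply regular_holomorphic, regular_const.
  - intros a b c _ _ _. apply C1_neq_0.
  - intros a b c _ _. field.
Qed.

Lemma intertwines_L (l1 l2 l3 eps kap : R) : 0 < eps < 1 / 2 -> 0 < kap < 1 / 2 ->
  let g1 := (RtoC l1 + Ci * RtoC eps)%C in let g2 := (RtoC l2 - Ci * RtoC eps)%C in let g3 := RtoC l3 in
  intertwines (is_BL kap g1 g2 g3) (kGT kap (Cconj g1) (Cconj g2) (Cconj g3))
    (GG (Cconj g1) (Cconj g2) (Cconj g3)).
Proof.
  intros He Hk g1 g2 g3 f Hf.
  set (h1 := Cconj g1). set (h2 := Cconj g2).
  assert (H3 : Cconj g3 = g3) by (unfold Cconj, g3, RtoC; cbn; f_equal; ring).
  rewrite H3.
  assert (E1 : Im h1 = - eps) by (unfold h1, g1; cbn; ring).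
  assert (E2 : Im h2 = eps) by (unfold h2, g2; cbn; ring).
  assert (E3 : Im g3 = 0) by reflexivity.
  destruct (mult_half_bound _ _ He Hk) as (Y0 & Y1 & Y2).
  apply schwartz_tube_hol in Hf.
  assert (HP : paramsL f h1 h2 g3 eps kap) by (repeat split; first [assumption | lra | apply Hf]).
  set (c := (Ci * RtoC (eps * kap))%C). assert (Ec : Im c = eps * kap) by (unfold c; reim; lra).
  exists (fun t11 t1 t2 => valL f h1 h2 g3 eps (muL kap) (t11 - Ci * RtoC kap)%C t1 t2).
  split; [apply valL_meromorphic, HP|]. split.
  - intros t11 t1 t2. set (T := (RtoC t11 - Ci * RtoC kap)%C).
    assert (ET : Im T = - kap) by (unfold T; reim; lra).
    rewrite (valL_0 f h1 h2 g3 eps kap c T) by (first [assumption | height | reim; lra]).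
    apply (is_BL_value f g1 g2 g3 c eps kap t11 t1 t2); try assumption.
    fold h1 h2 T. apply psi_test; try exact Hf; reim; lra.
  - intros i j Hi Hj t11 t1 t2 Hne. rewrite kGT_shifted. set (T := (RtoC t11 - Ci * RtoC kap)%C).
    assert (ET : Im T = - kap) by (unfold T; reim; lra).
    assert (HG : generic c T t1 t2 (eps * kap) kap).
    { repeat split; try (reim; lra). intros E. apply Hne. apply (f_equal Re) in E. exact E. }
    assert (Q := relL f h1 h2 g3 eps kap c T t1 t2 i j HP HG Hi Hj). unfold relatesL, relates in Q.
    rewrite Q. apply (is_BL_value (GG h1 h2 g3 i j f) g1 g2 g3 c eps kap t11 t1 t2); try assumption.
    fold h1 h2 T. apply GG_test; try assumption; apply Rabs_le; reim; lra.
Qed.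

Theorem lemma4p2 (l1 l2 l3 eps kap : R)
    (heps : 0 < eps < 1 / 2) (hkap : 0 < kap < 1 / 2) :
  let g1 : C := (RtoC l1 + Ci * RtoC eps)%C in
  let g2 : C := (RtoC l2 - Ci * RtoC eps)%C in
  let g3 : C := RtoC l3 in
  intertwines (is_BR kap g1 g2 g3) (kGT kap g1 g2 g3) (GG g1 g2 g3) /\
  intertwines (is_BL kap g1 g2 g3)
    (kGT kap (Cconj g1) (Cconj g2) (Cconj g3))
    (GG (Cconj g1) (Cconj g2) (Cconj g3)).
Proof.
  split; [apply intertwines_R | apply intertwines_L]; assumption.
Qed.
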